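(* Let $(Z,d,\mu)$ be an Ahlfors $Q$-regular metric measure space that is homeomorphic to the $2$-sphere $\mathbb{S}^2$ and linearly locally connected. Suppose there is a metric space $Y$ quasi-isometric to a hyperbolic filling $X$ of $Z$ and a group $G\subseteq\operatorname{Iso}(Y)$ acting cocompactly on $Y$. Then there exist finitely many pairs $(A_i,B_i)$ of positively separated open subsets of $Z$ with the property that if $\mathrm{wcap}_2(A_i,B_i)<\infty$ for all $i$, then $Z$ is quasisymmetrically equivalent to $\mathbb{S}^2$.
   Context: $\mathbb{S}^2$ carries its standard metric. A metric measure space $(Z,d,\mu)$ ($\mu$ Borel regular) is Ahlfors $Q$-regular if there are $c,C>0$ with $cr^Q\le\mu(B(z,r))\le Cr^Q$ for all $z\in Z$, $0<r\le\operatorname{diam}(Z)$. The metric is rescaled so that $\operatorname{diam}(Z)=1$. Quasisymmetry: a homeomorphism $f:(Z,d)\to(Z',d')$ for which there is an increasing $\eta:(0,\infty)\to(0,\infty)$ with $\lim_{t\to0}\eta(t)=0$ (put $\eta(0)=0$) such that $\frac{d'(f(x),f(y))}{d'(f(x),f(z))}\le\eta\big(\frac{d(x,y)}{d(x,z)}\big)$ for all $x,y,z$ with $x\ne z$. Two spaces are quasisymmetrically equivalent if there is a quasisymmetry between them. Linearly locally connected (LLC): there is $\lambda\ge1$ such that for every ball $B(a,r)\subseteq Z$: (i) any $x,y\in B(a,r)$ lie in a common continuum $E\subseteq B(a,\lambda r)$; (ii) any $x,y\in Z\setminus B(a,r)$ lie in a common continuum $E\subseteq Z\setminus B(a,r/\lambda)$.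 A continuum is a compact connected set with more than one point. Hyperbolic filling $X=(V_X,E_X)$: fix a scaling parameter $s>1$. For each $k\ge1$ choose a maximal $s^{-k}$-separated set $Z_k\subseteq Z$; each point of $Z_k$ gives a vertex $v$ of level $\ell(v)=k$ with associated ball $B_v=B(v,2s^{-k})$ of radius $r(B_v)=2s^{-k}$ (the same letter $v$ denotes the vertex and the center of its ball). On level $0$ there is a single vertex $O$ associated to all of $Z$. Distinct vertices $v,w$ are joined by an edge iff $|\ell(v)-\ell(w)|\le1$ and $B_v\cap B_w\neq\emptyset$. $X$ carries the graph metric, each edge being isometric to $[0,1]$. A map $f:(X,d_X)\to(Y,d_Y)$ is a quasi-isometry if there are $C,D>0$ with $\frac1Cd_X(x,x')-D\le d_Y(f(x),f(x'))\le Cd_X(x,x')+D$ for all $x,x'\in X$, and every $y\in Y$ satisfies $d_Y(f(x),y)\le D$ for some $x\in X$. $\operatorname{Iso}(Y)$ is the isometry group of $Y$. The action of $G$ on $Y$ is cocompact if there is a compact $K\subseteq Y$ with $Y=\bigcup_{g\in G}gK$. A path in $X$ is a sequence of vertices $(v_k)$ with consecutive vertices joined by edges, together with the edges $e_k$ joining $v_k$ to $v_{k+1}$. A one-sided infinite path converges to $z\in Z$ if $v_k\to z$ (centers) and $r(B_{v_k})\to0$; a two-sided infinite path can have a limit as $k\to\infty$ and one as $k\to-\infty$. Weak norm: for a countable set $S$ and $f:S\to[0,\infty)$, $\|f\|_{p,\infty}$ is the infimum of $C>0$ such that $\#\{x\in S:f(x)>\lambda\}\le C^p/\lambda^p$ for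 all $\lambda>0$ (value $\infty$ if there is none). Weak capacity: nonempty open sets $A,B\subseteq Z$ are positively separated if $\operatorname{dist}(A,B)>0$. A function $\tau:E_X\to[0,\infty)$ is admissible for $A,B$ if $\sum_{e\in\gamma}\tau(e)\ge1$ for every two-sided infinite path $\gamma$ with one limit in $A$ and the other in $B$. Then $\mathrm{wcap}_p(A,B)=\inf\{\|\tau\|_{p,\infty}^p:\tau\text{ admissible for }A,B\}\in[0,\infty]$. *)

(* Defs.v *)
From HB Require Import structures.
From mathcomp Require Import all_boot all_order all_algebra.
From mathcomp Require Import ring lra.
From mathcomp Require Import all_classical all_reals all_analysis.

Set Implicit Arguments.
Unset Strict Implicit.
Unset Printing Implicit Defensive.

Import Order.TTheory GRing.Theory Num.Def Num.Theory.
Import numFieldNormedType.Exports.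

Local Open Scope classical_set_scope.
Local Open Scope ring_scope.

Section sphere.
Context {R : realType}.

Definition euclid_dist (x y : 'rV[R]_3) : R :=
  Num.sqrt (\sum_i (x 0 i - y 0 i) ^+ 2).

Lemma euclid_distxx x : euclid_dist x x = 0.
Proof.
by rewrite /euclid_dist big1 ?sqrtr0// => i _; rewrite subrr expr0n.
Qed.

Lemma euclid_dist_positivity x y : euclid_dist x y = 0 -> x = y.
Proof.
move=> /eqP; rewrite sqrtr_eq0 => s0; apply/rowP => i; apply/eqP.
rewrite -subr_eq0 -sqrf_eq0 eq_le sqr_ge0 andbT (le_trans _ s0)//.
by rewrite (bigD1 i)//= lerDl sumr_ge0// => j _; exact: sqr_ge0.
Qed.

Lemma euclid_dist_sym x y : euclid_dist x y = euclid_dist y x.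
Proof.
by congr Num.sqrt; apply: eq_bigr => i _; rewrite -sqrrN opprB.
Qed.

Lemma euclid_dist_triangle y x z :
  euclid_dist x z <= euclid_dist x y + euclid_dist y z.
Proof.
rewrite /euclid_dist !big_ord_recl !big_ord0 !addr0.
set i0 := ord0; set i1 := lift _ _; set i2 := lift _ _.
have E i : x 0 i - z 0 i = (x 0 i - y 0 i) + (y 0 i - z 0 i) by ring.
rewrite (E i0) (E i1) (E i2).
move: (x 0 i0 - y 0 i0) (x 0 i1 - y 0 i1) (x 0 i2 - y 0 i2) => a1 a2 a3.
move: (y 0 i0 - z 0 i0) (y 0 i1 - z 0 i1) (y 0 i2 - z 0 i2) => b1 b2 b3.
set A := a1 ^+ 2 + _; set B := b1 ^+ 2 + _.
have sq_ge0 u v w : 0 <= u ^+ 2 + (v ^+ 2 + w ^+ 2) :> R.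
  by rewrite !addr_ge0// sqr_ge0.
have A0 : 0 <= A by exact: sq_ge0.
have B0 : 0 <= B by exact: sq_ge0.
rewrite -[leRHS]ger0_norm ?addr_ge0 ?sqrtr_ge0// -sqrtr_sqr ler_wsqrtr//.
rewrite [leRHS]sqrrD !sqr_sqrtr// -sqrtrM//.
suff CS : a1 * b1 + a2 * b2 + a3 * b3 <= Num.sqrt (A * B).
  apply: (@le_trans _ _ (A + (a1 * b1 + a2 * b2 + a3 * b3) *+ 2 + B)).
    by rewrite le_eqVlt; apply/orP; left; apply/eqP; rewrite /A /B; ring.
  by rewrite lerD2r lerD2l lerMn2r CS orbT.
apply: (le_trans (ler_norm _)); rewrite -sqrtr_sqr ler_wsqrtr// -subr_ge0.
rewrite (_ : _ - _ = (a1 * b2 - a2 * b1) ^+ 2 +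
  ((a1 * b3 - a3 * b1) ^+ 2 + (a2 * b3 - a3 * b2) ^+ 2)) ?sq_ge0//.
by rewrite /A /B; ring.
Qed.

End sphere.

(* The unit sphere of Euclidean R^3 with the chordal metric. *)
Definition sphere2 (R : realType) : Type :=
  {v : 'rV[R]_3 | \sum_i v 0 i ^+ 2 == 1}.

Section sphere_metric.
Context {R : realType}.

HB.instance Definition _ := Choice.on (sphere2 R).

Let dist (x y : sphere2 R) : R := euclid_dist (val x) (val y).

Let dist_positivity x y : dist x y = 0 -> x = y.
Proof. by move=> /euclid_dist_positivity/val_inj. Qed.

HB.instance Definition _ := @isMetric.Build R (sphere2 R) dist
  (fun x => euclid_distxx (val x)) dist_positivity
  (fun x y => euclid_dist_sym (val x) (val y))
  (fun y x z => euclid_dist_triangle (val y) (val x) (val z)).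

End sphere_metric.

Section metric_notions.
Context {R : realType}.
Implicit Types Z T Y : metricType R.

Definition diam Z : \bar R :=
  ereal_sup [set (mdist xy.1 xy.2)%:E | xy in [set: Z * Z]].

Definition borel_regular Z (mu : {outer_measure set Z -> \bar R}) :=
  (forall B, <<s open >> B -> mu.-caratheodory B) /\
  (forall A, exists B, [/\ <<s open >> B, A `<=` B & mu B = mu A]).

Definition ahlfors_regular (Q : R) Z (mu : {outer_measure set Z -> \bar R}) :=
  exists c C : R, [/\ 0 < c, 0 < C & forall (z : Z) (r : R),
    0 < r -> (r%:E <= diam Z)%E ->
    ((c * r `^ Q)%:E <= mu (ball z r) <= (C * r `^ Q)%:E)%E].

Definition homeomorphism (S T : topologicalType) (f : S -> T) :=
  exists g : T -> S,
    [/\ cancel f g, cancel g f, continuous f & continuous g].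

Definition homeomorphic (S T : topologicalType) :=
  exists f : S -> T, homeomorphism f.

Definition quasisymmetry Z T (f : Z -> T) :=
  homeomorphism f /\
  exists eta : R -> R,
    [/\ eta 0 = 0,
        forall t, 0 < t -> 0 < eta t,
        forall t t', 0 < t -> t < t' -> eta t < eta t',
        eta t @[t --> 0^'+] --> 0 &
        forall x y z : Z, x <> z ->
          mdist (f x) (f y) / mdist (f x) (f z)
            <= eta (mdist x y / mdist x z)].

Definition quasisymmetrically_equivalent Z T :=
  exists f : Z -> T, quasisymmetry f.

Definition continuum (T : topologicalType) (E : set T) :=
  [/\ compact E, connected E & exists x y, [/\ E x, E y & x <> y]].

Definition linearly_locally_connected Z :=
  exists lam : R, 1 <= lam /\ forall (a : Z) (r : R), 0 < r ->
    (forall x y, ball a r x -> ball a r y ->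
      exists E, [/\ continuum E, E x, E y & E `<=` ball a (lam * r)]) /\
    (forall x y, ~ ball a r x -> ~ ball a r y ->
      exists E, [/\ continuum E, E x, E y & E `<=` ~` ball a (r / lam)]).

Definition quasi_isometry T Y (f : T -> Y) :=
  exists C D : R, [/\ 0 < C, 0 < D,
    forall x x', C^-1 * mdist x x' - D <= mdist (f x) (f x')
                 /\ mdist (f x) (f x') <= C * mdist x x' + D &
    forall y, exists x, mdist (f x) y <= D].

Definition quasi_isometric T Y := exists f : T -> Y, quasi_isometry f.

Definition Iso Y : set (Y -> Y) :=
  [set g | (forall x y, mdist (g x) (g y) = mdist x y) /\
           (forall y, exists x, g x = y)].
Arguments Iso : clear implicits.

Definition isometry_subgroup Y (G : set (Y -> Y)) :=
  [/\ G `<=` Iso Y, G id,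
      forall g h, G g -> G h -> G (g \o h) &
      forall g, G g -> exists h, [/\ G h, cancel g h & cancel h g]].

Definition cocompact_action Y (G : set (Y -> Y)) :=
  exists K : set Y, compact K /\ [set: Y] = \bigcup_(g in G) (g @` K).

Definition positively_separated Z (A B : set Z) :=
  [/\ open A, open B, A !=set0, B !=set0 &
      0 < inf [set mdist a b | a in A & b in B]].

Definition separated_set Z (r : R) (S : set Z) :=
  forall x y, S x -> S y -> x <> y -> r <= mdist x y.

Definition maximal_separated_set Z (r : R) (S : set Z) :=
  separated_set r S /\
  forall S', separated_set r S' -> S `<=` S' -> S' = S.

End metric_notions.

(* Only the sets [net k] with [0 < k] are used. *)
Record hyperbolic_filling (R : realType) (Z : metricType R) :=
  HyperbolicFilling {
    scale : R;
    scale_gt1 : 1 < scale;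
    net : nat -> set Z;
    net_maximal : forall k, (0 < k)%N ->
      maximal_separated_set (scale ^- k) (net k)
  }.

Section filling.
Context {R : realType} {Z : metricType R} (X : hyperbolic_filling Z).

Inductive vertex : Type :=
  | root
  | node (k : nat) (z : Z) of (0 < k)%N & net X k z.

HB.instance Definition _ := gen_eqMixin vertex.
HB.instance Definition _ := gen_choiceMixin vertex.

Definition level (v : vertex) : nat := if v is node k _ _ _ then k else 0%N.

Definition vradius (v : vertex) : R := 2 * scale X ^- level v.

(* The root has no center; [z0] is the value returned for it. *)
Definition vcenter (z0 : Z) (v : vertex) : Z :=
  if v is node _ z _ _ then z else z0.

Definition vball (v : vertex) : set Z :=
  if v is node _ z _ _ then ball z (vradius v) else setT.

Definition adjacent (v w : vertex) :=
  [/\ v <> w, (level v <= (level w).+1)%N, (level w <= (level v).+1)%N &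
      vball v `&` vball w !=set0].

(* An edge is the unordered pair of its end points. *)
Definition is_edge (e : set vertex) :=
  exists v w, adjacent v w /\ e = [set v; w].

Definition edge : Type := {e : set vertex | is_edge e}.

HB.instance Definition _ := gen_eqMixin edge.
HB.instance Definition _ := gen_choiceMixin edge.

(* Geometric realization of the graph: a point is given by its barycentric
   coordinates.  [seg u v t] is the point at distance [t] from [u] on the edge
   joining [u] to [v]; [seg v v 0] is the vertex [v]. *)
Definition seg (u v : vertex) (t : R) : vertex -> R :=
  fun w => (1 - t) * (w == u)%:R + t * (w == v)%:R.

Definition is_point (b : vertex -> R) :=
  exists u v t, [/\ u = v \/ adjacent u v, 0 <= t <= 1 & b = seg u v t].

Definition realization : Type := {b : vertex -> R | is_point b}.

HB.instance Definition _ := gen_eqMixin realization.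
HB.instance Definition _ := gen_choiceMixin realization.

(* [step x y l]: [x] and [y] lie on a common edge, where their distance in a
   parametrization of this edge by [0, 1] is [l]. *)
Definition step (x y : realization) (l : R) :=
  exists u v t t', [/\ adjacent u v, 0 <= t <= 1, 0 <= t' <= 1 &
    [/\ sval x = seg u v t, sval y = seg u v t' & l = `|t - t'|]].

Inductive chain : realization -> realization -> R -> Prop :=
  | chain_nil x : chain x x 0
  | chain_cons x y z l m : step x y l -> chain y z m -> chain x z (l + m).

(* Length metric of the graph: infimum of the lengths of the chains. *)
Definition graph_dist (x y : realization) : R := inf [set l | chain x y l].

Lemma adjacent_sym v w : adjacent v w -> adjacent w v.
Proof. by move=> [? ? ? ?]; split => //; [exact: nesym|rewrite setIC]. Qed.

Lemma step_sym x y l : step x y l -> step y x l.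
Proof.
move=> [u [v [t [t' [uv t01 t'01 [xE yE ->]]]]]].
by exists u, v, t', t; split => //; split => //; rewrite distrC.
Qed.

Lemma chain_cat x y z l m : chain x y l -> chain y z m -> chain x z (l + m).
Proof.
elim=> [a|a b c l1 m1 ab _ IH] h; first by rewrite add0r.
by rewrite -addrA; apply: chain_cons ab _; exact: IH.
Qed.

Lemma step_chain x y l : step x y l -> chain x y l.
Proof. by move=> s; rewrite -(addr0 l); apply: chain_cons s (chain_nil _). Qed.

Lemma chain_sym x y l : chain x y l -> chain y x l.
Proof.
elim=> [a|a b c l1 m1 ab _ IH]; first exact: chain_nil.
by rewrite addrC; apply: chain_cat IH _; apply: step_chain; exact: step_sym.
Qed.

Lemma chain_bary x y l : chain x y l -> forall w, `|sval x w - sval y w| <= l.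
Proof.
elim=> [a w|a b c l1 m1 [u [v [t [t' [[uv _ _ _] _ _ [-> -> ->]]]]]] _ IH w].
  by rewrite subrr normr0.
apply: (le_trans (ler_distD (seg u v t' w) _ _)); rewrite lerD// /seg.
have [->|wu] := eqVneq w u.
  have /negbTE-> : u != v by exact/eqP.
  by rewrite (_ : _ - _ = t' - t) 1?distrC//=; ring.
have [wv|wv] := eqVneq w v.
  by rewrite (_ : _ - _ = t - t')//=; ring.
by rewrite !mulr0 !addr0 subrr normr0.
Qed.

Lemma chain_ge0 x y l : chain x y l -> 0 <= l.
Proof. by move=> /chain_bary/(_ root); exact: le_trans. Qed.

Lemma net_cover k (z : Z) : (0 < k)%N ->
  exists2 w, net X k w & mdist z w < scale X ^- k.
Proof.
move=> k0; have [sep mx] := net_maximal X k0; apply: contrapT => /forall2NP H.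
have far w : net X k w -> scale X ^- k <= mdist z w.
  by move=> Nw; have [//|/negP] := H w; rewrite -leNgt.
have s0 : 0 < scale X ^- k.
  by rewrite invr_gt0 exprn_gt0// (lt_trans _ (scale_gt1 X)).
have E : net X k `|` [set z] = net X k.
  apply: mx; last by move=> ?; left.
  move=> x y [Nx|->] [Ny|->] // xy.
  - exact: sep.
  - by rewrite metric_sym; exact: far.
  - exact: far.
have /far : net X k z by rewrite -E; right.
by rewrite mdistxx leNgt s0.
Qed.

Lemma is_point_vertex v : is_point (seg v v 0).
Proof. by exists v, v, 0; split; [left|rewrite lexx ler01|]. Qed.

Definition vertex_point v : realization := exist _ _ (is_point_vertex v).

Lemma realization_ext (x y : realization) : sval x = sval y -> x = y.
Proof.
case: x y => [b bP] [c cP] /= bc; subst c.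
by rewrite (Prop_irrelevance bP cP).
Qed.

Lemma adjacent_step u v : adjacent u v ->
  step (vertex_point u) (vertex_point v) 1.
Proof.
move=> uv; exists u, v, 0, 1; rewrite !lexx ler01.
split=> //; split=> //=.
- by apply/funext => w; rewrite /seg; ring.
- by apply/funext => w; rewrite /seg; ring.
- by rewrite sub0r normrN normr1.
Qed.

Lemma parent_vertex n v : level v = n.+1 ->
  exists2 w, adjacent v w & level w = n.
Proof.
case: v => [//|k z k0 Nz] /= kE; subst k.
have s0 m : 0 < 2 * scale X ^- m.
  by rewrite mulr_gt0// invr_gt0 exprn_gt0// (lt_trans _ (scale_gt1 X)).
case: n k0 Nz => [|n] k0 Nz.
  exists root => //; split => //=; exists z; split => //.
  by apply: ballxx; exact: s0.
have [w Nw zw] := net_cover z (ltn0Sn n).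
exists (node (ltn0Sn n) Nw) => //; split => //=.
- by move=> -[/esym/eqP]; rewrite ltn_eqF.
- by rewrite ltnW// ltnW.
- exists z; split; first by apply: ballxx; exact: s0.
  rewrite ballEmdist/= metric_sym (lt_le_trans zw)// /vradius/=.
  by rewrite ler_peMl ?ler1n// ltW// -(pmulr_rgt0 _ (ltr0Sn R 1)).
Qed.

Lemma chain_root_vertex v : exists l, chain (vertex_point v) (vertex_point root) l.
Proof.
move: {2}(level v) (erefl (level v)) => n; elim: n v => [|n IH] v vn.
  case: v vn => [_|k z k0 Nz /= kE]; first by exists 0; exact: chain_nil.
  by exfalso; move: k0; rewrite kE.
have [w vw wn] := parent_vertex vn.
have [l wl] := IH _ wn.
by exists (1 + l); apply: chain_cons wl; exact: adjacent_step.
Qed.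

Lemma chain_root x : exists l, chain x (vertex_point root) l.
Proof.
case: x => b bP; have [u [v [t [uv t01 bE]]]] := bP.
have [l ul] := chain_root_vertex u.
case: uv => [uv|uv].
  exists l; rewrite (_ : exist _ _ _ = vertex_point u)//.
  by apply: realization_ext => /=; rewrite bE -uv; apply/funext => w; rewrite /seg; ring.
exists (`|t - 0| + l); apply: chain_cons ul.
exists u, v, t, 0; rewrite lexx ler01; split => //; split => //=.
by apply/funext => w; rewrite /seg; ring.
Qed.

Lemma chain_connected x y : [set l | chain x y l] !=set0.
Proof.
have [l xl] := chain_root x; have [m ym] := chain_root y.
by exists (l + m); apply: chain_cat xl _; exact: chain_sym.
Qed.

Lemma chain_lbound x y : lbound [set l | chain x y l] 0.
Proof. by move=> l /chain_ge0. Qed.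

Lemma graph_dist_le x y l : chain x y l -> graph_dist x y <= l.
Proof. by move=> xy; apply: ge_inf => //; exists 0; exact: chain_lbound. Qed.

Lemma graph_distxx x : graph_dist x x = 0.
Proof.
apply/eqP; rewrite eq_le graph_dist_le//=; last exact: chain_nil.
by apply: lb_le_inf; [exact: chain_connected|exact: chain_lbound].
Qed.

Lemma graph_dist_positivity x y : graph_dist x y = 0 -> x = y.
Proof.
move=> d0; apply: realization_ext; apply/funext => w.
apply/eqP; rewrite -subr_eq0 -normr_le0 -d0.
by apply: lb_le_inf; [exact: chain_connected|move=> l /chain_bary].
Qed.

Lemma graph_dist_sym x y : graph_dist x y = graph_dist y x.
Proof.
by congr inf; apply/seteqP; split => l /=; exact: chain_sym.
Qed.

Lemma graph_dist_triangle y x z :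
  graph_dist x z <= graph_dist x y + graph_dist y z.
Proof.
rewrite -lerBlDr; apply: lb_le_inf => [|l xl]; first exact: chain_connected.
rewrite lerBlDl -lerBlDr; apply: lb_le_inf => [|m ym]; first exact: chain_connected.
by rewrite lerBlDr addrC; apply: graph_dist_le; exact: chain_cat xl ym.
Qed.

HB.instance Definition _ := @isMetric.Build R realization graph_dist
  graph_distxx graph_dist_positivity graph_dist_sym graph_dist_triangle.

Record biinfinite_path := BiinfinitePath {
  pvertex : int -> vertex;
  pedge : int -> edge;
  pedgeE : forall k : int,
    sval (pedge k) = [set pvertex k; pvertex (k + 1)]
}.

(* The radii tend to 0, so the root occurs finitely often and the default value
   of [vcenter] does not matter. *)
Definition path_converges (v : nat -> vertex) (z : Z) :=
  (vcenter z (v n) @[n --> \oo] --> z) /\ (vradius (v n) @[n --> \oo] --> 0).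

Definition path_limits (g : biinfinite_path) (a b : Z) :=
  path_converges (fun n => pvertex g (- n%:Z)) a /\
  path_converges (fun n => pvertex g n%:Z) b.

Definition path_joins (g : biinfinite_path) (A B : set Z) :=
  exists a b, path_limits g a b /\ (A a /\ B b \/ B a /\ A b).

Definition admissible (A B : set Z) (tau : edge -> R) :=
  (forall e, 0 <= tau e) /\
  forall g, path_joins g A B ->
    (1 <= \esum_(k in [set: int]) (tau (pedge g k))%:E)%E.

End filling.

Definition weak_norm (R : realType) (S : choiceType) (p : R) (f : S -> R)
    : \bar R :=
  ereal_inf [set C%:E | C in [set C : R | 0 < C /\ forall lam : R, 0 < lam ->
    (counting [set x | (lam < f x)%R] <= (C `^ p / lam `^ p)%:E)%E]].

Definition wcap (R : realType) (Z : metricType R) (X : hyperbolic_filling Z)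
    (p : R) (A B : set Z) : \bar R :=
  ereal_inf [set (weak_norm p tau `^ p)%E | tau in
    [set tau : edge X -> R | admissible A B tau]].

(* Main.v *)
(* If Z is quasisymmetric to the sphere, no pair is needed; otherwise one pair of
   infinite capacity is enough. So suppose that all positively separated pairs
   have finite 2-capacity.

   Modulus. Summing optimal weights over finitely many pairs of balls gives a
   weight on the vertices of the filling, in weak l^2, that is admissible for all
   paths with limits at a definite distance. The group moves every vertex close
   to the root, in a metric quasi-isometric to that of the filling; by stability
   of quasigeodesics, the weight pulls back to weights for rings around every
   vertex. A weak l^2 function has bounded energy on most layers of the filling,
   so these weights have bounded energy in a density sense, and composing two of
   them gives bounded energy on all deep layers. By the serial rule, wide rings
   have small modulus in all fine covers of Z by balls of the layers.

   Tilings. Through stereographic coordinates, the covers of large squares in Z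
   define finite graphs with the duality of the Hex theorem. Minimizing the
   energy of admissible weights tiles a rectangle by squares indexed by the
   vertices. A Loewner estimate for square tilings turns the small modulus of
   rings into control of distortion, so that the tilings, normalized and lifted to
   the sphere, converge along an ultrafilter to a quasisymmetry. *)

(* The obstacle is that a weight of finite weak norm need not have finite energy: the energy may
   diverge logarithmically. Two facts replace it. The number of vertices up to depth [n] is
   exponential in [n], so the energy up to depth [n] is [O(n)] and most single layers have bounded
   energy. And the sum of the cubes converges, so that below every deep vertex some descending ray
   has small weight; a finite crossing is completed by such rays to a bi-infinite path at little
   cost.

   The group acts on [Y], not on the filling, and a quasi-isometry distorts depth by a
   multiplicative constant. Depth is therefore measured in a chain metric coming from [Y], for which
   moving a vertex close to the root costs only an additive error; the layers are the spheres of
   this metric around the root.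

   A tiling needs a duality of the two kinds of crossings, which the covers of [Z] do not provide by
   themselves. A fine Hex board in coordinates provides it, and grouping the cells of the board into
   connected clusters that follow the cover preserves it. *)
Require Import Defs.
From HB Require Import structures.
From mathcomp Require Import all_boot all_order all_algebra.
From mathcomp Require Import ring lra zify.

Set Implicit Arguments.
Unset Strict Implicit.
Unset Printing Implicit Defensive.

Import Order.TTheory GRing.Theory Num.Theory.

Local Open Scope ring_scope.

(** * Connected sets in finite graphs *)

Section Connectivity.
Variables (V : finType) (e : rel V).
Implicit Types A B L : {set V}.

Definition edges_within A : rel V := [rel u v | [&& u \in A, v \in A & e u v]].

(** Membership of the ends is required separately, since [connect] is reflexive also outside [A]. *)
Definition conn A u v := [&& u \in A, v \in A & connect (edges_within A) u v].

Definition joins L L' A := [exists u in L, exists v in L', conn A u v].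

Lemma joins_connP L L' A :
  reflect (exists u v, [/\ u \in L, v \in L' & conn A u v]) (joins L L' A).
Proof.
apply: (iffP exists_inP) => [[u uL /exists_inP[v vL' c]]|[u [v [uL vL' c]]]].
  by exists u, v.
by exists u => //; apply/exists_inP; exists v.
Qed.

Lemma connS A B u v : A \subset B -> conn A u v -> conn B u v.
Proof.
move=> /subsetP AB /and3P[/AB uB /AB vB c]; rewrite /conn uB vB /=.
apply: connect_sub c => x y /and3P[xA yA exy]; apply: connect1.
by rewrite /edges_within/= !AB.
Qed.

Lemma joinsS L L' A B : A \subset B -> joins L L' A -> joins L L' B.
Proof.
by move=> AB /joins_connP[u [v [uL vL c]]]; apply/joins_connP; exists u, v; split=> //; exact: connS c.
Qed.

Lemma conn_refl A u : u \in A -> conn A u u.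
Proof. by move=> uA; rewrite /conn uA connect0. Qed.

Lemma conn_trans A v u w : conn A u v -> conn A v w -> conn A u w.
Proof.
move=> /and3P[uA _ c] /and3P[_ wA c']; rewrite /conn uA wA /=.
exact: connect_trans c c'.
Qed.


Lemma within_path A u p : path (edges_within A) u p ->
  path e u p /\ {subset p <= A}.
Proof.
elim: p u => [//|v p IH] u /= /andP[/and3P[uA vA euv] /IH[ep sp]].
by rewrite euv; split=> // z; rewrite inE => /predU1P[->//|/sp].
Qed.

Lemma path_within A u p : u \in A -> {subset p <= A} -> path e u p ->
  path (edges_within A) u p.
Proof.
elim: p u => [//|v p IH] u uA sp /= /andP[euv ep].
have vA : v \in A by apply: sp; rewrite inE eqxx.
by rewrite /edges_within/= uA vA euv IH// => z zp; apply: sp; rewrite inE zp orbT.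
Qed.

Lemma conn_path A u v : conn A u v ->
  exists p, [/\ path e u p, last u p = v, uniq (u :: p) & {subset u :: p <= A}].
Proof.
move=> /and3P[uA vA /connectP[p0 + ->]] => /shortenP[p pp up _].
have [ep sp] := within_path pp; exists p; split=> // z.
by rewrite inE => /predU1P[->//|/sp].
Qed.

Lemma path_conn A u p : path e u p -> {subset u :: p <= A} -> conn A u (last u p).
Proof.
move=> ep sp; have uA : u \in A by apply: sp; rewrite inE eqxx.
apply/and3P; split=> //; first by apply: sp; exact: mem_last.
apply/connectP; exists p => //; apply: path_within => // z zp.
by apply: sp; rewrite inE zp orbT.
Qed.

Hypothesis e_sym : symmetric e.

Lemma conn_sym A u v : conn A u v -> conn A v u.
Proof.
move=> /and3P[uA vA c]; rewrite /conn uA vA /=.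
have ws : symmetric (edges_within A).
  by move=> x y; rewrite /edges_within/= e_sym andbCA.
by rewrite (sym_connect_sym ws).
Qed.

Lemma conn1 A u v : u \in A -> v \in A -> e u v -> conn A u v.
Proof.
by move=> uA vA uv; rewrite /conn uA vA connect1//= /edges_within/= uA vA.
Qed.

Lemma conn_ind A (P : V -> Prop) u v :
  (forall x y, x \in A -> y \in A -> e x y -> P x -> P y) ->
  P u -> conn A u v -> P v.
Proof.
move=> Pe Pu /conn_path[p [ep <- _ sp]].
elim: p u Pu ep sp => [//|w p IH] u Pu /= /andP[uw ep] sp.
apply: IH => //.
  by apply: Pe uw Pu; apply: sp; rewrite !inE eqxx ?orbT.
by move=> z zp; apply: sp; rewrite inE zp orbT.
Qed.

(** The path is cut at its first vertex outside [P]; the part before it stays in [P]. *)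
Lemma conn_exit A (P : pred V) u v : P u -> ~~ P v -> conn A u v ->
  exists x y, [/\ P x, ~~ P y, e x y, conn [set z in A | P z] u x & y \in A].
Proof.
move=> Pu Pv /conn_path[p [ep lp _ sp]].
elim: p u Pu ep lp sp => [|w p IH] u Pu /=; first by move=> _ uv; rewrite -uv Pu in Pv.
move=> /andP[uw ep] lp sp.
have uA : u \in A by apply: sp; rewrite inE eqxx.
have wA : w \in A by apply: sp; rewrite !inE eqxx orbT.
case Pw: (P w); last by exists u, w; split=> //; [rewrite Pw|apply: conn_refl; rewrite inE uA].
have [|x [y [Px Py xy c yA]]] := IH _ Pw ep lp.
  by move=> z zp; apply: sp; rewrite inE zp orbT.
exists x, y; split=> //; apply: conn_trans c.
by apply: conn1 => //; rewrite inE ?uA ?wA.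
Qed.

End Connectivity.

(** * Lengths of intervals inside a window *)

Section Intervals.
Variable R : realFieldType.
Implicit Types (p q s t : R).

Definition clip p q t := Num.max p (Num.min q t).

Lemma clip_le p q t t' : t <= t' -> clip p q t <= clip p q t'.
Proof.
move=> tt'; rewrite /clip.
have h : Num.min q t <= Num.min q t' by rewrite le_min !ge_min lexx tt' orbT.
by rewrite ge_max !le_max lexx h orbT.
Qed.

Lemma clipP p q t : p <= q -> 
  [\/ (t <= p /\ clip p q t = p), (p <= t <= q /\ clip p q t = t) | (q <= t /\ clip p q t = q)].
Proof.
move=> pq; rewrite /clip; have [tp|pt] := leP t p.
  by constructor 1; split=> //; rewrite min_r ?(le_trans tp)// max_l.
have [tq|qt] := leP t q.
  by constructor 2; rewrite (ltW pt) max_r // ltW.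
by constructor 3; rewrite ltW // max_r.
Qed.

Lemma clip_lo p q t : p <= q -> t <= p -> clip p q t = p.
Proof. by move=> pq tp; rewrite /clip max_l // ge_min tp orbT. Qed.

Lemma clip_hi p q t : p <= q -> q <= t -> clip p q t = q.
Proof. by move=> pq qt; rewrite /clip min_l // max_r. Qed.

(** The length of the part of [[p, q]] inside [[s, t]], when [p <= q] and [s <= t]. *)
Definition len s t p q := clip s t q - clip s t p.

Lemma len_ge0 s t p q : p <= q -> 0 <= len s t p q.
Proof. by move=> pq; rewrite subr_ge0 clip_le. Qed.

Lemma len_le s t p q : s <= t -> p <= q -> len s t p q <= q - p.
Proof.
move=> st pq; rewrite /len.
by case: (clipP p st) => -[hp ->]; case: (clipP q st) => -[hq ->]; lra.
Qed.

Lemma len_split s z t p q : s <= z -> z <= t ->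
  len s t p q = len s z p q + len z t p q.
Proof.
move=> sz zt.
have E u : clip s t u = clip s z u + clip z t u - z.
  rewrite /clip; have [uz|zu] := leP u z.
    by rewrite (min_r (le_trans uz zt)) [Num.max z _]max_l ?ge_min ?uz ?orbT // addrK.
  have zm : z <= Num.min t u by rewrite le_min zt ltW.
  by rewrite !max_r ?(le_trans sz) // addrAC subrr add0r.
by rewrite /len !E; ring.
Qed.

(* Sweeping a finite family of weighted half-open intervals: the pointwise
   bound is integrated over [s, t), cutting at the end points. *)
Lemma sweep (I : finType) (p q g : I -> R) c s t : s <= t ->
  (forall i, p i <= q i) ->
  (forall z, s <= z < t -> c <= \sum_(i | p i <= z < q i) g i) ->
  c * (t - s) <= \sum_i g i * len s t (p i) (q i).
Proof.
move=> st pq.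
(* Induction on the number of end points strictly inside [(s, t)]. A cut at one of them lowers it on
   both sides; when none is left, every interval contains [[s, t)] or misses it, and the bound at
   [z = s] suffices. *)
pose brk s t := #|[set i | s < p i < t]| + #|[set i | s < q i < t]|.
have [n] := ubnP (brk s t); elim: n s t st => // n IH s t st bn H.
have split z : s < z < t -> (brk s z < brk s t)%N -> (brk z t < brk s t)%N ->
    c * (t - s) <= \sum_i g i * len s t (p i) (q i).
  move=> /andP[sz zt] b1 b2; have [sz' zt'] := (ltW sz, ltW zt).
  have h1 : c * (z - s) <= \sum_i g i * len s z (p i) (q i).
    apply: IH => //; first by rewrite (leq_trans b1).
    by move=> w /andP[sw wz]; apply: H; rewrite sw (lt_trans wz).
  have h2 : c * (t - z) <= \sum_i g i * len z t (p i) (q i).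
    apply: IH => //; first by rewrite (leq_trans b2).
    by move=> w /andP[sw wz]; apply: H; rewrite (le_trans _ sw).
  under eq_bigr do rewrite (len_split _ _ sz' zt') mulrDr.
  rewrite big_split /=; apply: le_trans (lerD h1 h2); lra.
have sub1 (f : I -> R) z : s < z < t -> [set i | s < f i < z] \subset [set i | s < f i < t].
  move=> /andP[_ zt]; apply/fintype.subsetP => i; rewrite !inE => /andP[-> h] /=; exact: lt_trans h zt.
have sub2 (f : I -> R) z : s < z < t -> [set i | z < f i < t] \subset [set i | s < f i < t].
  move=> /andP[sz _]; apply/fintype.subsetP => i; rewrite !inE => /andP[h ->]; rewrite andbT; exact: lt_trans sz h.
have prop (f : I -> R) i : s < f i < t -> 
  (#|[set j | (s < f j < f i)%R]| < #|[set j | (s < f j < t)%R]|)%N /\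
  (#|[set j | (f i < f j < t)%R]| < #|[set j | (s < f j < t)%R]|)%N.
  move=> h; split; apply: proper_card; apply/properP; split; [exact: sub1| |exact: sub2|].
    by exists i; rewrite !inE ?h // ltxx andbF.
  by exists i; rewrite !inE ?h // ltxx.
have [i hi|np] := pickP [pred i | s < p i < t].
  apply: (split (p i)) => //; have [h1 h2] := prop p i hi.
    by rewrite /brk -addSn leq_add // subset_leq_card // sub1.
  by rewrite /brk -addSn leq_add // subset_leq_card // sub2.
have [i hi|nq] := pickP [pred i | s < q i < t].
  apply: (split (q i)) => //; have [h1 h2] := prop q i hi.
    by rewrite /brk -addnS leq_add // subset_leq_card // sub1.
  by rewrite /brk -addnS leq_add // subset_leq_card // sub2.
have [ts|st'] := leP t s.
  have -> : t = s by apply/le_anti; rewrite ts.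
  rewrite subrr mulr0 big1 // => i _; suff -> : len s s (p i) (q i) = 0 by rewrite mulr0.
  by rewrite /len; case: (clipP (p i) (lexx s)) => -[hp ->]; case: (clipP (q i) (lexx s)) => -[hq ->]; lra.
apply: le_trans (_ : (\sum_(i | p i <= s < q i) g i) * (t - s) <= _).
  by rewrite ler_pM2r ?subr_gt0 // H // lexx.
rewrite mulr_suml big_mkcond /= ler_sum // => i _.
have h1 : (p i <= s) || (t <= p i) by have /negbT := np i; rewrite /= negb_and -!leNgt.
have h2 : (q i <= s) || (t <= q i) by have /negbT := nq i; rewrite /= negb_and -!leNgt.
have pqi := pq i.
suff -> : len s t (p i) (q i) = if p i <= s < q i then t - s else 0.
  by case: ifP; rewrite ?mulr0.
rewrite /len; case: ifP => [/andP[a b]|/negbT].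
  rewrite (clip_lo st a) clip_hi //.
  by case/orP: h2 => // qs; move: b; rewrite ltNge qs.
rewrite negb_and -ltNge -leNgt => /orP[sp|qs]; last first.
  by rewrite !clip_lo ?subrr // (le_trans pqi).
have tp : t <= p i by case/orP: h1 => //; rewrite leNgt sp.
by rewrite !clip_hi ?subrr // (le_trans tp).
Qed.

End Intervals.

(** * Square tilings *)

Section Tilings.
Variables (R : realFieldType) (V : finType) (e : rel V).
Implicit Types (L Lf Rt Bt Tp A : {set V}) (m D E rho : V -> R).

(* [D] behaves like the [m]-length of a shortest path from the side [L],
   both end points included. *)
Definition potential Lf Rt m D (a : R) :=
  [/\ forall v, v \in Lf -> D v = m v,
      forall u v, e u v -> D v <= D u + m v,
      forall v, m v <= D v &
      forall v, v \in Rt -> a <= D v].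

(* The data of a square tiling of [0, a] x [0, b]: the square of [v] has side
   [m v], right end [D v] and upper end [E v]. *)
Record tiling Lf Rt Bt Tp m D E (a b : R) : Prop := Tiling {
  tiling_sym : symmetric e;
  tiling_connected : forall u v, connect e u v;
  tiling_dual : forall A, joins e Bt Tp A = ~~ joins e Lf Rt (~: A);
  tiling_m : forall v, 0 <= m v;
  tiling_a : 0 < a;
  tiling_b : 0 < b;
  tiling_lr : forall A, joins e Lf Rt A -> a <= \sum_(v in A) m v;
  tiling_bt : forall A, joins e Bt Tp A -> b <= \sum_(v in A) m v;
  tiling_area : \sum_v m v * m v = a * b;
  tiling_D : potential Lf Rt m D a;
  tiling_E : potential Bt Tp m E b }.

Lemma tilingC Lf Rt Bt Tp m D E a b :
  tiling Lf Rt Bt Tp m D E a b -> tiling Bt Tp Lf Rt m E D b a.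
Proof.
case=> *; split=> //; last by rewrite mulrC.
by move=> A; rewrite -[A in LHS]setCK; apply/esym/negbLR; auto.
Qed.

Lemma ler_sum_sub (P Q : pred V) (f : V -> R) : (forall v, Q v -> 0 <= f v) ->
  (forall v, P v -> Q v) -> \sum_(v | P v) f v <= \sum_(v | Q v) f v.
Proof.
move=> f0 PQ; rewrite big_mkcond [leRHS]big_mkcond; apply: ler_sum => v _.
by case: ifP => [/PQ->//|_]; case: ifP => // /f0.
Qed.

(** * Level lines of a tiling *)

Section Levels.
Variables (Lf Rt Bt Tp : {set V}) (m D E : V -> R) (a b : R).
Hypothesis T : tiling Lf Rt Bt Tp m D E a b.

Let m0 := tiling_m T.

Definition lo D m v : R := D v - m v.

(** The squares met by the line at [t]. They are half open, so that two squares touching along a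
    side do not both count. *)
Definition level D m (t : R) := [set v | lo D m v <= t < D v].

Local Notation x := (lo D m).
Local Notation y := (lo E m).
Local Notation B := (level D m).
Local Notation C := (level E m).

Lemma lo_ge0 v : 0 <= x v.
Proof. by case: (tiling_D T) => _ _ + _; rewrite subr_ge0. Qed.

Lemma lo_le v : x v <= D v.
Proof. by rewrite gerBl m0. Qed.

Lemma lo_step u v : e u v -> x v <= D u.
Proof. by case: (tiling_D T) => _ + _ _ uv; rewrite lerBlDr; apply. Qed.

Lemma hi_lo v : D v - x v = m v.
Proof. by rewrite /lo; ring. Qed.

(** Neighbouring projections overlap by [lo_step], so a connected set cannot jump over [t]: if it
    avoided the line, [D w <= t] would propagate along it. *)
Lemma level_hit A u v t : conn e A u v -> x u <= t -> t < D v ->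
  exists2 w, w \in A & w \in B t.
Proof.
move=> c xu Dv; have [/exists_inP[w wA wB]|no] := boolP [exists w in A, w \in B t].
  by exists w.
have no' w : w \in A -> x w <= t -> D w <= t.
  move=> wA xw; rewrite leNgt; apply/negP => h.
  by move/exists_inP: no; apply; exists w; rewrite // inE xw.
suff : D v <= t by rewrite leNgt Dv.
apply: (conn_ind (P := fun w => D w <= t) _ _ c).
  by move=> w z wA zA wz Dw; apply: no' => //; exact: le_trans (lo_step wz) Dw.
by apply: no' => //; case/and3P: c.
Qed.

(** A connection from [Lf] to [Rt] has to meet the line by [level_hit], so the line blocks these two
    sides and the duality joins the other two. *)
Lemma level_bt t : 0 <= t < a -> joins e Bt Tp (B t).
Proof.
move=> /andP[t0 ta]; rewrite (tiling_dual T); apply/joins_connP => -[u [v [uL vR c]]].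
case: (tiling_D T) => D1 _ _ D4.
have [|//|w] := level_hit c (t := t).
- by rewrite /lo D1 // subrr.
- exact: lt_le_trans (D4 _ vR).
by rewrite inE => /negbTE->.
Qed.

Lemma len_lo s t v : s <= t -> len s t (x v) (D v) <= m v.
Proof. by move=> st; rewrite -(hi_lo v) len_le // lo_le. Qed.

(** Along a path from [Lf] to [Rt] the projections overlap and cover [[0, a]], so the increments of
    a monotone [f] add up to at least its total increment. *)
Lemma sum_potential (f : R -> R) A : {homo f : s t / s <= t} ->
  joins e Lf Rt A -> f a - f 0 <= \sum_(v in A) (f (D v) - f (x v)).
Proof.
move=> fh /joins_connP[u [v [uL vR /conn_path[p [ep lp up sp]]]]].
case: (tiling_D T) => D1 _ _ D4.
have pos w : 0 <= f (D w) - f (x w) by rewrite subr_ge0 fh // lo_le.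
apply: (@le_trans _ _ (\sum_(w <- u :: p) (f (D w) - f (x w)))); last first.
  by rewrite big_uniq //; apply: ler_sum_sub => // w /sp.
have x0 : x u = 0 by rewrite /lo D1 // subrr.
apply: (@le_trans _ _ (f (D (last u p)) - f (x u))).
  by rewrite x0 lerD2r fh // lp D4.
elim: p u {up sp lp uL x0} ep => [|w p IH] u; first by rewrite big_seq1.
rewrite big_cons /= => /andP[uw /IH] h.
have := fh _ _ (lo_step uw); move: h; lra.
Qed.

(** The case of the function [f] that collapses the slab [[t, t + d]] to a point. *)
Lemma sum_cut t d A : 0 <= t -> 0 <= d -> t + d <= a -> joins e Lf Rt A ->
  a - d <= \sum_(v in A) (m v - len t (t + d) (x v) (D v)).
Proof.
move=> t0 d0 tda jA; have td : t <= t + d by rewrite lerDl.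
pose f s := s - clip t (t + d) s.
have fh : {homo f : r s / r <= s}.
  move=> r s rs; rewrite /f.
  have := len_le td rs; rewrite /len; lra.
have -> : a - d = f a - f 0 by rewrite /f clip_hi // clip_lo //; ring.
apply: le_trans (sum_potential fh jA) _; apply: ler_sum => v _.
by rewrite /f /len /lo; lra.
Qed.

Lemma sweep_levels (A : {set V}) (g : V -> R) c s t : s <= t ->
  (forall z, s <= z < t -> c <= \sum_(v in A :&: B z) g v) ->
  c * (t - s) <= \sum_(v in A) g v * len s t (x v) (D v).
Proof.
move=> st H.
have -> : \sum_(v in A) g v * len s t (x v) (D v) =
    \sum_v (if v \in A then g v else 0) * len s t (x v) (D v).
  by rewrite big_mkcond; apply: eq_bigr => v _; case: ifP; rewrite ?mul0r.
apply: sweep => // [|z /H /le_trans]; first exact: lo_le.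
apply; rewrite big_mkcond [leRHS]big_mkcond /=.
by apply: ler_sum => v _; rewrite !inE; case: (v \in A) => //=; case: ifP.
Qed.

End Levels.

(** * Consequences of the area of a tiling *)

Section Crossing.
Variables (Lf Rt Bt Tp : {set V}) (m D E : V -> R) (a b : R).
Hypothesis T : tiling Lf Rt Bt Tp m D E a b.

Let m0 := tiling_m T.
Let T' := tilingC T.
Local Notation x := (lo D m).
Local Notation y := (lo E m).
Local Notation B := (level D m).
Local Notation C := (level E m).

Lemma level_lr s : 0 <= s < b -> joins e Lf Rt (C s).
Proof. exact: level_bt T' s. Qed.

(** Length-area: every line [C s] joins [Lf] to [Rt], and sweeping [s] over [[0, b]] counts each
    square with a factor at most its side. *)
Lemma cross (g : V -> R) c : (forall v, 0 <= g v) ->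
  (forall A, joins e Lf Rt A -> c <= \sum_(v in A) g v) ->
  c * b <= \sum_v g v * m v.
Proof.
move=> g0 H; have b0 := ltW (tiling_b T).
have := sweep_levels (A := setT) T' b0 (g := g) (c := c).
rewrite subr0 => /(_ _)/le_trans; apply; first by move=> s /level_lr/H; rewrite setTI.
rewrite big_mkcond /=; apply: ler_sum => v _; rewrite inE; apply: ler_wpM2l => //.
exact: len_lo T' _ _ _ b0.
Qed.

(* Cut a thin slab out of the x-coordinate. *)
Lemma thin t : 0 <= t < a -> exists d, [/\ 0 < d, t + d <= a &
  forall v, v \in B t -> len t (t + d) (x v) (D v) = d].
Proof.
move=> /andP[t0 ta].
pose d := \big[Num.min/a - t]_(v in B t) (D v - t).
have d_le v : v \in B t -> d <= D v - t by move=> vB; rewrite /d; exact: bigmin_le_cond.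
have d_a : d <= a - t by exact: bigmin_le_id.
have d0 : 0 < d.
  rewrite /d; elim/big_ind: _ => [|u v u0 v0|v]; rewrite ?subr_gt0 //.
    by rewrite lt_min u0.
  by rewrite inE => /andP[].
exists d; split=> //; first by rewrite -lerBrDl.
move=> v vB; have dv := d_le v vB; move: vB; rewrite inE => /andP[xt tD].
have td : t <= t + d by rewrite lerDl ltW.
by rewrite /len clip_hi ?clip_lo // -?lerBrDl //; ring.
Qed.

(** Shortening the squares by a thin slab at the line leaves a weight of length at least [a - d], so
    [cross] bounds its pairing with [m] from below. Compared with the area [a * b], this shows that
    the line has length at most [b]; the other bound is [tiling_bt]. *)
Lemma level_sum t : 0 <= t < a -> \sum_(v in B t) m v = b.
Proof.
move=> ht; apply/le_anti; rewrite (tiling_bt T (level_bt T ht)) andbT.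
have [d [d0 tda dE]] := thin ht; have /andP[t0 ta] := ht.
have := @cross (fun v => m v - len t (t + d) (x v) (D v)) (a - d) _ _.
have h1 v : 0 <= m v - len t (t + d) (x v) (D v).
  by rewrite subr_ge0 (len_lo T) // lerDl ltW.
move=> /(_ h1)-/(_ (fun A jA => sum_cut T t0 (ltW d0) tda jA)).
under eq_bigr do rewrite mulrBl; rewrite sumrB (tiling_area T) mulrBl lerD2l lerN2 => h.
rewrite -(ler_pM2l d0) (le_trans _ h) // mulr_sumr.
rewrite (eq_bigr (fun v => len t (t + d) (x v) (D v) * m v)); last by move=> v /dE->.
apply: ler_sum_sub => // v _; rewrite mulr_ge0 // len_ge0 // (lo_le T) //.
Qed.

End Crossing.

Section Lines.
Variables (Lf Rt Bt Tp : {set V}) (m D E : V -> R) (a b : R).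
Hypothesis T : tiling Lf Rt Bt Tp m D E a b.

Let m0 := tiling_m T.
Let T' := tilingC T.
Local Notation x := (lo D m).
Local Notation y := (lo E m).
Local Notation B := (level D m).
Local Notation C := (level E m).

Lemma level_pos t v : v \in B t -> 0 < m v.
Proof. by rewrite inE /lo => /andP[? ?]; lra. Qed.

(** If two squares contained the point [(t, s)], a thin slab at [t] would shorten the line [C s], of
    total length [a], by [2 * d], against [sum_cut]. *)
Lemma crossing_uniq t s u v : 0 <= t < a -> 0 <= s < b ->
  u \in B t -> u \in C s -> v \in B t -> v \in C s -> u = v.
Proof.
move=> ht hs uB uC vB vC; apply/eqP/negPn/negP => uv.
have [d [d0 tda dE]] := thin m D ht; have /andP[t0 ta] := ht.
have := sum_cut T t0 (ltW d0) tda (level_lr T hs).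
rewrite sumrB (level_sum T' hs) lerD2l lerN2.
rewrite (bigD1 u) //= (bigD1 v) /=; last by rewrite vC eq_sym.
rewrite !dE // => h.
have : 0 <= \sum_(i in C s | (i != u) && (i != v)) len t (t + d) (x i) (D i).
  by apply: sumr_ge0 => i _; rewrite len_ge0 // (lo_le T).
by rewrite (eq_bigl (fun i => (i \in C s) && (i != u) && (i != v))) => [?|i]; [lra|rewrite andbA].
Qed.

(** Otherwise [C s], which joins [Lf] to [Rt], would lie in the complement of [B t], against the
    duality. *)
Lemma crossing t s : 0 <= t < a -> 0 <= s < b -> exists2 v, v \in B t & v \in C s.
Proof.
move=> ht hs; have [/exists_inP[v]|no] := boolP [exists v in B t, v \in C s]; first by exists v.
have := level_bt T ht; rewrite (tiling_dual T) => /negP[].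
apply: joinsS (level_lr T hs); apply/fintype.subsetP => v vC; rewrite inE.
by apply/negP => vB; move/exists_inP: no; apply; exists v.
Qed.

(** The lines over [[0, a)] already sweep the full area [a * b], so no square of positive side
    sticks out. From a square of [Lf] the bound then spreads along edges, which reaches the squares
    of side [0]. *)
Lemma hi_le v : D v <= a.
Proof.
have a0 := ltW (tiling_a T).
have pos w : 0 < m w -> D w <= a.
  move=> mw; rewrite leNgt; apply/negP => aD.
  have := sweep_levels (A := setT) T a0 (g := m) (c := b).
  rewrite subr0 (eq_bigl predT) => [|i]; last by rewrite inE.
  have h : forall z, 0 <= z < a -> b <= \sum_(v in setT :&: B z) m v.
    by move=> z hz; rewrite setTI (level_sum T hz).
  move=> /(_ h); rewrite mulrC -(tiling_area T) leNgt => /negP[].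
  rewrite [ltRHS](bigD1 w) //= (bigD1 w) //= ltr_leD //.
    rewrite ltr_pM2l // /len [clip 0 a (D w)]clip_hi ?(ltW aD) // -(hi_lo m D w).
    have [xa|ax] := leP (x w) a; last by rewrite clip_hi ?(ltW ax) // subrr hi_lo.
    by case: (clipP (x w) a0) => -[hc ->]; have := lo_ge0 T w; move: hc aD; rewrite /lo; lra.
  by apply: ler_sum => i _; apply: ler_wpM2l => //; exact: len_lo T _ _ _ a0.
have [u [_ [uL _ _]]] : exists u v, [/\ u \in Lf, v \in Rt & conn e (C 0) u v].
  by apply/joins_connP/(level_lr T); rewrite lexx (tiling_b T).
have c : conn e setT u v by rewrite /conn !inE; apply: connect_sub (tiling_connected T u v) => z w zw; apply: connect1; rewrite /edges_within/= !inE.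
have hi z : x z <= a -> D z <= a.
  move=> xa; have [mz|] := ltP 0 (m z); first exact: pos.
  by move=> mz; move: xa; rewrite /lo; lra.
apply: (conn_ind (P := fun w => D w <= a) _ _ c) => [z w _ _ zw Dz|].
  by apply: hi; apply: le_trans (lo_step T zw) Dz.
by apply: hi; case: (tiling_D T) => D1 _ _ _; rewrite /lo D1 // subrr.
Qed.

(** Each step of a path raises [E] by at most [m]; when the total rise is attained, every step is
    tight. *)
Lemma path_order u p : path e u p -> E u + \sum_(w <- p) m w <= E (last u p) ->
  path (fun v w => E v <= y w) u p.
Proof.
case: (tiling_E T) => _ E2 _ _.
have bd p' v : path e v p' -> E (last v p') <= E v + \sum_(w <- p') m w.
  elim: p' v => [|w p' IH] v; first by rewrite big_nil addr0.
  by rewrite big_cons => /= /andP[/E2 h /IH]; lra.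
elim: p u => [//|w p IH] u; rewrite big_cons => /= /andP[uw ep] h.
have := bd _ _ ep; have := E2 _ _ uw => h1 h2.
by rewrite IH // ?andbT /lo; lra.
Qed.

(* Every level line is a path crossing its squares one after the other. *)
Lemma level_path t : 0 <= t < a -> exists u p, [/\ u \in Bt, last u p \in Tp,
  path e u p, B t =i u :: p & path (fun v w => E v <= y w) u p].
Proof.
move=> ht; have [u [v [uB vT /conn_path[p [ep lp up sp]]]]] := joins_connP _ _ _ _ (level_bt T ht).
case: (tiling_E T) => E1 E2 _ E4; subst v.
have bs : b <= \sum_(w <- u :: p) m w.
  rewrite big_uniq //= (eq_bigl (mem [set w in u :: p])) => [|w]; last by rewrite /= !inE.
  apply: (tiling_bt T (A := [set w in u :: p])); apply/joins_connP; exists u, (last u p); split=> //.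
  by apply: path_conn => // w; rewrite !inE.
(* The path alone has length [b], which is the length of the whole line by [level_sum], and the
   squares of the line have positive side; so none is left over. *)
have cov : B t =i u :: p.
  move=> w; apply/idP/idP => [wB|/sp//]; apply/negPn/negP => wp.
  have : \sum_(z <- u :: p) m z + m w <= b.
    rewrite -(level_sum T ht) (bigD1 w wB) /= big_uniq // [leLHS]addrC lerD2l.
    apply: ler_sum_sub => // z zp; apply/andP; split; first exact: sp.
    by apply: contraNneq wp => <-.
  by have := level_pos wB; lra.
exists u, p; split=> //; apply: path_order => //.
by apply: le_trans (E4 _ vT); rewrite E1 // -(level_sum T ht) (eq_bigl _ _ cov) -big_uniq // big_cons.
Qed.

(** The piece of the level path between two of its squares; all its other squares lie between them
    in the direction of the line. *)
Lemma level_link t u w : 0 <= t < a -> u \in B t -> w \in B t -> u != w ->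
  exists A : {set V}, [/\ A \subset B t, conn e A u w &
  (E u <= y w /\ forall z, z \in A -> [\/ z = u, z = w | E u <= y z /\ E z <= y w]) \/
  (E w <= y u /\ forall z, z \in A -> [\/ z = u, z = w | E w <= y z /\ E z <= y u])].
Proof.
move=> ht; have [u0 [p [_ _ ep cov op]]] := level_path ht; rewrite !cov.
have tr : transitive (fun v w => E v <= y w).
  by move=> z2 z1 z3 h1 h2; rewrite (le_trans h1) // (le_trans (lo_le T' z2)).
have main u1 u2 q1 q2 q3 : u0 :: p = q1 ++ u1 :: q2 ++ u2 :: q3 ->
    exists A : {set V}, [/\ A \subset B t, conn e A u1 u2 &
      (E u1 <= y u2 /\ forall z, z \in A -> [\/ z = u1, z = u2 | E u1 <= y z /\ E z <= y u2])].
  move=> eq; exists [set z in u1 :: rcons q2 u2].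
  have e1 : path e u1 (rcons q2 u2).
    have : sorted e (u0 :: p) by [].
    rewrite eq => /(@drop_sorted _ _ (size q1)); rewrite drop_size_cat //= cat_path /=.
    by rewrite rcons_path => /and3P[-> ->].
  have sub z : z \in u1 :: rcons q2 u2 -> z \in u0 :: p.
    rewrite inE mem_rcons inE => h; rewrite eq mem_cat inE mem_cat inE.
    by case/or3P: h => ->; rewrite ?orbT.
  have : pairwise (fun v w => E v <= y w) (u0 :: p) by rewrite -sorted_pairwise.
  rewrite eq pairwise_cat /= all_cat /= pairwise_cat => /and3P[_ _ /andP[/and3P[a1 a2 _]]].
  move=> /and3P[/allrelP a3 _ _]; split.
  - by apply/fintype.subsetP => z; rewrite inE cov => /sub.
  - have := path_conn (A := [set z in u1 :: rcons q2 u2]) e1.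
    by rewrite last_rcons; apply=> z; rewrite !inE.
  split=> // z; rewrite !inE mem_rcons inE => /or3P[/eqP->|/eqP->|zq]; [by constructor 1|by constructor 2|].
  by constructor 3; split; [exact: (allP a1)|apply: a3 => //; rewrite inE eqxx].
move=> up; case/splitPr: up main => q1 q2 main; rewrite mem_cat inE => /or3P[|/eqP->|]; last 2 first.
- by rewrite eqxx.
- move=> /splitPr wq _; case: wq main => q3 q4 main.
  by have [A [AB c h]] := main u w q1 q3 q4 erefl; exists A; split=> //; left.
move=> /splitPr wq _; case: wq main => q3 q4 main.
have [|A [AB c [h1 h2]]] := main w u q3 q4 q2; first by rewrite -catA.
exists A; split=> //; first by apply: conn_sym c; exact: tiling_sym T.
by right; split=> // z /h2[->|->|?]; [constructor 2|constructor 1|constructor 3].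
Qed.

End Lines.
End Tilings.

(** * The Hex theorem *)

Local Open Scope nat_scope.

(* The Hex board: a square grid with one diagonal in each square. *)
Definition hexup (p q : nat * nat) := 
  [|| (q.1 == p.1) && (q.2 == p.2.+1), (q.1 == p.1.+1) && (q.2 == p.2) |
      (q.1 == p.1.+1) && (q.2 == p.2.+1)].
Definition hexnat p q := hexup p q || hexup q p.

Section Crossings.
Variable N : nat.

Fixpoint xsum (P : nat * nat -> nat * nat -> bool) u p :=
  if p is v :: p' then P u v (+) xsum P v p' else false.

Lemma xsum_coboundary (S : pred (nat * nat)) u p :
  xsum (fun a b => S a (+) S b) u p = S u (+) S (last u p).
Proof. by elim: p u => [|v p IH] u /=; [rewrite addbb|rewrite IH addbA addbK]. Qed.

Lemma xsumD P P' u p :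
  xsum (fun a b => P a b (+) P' a b) u p = xsum P u p (+) xsum P' u p.
Proof. by elim: p u => [//|v p IH] u /=; rewrite IH addbACA. Qed.

Lemma eq_xsum (C : pred (nat * nat)) P P' u p :
  (forall a b, C a -> C b -> hexnat a b -> P a b = P' a b) ->
  path hexnat u p -> all C (u :: p) -> xsum P u p = xsum P' u p.
Proof.
move=> PP'; elim: p u => [//|v p IH] u /= /andP[uv pv] /and3P[Cu Cv Cp].
by rewrite PP' // IH //= Cv.
Qed.

(* Edges between the rows [v.2] and [v.2.+1] whose lower end lies to the left of [v]. *)
Definition leftof (v a b : nat * nat) :=
  [&& a.2 == v.2, b.2 == v.2.+1 & a.1 < v.1] || [&& b.2 == v.2, a.2 == v.2.+1 & b.1 < v.1].

Lemma leftofC v a b : leftof v a b = leftof v b a.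
Proof. by rewrite /leftof orbC. Qed.

Lemma leftof_up v a b : hexup a b ->
  leftof v a b = [&& a.2 == v.2, b.2 == v.2.+1 & a.1 < v.1].
Proof.
rewrite /leftof; case: (boolP [&& b.2 == v.2, _ & _]); rewrite ?orbF //.
by move=> /and3P[/eqP e1 /eqP e2 _]; rewrite /hexup e1 e2 => h; exfalso; move: h; clear; lia.
Qed.

(** Parity of the crossings of the path with the ray going left from just above [v]: it tells on
    which side of the path [v] lies. *)
Definition side v u p := xsum (leftof v) u p.

(** On edges avoiding both cells, the two ray counts differ by the coboundary of a set [S] of cells.
    Its sum along the path depends only on the ends, where [S] takes equal values. *)
Lemma side_step i j i' j' u p : path hexnat u p -> u.2 = 0 -> (last u p).2 = N.+1 ->
  (i, j) \notin u :: p -> (i', j') \notin u :: p -> j' <= N -> hexup (i, j) (i', j') ->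
  side (i, j) u p = side (i', j') u p.
Proof.
move=> pp u0 lN vp v'p v'N vv'.
have av w : w \notin u :: p -> all (predC1 w) (u :: p).
  by move=> wp; apply/allP => z zp /=; apply: contraNneq wp => <-.
pose C := predI (predC1 (i, j)) (predC1 (i', j')).
have aC : all C (u :: p) by rewrite all_predI !av.
have key (S : pred (nat * nat)) : S u = S (last u p) ->
    (forall a b, C a -> C b -> hexup a b ->
      [&& a.2 == j, b.2 == j.+1 & a.1 < i] (+) [&& a.2 == j', b.2 == j'.+1 & a.1 < i'] =
      S a (+) S b) ->
    side (i, j) u p = side (i', j') u p.
  move=> Sul H; suff : side (i, j) u p (+) side (i', j') u p = false by case: side; case: side.
  rewrite /side -xsumD (eq_xsum (C := C) (P' := fun a b => S a (+) S b)) //.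
    by rewrite xsum_coboundary Sul addbb.
  move=> a b Ca Cb /orP[ab|ba]; first by rewrite !(leftof_up _ ab) H.
  by rewrite !(leftofC _ a b) !(leftof_up _ ba) H // addbC.
pose S k (a : nat * nat) := (a.2 == j.+1) && (a.1 < k).
have c3 : [\/ i' = i /\ j' = j.+1, i' = i.+1 /\ j' = j | i' = i.+1 /\ j' = j.+1].
  case/orP: vv' => [/andP[/eqP/= -> /eqP/= ->]|]; first by constructor 1.
  by case/orP => /andP[/eqP/= -> /eqP/= ->]; [constructor 2|constructor 3].
have stp (T : Prop) a b : hexup a b ->
    (b = (a.1, a.2.+1) -> T) -> (b = (a.1.+1, a.2) -> T) -> (b = (a.1.+1, a.2.+1) -> T) -> T.
  case: a b => [a1 a2] [b1 b2]; rewrite /hexup /= => h h1 h2 h3; case/or3P: h => /andP[/eqP e1 /eqP e2]; subst.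
  - exact: h1.
  - exact: h2.
  - exact: h3.
clear vv'; case: c3 => -[? ?]; subst i' j'.
- apply: (key (S i)); first by rewrite /S /= u0 lN; lia.
  move=> [a1 a2] [b1 b2] Ca Cb ab; apply: (stp _ _ _ ab) => -[? ?]; subst b1 b2; move: Ca Cb;
  rewrite /C /S /= -!pair_eqE /=; clear; lia.
- apply: (key pred0) => //.
  move=> [a1 a2] [b1 b2] Ca Cb ab; apply: (stp _ _ _ ab) => -[? ?]; subst b1 b2; move: Ca Cb;
  rewrite /C /S /= -!pair_eqE /=; clear; lia.
- apply: (key (S i.+1)); first by rewrite /S /= u0 lN; lia.
  move=> [a1 a2] [b1 b2] Ca Cb ab; apply: (stp _ _ _ ab) => -[? ?]; subst b1 b2; move: Ca Cb;
  rewrite /C /S /= -!pair_eqE /=; clear; lia.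
Qed.

Lemma side_left j u p : side (0, j) u p = false.
Proof.
by rewrite /side; elim: p u => [//|v p IH] u /=; rewrite IH addbF /leftof /= !ltn0 !andbF.
Qed.

(** Seen from the right side every crossing between the rows [j] and [j.+1] counts, and a path from
    the bottom row to row [N.+1] makes an odd number of them. *)
Lemma side_right j u p : path hexnat u p -> u.2 = 0 -> (last u p).2 = N.+1 -> j <= N ->
  (N, j) \notin u :: p -> all (fun a => a.1 <= N) (u :: p) -> side (N, j) u p = true.
Proof.
move=> pp u0 lN jN vp aN; pose C (a : nat * nat) := (a != (N, j)) && (a.1 <= N).
pose S (a : nat * nat) := a.2 <= j.
have aC : all C (u :: p).
  apply/allP => z zp; rewrite /C (allP aN z zp) andbT.
  by apply: contraNneq vp => <-.
rewrite /side (eq_xsum (C := C) (P' := fun a b => S a (+) S b)) //.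
  by rewrite xsum_coboundary /S u0 lN leq0n ltnNge jN.
have up a b : C a -> C b -> hexup a b -> leftof (N, j) a b = S a (+) S b.
  move=> Ca Cb ab; rewrite (leftof_up _ ab); case: a b ab Ca Cb => [a1 a2] [b1 b2].
  rewrite /hexup /C /S /= -!pair_eqE /= => h; case/or3P: h => /andP[/eqP-> /eqP->]; clear; lia.
move=> a b Ca Cb /orP[ab|ba]; first exact: up.
by rewrite leftofC up // addbC.
Qed.

Definition inboard (a : nat * nat) := (a.1 <= N) && (a.2 <= N).

Lemma hex_meet u p v q : path hexnat u p -> path hexnat v q ->
  all inboard (u :: p) -> all inboard (v :: q) ->
  u.2 = 0 -> (last u p).2 = N -> v.1 = 0 -> (last v q).1 = N ->
  exists2 w, w \in u :: p & w \in v :: q.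
Proof.
move=> pp pq bp bq u0 lN v0 lqN.
have [/hasP[w wq wp]|no] := boolP (has (mem (u :: p)) (v :: q)); first by exists w.
(* The path is prolonged to row [N.+1], so that the ray of a cell in row [N] also has edges to
   cross. *)
pose t := ((last u p).1, N.+1); pose p' := rcons p t.
have pp' : path hexnat u p' by rewrite rcons_path pp /= /hexnat /hexup /t /= lN !eqxx.
have nin w : w \in v :: q -> w \notin u :: p'.
  move=> wq; rewrite -rcons_cons mem_rcons inE negb_or; apply/andP; split.
    by apply/eqP => wt; have /andP[_] := allP bq w wq; rewrite wt /= ltnn.
  by apply/negP => wp; move/hasP: no; apply; exists w.
have lp' : (last u p').2 = N.+1 by rewrite last_rcons.
have ss w w' : w \in v :: q -> w' \in v :: q -> hexnat w w' -> side w u p' = side w' u p'.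
  move=> wq w'q; have /andP[_ w2] := allP bq w wq; have /andP[_ w'2] := allP bq w' w'q.
  move: (nin _ wq) (nin _ w'q) w2 w'2; case: w {wq} => i j; case: w' {w'q} => i' j' /= h1 h2 h3 h4.
  by case/orP => h; [|apply/esym]; apply: side_step => //.
have : side (last v q) u p' = side v u p'.
  elim: q v pq ss {bq lqN v0 no nin} => [//|w q IH] v /= /andP[vw pq] ss.
  rewrite IH // => [|a b aq bq]; last by apply: ss; rewrite inE ?aq ?bq orbT.
  by apply/esym/ss; rewrite ?inE ?eqxx ?orbT.
have -> : v = (0, v.2) by rewrite -v0; case: (v).
rewrite side_left; have lv : last v q \in v :: q by exact: mem_last.
have El : last v q = (N, (last v q).2) by rewrite -lqN; case: (last _ _).
rewrite -v0 -surjective_pairing El side_right //.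
- by have /andP[] := allP bq _ lv.
- by rewrite -El nin.
apply/allP => z; rewrite -rcons_cons mem_rcons inE => /orP[/eqP->|/(allP bp)/andP[]//].
by have /andP[] := allP bp _ (mem_last u p).
Qed.

End Crossings.
Local Open Scope nat_scope.

(** * Duality of the crossings of the Hex board *)

Section Duality.
Variable N : nat.
Notation T := ('I_N.+1 * 'I_N.+1)%type.

Definition hexpt (c : T) : nat * nat := (c.1 : nat, c.2 : nat).
Definition hexadj : rel T := fun c d => hexnat (hexpt c) (hexpt d).
Definition hexleft : {set T} := [set c : T | c.1 == ord0].
Definition hexright : {set T} := [set c : T | c.1 == ord_max].
Definition hexbot : {set T} := [set c : T | c.2 == ord0].
Definition hextop : {set T} := [set c : T | c.2 == ord_max].

Lemma hexadj_sym : symmetric hexadj.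
Proof. by move=> c d; rewrite /hexadj /hexnat orbC. Qed.

Lemma hexpt_inj : injective hexpt.
Proof. by move=> [a b] [c d] [/val_inj -> /val_inj ->]. Qed.

Lemma hex_not_both (A : {set T}) :
  joins hexadj hexbot hextop A -> joins hexadj hexleft hexright (~: A) -> False.
Proof.
move=> /joins_connP[u [u' [uB uT /conn_path[p [pp lu _ sp]]]]].
move=> /joins_connP[v [v' [vL vR /conn_path[q [pq lv _ sq]]]]]; subst u' v'.
move: uB vL uT vR; rewrite !inE => /eqP uB /eqP vL /eqP uT /eqP vR.
have mp (c : T) s : path hexadj c s -> path hexnat (hexpt c) (map hexpt s) by rewrite path_map.
have ib (c : T) s : all (inboard N) (hexpt c :: map hexpt s).
  by rewrite -map_cons; apply/allP => _ /mapP[d _ ->]; rewrite /inboard /= !leq_ord.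
have [] := @hex_meet N _ _ _ _ (mp _ _ pp) (mp _ _ pq) (ib _ _) (ib _ _).
- by rewrite /= uB.
- by rewrite last_map /= uT.
- by rewrite /= vL.
- by rewrite last_map /= vR.
move=> w; rewrite -!map_cons => /mapP[c cp ->] /mapP[d dq] /hexpt_inj cd; subst d.
by have := sq _ dq; rewrite inE (sp _ cp).
Qed.

Lemma xor_telescope (f : nat -> bool) n :
  \big[addb/false]_(0 <= i < n) (f i (+) f i.+1) = f 0 (+) f n.
Proof.
elim: n => [|n IH]; first by rewrite big_geq // addbb.
by rewrite big_nat_recr //= IH addbA addbK.
Qed.

(** Parity: mark the grid edges whose ends have different colours and are both labelled. The
    diagonal makes the number of marks around each unit square even, so the number of marks on the
    boundary is even. There is none on the top and right sides, and on the other two the changes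
    telescope to the corner [(0, 0)], which is always labelled and contributes exactly one. *)
Lemma hex_one (A : {set T}) : 
  ~~ joins hexadj hexbot hextop A -> ~~ joins hexadj hexleft hexright (~: A) -> False.
Proof.
move=> noB noL.
pose pt (i j : nat) : T := (inord i, inord j).
pose b i j := pt i j \in A.
(* [l] marks what is connected to the bottom inside [A], or to the left outside. *)
pose lab c := if c \in A then [exists u in hexbot, conn hexadj A u c]
              else [exists u in hexleft, conn hexadj (~: A) u c].
pose l i j := lab (pt i j).
have labE c d : hexadj c d -> (c \in A) = (d \in A) -> lab c = lab d.
  move=> cd cA; rewrite /lab -cA.
  case: ifPn => cA'; apply: eq_existsb => u; congr (_ && _); apply/idP/idP => h;
    apply: conn_trans h _; apply: conn1 => //; rewrite ?inE -?cA //; first by rewrite hexadj_sym.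
  by rewrite hexadj_sym.
have adjE i j i' j' : (i <= N) -> (j <= N) -> (i' <= N) -> (j' <= N) ->
    hexadj (pt i j) (pt i' j') = hexnat (i, j) (i', j').
  by move=> *; rewrite /hexadj /hexpt /= !inordK.
have lE i j i' j' : i <= N -> j <= N -> i' <= N -> j' <= N -> hexup (i, j) (i', j') ->
    b i j = b i' j' -> l i j = l i' j'.
  by move=> *; apply: labE => //; rewrite adjE // /hexnat; apply/orP; left.
pose e i j i' j' := [&& b i j != b i' j', l i j & l i' j'].
pose h i j := e i j i.+1 j; pose v i j := e i j i j.+1.
have square i j : i < N -> j < N -> (h i j (+) h i j.+1) (+) (v i j (+) v i.+1 j) = false.
  move=> iN jN; have [iN' jN'] := (ltnW iN, ltnW jN).
  have h1 := @lE i j i.+1 j iN' jN' iN jN'; have h2 := @lE i j i j.+1 iN' jN' iN' jN.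
  have h3 := @lE i j i.+1 j.+1 iN' jN' iN jN; have h4 := @lE i.+1 j i.+1 j.+1 iN jN' iN jN.
  have h5 := @lE i j.+1 i.+1 j.+1 iN' jN iN jN.
  move: h1 h2 h3 h4 h5; rewrite /hexup /= !eqxx ?orbT => /(_ erefl) h1 /(_ erefl) h2 /(_ erefl) h3 /(_ erefl) h4 /(_ erefl) h5.
  rewrite /h /v /e; move: (b i j) (b i.+1 j) (b i j.+1) (b i.+1 j.+1) h1 h2 h3 h4 h5.
  move: (l i j) (l i.+1 j) (l i j.+1) (l i.+1 j.+1).
  by move=> [] [] [] [] [] [] [] [] //= h1 h2 h3 h4 h5; first [by have := h1 erefl | by have := h2 erefl | by have := h3 erefl | by have := h4 erefl | by have := h5 erefl].
have bnd : (\big[addb/false]_(0 <= i < N) (h i 0 (+) h i N)) (+)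
           (\big[addb/false]_(0 <= j < N) (v 0 j (+) v N j)) = false.
  transitivity (\big[addb/false]_(0 <= i < N) \big[addb/false]_(0 <= j < N) 
     ((h i j (+) h i j.+1) (+) (v i j (+) v i.+1 j))).
    under [RHS]eq_bigr do rewrite big_split /= (xor_telescope (h _)).
    rewrite [RHS]big_split /=; congr (_ (+) _).
    rewrite exchange_big_nat /=; apply: eq_bigr => j _.
    by rewrite (xor_telescope (v^~ j)).
  rewrite big_nat big1 // => i /andP[_ iN]; rewrite big_nat big1 // => j /andP[_ jN].
  exact: square.
have top i : i <= N -> b i N -> l i N = false.
  rewrite /b /l /lab => iN ->; apply: negbTE; apply/negP => /exists_inP[u uB c].
  move/joins_connP: noB; apply; exists u, (pt i N); split=> //.
  by rewrite inE /=; apply/eqP/val_inj; rewrite /= inordK.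
have right j : j <= N -> b N j = false -> l N j = false.
  rewrite /b /l /lab => jN bN; rewrite bN; apply: negbTE; apply/negP => /exists_inP[u uB c].
  move/joins_connP: noL; apply; exists u, (pt N j); split=> //.
  by rewrite inE /=; apply/eqP/val_inj; rewrite /= inordK.
have left j : j <= N -> b 0 j = false -> l 0 j.
  rewrite /b /l /lab => jN bN; rewrite bN; apply/exists_inP; exists (pt 0 j).
    by rewrite inE /=; apply/eqP/val_inj; rewrite /= inordK.
  by rewrite conn_refl // inE bN.
have bot i : i <= N -> b i 0 -> l i 0.
  rewrite /b /l /lab => iN bN; rewrite bN; apply/exists_inP; exists (pt i 0).
    by rewrite inE /=; apply/eqP/val_inj; rewrite /= inordK.
  by rewrite conn_refl.
move: bnd; rewrite !big_split /=.
rewrite [X in _ (+) X (+) _]big_nat [X in _ (+) X (+) _]big1; last first.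
  move=> i /andP[_ iN]; rewrite /h /e; case bi: (b i N); case bi': (b i.+1 N); rewrite ?eqxx //=.
    by rewrite top // ltnW.
  by rewrite (top i.+1) // andbF.
rewrite [X in _ (+) (_ (+) X)]big_nat [X in _ (+) (_ (+) X)]big1; last first.
  move=> j /andP[_ jN]; rewrite /v /e; case bj: (b N j); case bj': (b N j.+1); rewrite ?eqxx //=.
    by rewrite (right j.+1) // andbF.
  by rewrite (right j) // ltnW.
rewrite !addbF.
have -> : \big[addb/false]_(0 <= i < N) h i 0 = \big[addb/false]_(0 <= i < N)
    ((~~ b i 0 && l i 0) (+) (~~ b i.+1 0 && l i.+1 0)).
  rewrite big_nat [RHS]big_nat; apply: eq_bigr => i /andP[_ iN].
  have := @lE i 0 i.+1 0 (ltnW iN) (leq0n _) iN (leq0n _).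
  rewrite /hexup /= !eqxx orbT => /(_ erefl); have := bot i (ltnW iN); have := bot i.+1 iN; rewrite /h /e.
  move: (b i 0) (b i.+1 0) (l i 0) (l i.+1 0).
  by move=> [] [] [] [] //= h1 h2 h3; first [by have := h1 erefl | by have := h2 erefl | by have := h3 erefl].
have -> : \big[addb/false]_(0 <= j < N) v 0 j = \big[addb/false]_(0 <= j < N)
    ((b 0 j && l 0 j) (+) (b 0 j.+1 && l 0 j.+1)).
  rewrite big_nat [RHS]big_nat; apply: eq_bigr => j /andP[_ jN].
  have := @lE 0 j 0 j.+1 (leq0n _) (ltnW jN) (leq0n _) jN.
  rewrite /hexup /= !eqxx => /(_ erefl); have := left j (ltnW jN); have := left j.+1 jN; rewrite /v /e.
  move: (b 0 j) (b 0 j.+1) (l 0 j) (l 0 j.+1).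
  by move=> [] [] [] [] //= h1 h2 h3; first [by have := h1 erefl | by have := h2 erefl | by have := h3 erefl].
rewrite (xor_telescope (fun i => ~~ b i 0 && l i 0)) (xor_telescope (fun j => b 0 j && l 0 j)).
have := top 0 (leq0n _); have := right 0 (leq0n _); have := left 0 (leq0n _); have := bot 0 (leq0n _).
move: (b 0 0) (b N 0) (b 0 N) (l 0 0) (l N 0) (l 0 N).
by move=> [] [] [] [] [] [] //= h1 h2 h3 h4; first [by have := h1 erefl | by have := h2 erefl | by have := h3 erefl | by have := h4 erefl].
Qed.

Lemma hex_dual (A : {set T}) :
  joins hexadj hexbot hextop A = ~~ joins hexadj hexleft hexright (~: A).
Proof.
apply/idP/idP => [h|h]; first by apply/negP => h'; exact: (hex_not_both h h').
by case: (boolP (joins hexadj hexbot hextop A)) => // h'; case: (hex_one h' h).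
Qed.

End Duality.

Local Open Scope ring_scope.

From mathcomp Require Import boolp.

(** * A Loewner estimate for square tilings *)

Section GoodLevels.
Variables (R : realFieldType) (V : finType) (e : rel V).
Variables (Lf Rt Bt Tp : {set V}) (m D E : V -> R) (a b : R).
Hypothesis T : tiling e Lf Rt Bt Tp m D E a b.

Let m0 := tiling_m T.
Let T' := tilingC T.
Local Notation x := (lo D m).
Local Notation y := (lo E m).
Local Notation B := (level D m).
Local Notation C := (level E m).

Lemma cauchy_schwarz (P : pred V) (f g : V -> R) :
  (\sum_(v | P v) f v * g v) ^+ 2 <=
  (\sum_(v | P v) f v ^+ 2) * (\sum_(v | P v) g v ^+ 2).
Proof.
set F := \sum_(v | P v) f v ^+ 2; set G := \sum_(v | P v) g v ^+ 2.
set H := \sum_(v | P v) _.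
have quad t : 0 <= F * t ^+ 2 - 2 * H * t + G.
  rewrite /F /G /H mulr_sumr !mulr_suml -sumrB -big_split /= sumr_ge0 // => v _.
  by rewrite (_ : _ + _ = (f v * t - g v) ^+ 2) ?sqr_ge0 //; ring.
have F0 : 0 <= F by apply: sumr_ge0 => v _; exact: sqr_ge0.
have [Fp|] := ltP 0 F; last first.
  move=> FN; have F00 : F = 0 by apply/le_anti; rewrite FN.
  have h v : P v -> f v = 0.
    by move=> Pv; apply/eqP; rewrite -sqrf_eq0; apply/eqP; move: v Pv; apply: psumr_eq0P => // v _; exact: sqr_ge0.
  by rewrite /H big1 ?expr0n ?F00 ?mul0r // => v /h->; rewrite mul0r.
have := quad (H / F); rewrite -(pmulr_rge0 _ Fp).
rewrite [X in 0 <= X -> _](_ : _ = F * G - H ^+ 2) ?subr_ge0 //.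
by field; rewrite gt_eqF.
Qed.

(** The line [B t] has length [b], and at least [b - (q - p)] after the window is cut out of the
    [y]-direction; so the window holds at most [q - p] of it. *)
Lemma window_sum t p q : 0 <= t < a -> 0 <= p -> p <= q -> q <= b ->
  \sum_(v in B t | (p <= y v) && (E v <= q)) m v <= q - p.
Proof.
move=> ht p0 pq qb.
have := sum_cut T' p0 (d := q - p) _ _ (level_bt T ht).
rewrite subr_ge0 addrC subrK => /(_ pq qb); rewrite sumrB (level_sum T ht) lerD2l lerN2.
apply: le_trans; rewrite [leRHS](bigID (fun v => (p <= y v) && (E v <= q))) /=.
rewrite -[leLHS]addr0 lerD //; last by apply: sumr_ge0 => v _; rewrite len_ge0 // (lo_le T').
rewrite (eq_bigl (fun v => (v \in B t) && ((p <= y v) && (E v <= q)))) //.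
apply: ler_sum => v /and3P[_ h1 h2]; rewrite /len.
have yE := lo_le T' v.
case: (clipP (y v) pq) => -[h3 ->]; case: (clipP (E v) pq) => -[h4 ->]; rewrite /lo in h1 h3 yE *; lra.
Qed.

(** Length-area: if all lines over [[s, t)] had weight at least [k] in the window, the
    Cauchy-Schwarz inequality, with the area of the window at most [(q - p) * (t - s)], would force
    too much energy. *)
Lemma good_level (rho : V -> R) k s t p q : (forall v, 0 <= rho v) ->
  0 <= s -> s < t -> t <= a -> 0 <= p -> p <= q -> q <= b -> 0 < k ->
  (q - p) * (\sum_v rho v ^+ 2) < k ^+ 2 * (t - s) ->
  exists2 z, s <= z < t & \sum_(v in B z | (p <= y v) && (E v <= q)) rho v < k.
Proof.
move=> r0 s0 st ta p0 pq qb k0 small.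
apply: contrapT => no.
pose U := [set v | (p <= y v) && (E v <= q)].
pose g v := len s t (x v) (D v).
have g0 v : 0 <= g v by rewrite len_ge0 // (lo_le T).
have gm v : g v <= m v by rewrite (len_lo T) // ltW.
have h1 : k * (t - s) <= \sum_(v in U) rho v * g v.
  apply: (sweep_levels T (ltW st)) => z hz; rewrite leNgt; apply/negP => lt; apply: no.
  exists z => //; apply: le_lt_trans lt; rewrite le_eqVlt; apply/orP; left; apply/eqP.
  by apply: eq_bigl => v; rewrite !inE andbC.
have h2 : - (q - p) * (t - s) <= \sum_(v in U) - m v * g v.
  apply: (sweep_levels T (ltW st)) => z /andP[sz zt]; rewrite sumrN lerN2.
  rewrite (eq_bigl (fun v => (v \in B z) && ((p <= y v) && (E v <= q)))).
    by apply: window_sum => //; rewrite (le_trans s0 sz) (lt_le_trans zt).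
  by move=> v; rewrite !inE andbC.
have h3 : \sum_(v in U) g v ^+ 2 <= (q - p) * (t - s).
  move: h2; under eq_bigr do rewrite mulNr; rewrite sumrN mulNr lerN2; apply: le_trans.
  by apply: ler_sum => v _; rewrite expr2 ler_wpM2r.
have h4 := cauchy_schwarz (mem U) rho g.
have S0 : \sum_(v in U) rho v ^+ 2 <= \sum_v rho v ^+ 2.
  by apply: ler_sum_sub => // v _; exact: sqr_ge0.
have ts : 0 < t - s by rewrite subr_gt0.
have : (k * (t - s)) ^+ 2 <= (\sum_v rho v ^+ 2) * ((q - p) * (t - s)).
  apply: le_trans (le_trans h4 _).
    have G0 : 0 <= \sum_(v in U) rho v * g v by apply: sumr_ge0 => v _; rewrite mulr_ge0.
    have kt : 0 <= k * (t - s) by rewrite mulr_ge0 // ltW.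
    by apply: lerXn2r h1; rewrite nnegrE.
  by apply: ler_pM; rewrite ?sumr_ge0 // => v _; exact: sqr_ge0.
move: small; set S := \sum_v _ => small h.
have : (t - s) * (k ^+ 2 * (t - s)) <= (t - s) * ((q - p) * S).
  by move: h; congr (_ <= _); ring.
by rewrite ler_pM2l // leNgt small.
Qed.

End GoodLevels.

Section Reach.
Variables (R : realFieldType) (V : finType) (e : rel V).
Variables (Lf Rt Bt Tp : {set V}) (m D E : V -> R) (a b : R).
Hypothesis T : tiling e Lf Rt Bt Tp m D E a b.
Variables (P Q : {set V}) (rho : V -> R).
Hypothesis rho0 : forall v, 0 <= rho v.

Local Notation x := (lo D m).
Local Notation y := (lo E m).
Local Notation B := (level D m).
Local Notation C := (level E m).

(** Weight inside [P] and [Q] is not counted, since the weight of a ring is only admissible between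
    the two sets. *)
Definition reach (k : R) v := exists A p, [/\ p \in P, conn e A p v &
  \sum_(z in A :\: (P :|: Q)) rho z <= k].

Lemma reach_step A k k' u w : reach k u -> conn e A u w ->
  \sum_(z in A :\: (P :|: Q) | z != u) rho z <= k' -> reach (k + k') w.
Proof.
move=> [A0 [p [pP c h]]] c' h'; exists (A0 :|: A), p; split=> //.
  apply: conn_trans (connS (finset.subsetUl _ _) c) _.
  exact: connS (finset.subsetUr _ _) c'.
have uA0 : u \in A0 by case/and3P: c.
apply: le_trans (lerD h h'); rewrite [leLHS](bigID (mem A0)) /= lerD //.
  apply: ler_sum_sub => // z; rewrite !in_setD => /andP[/andP[-> _] zA0] /=.
  exact: zA0.
apply: ler_sum_sub => // z; rewrite !in_setD => /andP[/andP[-> zA] zA0] /=.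
have {zA0} zA0 : z \notin A0 by [].
by move: zA; rewrite in_setU (negbTE zA0) /= => -> /=; apply: contraNneq zA0 => ->.
Qed.

(** The squares strictly between [u] and [w] on the line lie in the window and cost less than [k1];
    [w] itself may stick out of the window and costs at most [k2]. *)
Lemma line_step k k1 k2 t p q u w : 0 <= t < a -> u \in B t -> w \in B t ->
  \sum_(v in B t | (p <= y v) && (E v <= q)) rho v < k1 -> (forall v, rho v <= k2) ->
  y u <= q -> p <= E u -> y w <= q -> p <= E w ->
  reach k u -> reach (k + (k1 + k2)) w.
Proof.
move=> ht uB wB good rk yu Eu yw Ew ru.
have T' := tilingC T.
have k20 : 0 <= k2 by apply: le_trans (rk u).
have k10 : 0 < k1 by apply: le_lt_trans good; exact: sumr_ge0.
have [<-|uw] := eqVneq u w.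
  apply: (reach_step (A := [set u]) ru); first by rewrite conn_refl // inE.
  by rewrite big1 ?addr_ge0 // ?ltW // => z; rewrite !inE => /andP[/andP[_ /eqP->]]; rewrite eqxx.
have key A : conn e A u w -> A \subset B t ->
    (forall z, z \in A -> [\/ z = u, z = w | p <= y z /\ E z <= q]) ->
    reach (k + (k1 + k2)) w.
  move=> c /fintype.subsetP AB h; apply: (reach_step ru c).
  apply: (@le_trans _ _ (rho w + \sum_(v in B t | (p <= y v) && (E v <= q)) rho v)); last first.
    by rewrite addrC lerD // ltW.
  apply: (@le_trans _ _ (\sum_(z | (z == w) || [&& z \in B t, p <= y z & E z <= q]) rho z)).
    apply: ler_sum_sub => // z; rewrite in_setD => /andP[/andP[_ zA] zu].
    by have [zu'|->|[h1 h2]] := h _ zA; [rewrite zu' eqxx in zu|rewrite eqxx|rewrite AB // h1 h2 orbT].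
  rewrite (bigD1 w) ?eqxx //= lerD2l.
  by apply: ler_sum_sub => // z /andP[/orP[->|]].
have [A [AB c [[h1 h]|[h1 h]]]] := level_link T ht uB wB uw; apply: (key A c AB) => z /h.
  move=> [->|->|[h2 h3]]; [by constructor 1|by constructor 2|constructor 3].
  by split; [exact: le_trans Eu h2|exact: le_trans h3 yw].
move=> [->|->|[h2 h3]]; [by constructor 1|by constructor 2|constructor 3].
by split; [exact: le_trans Ew h2|exact: le_trans h3 yu].
Qed.

End Reach.

(* A connected set leaving the ball of radius [r] around a point of its first
   square meets all the vertical, or all the horizontal lines of an interval of
   length [r]. *)
Section Exit.
Variables (R : realFieldType) (V : finType) (e : rel V).
Variables (Lf Rt Bt Tp : {set V}) (m D E : V -> R) (a b : R).
Hypothesis T : tiling e Lf Rt Bt Tp m D E a b.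

Local Notation x := (lo D m).
Local Notation y := (lo E m).
Local Notation B := (level D m).
Local Notation C := (level E m).

Definition insq v s t := (x v <= s <= D v) && (y v <= t <= E v).

Definition meets (P : {set V}) s t r (al : R) :=
  [/\ 0 <= al, al + r <= a, s - r <= al, al <= s & forall z, al <= z < al + r ->
    exists2 v, v \in P :&: B z & y v <= t + r /\ t - r <= E v].

Definition inball v s t r := [&& s - r <= x v, D v <= s + r, t - r <= y v & E v <= t + r].

End Exit.

Lemma exit_lines (R : realFieldType) (V : finType) (e : rel V)
   (Lf Rt Bt Tp : {set V}) (m D E : V -> R) (a b : R) (P : {set V}) s t r v0 v1 :
  tiling e Lf Rt Bt Tp m D E a b -> 0 < r -> conn e P v0 v1 -> insq m D E v0 s t ->
  ~~ inball m D E v1 s t r ->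
  (exists al, meets m D E a P s t r al) \/ (exists al, meets m E D b P t s r al).
Proof.
move=> T r0 cP in0 out1; have T' := tilingC T.
have /andP[/andP[xs sD] /andP[yt tE]] := in0.
(* [g] is the first square not contained in the ball; together with squares contained in it, it
   forms [A], all of whose squares touch the ball. *)
have [A [g [AP cA outg near]]] : exists (A : {set V}) g, [/\ A \subset P, conn e A v0 g, ~~ inball m D E g s t r &
    forall v, v \in A -> [/\ lo D m v <= s + r, s - r <= D v, lo E m v <= t + r & t - r <= E v]].
  have [in0'|out0] := boolP (inball m D E v0 s t r); last first.
    exists [set v0], v0; rewrite conn_refl ?inE // sub1set; split=> //; first by case/and3P: cP.
    by move=> v /set1P ->; split; lra.
  have [u [g [Pu Pg ug c gP]]] := conn_exit (P := fun v => inball m D E v s t r) in0' out1 cP.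
  have /and4P[u1 u2 u3 u4] := Pu.
  exists (g |: [set z in P | inball m D E z s t r]), g; split=> //.
  - by rewrite subUset sub1set gP; apply/fintype.subsetP => z; rewrite inE => /andP[].
  - apply: (@conn_trans _ _ _ u); first exact: connS (finset.subsetUr _ _) c.
    by case/and3P: c => _ uF _; apply: conn1 => //; rewrite in_setU ?uF ?orbT // set11.
  move=> v; rewrite !inE => /orP[/eqP->|/andP[_ /and4P[h1 h2 h3 h4]]]; last first.
    by have := lo_le T v; have := lo_le T' v; split; lra.
  have gu : e g u by rewrite (tiling_sym T).
  by have := lo_step T ug; have := lo_step T' ug; have := lo_step T gu; have := lo_step T' gu; split; lra.
have v0P : v0 \in P by case/and3P: cP.
have hit z u v : conn e A u v -> lo D m u <= z -> z < D v ->
    exists2 w, w \in P :&: level D m z & lo E m w <= t + r /\ t - r <= E w.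
  move=> c h1 h2; have [w wA wB] := level_hit T c h1 h2; have [_ _ ? ?] := near _ wA.
  by exists w => //; rewrite inE (fintype.subsetP AP _ wA).
have hit' z u v : conn e A u v -> lo E m u <= z -> z < E v ->
    exists2 w, w \in P :&: level E m z & lo D m w <= s + r /\ s - r <= D w.
  move=> c h1 h2; have [w wA wB] := level_hit T' c h1 h2; have [? ? _ _] := near _ wA.
  by exists w => //; rewrite inE (fintype.subsetP AP _ wA).
have cA' := conn_sym (tiling_sym T) cA.
have := lo_ge0 T v0; have := lo_ge0 T' v0; have := hi_le T v0; have := hi_le T' v0.
have := lo_ge0 T g; have := lo_ge0 T' g; have := hi_le T g; have := hi_le T' g.
move=> g1 g2 g3 g4 w1 w2 w3 w4.
move: outg; rewrite !negb_and -!ltNge => /or4P[h|h|h|h].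
- left; exists (s - r); split; try lra; move=> z /andP[z1 z2].
  by apply: (hit z g v0 cA'); lra.
- left; exists s; split; try lra; move=> z /andP[z1 z2].
  by apply: (hit z v0 g cA); lra.
- right; exists (t - r); split; try lra; move=> z /andP[z1 z2].
  by apply: (hit' z g v0 cA'); lra.
- right; exists t; split; try lra; move=> z /andP[z1 z2].
  by apply: (hit' z v0 g cA); lra.
Qed.

(** * Connecting two sets along good lines *)

Section Loewner.
Variables (R : realFieldType) (V : finType) (e : rel V).
Variables (P Q : {set V}) (rho : V -> R).
Hypothesis rho0 : forall v, 0 <= rho v.
Hypothesis sep : forall A p q, p \in P -> q \in Q -> conn e A p q ->
  1 <= \sum_(z in A :\: (P :|: Q)) rho z.

Let S := \sum_v rho v ^+ 2.

Lemma reach_target k q : q \in Q -> reach e P Q rho k q -> 1 <= k.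
Proof. by move=> qQ [A [p [pP c h]]]; exact: le_trans (sep pP qQ c) h. Qed.

Definition gline m D E (a s t w z : R) := [/\ 0 <= z < a, s - w <= z <= s + w &
  \sum_(v in level D m z | (t - w <= lo E m v) && (E v <= t + w)) rho v < 8^-1].

Definition hits m D E (X : {set V}) (t w z : R) :=
  exists2 v, v \in X :&: level D m z & lo E m v <= t + w /\ t - w <= E v.

Section Window.
Variables (Lf Rt Bt Tp : {set V}) (m D E : V -> R) (a b : R).
Hypothesis T : tiling e Lf Rt Bt Tp m D E a b.
Variables (s t w : R).

Lemma window_good al l : 0 <= t <= b ->
  0 < l -> 0 <= al -> al + l <= a -> 0 < w ->
  2 * w * S < 64^-1 * l ->
  exists2 z, al <= z < al + l &
  \sum_(v in level D m z | (t - w <= lo E m v) && (E v <= t + w)) rho v < 8^-1.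
Proof.
move=> in_t l0 al0 ala w0 small; have T' := tilingC T.
(* [good_level] wants a window inside [[0, b]]; clipping loses no square, as all squares lie in the
   rectangle. *)
pose p := clip 0 b (t - w); pose q := clip 0 b (t + w).
have b0 := ltW (tiling_b T); have /andP[t0 tb] := in_t.
have S0 : 0 <= S by apply: sumr_ge0 => v _; exact: sqr_ge0.
have p0 : 0 <= p by rewrite /p; case: (clipP (t - w) b0) => -[? ->]; lra.
have pq : p <= q by apply: clip_le; lra.
have qb : q <= b by rewrite /q; case: (clipP (t + w) b0) => -[? ->]; lra.
have qp : q - p <= 2 * w.
  have h : t - w <= t + w by lra.
  by have := len_le b0 h; rewrite /len -/p -/q; lra.
have [|||z hz gz] := good_level T rho0 al0 (t := al + l) (k := 8^-1) _ ala p0 pq qb.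
- by rewrite ltrDl.
- by rewrite invr_gt0.
- apply: le_lt_trans (_ : 2 * w * S < _); first by rewrite ler_wpM2r.
  by rewrite [X in _ < X](_ : _ = 64^-1 * l) //; field.
exists z => //; apply: le_lt_trans gz; apply: ler_sum_sub => // v /and3P[-> h1 h2] /=.
apply/andP; split.
  by rewrite /p; case: (clipP (t - w) b0) => -[? ->]; have := lo_ge0 T' v; have := lo_le T' v; have := hi_le T' v; lra.
by rewrite /q; case: (clipP (t + w) b0) => -[? ->]; have := lo_ge0 T' v; have := lo_le T' v; have := hi_le T' v; lra.
Qed.

Lemma good_meets X s' t' r al : 0 <= t <= b -> meets m D E a X s' t' r al -> 0 < r ->
  `|s' - s| + r <= w -> `|t' - t| + r <= w -> 2 * w * S < 64^-1 * r ->
  exists2 z, gline m D E a s t w z & hits m D E X t w z.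
Proof.
move=> in_t [h1 h2 h3 h4 H] r0 hs ht small.
have := ler_norm (s' - s); have := ler_norm (t' - t); have := ler_norm (s - s'); have := ler_norm (t - t').
rewrite [X in _ <= X](distrC t) [X in _ -> _ <= X -> _](distrC s) => n1 n2 n3 n4.
have w0 : 0 < w by apply: lt_le_trans hs; rewrite ltr_wpDl.
have [z /andP[z1 z2] gz] := window_good in_t r0 h1 h2 w0 small.
have [|v vX [v1 v2]] := H z; first by rewrite z1.
by exists z; [split=> //; apply/andP; split; lra|exists v => //; split; lra].
Qed.

Hypothesis rho_small : forall v, rho v <= 16^-1.

Lemma reach0 p : p \in P -> reach e P Q rho 0 p.
Proof.
move=> pP; exists [set p], p; split=> //; first by rewrite conn_refl ?inE.
by rewrite big1 // => z; rewrite !inE => /andP[+ /eqP zp]; rewrite zp pP.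
Qed.

(** Two lines crossing in [c] lead from [P] to [Q] at a cost of at most [2 * (8^-1 + 16^-1)], less
    than the [1] required by [sep]. *)
Lemma finish_VH z z' : gline m D E a s t w z -> hits m D E P t w z ->
  gline m E D b t s w z' -> hits m E D Q s w z' -> False.
Proof.
move=> [za /andP[z1 z2] gz] [p /setIP[pP pB] [p1 p2]] [zb /andP[z3 z4] gz'] [q /setIP[qQ qC] [q1 q2]].
have T' := tilingC T; have [c cB cC] := crossing T za zb.
have /andP[c1 c2] : lo D m c <= z < D c by rewrite inE in cB.
have /andP[c3 c4] : lo E m c <= z' < E c by rewrite inE in cC.
have r1 : reach e P Q rho (0 + (8^-1 + 16^-1)) c.
  by apply: (line_step T rho0 za pB cB gz rho_small) (reach0 pP); lra.
have r2 : reach e P Q rho (0 + (8^-1 + 16^-1) + (8^-1 + 16^-1)) q.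
  by apply: (line_step T' rho0 zb cC qC gz' rho_small) r1; lra.
by have := reach_target qQ r2; lra.
Qed.

(** Two parallel lines are linked by a third one: three moves cost at most [9 / 16], still less than
    [1]. *)
Lemma finish_VV z z' z2 : gline m D E a s t w z -> hits m D E P t w z ->
  gline m D E a s t w z' -> hits m D E Q t w z' -> gline m E D b t s w z2 -> False.
Proof.
move=> [za /andP[z1 z3] gz] [p /setIP[pP pB] [p1 p2]] [za' /andP[z4 z5] gz'] [q /setIP[qQ qB] [q1 q2]].
move=> [zb /andP[z6 z7] gz2].
have T' := tilingC T; have [c cB cC] := crossing T za zb.
have [c' cB' cC'] := crossing T za' zb.
have /andP[c1 c2] : lo D m c <= z < D c by rewrite inE in cB.
have /andP[c3 c4] : lo E m c <= z2 < E c by rewrite inE in cC.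
have /andP[c1' c2'] : lo D m c' <= z' < D c' by rewrite inE in cB'.
have /andP[c3' c4'] : lo E m c' <= z2 < E c' by rewrite inE in cC'.
have r1 : reach e P Q rho (0 + (8^-1 + 16^-1)) c.
  by apply: (line_step T rho0 za pB cB gz rho_small) (reach0 pP); lra.
have r2 : reach e P Q rho (0 + (8^-1 + 16^-1) + (8^-1 + 16^-1)) c'.
  by apply: (line_step T' rho0 zb cC cC' gz2 rho_small) r1; lra.
have r3 : reach e P Q rho (0 + (8^-1 + 16^-1) + (8^-1 + 16^-1) + (8^-1 + 16^-1)) q.
  by apply: (line_step T rho0 za' cB' qB gz' rho_small) r2; lra.
by have := reach_target qQ r3; lra.
Qed.

(* In a window as high as the rectangle, a line meeting [P] already reaches the sides. *)
Lemma finish_V z : gline m D E a s t w z -> hits m D E P t w z ->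
  0 <= t <= b -> b <= w -> Bt \subset Q -> False.
Proof.
move=> [za /andP[z1 z2] gz] [p /setIP[pP pB] [p1 p2]] /andP[t0 tb] bw /fintype.subsetP BQ.
have T' := tilingC T; have [u [l [uB _ _ cov _]]] := level_path T za.
have uL : u \in level D m z by rewrite cov inE eqxx.
have r1 : reach e P Q rho (0 + (8^-1 + 16^-1)) u.
  apply: (line_step T rho0 za pB uL gz rho_small) (reach0 pP) => //.
    by have := hi_le T' u; have := lo_le T' u; lra.
  by have := lo_ge0 T' u; have := lo_le T' u; lra.
by have := reach_target (BQ _ uB) r1; lra.
Qed.

(** Of the intervals of length [l] to the right and to the left of [s], one lies in [[0, a]]. *)
Lemma some_gline l : 0 <= s <= a -> 0 <= t <= b -> 0 < l -> 2 * l <= a -> l <= w ->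
  2 * w * S < 64^-1 * l -> exists z, gline m D E a s t w z.
Proof.
move=> /andP[s0 sa] in_t l0 la lw small; have w0 := lt_le_trans l0 lw.
have [h|h] := leP (s + l) a.
  have [z /andP[z1 z2] gz] := window_good in_t l0 s0 h w0 small.
  by exists z; split=> //; apply/andP; split; lra.
have s1 : 0 <= s - l by lra.
have s2 : s - l + l <= a by lra.
have [z /andP[z1 z2] gz] := window_good in_t l0 s1 s2 w0 small.
by exists z; split=> //; apply/andP; split; lra.
Qed.

End Window.
End Loewner.

Section LoewnerMain.
Variables (R : realFieldType) (V : finType) (e : rel V).
Variables (P Q : {set V}) (rho : V -> R).
Hypothesis rho0 : forall v, 0 <= rho v.
Hypothesis sep : forall A p q, p \in P -> q \in Q -> conn e A p q ->
  1 <= \sum_(z in A :\: (P :|: Q)) rho z.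
Hypothesis rho_small : forall v, rho v <= 16^-1.

Let S := \sum_v rho v ^+ 2.

Lemma loewner_V (Lf Rt Bt Tp : {set V}) (m D E : V -> R) (a b s t s' t' r w al : R) :
  tiling e Lf Rt Bt Tp m D E a b -> Bt \subset Q -> 0 <= s <= a -> 0 <= t <= b ->
  0 < r -> `|s' - s| + r <= w -> `|t' - t| + r <= w -> 2 * w * S < 64^-1 * (r / 2) ->
  meets m D E a P s t r al ->
  (exists al', meets m D E a Q s' t' r al') \/ (exists al', meets m E D b Q t' s' r al') ->
  False.
Proof.
move=> T BQ in_s in_t r0 hs ht small mP mQ; have T' := tilingC T.
have ns := normr_ge0 (s' - s); have nt := normr_ge0 (t' - t).
have small' : 2 * w * S < 64^-1 * r by apply: lt_trans small _; lra.
have w0 : r <= w by lra.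
have [z gz hz] : exists2 z, gline rho m D E a s t w z & hits m D E P t w z.
  by apply: (good_meets rho0 T in_t mP r0 _ _ small'); rewrite subrr normr0 add0r.
(* If the rectangle is lower than [r], the line reaches the side [Bt], which is in [Q]. If not,
   [2 * (r / 2) <= b] leaves room for the transversal of [some_gline]; hence [r / 2] in [small]. *)
have [br|rb] := ltP b r.
  by apply: (finish_V rho0 sep T rho_small gz hz in_t _ BQ); lra.
case: mQ => -[al' mQ].
  have [z' gz' hz'] := good_meets rho0 T in_t mQ r0 hs ht small'.
  have [z2 gz2] : exists z2, gline rho m E D b t s w z2.
    by apply: (some_gline rho0 T' in_t in_s _ _ _ small); lra.
  exact (finish_VV rho0 sep T rho_small gz hz gz' hz' gz2).
have [z' gz' hz'] := good_meets rho0 T' in_s mQ r0 ht hs small'.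
exact (finish_VH rho0 sep T rho_small gz hz gz' hz').
Qed.

End LoewnerMain.

(** If [P] were large compared with its distance from [Q], both sets would leave balls of radius [r]
    in a common window of size comparable to [r]. By [exit_lines] each meets all lines of an
    interval, some of these lines are good, and good lines would connect [P] to [Q] at a cost below
    [1]. *)
Lemma loewner (R : realFieldType) (eps : R) : 0 < eps -> exists2 c, 0 < c &
  forall (V : finType) (e : rel V) (Lf Rt Bt Tp : {set V}) (m D E : V -> R) (a b : R)
    (P Q : {set V}) (rho : V -> R) v0 v1 v' (s0 t0 s1 t1 s' t' : R),
  tiling e Lf Rt Bt Tp m D E a b -> (forall v, 0 <= rho v) ->
  (forall A p q, p \in P -> q \in Q -> conn e A p q ->
    1 <= \sum_(z in A :\: (P :|: Q)) rho z) ->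
  conn e P v0 v1 -> (forall u v, u \in Q -> v \in Q -> conn e Q u v) ->
  Lf :|: Rt :|: Bt :|: Tp \subset Q -> v' \in Q ->
  insq m D E v0 s0 t0 -> insq m D E v1 s1 t1 -> insq m D E v' s' t' ->
  \sum_v rho v ^+ 2 < c ->
  Num.max `|s1 - s0| `|t1 - t0| <= eps * Num.max `|s' - s0| `|t' - t0|.
Proof.
move=> eps0; exists (eps / (1024 * (1 + eps))).
  by rewrite divr_gt0 // mulr_gt0 // addr_gt0.
move=> V e Lf Rt Bt Tp m D E a b P Q rho v0 v1 v' s0 t0 s1 t1 s' t' T r0 sep cP cQ.
rewrite !subUset => /andP[/andP[/andP[LQ RQ] BQ] TQ] v'Q in0 in1 in' Sc.
set dl := Num.max `|s1 - s0| _; set d0 := Num.max `|s' - s0| _.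
rewrite leNgt; apply/negP => lt.
have d00 : 0 <= d0 by rewrite le_max normr_ge0.
have dl0 : 0 < dl by apply: le_lt_trans lt; rewrite mulr_ge0 // ltW.
have [ns nt] : `|s' - s0| <= d0 /\ `|t' - t0| <= d0 by rewrite !le_max !lexx orbT.
have S0 : 0 <= \sum_v rho v ^+ 2 by apply: sumr_ge0 => v _; exact: sqr_ge0.
have T' := tilingC T.
have Sc' : (\sum_v rho v ^+ 2) * (1024 * (1 + eps)) < eps.
  by rewrite -ltr_pdivlMr // mulr_gt0 // addr_gt0.
move: S0 Sc Sc'; set S := \sum_v _ => S0 Sc Sc'.
(* The constant is less than [256^-1], and no single square of a weight exceeds the energy. *)
have rs v : rho v <= 16^-1.
  have h : rho v ^+ 2 <= S by rewrite /S (bigD1 v) //= lerDl sumr_ge0 // => u _; exact: sqr_ge0.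
  rewrite leNgt; apply/negP => lt16.
  have c256 : 256^-1 <= S.
    have p16 : 0 <= 16^-1 :> R by rewrite invr_ge0.
    by apply: le_trans h; have := ltr_pM p16 p16 lt16 lt16; rewrite expr2; lra.
  have : 256^-1 * (1024 * (1 + eps)) <= S * (1024 * (1 + eps)).
    by rewrite ler_pM2r // mulr_gt0 // addr_gt0.
  by clear -eps0 Sc'; lra.
(* [dl] is at most one side of the rectangle, so two opposite sides do not fit into a ball of radius
   [dl / 4]; hence [Q], which contains all sides, leaves the ball at [(s', t')]. *)
pose r := dl / 4; pose w := d0 + dl.
have rp : 0 < r by rewrite divr_gt0.
have hs : `|s' - s0| + r <= w by rewrite /w /r; clear -ns nt d00 dl0; lra.
have ht : `|t' - t0| + r <= w by rewrite /w /r; clear -ns nt d00 dl0; lra.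
have small : 2 * w * S < 64^-1 * (r / 2).
  have h : d0 * S <= dl / eps * S by rewrite ler_wpM2r // ler_pdivlMr // mulrC ltW.
  have h2 : dl / eps * (S * (1024 * (1 + eps))) < dl / eps * eps by rewrite ltr_pM2l // divr_gt0.
  have h3 : dl / eps * (S * (1024 * (1 + eps))) = 1024 * (dl / eps * S + dl * S) by field; rewrite gt_eqF.
  have h4 : dl / eps * eps = dl by field; rewrite gt_eqF.
  by rewrite /w /r mulrDr mulrDl; clear -h h2 h3 h4; lra.
have /andP[/andP[x0 D0] /andP[y0 E0]] := in0; have /andP[/andP[x1 D1] /andP[y1 E1]] := in1.
have [[[g1 g2] g3] g4] := (lo_ge0 T v0, lo_ge0 T' v0, hi_le T v0, hi_le T' v0).
have [[[g5 g6] g7] g8] := (lo_ge0 T v1, lo_ge0 T' v1, hi_le T v1, hi_le T' v1).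
have in_s : 0 <= s0 <= a by rewrite (le_trans g1 x0) (le_trans D0 g3).
have in_t : 0 <= t0 <= b by rewrite (le_trans g2 y0) (le_trans E0 g4).
have in_s1 : 0 <= s1 <= a by rewrite (le_trans g5 x1) (le_trans D1 g7).
have in_t1 : 0 <= t1 <= b by rewrite (le_trans g6 y1) (le_trans E1 g8).
have big : r < `|s1 - s0| \/ r < `|t1 - t0|.
  have : r < dl by rewrite ltr_pdivrMr // ltr_pMr // ltr1n.
  by rewrite /dl; case: (leP `|s1 - s0| `|t1 - t0|) => _ ?; [right|left].
have out1 : ~~ inball m D E v1 s0 t0 r.
  apply/negP => /and4P[i1 i2 i3 i4]; clear -big x1 D1 y1 E1 i1 i2 i3 i4.
  by case: big; rewrite ltNge => /negP[]; rewrite ler_norml; apply/andP; split; lra.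
have mP := exit_lines T rp cP in0 out1.
have wide : dl <= a \/ dl <= b.
  clear -in_s in_t in_s1 in_t1; move: in_s in_t in_s1 in_t1 => /andP[? ?] /andP[? ?] /andP[? ?] /andP[? ?].
  by rewrite /dl; case: (leP `|s1 - s0| `|t1 - t0|) => _; [right|left]; rewrite ler_norml; apply/andP; split; lra.
have [q qQ outq] : exists2 q, q \in Q & ~~ inball m D E q s' t' r.
  case: wide => wd.
    have [|u [v [uL vR _]]] := joins_connP _ _ _ _ (level_lr T (s := 0) _); first by rewrite lexx (tiling_b T).
    have [iu|?] := boolP (inball m D E u s' t' r); last by exists u => //; exact: (fintype.subsetP LQ).
    exists v; first exact: (fintype.subsetP RQ).
    case: (tiling_D T) => d1 _ _ d4; have := d1 _ uL; have := d4 _ vR.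
    move: iu => /and4P[i1 i2 i3 i4] da du; apply/negP => /and4P[j1 j2 j3 j4].
    move: i1 j2; rewrite /lo du subrr /r; clear -wd dl0 da; lra.
  have [|u [v [uL vR _]]] := joins_connP _ _ _ _ (level_lr T' (s := 0) _); first by rewrite lexx (tiling_b T').
  have [iu|?] := boolP (inball m D E u s' t' r); last by exists u => //; exact: (fintype.subsetP BQ).
  exists v; first exact: (fintype.subsetP TQ).
  case: (tiling_E T) => d1 _ _ d4; have := d1 _ uL; have := d4 _ vR.
  move: iu => /and4P[i1 i2 i3 i4] da du; apply/negP => /and4P[j1 j2 j3 j4].
  move: i3 j4; rewrite /lo du subrr /r; clear -wd dl0 da; lra.
have mQ := exit_lines T rp (cQ _ _ v'Q qQ) in' outq.
case: mP => -[al mP].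
  exact (loewner_V r0 sep rs T BQ in_s in_t rp hs ht small mP mQ).
apply: False_ind; refine (loewner_V r0 sep rs T' LQ in_t in_s rp ht hs small mP _).
by case: mQ; [right|left].
Qed.

(** * Clusters *)

Section Clusters.
Variables (T : finType) (adj : rel T) (V : finType) (cl : T -> V).
Hypothesis adj_sym : symmetric adj.
Hypothesis cl_conn : forall c d, cl c = cl d -> conn adj [set x | cl x == cl c] c d.

Definition cladj : rel V := [rel u v | [exists c, exists d, [&& cl c == u, cl d == v & adj c d]]].

Lemma cladjP u v : reflect (exists c d, [/\ cl c = u, cl d = v & adj c d]) (cladj u v).
Proof.
apply: (iffP existsP) => [[c /existsP[d /and3P[/eqP ? /eqP ? ?]]]|[c [d [cu dv cd]]]].
  by exists c, d.
by exists c; apply/existsP; exists d; rewrite cu dv !eqxx.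
Qed.

Lemma cladj_sym : symmetric cladj.
Proof.
by move=> u v; apply/cladjP/cladjP => -[c [d [<- <- cd]]]; exists d, c; rewrite adj_sym.
Qed.

Lemma conn_cl (A : {set V}) c d : conn adj (cl @^-1: A) c d -> conn cladj A (cl c) (cl d).
Proof.
move=> h; have cA : cl c \in A by case/and3P: h; rewrite inE.
apply: (conn_ind (P := fun x => conn cladj A (cl c) (cl x)) _ _ h); last exact: conn_refl.
move=> x y; rewrite !inE => xA yA xy /conn_trans; apply; apply: conn1 => //.
by apply/cladjP; exists x, y.
Qed.

Lemma cl_conn_lift (A : {set V}) u v c d : conn cladj A u v -> cl c = u -> cl d = v ->
  conn adj (cl @^-1: A) c d.
Proof.
move=> /conn_path[p [pp lp _ sp]]; elim: p u c pp lp sp => [|w p IH] u c /= pp lp sp cu dv.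
  apply: connS (cl_conn _); last by rewrite cu dv -lp.
  by apply/subsetP => x; rewrite !inE => /eqP->; rewrite cu sp // inE.
move: pp => /andP[/cladjP[x [y [xu yw xy]]] pp].
have uA : u \in A by apply: sp; rewrite inE eqxx.
have wA : w \in A by apply: sp; rewrite !inE eqxx orbT.
apply: (@conn_trans _ _ _ x).
  apply: connS (cl_conn _); last by rewrite cu xu.
  by apply/subsetP => z; rewrite !inE => /eqP->; rewrite cu.
apply: (@conn_trans _ _ _ y); first by apply: conn1 => //; rewrite inE ?xu ?yw.
apply: IH pp lp _ yw dv => z zp; apply: sp; rewrite inE zp orbT //.
Qed.

Lemma joins_cl (L L' : {set T}) (A : {set V}) :
  joins cladj (cl @: L) (cl @: L') A = joins adj L L' (cl @^-1: A).
Proof.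
apply/joins_connP/joins_connP => [[u [v [/imsetP[c cL ->] /imsetP[d dL ->] h]]]|[c [d [cL dL h]]]].
  by exists c, d; split=> //; exact: cl_conn_lift h erefl erefl.
by exists (cl c), (cl d); rewrite !imset_f //; split=> //; exact: conn_cl.
Qed.

End Clusters.

(** * Connected classes of cells that follow a cover *)

Section Partition.
Variables (T : finType) (adj : rel T) (W : finType) (Q : W -> {set T}).
Hypothesis adj_sym : symmetric adj.
Hypothesis Q_conn : forall w c d, c \in Q w -> d \in Q w -> conn adj (Q w) c d.

Definition meet w w' := Q w :&: Q w' != set0.

Fixpoint hops k w : {set W} :=
  if k is k'.+1 then hops k' w :|: [set u | [exists v in hops k' w, meet u v]] else [set w].

Lemma hops_refl k w : w \in hops k w.
Proof. by elim: k => [|k IH] /=; rewrite inE ?IH. Qed.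

Lemma card_bigU_le (I J : finType) (S : {set I}) (F : I -> {set J}) n :
  (forall i, i \in S -> #|F i| <= n)%N -> (#|\bigcup_(i in S) F i| <= #|S| * n)%N.
Proof.
move=> Fn; rewrite -sum_nat_const; apply: leq_trans (_ : (\sum_(i in S) #|F i| <= _)%N).
  elim/big_rec2: _ => [|i n0 A _ h]; first by rewrite cards0.
  by apply: leq_trans (leq_card_setU _ _) _; rewrite leq_add2l.
exact: leq_sum.
Qed.

Lemma card_hops d k w : (forall v, #|[set u | meet u v]| <= d)%N -> (#|hops k w| <= d.+1 ^ k)%N.
Proof.
move=> md; elim: k => [|k IH] /=; first by rewrite cards1.
apply: leq_trans (leq_card_setU _ _) _; rewrite expnS mulSn leq_add //.
have -> : [set u | [exists v in hops k w, meet u v]] = \bigcup_(v in hops k w) [set u | meet u v].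
  by apply/setP => u; rewrite inE; apply/exists_inP/bigcupP => -[v ? b]; exists v => //; move: b; rewrite inE.
rewrite mulnC; apply: leq_trans (card_bigU_le (n := d) _) _ => [v _|]; first exact: md.
by rewrite leq_mul2r IH orbT.
Qed.

Lemma card_hops_inv d k u : (forall v, #|[set u | meet v u]| <= d)%N ->
  (#|[set w | u \in hops k w]| <= d.+1 ^ k)%N.
Proof.
move=> md; elim: k u => [|k IH] u /=.
  rewrite expn0 -(cards1 u) subset_leq_card //; apply/subsetP => w; rewrite !inE eq_sym //.
apply: leq_trans (_ : #|[set w | u \in hops k w] :|: \bigcup_(v in [set v | meet u v]) [set w | v \in hops k w]| <= _)%N.
  apply: subset_leq_card; apply/subsetP => w; rewrite !inE => /orP[->//|].
  by move=> /exists_inP[v vw uv]; apply/orP; right; apply/bigcupP; exists v; rewrite inE.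
apply: leq_trans (leq_card_setU _ _) _; rewrite expnS mulSn leq_add //.
apply: leq_trans (card_bigU_le (n := (d.+1 ^ k)%N) _) _ => [v _|]; first exact: IH.
by rewrite leq_mul2r md orbT.
Qed.

Implicit Types a : T -> option W.

Definition classes_conn a := forall c d, a c = a d -> a c != None ->
  conn adj [set x | a x == a c] c d.

Definition extends a a' := forall c, a c != None -> a' c = a c.

(** As long as [S] has unlabelled cells, connectedness provides one next to a labelled cell of [S].
    It takes the label of that cell, which keeps the classes connected. *)
Lemma fill_connected a (S : {set T}) c0 : classes_conn a ->
  (forall c d, c \in S -> d \in S -> conn adj S c d) -> c0 \in S -> a c0 != None ->
  exists a', [/\ classes_conn a', extends a a',
    forall c, (a' c != None) = (a c != None) || (c \in S) &
    forall c, c \in S -> a c = None -> exists c1, [/\ c1 \in S, a c1 != None & a' c = a c1]].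
Proof.
have [n] := ubnP #|[set c in S | a c == None]|; elim: n a => // n IH a le ca cS c0S ac0.
have [/existsP[c1 /andP[c1S /eqP ac1]]|no] := boolP [exists c, (c \in S) && (a c == None)]; last first.
  exists a; split=> // c; last by move=> cS' ac; case/existsP: no; exists c; rewrite cS' ac /=.
  case: (boolP (c \in S)) => [cS'|]; rewrite ?orbF // orbT.
  by apply/negP => /eqP ac; case/existsP: no; exists c; rewrite cS' ac /=.
have [|x [y [ax ay xy c yS]]] := conn_exit (P := fun c => a c != None) ac0 _ (cS _ _ c0S c1S).
  by rewrite ac1.
move/negbNE/eqP: ay => ay.
have xS : x \in S by case/and3P: c => _; rewrite inE => /andP[].
pose a1 z := if z == y then a x else a z.
have xy' : x != y by apply: contraNneq ax => ->; rewrite ay.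
have a1x : a1 x = a x by rewrite /a1 (negbTE xy').
have a1y : a1 y = a x by rewrite /a1 eqxx.
have a1E z : z != y -> a1 z = a z by rewrite /a1 => /negbTE->.
have a1N z : (a1 z != None) = (a z != None) || (z == y).
  by have [->|zy] := eqVneq z y; rewrite ?a1y ?ax ?orbT // a1E ?orbF.
have ex : extends a a1.
  by move=> z az; apply: a1E; apply: contraNneq az => ->; rewrite ay.
have old z u : a z = a u -> a z != None -> conn adj [set v | a1 v == a z] z u.
  move=> azu az; apply: connS (ca _ _ azu az); apply/subsetP => v; rewrite !inE => /eqP av.
  by rewrite ex ?av.
have xyc : conn adj [set v | a1 v == a x] x y.
  by apply: conn1 => //; rewrite inE ?a1x ?a1y.
have ca1 : classes_conn a1.
  move=> z u; have [->|zy] := eqVneq z y; have [->|uy] := eqVneq u y.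
  - by move=> _ _; rewrite a1y; apply: conn_refl; rewrite inE a1y.
  - rewrite a1y (a1E _ uy) => axu _.
    by apply: conn_trans (conn_sym adj_sym xyc) _; exact: old.
  - rewrite a1y (a1E _ zy) => azx az.
    by apply: (@conn_trans _ _ _ x); [exact: old|rewrite azx].
  - by rewrite (a1E _ zy) (a1E _ uy) => azu az; exact: old.
have lt : (#|[set c in S | a1 c == None]| < n)%N.
  apply: leq_trans (_ : #|[set c in S | a c == None]| <= n)%N; last by rewrite -ltnS.
  apply: proper_card; apply/properP; split.
    apply/subsetP => z; rewrite !inE => /andP[-> /eqP az] /=.
    by apply/negPn/negP => az'; have := a1N z; rewrite az az'.
  by exists y; rewrite !inE ?yS ?ay // a1y (negbTE ax) andbF.
have a10 : a1 c0 != None by rewrite a1N ac0.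
have [a' [ca' ex' dom' val']] := IH a1 lt ca1 cS c0S a10.
exists a'; split=> //.
- by move=> z az; rewrite ex' ?ex // a1N az.
- move=> z; rewrite dom' a1N -orbA; congr orb.
  by case: eqVneq => // ->; rewrite yS.
move=> z zS az; have [zy|zy] := eqVneq z y.
  by exists x; split=> //; rewrite zy ex' ?a1y.
have [|c2 [c2S a1c2 ->]] := val' z zS; first by rewrite /a1 (negbTE zy).
have [cy|cy] := eqVneq c2 y; first by exists x; split=> //; rewrite cy a1y.
by exists c2; split=> //; rewrite /a1 (negbTE cy) in a1c2 *.
Qed.

Variables (K : nat) (col : W -> nat).
Hypothesis col_K : forall w, (col w < K)%N.
Hypothesis col_disj : forall w w', col w = col w' -> w != w' -> ~~ meet w w'.

(* Colour by colour: the pieces of one colour are disjoint, so that a new cell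
   of [Q u] takes the label of an older cell of [Q u], whence the bound on the
   number of hops from a cell to its label. *)
Lemma partition_exists : exists a, [/\ classes_conn a,
  forall c, (a c != None) = [exists w, c \in Q w] &
  forall c w, a c = Some w -> exists2 u, u \in hops K w & c \in Q u].
Proof.
suff [a [ca dom hop]] : exists a, [/\ classes_conn a,
    forall c, (a c != None) = [exists w, (col w < K)%N && (c \in Q w)] &
    forall c w, a c = Some w -> (col w < K)%N /\ exists2 u, u \in hops K w & c \in Q u].
  exists a; split=> // [c|c w /hop[]//]; rewrite dom; apply: eq_existsb => w.
  by rewrite col_K.
elim: K => [|k [a [ca dom hop]]].
  by exists (fun=> None); split=> // c; apply/esym/existsP => -[].
suff [a' [ca' [dom' [val' ext']]]] : exists a', classes_conn a' /\
    (forall c, (a' c != None) = (a c != None) || [exists w, (w \in enum W) && (col w == k) && (c \in Q w)]) /\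
    (forall c w, a c = None -> a' c = Some w -> ((col w < k) || (w \in enum W) && (col w == k))%N /\ exists2 u, u \in hops k.+1 w & c \in Q u) /\
    extends a a'.
  exists a'; split=> // [c|c w acw].
    rewrite dom' dom; apply/orP/existsP => [[/existsP|/existsP]|] [w].
    - by move=> /andP[h1 h2]; exists w; rewrite ltnS ltnW.
    - by move=> /andP[/andP[_ /eqP h1] h2]; exists w; rewrite h1 ltnS leqnn.
    rewrite ltnS leq_eqVlt => /andP[/orP[h|h] h2]; [right|left]; apply/existsP; exists w; by rewrite ?mem_enum h h2.
  case ac: (a c) => [w'|]; last first.
    have [h1 h2] := val' c w ac acw; split=> //.
    by case/orP: h1 => [/ltnW|/andP[_ /eqP->]].
  have : a' c = a c by rewrite ext' ?ac.
  rewrite acw ac => -[ww']; have [h1 [u h2 h3]] := hop c w' ac; subst w'.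
  by split; [exact: leqW|exists u => //=; rewrite inE h2].
elim: (enum W) (enum_uniq W) => [|u s IH] /=.
  move=> _; exists a; split=> //; split=> [c|]; last by split=> // c w ->.
  suff -> : [exists w, (w \in [::]) && (col w == k) && (c \in Q w)] = false by rewrite orbF.
  by apply/existsP => -[].
move=> /andP[us /IH[a1 [ca1 [dom1 [val1 ext1]]]]].
have [uk|uk] := eqVneq (col u) k; last first.
  exists a1; split=> //; split=> [c|]; last split=> // c w ac a1c.
    rewrite dom1; congr orb; apply: eq_existsb => w.
    by rewrite inE; case: (eqVneq w u) => //= ->; rewrite (negbTE uk) !andbF.
  have [h1 h2] := val1 c w ac a1c; split=> //; case/orP: h1 => [->//|/andP[ws ->]].
  by rewrite inE ws !orbT.
have domE c : [exists w, (w \in u :: s) && (col w == k) && (c \in Q w)] =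
    [exists w, (w \in s) && (col w == k) && (c \in Q w)] || (c \in Q u).
  apply/existsP/orP => [[w]|[/existsP[w /andP[/andP[h1 h2] h3]]|cu]].
  - rewrite inE => /andP[/andP[/orP[/eqP->|h1] h2] h3]; [by right|left].
    by apply/existsP; exists w; rewrite h1 h2.
  - by exists w; rewrite inE h1 h2 h3 orbT.
  - by exists u; rewrite inE eqxx uk eqxx.
(* Other pieces of the present colour are disjoint from [Q u], so the labelled cells of [Q u] got
   their labels from earlier colours. *)
have old c : c \in Q u -> a1 c != None -> a c != None.
  move=> cu; rewrite dom1 => /orP[//|/existsP[w /andP[/andP[ws /eqP wk] cw]]].
  have wu : w != u by apply: contraNneq us => <-.
  have := col_disj (etrans wk (esym uk)) wu; rewrite /meet negbK => /eqP e0.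
  by have : c \in Q w :&: Q u; [rewrite inE cw|rewrite e0 inE].
(* If [Q u] has labelled cells, it is filled from them; otherwise [u] becomes a new label. *)
have [/existsP[c0 /andP[c0u a1c0]]|no] := boolP [exists c, (c \in Q u) && (a1 c != None)].
  have [a' [ca' ext' dom' val']] := fill_connected ca1 (@Q_conn u) c0u a1c0.
  exists a'; split=> //; split=> [c|]; first by rewrite dom' dom1 domE orbA.
  split=> [c w ac a'c|c ac]; last by rewrite ext' ?ext1 // dom1 ac.
  have [a1c|a1c] := eqVneq (a1 c) None; last first.
    have [|h1 h2] := val1 c w ac; first by rewrite -ext'.
    by split=> //; case/orP: h1 => [->//|/andP[ws ->]]; rewrite inE ws !orbT.
  have cu : c \in Q u by have := dom' c; rewrite a'c a1c /= => <-.
  have [c1 [c1u a1c1 a'c1]] := val' c cu a1c.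
  have ac1 := old _ c1u a1c1.
  have : a c1 = Some w by rewrite -(ext1 _ ac1) -a'c1.
  move=> /hop[h1 [v h2 h3]]; split; first by rewrite h1.
  exists u => //=; rewrite inE; apply/orP; right; rewrite inE; apply/exists_inP; exists v => //.
  by apply/set0Pn; exists c1; rewrite inE c1u.
have no' c : c \in Q u -> a1 c = None.
  by move=> cu; apply/eqP/negPn/negP => h; move/existsP: no; apply; exists c; rewrite cu.
have fresh c : a1 c != Some u.
  apply/eqP => acu; have [ac|ac] := eqVneq (a c) None.
    by have [] := val1 c u ac acu; rewrite uk ltnn (negbTE us).
  by have := ext1 c ac; rewrite acu => /esym/hop[]; rewrite uk ltnn.
pose a' c := if c \in Q u then Some u else a1 c.
have a'Q c : c \in Q u -> a' c = Some u by rewrite /a' => ->.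
have a'N c : c \notin Q u -> a' c = a1 c by rewrite /a' => /negbTE->.
exists a'; split; [|split; [|split]].
- move=> c d; have [cu|cu] := boolP (c \in Q u); have [du|du] := boolP (d \in Q u).
  + move=> _ _; apply: connS (Q_conn cu du); apply/subsetP => z zu.
    by rewrite inE !a'Q.
  + by rewrite (a'Q _ cu) (a'N _ du) => /esym/eqP; rewrite (negbTE (fresh d)).
  + by rewrite (a'Q _ du) (a'N _ cu) => /eqP; rewrite (negbTE (fresh c)).
  rewrite (a'N _ cu) (a'N _ du) => cd c0; apply: connS (ca1 _ _ cd c0).
  apply/subsetP => z; rewrite !inE => /eqP zc.
  have zu : z \notin Q u by apply/negP => /no'; rewrite zc; apply/eqP.
  by rewrite a'N ?zc.
- move=> c; rewrite domE; have [cu|cu] := boolP (c \in Q u); first by rewrite a'Q ?orbT.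
  by rewrite a'N // orbF dom1.
- move=> c w ac; have [cu|cu] := boolP (c \in Q u).
    rewrite a'Q // => -[<-]; rewrite uk ltnn inE eqxx eqxx; split=> //.
    by exists u => //; exact: (hops_refl k.+1 u).
  rewrite a'N // => a1c; have [h1 h2] := val1 c w ac a1c; split=> //.
  by case/orP: h1 => [->//|/andP[ws ->]]; rewrite inE ws !orbT.
move=> c ac; rewrite a'N ?ext1 //; apply/negP => cu; have := ext1 c ac; rewrite no' // => e.
by rewrite -e in ac.
Qed.

End Partition.

(** Greedy colouring: the neighbours use at most [d] of the [d.+1] colours. *)
Lemma coloring_exists (W : finType) (r : rel W) (d : nat) : symmetric r ->
  (forall w, #|[set u | r u w]| <= d)%N ->
  exists col : W -> 'I_d.+1, forall w w', r w w' -> w != w' -> col w != col w'.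
Proof.
move=> rs deg.
suff [col H] : exists col : W -> 'I_d.+1, forall w w', w \in enum W -> w' \in enum W ->
    r w w' -> w != w' -> col w != col w'.
  by exists col => w w'; apply: H; rewrite mem_enum.
elim: (enum W) => [|u s [col H]]; first by exists (fun=> ord0).
pose used := [set col w | w in [set v | r v u]].
have [k ku] : exists k, k \notin used.
  apply/existsP; rewrite -negb_forall; apply/negP => /forallP all_used.
  have : (#|'I_d.+1| <= #|used|)%N.
    by rewrite -cardsT subset_leq_card //; apply/subsetP => k _; exact: all_used.
  by rewrite card_ord leqNgt ltnS (leq_trans (leq_imset_card _ _) (deg u)).
have fresh w : r w u -> col w != k.
  by move=> wu; apply: contraNneq ku => <-; apply: imset_f; rewrite inE.
exists (fun w => if w == u then k else col w) => w w'; rewrite !inE.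
case: (eqVneq w u) => [->|wu] /=; case: (eqVneq w' u) => [->|w'u] /=.
- by rewrite eqxx.
- by move=> _ _ ruw' _; rewrite eq_sym fresh // rs.
- by move=> _ _ rwu _; exact: fresh.
- exact: H.
Qed.

Section Component.
Variables (T : finType) (e : rel T).
Hypothesis es : symmetric e.

Definition component (A : {set T}) u := [set v | conn e A u v].

Lemma component_sub A u : component A u \subset A.
Proof. by apply/subsetP => v; rewrite inE => /and3P[]. Qed.

Lemma conn_component A u v w : v \in component A u -> w \in component A u ->
  conn e (component A u) v w.
Proof.
have base z : z \in component A u -> conn e (component A u) u z.
  rewrite inE => c; have uA : u \in A by case/and3P: c.
  suff [] : conn e A u z /\ conn e (component A u) u z by [].
  apply: (conn_ind (P := fun z => conn e A u z /\ conn e (component A u) u z) _ _ c).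
    move=> x y xA yA xy [c1 c2]; have c3 : conn e A u y by apply: conn_trans c1 _; exact: conn1.
    split=> //; apply: conn_trans c2 _; apply: conn1; rewrite // inE //.
  by split; rewrite conn_refl // inE conn_refl.
by move=> /base vu /base; apply: conn_trans; exact: conn_sym.
Qed.

End Component.

Section Sides.
Variable N : nat.
Notation T := ('I_N.+1 * 'I_N.+1)%type.

Definition hexsides : {set T} := hexleft N :|: hexright N :|: hexbot N :|: hextop N.

Lemma row_conn (A : {set T}) (i i' k : 'I_N.+1) : 
  (forall l : 'I_N.+1, (l, k) \in A) -> conn (@hexadj N) A (i, k) (i', k).
Proof.
move=> kA.
suff H n (l : 'I_N.+1) : l = n :> nat -> conn (@hexadj N) A (ord0, k) (l, k).
  apply: (@conn_trans _ _ _ (ord0, k)); last exact: H.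
  by apply: conn_sym; [exact: hexadj_sym|exact: H].
elim: n l => [|n IH] l ln.
  by have -> : l = ord0; [apply/val_inj; rewrite /= ln|exact: conn_refl].
have nN : (n < N.+1)%N by have := ltn_ord l; rewrite ln => /ltnW.
apply: conn_trans (IH (Ordinal nN) erefl) _; apply: conn1 => //.
by apply/orP; left; apply/or3P; constructor 2; rewrite /= ln !eqxx.
Qed.

Lemma col_conn (A : {set T}) (i k k' : 'I_N.+1) : 
  (forall l : 'I_N.+1, (i, l) \in A) -> conn (@hexadj N) A (i, k) (i, k').
Proof.
move=> kA.
suff H n (l : 'I_N.+1) : l = n :> nat -> conn (@hexadj N) A (i, ord0) (i, l).
  apply: (@conn_trans _ _ _ (i, ord0)); last exact: H.
  by apply: conn_sym; [exact: hexadj_sym|exact: H].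
elim: n l => [|n IH] l ln.
  by have -> : l = ord0; [apply/val_inj; rewrite /= ln|exact: conn_refl].
have nN : (n < N.+1)%N by have := ltn_ord l; rewrite ln => /ltnW.
apply: conn_trans (IH (Ordinal nN) erefl) _; apply: conn1 => //.
by apply/orP; left; apply/or3P; constructor 1; rewrite /= ln !eqxx.
Qed.

Lemma sides_conn c d : c \in hexsides -> d \in hexsides -> conn (@hexadj N) hexsides c d.
Proof.
have base z : z \in hexsides -> conn (@hexadj N) hexsides (ord0, ord0) z.
  have lf k : (ord0, k) \in hexsides by rewrite !inE eqxx.
  have rt k : (ord_max, k) \in hexsides by rewrite !inE eqxx orbT.
  have bt k : (k, ord0) \in hexsides by rewrite !inE eqxx ?orbT.
  have tp k : (k, ord_max) \in hexsides by rewrite !inE eqxx ?orbT.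
  case: z => i k; rewrite !inE /= => /orP[/orP[/orP[]|]|] /eqP ->.
  - exact: col_conn.
  - by apply: (@conn_trans _ _ _ (ord_max, ord0)); [exact: row_conn|exact: col_conn].
  - exact: row_conn.
  - by apply: (@conn_trans _ _ _ (ord0, ord_max)); [exact: col_conn|exact: row_conn].
by move=> /base cs /base; apply: conn_trans; apply: conn_sym; [exact: hexadj_sym|].
Qed.

Lemma board_connected c d : connect (@hexadj N) c d.
Proof.
have := @row_conn [set: T] c.1 d.1 c.2; have := @col_conn [set: T] d.1 c.2 d.2.
move=> /(_ (fun l => in_setT _))/and3P[_ _ h1] /(_ (fun l => in_setT _))/and3P[_ _ h2].
have sub : subrel (edges_within (@hexadj N) [set: T]) (@hexadj N) by move=> x y /and3P[].
case: c d h1 h2 => [c1 c2] [d1 d2] /= h1 h2.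
by apply: connect_trans (connect_sub _ h2) (connect_sub _ h1) => x y /sub/connect1.
Qed.

End Sides.

From mathcomp Require Import all_classical all_reals all_analysis.

Import Order.TTheory GRing.Theory Num.Theory.
Import numFieldNormedType.Exports.

Local Open Scope classical_set_scope.
Local Open Scope ring_scope.

(** * Existence of square tilings *)

Section Minimum.
Variables (R : realType) (V : finType).

Definition adm (F : {set {set V}}) (m : V -> R) :=
  (forall v, 0 <= m v) /\ (forall A : {set V}, A \in F -> 1 <= \sum_(v in A) m v).

(** Truncation at [1] preserves admissibility and does not raise the energy, so the minimum can be
    sought in a compact cube. *)
Lemma adm_minimum (F : {set {set V}}) : finset.set0 \notin F ->
  exists2 m, adm F m & forall m', adm F m' -> \sum_v m v ^+ 2 <= \sum_v m' v ^+ 2.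
Proof.
move=> F0; pose n := #|V|.
pose K : set 'rV[R]_n := [set u | (forall i, 0 <= u ord0 i <= 1) /\
  forall A : {set V}, A \in F -> 1 <= \sum_(v in A) u ord0 (enum_rank v)].
have coord i : continuous (fun u : 'rV[R]_n => u ord0 i) by exact: coord_continuous.
have csum A : continuous (fun u : 'rV[R]_n => \sum_(v in A) u ord0 (enum_rank v)).
  by apply: continuous_big => [|v _]; [exact: add_continuous|exact: coord].
have cK : compact K.
  apply: (@subclosed_compact _ _ [set u : 'rV[R]_n | forall i, u ord0 i \in `[0, 1]]).
  - rewrite (_ : K = (\bigcap_i [set u | 0 <= u ord0 i]) `&` (\bigcap_i [set u | u ord0 i <= 1]) `&`
       (\bigcap_(A in [set A | A \in F]) [set u | 1 <= \sum_(v in A) u ord0 (enum_rank v)])).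
      apply: closedI; first apply: closedI; apply: closed_bigI => A _.
      + by apply: (@preimage_closed _ _ (fun u : 'rV[R]_n => u ord0 A) [set x | 0 <= x]); [move=> u _; exact: coord|exact: closed_ge].
      + by apply: (@preimage_closed _ _ (fun u : 'rV[R]_n => u ord0 A) [set x | x <= 1]); [move=> u _; exact: coord|exact: closed_le].
      + by apply: (@preimage_closed _ _ (fun u : 'rV[R]_n => \sum_(v in A) u ord0 (enum_rank v)) [set x | 1 <= x]); [move=> u _; exact: csum|exact: closed_ge].
    apply/seteqP; split=> u /=.
      by move=> [h1 h2]; split=> //; split=> i _ /=; case/andP: (h1 i).
    move=> [[h1 h2] h3]; split=> // i; apply/andP; split; [exact: h1|exact: h2].
  - by apply: (@rV_compact _ _ (fun=> (`[0, 1]%classic : set R))) => _; exact: segment_compact.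
  - by move=> u [h _] i /=; rewrite in_itv /=.
have K0 : K !=set0.
  exists (const_mx 1); split=> [i|A AF]; first by rewrite mxE ler01 lexx.
  under eq_bigr do rewrite mxE; rewrite sumr_const.
  have [A0|[v vA]] := set_0Vmem A; first by rewrite A0 (negbTE F0) in AF.
  by rewrite ler1n card_gt0; apply/set0Pn; exists v.
have cf : {within K, continuous (fun u : 'rV[R]_n => \sum_v u ord0 (enum_rank v) ^+ 2)}.
  apply: continuous_subspaceT; apply: continuous_big => [|v _]; first exact: add_continuous.
  by move=> u; apply: (@continuous_comp _ _ _ (fun u : 'rV[R]_n => u ord0 (enum_rank v)) (fun x : R => x ^+ 2)); [exact: coord|exact: exprn_continuous].
have [u uK umin] := compact_EVT_min K0 cK cf.
rewrite inE in uK; case: uK => u01 uF.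
exists (fun v => u ord0 (enum_rank v)); first by split=> // v; case/andP: (u01 (enum_rank v)).
move=> m' [m0 mF].
pose w : 'rV[R]_n := \row_i Num.min (m' (enum_val i)) 1.
have wE v : w ord0 (enum_rank v) = Num.min (m' v) 1 by rewrite mxE enum_rankK.
apply: le_trans (umin w _) _.
  rewrite inE; split=> [i|A AF].
    by rewrite mxE le_min m0 ler01 ge_min lexx orbT.
  under eq_bigr do rewrite wE.
  have [[v vA v1]|no] := pselect (exists2 v, v \in A & 1 <= m' v).
    rewrite (bigD1 v) //= min_r // lerDl sumr_ge0 // => z _.
    by rewrite le_min m0 ler01.
  rewrite (eq_bigr m') ?mF // => v vA; rewrite min_l //.
  by rewrite leNgt; apply/negP => h; apply: no; exists v => //; exact: ltW.
apply: ler_sum => v _; rewrite wE lerXn2r ?nnegrE ?le_min ?m0 ?ler01 //.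
by rewrite ge_min lexx.
Qed.

(** The derivative of the energy at the minimizer [m] in the direction of [m'] is not negative. *)
Lemma adm_variation (F : {set {set V}}) m m' : adm F m -> adm F m' ->
  (forall m1, adm F m1 -> \sum_v m v ^+ 2 <= \sum_v m1 v ^+ 2) ->
  \sum_v m v ^+ 2 <= \sum_v m v * m' v.
Proof.
move=> [m0 mF] [m'0 m'F] mn; set M := \sum_v m v ^+ 2; set N := \sum_v m v * m' v.
pose L := \sum_v (m v - m' v) ^+ 2.
have L0 : 0 <= L by apply: sumr_ge0 => v _; exact: sqr_ge0.
have key t : 0 < t -> t <= 1 -> 0 <= 2 * (N - M) + t * L.
  move=> t0 t1; rewrite -(pmulr_rge0 _ t0).
  have := mn (fun v => (1 - t) * m v + t * m' v); rewrite -/M.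
  have -> : \sum_v ((1 - t) * m v + t * m' v) ^+ 2 = M + t * (2 * (N - M) + t * L).
    rewrite /M /N /L -sumrB !mulr_sumr -big_split mulr_sumr -big_split /=.
    by apply: eq_bigr => v _; ring.
  rewrite lerDl; apply; split=> [v|A AF].
    by rewrite addr_ge0 // mulr_ge0 // ?subr_ge0 // ltW.
  rewrite big_split /= -!mulr_sumr -[leLHS](_ : (1 - t) * 1 + t * 1 = 1); last by ring.
  by rewrite lerD // ler_wpM2l ?mF ?m'F ?subr_ge0 // ltW.
rewrite leNgt; apply/negP => NM.
pose t := Num.min 1 ((M - N) / (L + 1)).
have L1 : 0 < L + 1 by rewrite ltr_wpDl.
have t0 : 0 < t by rewrite lt_min ltr01 divr_gt0 // subr_gt0.
have t1 : t <= 1 by rewrite ge_min lexx.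
have tL : t * (L + 1) <= M - N by rewrite -ler_pdivlMr // ge_min lexx orbT.
have := key t t0 t1; nra.
Qed.

End Minimum.

(** Let [m] minimize the energy for the crossings from [Lf] to [Rt], with minimum [M], and put
    [a = 1], [b = M]; then the area is [a * b]. By the duality a crossing from [Bt] to [Tp] meets
    all crossings from [Lf] to [Rt], so its indicator is admissible and [adm_variation] bounds its
    length below by [M]. The potentials are the lengths of shortest connections. *)
Lemma tiling_exists (R : realType) (V : finType) (e : rel V) (Lf Rt Bt Tp : {set V}) :
  symmetric e -> (forall u v, connect e u v) ->
  (forall A, joins e Bt Tp A = ~~ joins e Lf Rt (~: A)) ->
  exists (m D E : V -> R) a b, tiling e Lf Rt Bt Tp m D E a b.
Proof.
move=> es ec dual.
have no0 L L' : ~~ joins e L L' finset.set0.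
  by apply/joins_connP => -[u [v [_ _ /and3P[]]]]; rewrite inE.
have lrT : joins e Lf Rt [set: V]%SET by have := dual finset.set0; rewrite (negbTE (no0 _ _)) finset.setC0 => /esym/negbFE.
have btT : joins e Bt Tp [set: V]%SET by rewrite dual finset.setCT no0.
pose F : {set {set V}} := [set A | joins e Lf Rt A]%SET.
have [|m mF mn] := @adm_minimum R V F; first by rewrite inE no0.
have [m0 mA] := mF; pose M := \sum_v m v ^+ 2.
have M0 : 0 < M.
  rewrite lt_neqAle sumr_ge0 ?andbT => [|v _]; last exact: sqr_ge0.
  apply/negP => /eqP/esym M0.
  have := mA [set: V]%SET; rewrite inE => /(_ lrT); rewrite big1 ?ler10 // => v _.
  apply/eqP; rewrite -sqrf_eq0; apply/eqP.
  exact: (@psumr_eq0P _ _ predT (fun v => m v ^+ 2) (fun u _ => sqr_ge0 (m u)) M0).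
have pot (L L' : {set V}) (a : R) : (exists u, u \in L) -> (forall A, joins e L L' A -> a <= \sum_(v in A) m v) ->
    exists D, potential e L L' m D a.
  move=> [u0 u0L] La.
  pose Pv v := [pred A : {set V} | [exists u in L, conn e A u v]].
  have PT v : Pv v [set: V]%SET.
    by apply/exists_inP; exists u0 => //; rewrite /conn !inE; apply: connect_sub (ec u0 v) => z w zw; apply: connect1; rewrite /edges_within/= !inE.
  pose D v := \sum_(w in [arg min_(A < [set: V]%SET | Pv v A) (\sum_(w in A) m w)%R]%O) m w.
  have Dle v A : Pv v A -> D v <= \sum_(w in A) m w.
    by rewrite /D; case: arg_minP => [|B PB h /h]; first exact: PT.
  have Dex v : exists2 A, Pv v A & D v = \sum_(w in A) m w.
    by rewrite /D; case: arg_minP => [|B PB h]; [exact: PT|exists B].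
  have Dm v : m v <= D v.
    have [A /exists_inP[u uL /and3P[_ vA _]] ->] := Dex v.
    by rewrite (bigD1 v) //= lerDl sumr_ge0.
  exists D; split=> [v vL|u v uv|//|v vL'].
  - apply/le_anti; rewrite Dm andbT; have := Dle v [set v]%SET; rewrite big_set1; apply.
    by apply/exists_inP; exists v => //; rewrite conn_refl ?set11.
  - have [A /exists_inP[w wL c] ->] := Dex u.
    apply: (@le_trans _ _ (\sum_(z in v |: A) m z)).
      apply: Dle; apply/exists_inP; exists w => //.
      apply: conn_trans (connS (finset.subsetUr _ _) c) _.
      by apply: conn1 => //; rewrite ?finset.setU11 // finset.in_setU; case/and3P: c => _ -> _; rewrite orbT.
    have [vA|vA] := boolP (v \in A).
      have -> : (v |: A = A)%SET by apply/finset.setUidPr; rewrite finset.sub1set.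
      by rewrite lerDl m0.
    by rewrite big_setU1 //= addrC.
  - have [A /exists_inP[w wL c] ->] := Dex v.
    by apply: La; apply/joins_connP; exists w, v.
have lr A : joins e Lf Rt A -> 1 <= \sum_(v in A) m v by move=> h; apply: mA; rewrite inE.
have bt A : joins e Bt Tp A -> M <= \sum_(v in A) m v.
  move=> bA; have <- : \sum_v m v * (v \in A)%:R = \sum_(v in A) m v.
    by rewrite [RHS]big_mkcond; apply: eq_bigr => v _; case: ifP; rewrite ?mulr1 ?mulr0.
  apply: (adm_variation mF _ mn); split=> [v|B]; first by rewrite ler0n.
  rewrite inE => lB; have [v vA vB] : exists2 v, v \in A & v \in B.
    apply: contrapT => no; move: bA; rewrite dual => /negP[]; apply: joinsS lB.
    by apply/fintype.subsetP => v vB; rewrite inE; apply/negP => vA; apply: no; exists v.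
  by rewrite (bigD1 v) //= vA lerDl sumr_ge0 // => u _; rewrite ler0n.
have [u [_ [uL _ _]]] := joins_connP _ _ _ _ lrT; have [u' [_ [u'L _ _]]] := joins_connP _ _ _ _ btT.
have [D DP] := pot Lf Rt 1 (ex_intro (fun u => u \in Lf) u uL) lr.
have [E EP] := pot Bt Tp M (ex_intro (fun u => u \in Bt) u' u'L) bt.
exists m, D, E, 1, M; split=> //.
by rewrite mul1r; apply: eq_bigr => v _; rewrite expr2.
Qed.

(* One square for each quadrant. *)
Lemma four_squares (R : realFieldType) (V : finType) (e : rel V) (Lf Rt Bt Tp : {set V})
    (m D E : V -> R) (a b s t : R) (I : finType) (g : I -> V) :
  tiling e Lf Rt Bt Tp m D E a b -> injective g ->
  (forall i, 0 < m (g i)) -> (forall i, insq m D E (g i) s t) -> (#|I| <= 4)%N.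
Proof.
move=> T gi g0 gs; have T' := tilingC T.
pose q i := (s < D (g i), t < E (g i)).
have <- : #|{: bool * bool}| = 4%N by rewrite card_prod card_bool.
suff qi : injective q by exact: leq_card qi.
move=> i j [h1 h2]; apply: gi.
pose d := Num.min (m (g i)) (m (g j)).
have d0 : 0 < d by rewrite lt_min !g0.
have /andP[/andP[xi Di] /andP[yi Ei]] := gs i; have /andP[/andP[xj Dj] /andP[yj Ej]] := gs j.
have di : d <= m (g i) by rewrite ge_min lexx. have dj : d <= m (g j) by rewrite ge_min lexx orbT.
have gen (lo_ D0 : V -> R) (c z : R) : (forall v, D0 v - m v = lo_ v) ->
   (forall v, 0 <= lo_ v) -> (forall v, D0 v <= c) ->
   lo_ (g i) <= z -> z <= D0 (g i) -> lo_ (g j) <= z -> z <= D0 (g j) ->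
   (z < D0 (g i)) = (z < D0 (g j)) ->
   exists2 z', 0 <= z' < c & lo_ (g i) <= z' < D0 (g i) /\ lo_ (g j) <= z' < D0 (g j).
  move=> H l0 Dc; have [Hi Hj] := (H (g i), H (g j)).
  have [l0i l0j] := (l0 (g i), l0 (g j)); have [ci cj] := (Dc (g i), Dc (g j)).
  have [gi0 gj0] := (g0 i, g0 j).
  clear -d0 di dj Hi Hj l0i l0j ci cj gi0 gj0 => a1 a2 a3 a4.
  have [zi|iz] := ltP z (D0 (g i)) => /esym zj.
    by exists z; [|split]; apply/andP; split; lra.
  have jz : D0 (g j) <= z by rewrite leNgt zj.
  by exists (z - d); [|split]; apply/andP; split; lra.
have [z hz [zi zj]] := gen (lo D m) D a s (fun=> erefl) (lo_ge0 T) (hi_le T) xi Di xj Dj h1.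
have [w hw [wi wj]] := gen (lo E m) E b t (fun=> erefl) (lo_ge0 T') (hi_le T') yi Ei yj Ej h2.
by apply: (crossing_uniq T hz hw); rewrite inE.
Qed.

(** * Tilings of large squares in the space *)

Lemma mtri (R : realType) (Z : metricType R) (y x z : Z) :
  mdist x z <= mdist x y + mdist y z.
Proof. exact: metric_triangle. Qed.

Section Stage.
Variables (R : realType) (Z : metricType R) (N : nat).
Notation T := ('I_N.+1 * 'I_N.+1)%type.
Notation hadj := (@hexadj N).
Variables (pos : T -> Z) (rnd : Z -> T) (Qj : set Z) (p : Z) (delta rj : R).

Definition nearcells (E : set Z) : {set T} :=
  finset.finset (fun c => `[< exists2 z, E z & mdist (pos c) z < delta >]).

(** A discrete copy of a region [Qj] that contains everything outside a ball around [p]: [pos]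
    places the cells and [rnd] rounds points to cells. By [board_lift] the cells near a connected
    set contain a discrete connection, unless the set leads to the sides of the board. *)
Record board : Prop := Board {
  board_adj : forall c d, hadj c d -> mdist (pos c) (pos d) < delta;
  board_rnd : forall z, Qj z -> mdist (pos (rnd z)) z < delta;
  board_pos : forall c, Qj (pos c) /\ rnd (pos c) = c;
  board_lift : forall E e0 e1, connected E -> E e0 -> E e1 -> Qj e0 ->
    (Qj e1 /\ conn hadj (nearcells E) (rnd e0) (rnd e1)) \/
    (exists2 s, s \in hexsides N & conn hadj (nearcells E) (rnd e0) s);
  board_side : forall s, s \in hexsides N -> mdist (pos s) p < rj;
  board_far : forall z, rj <= mdist z p -> Qj z;
  board_p : ~ Qj p }.

Hypothesis Bd : board.

Variables (W : finType) (ctr : W -> Z) (rad : W -> R) (e0 lam : R) (deg : nat).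
Let Lam := 3 * lam + 1.
Hypothesis lam1 : 1 <= lam.
Hypothesis LLC1 : forall (a : Z) (r : R), 0 < r -> forall x y, ball a r x -> ball a r y ->
  exists E : set Z, [/\ connected E, E x, E y & forall z, E z -> ball a (lam * r) z].
Hypothesis radP : forall w, delta < rad w < e0.
Hypothesis delta0 : 0 < delta.
Hypothesis cover : forall z, exists w, mdist z (ctr w) <= rad w.
Hypothesis mult : forall w, (#|[set u | (mdist (ctr u) (ctr w) <= Lam * (rad u + rad w))%R]%SET| <= deg)%N.
Hypothesis mesh : Lam * e0 <= rj.

Let Lam1 : 4 <= Lam. Proof. by rewrite /Lam; have := lam1; lra. Qed.
Let rad0 w : 0 < rad w. Proof. by case/andP: (radP w) => h _; exact: lt_trans h. Qed.
Let rad_e0 w : rad w < e0. Proof. by case/andP: (radP w). Qed.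

Definition inner w := 3 * rj <= mdist (ctr w) p.

Definition patch w : {set T} :=
  if inner w then component hadj [set c | (mdist (pos c) (ctr w) < Lam * rad w)%R]%SET (rnd (ctr w))
  else finset.set0.

Lemma patch_conn w c c' : c \in patch w -> c' \in patch w -> conn hadj (patch w) c c'.
Proof.
rewrite /patch; case: ifP => _; last by rewrite finset.in_set0.
exact/conn_component/hexadj_sym.
Qed.

Lemma patch_dist w c : c \in patch w -> mdist (pos c) (ctr w) < Lam * rad w.
Proof.
rewrite /patch; case: ifP => _; last by rewrite finset.in_set0.
by move=> /(fintype.subsetP (component_sub _ _ _)); rewrite finset.inE.
Qed.

(** The origin of [Lam]: [LLC1] at radius [3 * rad w] joins the point to the centre inside the ball
    of radius [3 * lam * rad w], and the cells near this connection are less than [delta < rad w]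
    away from it. They do not lead to a side, because the centre is at distance at least [3 * rj]
    from [p]. *)
Lemma patch_cover w c : inner w -> mdist (pos c) (ctr w) <= rad w -> c \in patch w.
Proof.
move=> iw cw; rewrite /patch iw finset.inE.
have r3 : 0 < 3 * rad w by rewrite mulr_gt0.
have b1 : ball (ctr w) (3 * rad w) (ctr w) by exact: ballxx.
have b2 : ball (ctr w) (3 * rad w) (pos c).
  by rewrite ballEmdist /= metric_sym; apply: le_lt_trans cw _; have := rad0 w; lra.
have [E [cE E1 E2 EB]] := LLC1 r3 b1 b2.
have rw := rad0 w; have rj0 : 0 < rj.
  by apply: lt_le_trans mesh; rewrite mulr_gt0 //; [have := Lam1; lra|exact: lt_trans (rad_e0 w)].
have Qc : Qj (ctr w) by apply: (board_far Bd); move: iw; rewrite /inner; lra.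
have lr : Lam * rad w <= rj.
  by apply: le_trans mesh; rewrite ler_wpM2l ?(ltW (rad_e0 w)) //; have := Lam1; lra.
have nE c' : c' \in nearcells E -> mdist (pos c') (ctr w) < Lam * rad w.
  rewrite finset.inE => /asboolP[z /EB]; rewrite ballEmdist /= => h1 h2.
  apply: le_lt_trans (mtri z _ _) _; rewrite [mdist z _]metric_sym.
  by have /andP[h3 _] := radP w; rewrite /Lam mulrDl mul1r; move: h1; rewrite mulrA [lam * 3]mulrC; lra.
case: (board_lift Bd cE E1 E2 Qc) => [[_]|[s sS c1]].
  by rewrite (board_pos Bd c).2; apply: connS; apply/fintype.subsetP => c' /nE; rewrite finset.inE.
have sE : s \in nearcells E by case/and3P: c1.
have := nE _ sE; have := board_side Bd sS; move: iw; rewrite /inner.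
have := mtri (pos s) (ctr w) p; rewrite [mdist (ctr w) (pos s)]metric_sym; lra.
Qed.

Lemma patch_meet u w : meet patch u w -> mdist (ctr u) (ctr w) <= Lam * (rad u + rad w).
Proof.
move=> /set0Pn[c]; rewrite finset.inE => /andP[/patch_dist h1 /patch_dist h2].
apply: ltW; apply: le_lt_trans (mtri (pos c) _ _) _; rewrite [mdist (ctr u) _]metric_sym; lra.
Qed.

Lemma patch_meet_sym : symmetric (meet patch).
Proof. by move=> u w; rewrite /meet finset.setIC. Qed.

Lemma patch_deg w : (#|[set u | meet patch u w]%SET| <= deg)%N.
Proof.
apply: leq_trans (mult w); apply: subset_leq_card; apply/fintype.subsetP => u.
by rewrite !finset.inE; exact: patch_meet.
Qed.

Lemma patch_deg' w : (#|[set u | meet patch w u]%SET| <= deg)%N.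
Proof.
by apply: leq_trans (patch_deg w); apply: subset_leq_card; apply/fintype.subsetP => u; rewrite !finset.inE patch_meet_sym.
Qed.

Let K := deg.+1.

Lemma patch_partition : exists a : T -> option W, [/\ classes_conn hadj a,
  forall c, (a c != None) = [exists w, c \in patch w] &
  forall c w, a c = Some w -> exists2 u, u \in hops patch K w & c \in patch u].
Proof.
have [col colP] := coloring_exists patch_meet_sym patch_deg.
apply: (@partition_exists _ _ _ patch (@hexadj_sym N) patch_conn K (fun w => col w)).
  by move=> w; exact: ltn_ord.
move=> w w' cw ww'; apply/negP => /colP-/(_ ww'); apply/negP; rewrite negbK.
by apply/eqP/val_inj.
Qed.

Lemma hops_dist k u w : u \in hops patch k w -> mdist (ctr u) (ctr w) <= (2 * k%:R) * (Lam * e0).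
Proof.
elim: k u => [|k IH] u /=; rewrite finset.inE.
  by move=> /eqP->; rewrite mdistxx mulr0 mul0r.
have L0 : 0 <= Lam * e0.
  by rewrite mulr_ge0 //; [have := Lam1; lra|exact/ltW/(lt_trans (rad0 u))].
move=> /orP[/IH|].
  by rewrite -[k.+1%:R]natr1 mulrDr mulrDl; lra.
rewrite finset.inE => /exists_inP[v /IH h1 /patch_meet h2].
apply: le_trans (mtri (ctr v) _ _) _.
rewrite -[k.+1%:R]natr1 mulrDr mulrDl addrC lerD //; apply: le_trans h2 _.
rewrite mulr1 mulrCA ler_wpM2l //; first by have := Lam1; lra.
by have := rad_e0 u; have := rad_e0 v; lra.
Qed.


Variable a : T -> option W.
Hypothesis aC : classes_conn hadj a.
Hypothesis aD : forall c, (a c != None) = [exists w, c \in patch w].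
Hypothesis aH : forall c w, a c = Some w -> exists2 u, u \in hops patch K w & c \in patch u.

(** Cells in no patch are close to [p]; each of them is a cluster of its own. *)
Definition label c : W + T := if a c is Some w then inl w else inr c.
Definition cluster := {v : W + T | v \in codom label}.
Definition cl c : cluster := Sub (label c) (codom_f label c).

Lemma clE c d : cl c = cl d -> (exists2 w, a c = Some w & a d = Some w) \/ c = d.
Proof.
move=> /(congr1 val) /=; rewrite /label.
case: (a c) => [w|]; case: (a d) => [w'|] //.
  by move=> [->]; left; exists w'.
by move=> [->]; right.
Qed.

Lemma cl_eq c d : label c = label d -> cl c = cl d.
Proof. by move=> h; exact: val_inj. Qed.

Lemma cl_conn c d : cl c = cl d -> conn hadj [set x | cl x == cl c]%SET c d.
Proof.
move=> cd; have [[w ac ad]|<-] := clE cd; last by rewrite conn_refl // finset.inE.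
have : conn hadj [set x | a x == a c]%SET c d by apply: aC; rewrite ac.
apply: connS; apply/fintype.subsetP => z; rewrite !finset.inE => /eqP az.
by apply/eqP/cl_eq; rewrite /label az ac.
Qed.

Let D0 := (4 * K%:R + 4) * (Lam * e0).

Let Le0 (w : W) : 0 <= Lam * e0.
Proof. by rewrite mulr_ge0 //; [have := Lam1; lra|exact/ltW/(lt_trans (rad0 w))]. Qed.

Lemma label_dist c w : a c = Some w -> mdist (pos c) (ctr w) <= (2 * K%:R + 1) * (Lam * e0).
Proof.
move=> /aH[u /hops_dist h1 /patch_dist h2].
apply: le_trans (mtri (ctr u) _ _) _; rewrite mulrDl mul1r addrC lerD //.
apply: ltW; apply: lt_le_trans h2 _; rewrite ler_wpM2l ?(ltW (rad_e0 u)) //.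
by have := Lam1; lra.
Qed.

Lemma cl_dist (w0 : W) c d : cl c = cl d -> mdist (pos c) (pos d) <= D0.
Proof.
move=> /clE[[w /label_dist h1 /label_dist h2]|->].
  apply: le_trans (mtri (ctr w) _ _) _; rewrite [mdist (ctr w) _]metric_sym /D0.
  by move: (Le0 w) h1 h2; move: (Lam * e0) (K%:R) => L k L0; nra.
by rewrite mdistxx mulr_ge0 ?(Le0 w0) // addr_ge0 // mulr_ge0.
Qed.

Variables (m D E : cluster -> R) (wd ht : R).
Hypothesis Tl : tiling (cladj hadj cl) (cl @: hexleft N) (cl @: hexright N)
  (cl @: hexbot N) (cl @: hextop N) m D E wd ht.

Definition insquare z s t := Qj z /\ insq m D E (cl (rnd z)) s t.
Definition inside s t := exists2 c, c \in hexsides N & insq m D E (cl c) s t.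

Lemma insq_corner v : insq m D E v (D v) (E v).
Proof. by rewrite /insq !lexx !andbT; apply/andP; split; exact: (lo_le Tl) || exact: (lo_le (tilingC Tl)). Qed.

Lemma insquare_exists z : Qj z -> exists s t, insquare z s t.
Proof. by move=> Qz; exists (D (cl (rnd z))), (E (cl (rnd z))); split=> //; exact: insq_corner. Qed.

Lemma insq_range v s t : insq m D E v s t -> (0 <= s <= wd) /\ (0 <= t <= ht).
Proof.
have T' := tilingC Tl.
move=> /andP[/andP[h1 h2] /andP[h3 h4]]; split; apply/andP; split.
- exact: le_trans (lo_ge0 Tl v) h1.
- exact: le_trans h2 (hi_le Tl v).
- exact: le_trans (lo_ge0 T' v) h3.
- exact: le_trans h4 (hi_le T' v).
Qed.

Lemma insquare_onto s t : 0 <= s < wd -> 0 <= t < ht -> exists z, insquare z s t.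
Proof.
move=> s0 t0; have [v] := crossing Tl s0 t0; rewrite !finset.inE => /andP[h1 h2] /andP[h3 h4].
have /codomP[c vc] := valP v; have {vc} vc : v = cl c by exact: val_inj.
have [Qc rc] := board_pos Bd c; exists (pos c); split=> //; rewrite rc -vc.
by rewrite /insq h1 h3 !ltW.
Qed.

Lemma inside_edges : (forall t, 0 <= t < ht -> inside 0 t /\ inside wd t) /\
  (forall s, 0 <= s < wd -> inside s 0 /\ inside s ht).
Proof.
have T' := tilingC Tl.
have side (S : {set T}) v : S \subset hexsides N -> v \in cl @: S -> exists2 c, c \in hexsides N & v = cl c.
  by move=> /fintype.subsetP SS /imsetP[c /SS cS ->]; exists c.
have [sl sr sb st] : [/\ hexleft N \subset hexsides N, hexright N \subset hexsides N,
    hexbot N \subset hexsides N & hextop N \subset hexsides N].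
  by split; apply/fintype.subsetP => c; rewrite /hexsides !finset.in_setU => ->; rewrite ?orbT.
split=> t t0; [have := level_lr Tl t0|have := level_lr T' t0].
  move=> /joins_connP[u [v [uL vR /and3P[]]]]; rewrite !finset.inE => uC vC _; split.
    have [c cS ec] := side _ _ sl uL; exists c => //; rewrite -ec /insq /lo.
    have [-> // _ _ _] := tiling_D Tl; rewrite subrr lexx (tiling_m Tl).
    by case/andP: uC => -> /ltW->.
  have [c cS ec] := side _ _ sr vR; exists c => //; rewrite -ec /insq.
  have [_ _ _ /(_ _ vR) h] := tiling_D Tl; rewrite h (le_trans (lo_le Tl v) (hi_le Tl v)).
  by case/andP: vC => -> /ltW->.
move=> /joins_connP[u [v [uL vR /and3P[]]]]; rewrite !finset.inE => uC vC _; split.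
  have [c cS ec] := side _ _ sb uL; exists c => //; rewrite -ec /insq /lo.
  have [-> // _ _ _] := tiling_E Tl; rewrite subrr lexx (tiling_m Tl).
  by case/andP: uC => -> /ltW->.
have [c cS ec] := side _ _ st vR; exists c => //; rewrite -ec /insq.
have [_ _ _ /(_ _ vR) h] := tiling_E Tl; rewrite h (le_trans (lo_le T' v) (hi_le T' v)).
by case/andP: vC => -> /ltW->.
Qed.

(** This keeps the tilings from degenerating. If all five squares contained [(s, t)], each row would
    have a square of positive side through this point: otherwise the whole row, from the left to the
    right side, would consist of squares of side [0] at the point. The five squares are distinct
    since the rows are far apart, against [four_squares]. *)
Lemma five_squares (w0 : W) (mid : 'I_N.+1) (rows : 'I_5 -> 'I_N.+1) s t :
  (forall i j c c', i != j -> D0 < mdist (pos (c, rows i)) (pos (c', rows j))) ->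
  (forall i, insquare (pos (mid, rows i)) s t) -> False.
Proof.
move=> sep sq; have T' := tilingC Tl.
pose row i : {set T} := [set c : T | c.2 == rows i]%SET.
have rowc i k k' : conn hadj (row i) (k, rows i) (k', rows i).
  by apply: row_conn => l; rewrite finset.inE.
have flat i : (forall c, c \in row i -> insq m D E (cl c) s t -> m (cl c) <= 0) -> forall k,
    insq m D E (cl (k, rows i)) s t /\ m (cl (k, rows i)) = 0.
  move=> no k; suff h : insq m D E (cl (k, rows i)) s t.
    by split=> //; apply/eqP; rewrite eq_le (tiling_m Tl) no // finset.inE.
  apply: (conn_ind (P := fun c => insq m D E (cl c) s t) _ _ (rowc i mid k)); last first.
    by have [_] := sq i; rewrite (board_pos Bd _).2.
  move=> c d cr dr cd hc; have mc : m (cl c) = 0 by apply/eqP; rewrite eq_le (tiling_m Tl) no.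
  have e1 : cladj hadj cl (cl c) (cl d) by apply/cladjP; exists c, d.
  have e2 : cladj hadj cl (cl d) (cl c) by apply/cladjP; exists d, c; rewrite hexadj_sym.
  have := lo_step Tl e1; have := lo_step Tl e2; have := lo_step T' e1; have := lo_step T' e2.
  move: hc; rewrite /insq /lo mc !subr0 => /andP[/andP[h1 h2] /andP[h3 h4]] g1 g2 g3 g4.
  by rewrite (le_trans g4 h1) (le_trans h2 g3) (le_trans g2 h3) (le_trans h4 g1).
have posi i : exists2 c, c \in row i & (0 < m (cl c)) && insq m D E (cl c) s t.
  apply: contrapT => no; have [|h1 m1] := flat i _ ord0.
    move=> c cr hc; rewrite leNgt; apply/negP => mc; apply: no; exists c => //; rewrite mc //.
  have [|h2 m2] := flat i _ ord_max.
    move=> c cr hc; rewrite leNgt; apply/negP => mc; apply: no; exists c => //; rewrite mc //.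
  have [DL _ _ DR] := tiling_D Tl.
  have l1 : cl (ord0, rows i) \in cl @: hexleft N by rewrite imset_f // finset.inE.
  have l2 : cl (ord_max, rows i) \in cl @: hexright N by rewrite imset_f // finset.inE.
  have := DL _ l1; have := DR _ l2; rewrite m1; move: h1 h2; rewrite /insq /lo m2 subr0.
  move=> /andP[/andP[_ h1] _] /andP[/andP[h2 _] _] h3 h4; have := tiling_a Tl.
  by rewrite ltNge (le_trans h3) // (le_trans h2) // -h4.
pose g i := sval (cid2 (posi i)).
have g1 i : g i \in row i by rewrite /g; case: cid2.
have g2 i : (0 < m (cl (g i))) && insq m D E (cl (g i)) s t by rewrite /g; case: cid2.
have gi : injective (fun i => cl (g i)).
  move=> i j ij; apply/eqP; apply: contraT => nij.
  have := cl_dist w0 ij; have := g1 i; have := g1 j; rewrite !finset.inE.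
  case: (g i) (g j) => [c1 c2] [d1 d2] /= /eqP-> /eqP->.
  by rewrite leNgt sep.
have := four_squares (s := s) (t := t) Tl gi (fun i => proj1 (andP (g2 i))) (fun i => proj2 (andP (g2 i))).
by rewrite card_ord.
Qed.


(** * Weights on the cover pulled back to the clusters *)

Definition touch : rel W := [rel u w | (mdist (ctr u) (ctr w) <= 2 * (rad u + rad w))%R].

Variables (x : Z) (r r' : R) (rho : W -> R).
Hypothesis rho0 : forall w, 0 <= rho w.
Hypothesis rho_supp : forall w, rho w != 0 -> r <= mdist (ctr w) x <= r'.
Hypothesis rho_chain : forall A w w', conn touch A w w' ->
  mdist (ctr w) x <= r -> r' <= mdist (ctr w') x -> 1 <= \sum_(u in A) rho u.
Hypothesis rr' : r < r'.
Hypothesis small : 16 * (D0 + e0 + rj) <= r.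

Definition near_label (u : W) (v : cluster) : bool :=
  if val v is inl w then u \in hops patch K.+1 w else false.

(** The cells labelled [w] lie in patches at most [K] hops from [w], and one more hop reaches all
    patches containing such a cell. So a cluster carries the weight of all inner balls that cover
    its cells. *)
Definition pull (v : cluster) : R := \sum_(u | near_label u v) rho u.

Lemma touch_sym : symmetric touch.
Proof. by move=> u w; rewrite /touch /= metric_sym addrC. Qed.

Lemma near_label_dist u c : near_label u (cl c) -> mdist (pos c) (ctr u) <= D0.
Proof.
rewrite /near_label SubK /label; case ac: (a c) => [w|] // h0; have h := hops_dist h0.
apply: le_trans (mtri (ctr w) _ _) _; rewrite [mdist (ctr w) _]metric_sym.
have := label_dist ac; move: h; rewrite -[K.+1%:R]natr1 /D0.
move: (Le0 w); move: (Lam * e0) (K%:R) => L k L0; nra.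
Qed.

Lemma rj_pos (w : W) : 0 < e0 /\ e0 <= rj.
Proof.
have e00 : 0 < e0 by exact: lt_trans (rad_e0 w).
by split=> //; apply: le_trans mesh; rewrite ler_peMl ?(ltW e00) //; have := Lam1; lra.
Qed.

Lemma D0_ge0 (w : W) : 0 <= D0.
Proof. by rewrite /D0 mulr_ge0 ?(Le0 w) // addr_ge0 // mulr_ge0. Qed.

(** The balls covering the cells of the chain form a chain of touching balls. The distance from [p]
    makes them inner, so that their patches are not empty and they are near the labels. *)
Lemma ring_chain (A : {set cluster}) (A' : {set T}) c d : conn hadj A' c d ->
  A' \subset cl @^-1: A -> (forall c, c \in A' -> 4 * rj <= mdist (pos c) p) ->
  (mdist (pos c) x <= r - e0 /\ r' + e0 <= mdist (pos d) x) \/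
  (mdist (pos d) x <= r - e0 /\ r' + e0 <= mdist (pos c) x) ->
  1 <= \sum_(u | [exists v in A, near_label u v]) rho u.
Proof.
move=> cd /fintype.subsetP AA far ends.
pose cov c := sval (cid (cover (pos c))).
have covP z : mdist (pos z) (ctr (cov z)) <= rad (cov z) by rewrite /cov; case: cid.
pose U := [set u | [exists v in A, near_label u v]]%SET.
have covU z : z \in A' -> cov z \in U.
  move=> zA; rewrite finset.inE; apply/exists_inP; exists (cl z).
    by have := AA _ zA; rewrite finset.inE.
  have zp : z \in patch (cov z).
    apply: patch_cover (covP z); rewrite /inner; have := far _ zA.
    have := mtri (ctr (cov z)) (pos z) p; have := covP z; have := rad_e0 (cov z).
    have [] := rj_pos (cov z); lra.
  have := aD z; rewrite /near_label SubK /label; case ac: (a z) => [w|] => [_|/esym/existsP[]]; last by exists (cov z).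
  have [u uw cu] := aH ac; rewrite /= finset.inE; apply/orP; right.
  rewrite finset.inE; apply/exists_inP; exists u => //.
  by apply/set0Pn; exists z; rewrite finset.inE zp cu.
have link : conn touch U (cov c) (cov d).
  have cA : c \in A' by case/and3P: cd.
  apply: (conn_ind (P := fun d => conn touch U (cov c) (cov d)) _ _ cd); last exact/conn_refl/covU.
  move=> y z yA zA yz /conn_trans; apply; apply: conn1; rewrite ?covU //.
  have := covP y; have := covP z; have := board_adj Bd yz.
  have := mtri (pos y) (ctr (cov y)) (ctr (cov z)); have := mtri (pos z) (pos y) (ctr (cov z)).
  rewrite [mdist (ctr (cov y)) (pos y)]metric_sym /touch /=.
  by have /andP[+ _] := radP (cov y); have := rad0 (cov z); lra.
have bd z : mdist (ctr (cov z)) x <= mdist (pos z) x + e0 /\ mdist (pos z) x <= mdist (ctr (cov z)) x + e0.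
  have := covP z; have := rad_e0 (cov z); have := mtri (ctr (cov z)) (pos z) x.
  by have := mtri (pos z) (ctr (cov z)) x; rewrite [mdist (ctr _) (pos _)]metric_sym; lra.
have -> : \sum_(u | [exists v in A, near_label u v]) rho u = \sum_(u in U) rho u.
  by apply: eq_bigl => u; rewrite finset.inE.
have [bc1 bc2] := bd c; have [bd1 bd2] := bd d.
case: ends => -[h1 h2]; [apply: (rho_chain link)|apply: (rho_chain (conn_sym touch_sym link))]; lra.
Qed.

Variables (Eo Ep : set Z).
Hypothesis separated : (forall z, Eo z -> mdist z x <= r / 2) /\ (forall z, Ep z -> 2 * r' <= mdist z x) \/
   (forall z, Eo z -> 2 * r' <= mdist z x) /\ (forall z, Ep z -> mdist z x <= r / 2).
Hypothesis Epp : Ep p.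

(** A connection between [P] and [Q] is cut so that the part kept crosses the ring and stays away
    from [p]. The balls of positive weight are near no cluster of [P] or [Q], so the sum over the
    remaining clusters is large enough. *)
Lemma pull_sum (P Q A : {set cluster}) p0 q0 : p0 \in P -> q0 \in Q ->
  (forall c, cl c \in P -> exists2 z, Eo z & mdist (pos c) z <= D0 + e0) ->
  (forall c, cl c \in Q -> exists2 z, Ep z & mdist (pos c) z <= D0 + e0 + rj) ->
  conn (cladj hadj cl) A p0 q0 -> 1 <= \sum_(z in A :\: (P :|: Q)) pull z.
Proof.
move=> pP qQ PE QE pq.
have cells v : exists c, v = cl c.
  by have /codomP[c vc] := valP v; exists c; exact: val_inj.
have [c pc] := cells p0; have [d qd] := cells q0.
have [w0 _] := cover x.
have [e00 erj] := rj_pos w0; have D00 := D0_ge0 w0.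
have link : conn hadj (cl @^-1: A) c d by exact: (cl_conn_lift cl_conn pq).
have [zc Ezc dc] := PE c (eq_ind _ (fun v => v \in P) pP _ pc).
have [zd Ezd dd] := QE d (eq_ind _ (fun v => v \in Q) qQ _ qd).
have t1 := mtri zc (pos c) x; have t2 := mtri zd (pos d) x.
have t3 := mtri (pos c) zc x; have t4 := mtri (pos d) zd x.
rewrite [mdist zc (pos c)]metric_sym in t3; rewrite [mdist zd (pos d)]metric_sym in t4.
have lower : 1 <= \sum_(u | [exists v in A, near_label u v]) rho u.
  case: separated => -[so sp].
    have h1 := so _ Ezc; have h2 := sp _ Ezd; have h3 := sp _ Epp.
    (* Here [p] is outside the ring: the chain is stopped at the first cell beyond [r' + e0], still
       far from [p]. *)
    pose Pr : pred T := [pred c | (mdist (pos c) x < r' + e0)%R].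
    have [||y [z [Py Pz yz cy zA]]] := @conn_exit _ hadj _ Pr c d _ _ link.
    - by rewrite /Pr /=; move: small rr'; lra.
    - by rewrite /Pr /= -leNgt; move: small rr'; lra.
    rewrite /Pr /= in Py Pz; rewrite -leNgt in Pz.
    have hz : mdist (pos z) x < r' + e0 + delta.
      have := mtri (pos y) (pos z) x; rewrite [mdist (pos z) (pos y)]metric_sym; have := board_adj Bd yz; lra.
    pose A' := z |: [set z in cl @^-1: A | Pr z]%SET.
    have cz : conn hadj A' c z.
      apply: conn_trans (connS (finset.subsetU1 _ _) cy) _; apply: conn1 => //; last exact: finset.setU11.
      by apply/finset.setU1r; case/and3P: cy.
    apply: (ring_chain cz).
    - apply/fintype.subsetP => u; rewrite !finset.inE => /orP[/eqP->|/andP[]//].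
      by move: zA; rewrite finset.inE.
    - move=> u uA; have hu : mdist (pos u) x < r' + e0 + delta.
        by move: uA; rewrite /A' !finset.inE /Pr => /orP[/eqP->//|/andP[_ /=]]; move: delta0; lra.
      have := mtri (pos u) p x; rewrite [mdist p (pos u)]metric_sym.
      by have /andP[h4 h5] := radP w0; move: small rr'; lra.
    - by left; split=> //; move: small rr'; lra.
  have h1 := so _ Ezc; have h2 := sp _ Ezd; have h3 := sp _ Epp.
  (* Here [p] is inside the ring: the chain is stopped at the first cell within [r - e0] of [x]. *)
  pose Pr : pred T := [pred c | (r - e0 < mdist (pos c) x)%R].
  have [||y [z [Py Pz yz cy zA]]] := @conn_exit _ hadj _ Pr c d _ _ link.
  - by rewrite /Pr /=; move: small rr'; lra.
  - by rewrite /Pr /= -leNgt; move: small rr'; lra.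
  rewrite /Pr /= in Py Pz; rewrite -leNgt in Pz.
  have hz : r - e0 - delta < mdist (pos z) x.
    have := mtri (pos z) (pos y) x; have := board_adj Bd yz; lra.
  pose A' := z |: [set z in cl @^-1: A | Pr z]%SET.
  have cz : conn hadj A' c z.
    apply: conn_trans (connS (finset.subsetU1 _ _) cy) _; apply: conn1 => //; last exact: finset.setU11.
    by apply/finset.setU1r; case/and3P: cy.
  apply: (ring_chain cz).
  - apply/fintype.subsetP => u; rewrite !finset.inE => /orP[/eqP->|/andP[]//].
    by move: zA; rewrite finset.inE.
  - move=> u uA; have hu : r - e0 - delta < mdist (pos u) x.
      by move: uA; rewrite /A' !finset.inE /Pr => /orP[/eqP->//|/andP[_ /=]]; move: delta0; lra.
    have := mtri p (pos u) x.
    by have /andP[h4 h5] := radP w0; move: small rr'; lra.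
  - by right; split=> //; move: small rr'; lra.
apply: le_trans lower _.
have -> : \sum_(z in A :\: (P :|: Q)) pull z =
    \sum_u \sum_(z in A :\: (P :|: Q) | near_label u z) rho u.
  rewrite /pull (exchange_big_dep predT) //=.
rewrite big_mkcond /=; apply: ler_sum => u _; case: ifP => [|_]; last exact: sumr_ge0.
move=> /exists_inP[v vA uv]; have [->|ru] := eqVneq (rho u) 0; first exact: sumr_ge0.
have [c' vc'] := cells v; subst v.
have /andP[s1 s2] := rho_supp ru; have nd := near_label_dist uv.
rewrite (bigD1 (cl c')) /=; last first.
  rewrite uv andbT finset.inE vA andbT finset.in_setU negb_or; apply/andP; split; apply/negP.
    move=> /PE[z Ez dz]; have t5 := mtri (pos c') (ctr u) x; have t6 := mtri z (pos c') x.
    have t7 := mtri (pos c') z x; have t8 := mtri (ctr u) (pos c') x.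
    rewrite [mdist (ctr u) (pos _)]metric_sym in t5; rewrite [mdist z (pos _)]metric_sym in t7.
    by case: separated => -[/(_ _ Ez) h _]; move: small rr'; lra.
  move=> /QE[z Ez dz]; have t5 := mtri (pos c') (ctr u) x; have t6 := mtri z (pos c') x.
  have t7 := mtri (pos c') z x; have t8 := mtri (ctr u) (pos c') x.
  rewrite [mdist (ctr u) (pos _)]metric_sym in t5; rewrite [mdist z (pos _)]metric_sym in t7.
  by case: separated => -[_ /(_ _ Ez) h]; move: small rr'; lra.
by rewrite lerDl sumr_ge0.
Qed.

Let B : R := (deg.+1 ^ K.+1)%N%:R.

(** Cauchy-Schwarz; counting hops, [B] bounds both the number of balls near a cluster and the number
    of clusters near a ball. *)
Lemma pull_energy : \sum_v pull v ^+ 2 <= B ^+ 2 * \sum_w rho w ^+ 2.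
Proof.
have cs v : pull v ^+ 2 <= B * \sum_(u | near_label u v) rho u ^+ 2.
  have := cauchy_schwarz (fun u => near_label u v) (fun=> 1) rho.
  rewrite /pull; under eq_bigr do rewrite mul1r.
  move=> /le_trans; apply; rewrite ler_wpM2r ?sumr_ge0 // => [*|]; first exact: sqr_ge0.
  rewrite expr1n sumr_const ler_nat /near_label; case: (val v) => [w|t]; last by rewrite (eq_card0 (fun=> erefl)).
  by apply: leq_trans (@card_hops _ _ _ deg K.+1 w patch_deg); apply: subset_leq_card; apply/fintype.subsetP.
apply: le_trans (ler_sum _ (fun v _ => cs v)) _; rewrite -mulr_sumr expr2 -mulrA ler_wpM2l // /B.
rewrite (exchange_big_dep predT) //= mulr_sumr; apply: ler_sum => u _.
rewrite sumr_const -[leLHS]mulr_natr mulrC ler_wpM2r ?sqr_ge0 // ler_nat.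
apply: leq_trans (@card_hops_inv _ _ _ deg K.+1 u patch_deg').
rewrite -cardsE -(@card_in_imset _ _ (fun v : cluster => val v) [set v | near_label u v]%SET) ; last by move=> v v' _ _ /val_inj.
rewrite -(@card_in_imset _ _ (@inl W T) [set w | u \in hops patch K.+1 w]%SET) ; last by move=> v v' _ _ [].
apply: subset_leq_card; apply/fintype.subsetP => z /imsetP[v]; rewrite finset.inE /near_label.
by case: (val v) => [w uw ->|t //]; apply: imset_f; rewrite finset.inE.
Qed.


Lemma nearcell_rnd (S : set Z) z : S z -> Qj z -> rnd z \in nearcells S.
Proof. by move=> Sz Qz; rewrite finset.inE; apply/asboolP; exists z => //; exact: (board_rnd Bd). Qed.

Hypothesis Ep_conn : connected Ep.
Hypothesis Eo_conn : connected Eo.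

(** [Ep] contains [p], which is not in [Qj], so the cells near [Ep] lead to a side; together with
    the sides they form a connected set. *)
Lemma outer_cells c' : c' \in hexsides N \/ (exists e', [/\ Ep e', Qj e' & c' = rnd e']) ->
  exists S : {set T}, [/\ hexsides N \subset S, c' \in S,
    forall u v, u \in S -> v \in S -> conn hadj S u v &
    forall c, c \in S -> exists2 z, Ep z & mdist (pos c) z <= e0 + rj].
Proof.
have [w0 _] := cover x; have [e00 erj] := rj_pos w0.
have sd c : c \in hexsides N -> exists2 z, Ep z & mdist (pos c) z <= e0 + rj.
  by move=> /(board_side Bd) h; exists p => //; apply: ltW; apply: lt_le_trans h _; rewrite lerDr ltW.
case=> [cs|[e' [Epe Qe ->]]].
  by exists (hexsides N); split=> // u v; exact: sides_conn.
have rn := nearcell_rnd Epe Qe.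
case: (board_lift Bd Ep_conn Epe Epp Qe) => [[/(board_p Bd)//]|[s sS cs]].
pose C := component hadj (nearcells Ep) (rnd e').
have sC : s \in C by rewrite finset.inE.
have eC : rnd e' \in C by rewrite finset.inE conn_refl.
exists (hexsides N :|: C); split.
- exact: finset.subsetUl.
- by rewrite finset.in_setU eC orbT.
- have to_s u : u \in hexsides N :|: C -> conn hadj (hexsides N :|: C) u s.
    rewrite finset.in_setU => /orP[uS|uC].
      exact: connS (finset.subsetUl _ _) (sides_conn uS sS).
    exact: connS (finset.subsetUr _ _) (conn_component (@hexadj_sym N) uC sC).
  by move=> u v /to_s us /to_s vs; apply: conn_trans us (conn_sym (@hexadj_sym N) vs).
- move=> c; rewrite finset.in_setU => /orP[/sd//|/(fintype.subsetP (component_sub _ _ _))].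
  rewrite finset.inE => /asboolP[z Ez h]; exists z => //; apply: ltW; apply: lt_le_trans h _.
  by have /andP[h1 h2] := radP w0; lra.
Qed.

(** The conclusion of [loewner], named so that [eps] and [c] are chosen independently of the
    stage. *)
Definition loewner_bound (eps c : R) : Prop :=
  forall (V : finType) (e : rel V) (Lf Rt Bt Tp : {set V}) (m D E : V -> R) (a b : R)
    (P Q : {set V}) (rho : V -> R) v0 v1 v' (s0 t0 s1 t1 s' t' : R),
  tiling e Lf Rt Bt Tp m D E a b -> (forall v, 0 <= rho v) ->
  (forall A p q, p \in P -> q \in Q -> conn e A p q ->
    1 <= \sum_(z in A :\: (P :|: Q)) rho z) ->
  conn e P v0 v1 -> (forall u v, u \in Q -> v \in Q -> conn e Q u v) ->
  Lf :|: Rt :|: Bt :|: Tp \subset Q -> v' \in Q ->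
  insq m D E v0 s0 t0 -> insq m D E v1 s1 t1 -> insq m D E v' s' t' ->
  \sum_v rho v ^+ 2 < c ->
  Num.max `|s1 - s0| `|t1 - t0| <= eps * Num.max `|s' - s0| `|t' - t0|.

Lemma square_ring (eps c : R) e1 e2 s0 t0 s1 t1 s' t' : loewner_bound eps c ->
  B ^+ 2 * \sum_w rho w ^+ 2 < c ->
  Eo e1 -> Eo e2 -> insquare e1 s0 t0 -> insquare e2 s1 t1 ->
  (exists e', Ep e' /\ insquare e' s' t') \/ inside s' t' ->
  Num.max `|s1 - s0| `|t1 - t0| <= eps * Num.max `|s' - s0| `|t' - t0|.
Proof.
move=> Lb en Ee1 Ee2 [Q1 sq1] [Q2 sq2] target.
have [w0 _] := cover x; have [e00 erj] := rj_pos w0; have D00 := D0_ge0 w0.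
have /andP[dr _] := radP w0; have rw0 := rad_e0 w0.
pose P := cl @: component hadj (nearcells Eo) (rnd e1).
have c12 : conn hadj (nearcells Eo) (rnd e1) (rnd e2).
  case: (board_lift Bd Eo_conn Ee1 Ee2 Q1) => [[]//|[s sS cs]]; exfalso.
  have : s \in nearcells Eo by case/and3P: cs.
  rewrite finset.inE => /asboolP[z Ez sz]; have sp := board_side Bd sS.
  have h1 := mtri (pos s) z x; have h2 := mtri p (pos s) x; have h3 := mtri z (pos s) x.
  have h4 := mtri (pos s) p x.
  rewrite [mdist z (pos s)]metric_sym in h1 h3; rewrite [mdist p (pos s)]metric_sym in h4.
  by case: separated => -[/(_ _ Ez) h5 /(_ _ Epp) h6]; move: small rr'; lra.
have [c' [c'P sq']] : exists c', (c' \in hexsides N \/ (exists e', [/\ Ep e', Qj e' & c' = rnd e'])) /\ insq m D E (cl c') s' t'.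
  case: target => [[e' [Ee [Qe sq]]]|[c' cS sq]]; last by exists c'; split=> //; left.
  by exists (rnd e'); split=> //; right; exists e'.
have [S [hS c'S Sc Sn]] := outer_cells c'P.
pose Q := cl @: S.
apply: (Lb _ _ _ _ _ _ _ _ _ _ _ P Q pull (cl (rnd e1)) (cl (rnd e2)) (cl c')) Tl _ _ _ _ _ _ sq1 sq2 sq' _.
- by move=> v; exact: sumr_ge0.
- move=> A p0 q0 pP qQ; apply: (pull_sum pP qQ).
    move=> c0 /imsetP[c1 /(fintype.subsetP (component_sub _ _ _))]; rewrite finset.inE => /asboolP[z Ez h] e.
    exists z => //; apply: le_trans (mtri (pos c1) _ _) _; apply: lerD; first exact: cl_dist.
    by apply: ltW; lra.
  move=> c0 /imsetP[c1 /Sn[z Ez h] e]; exists z => //; apply: le_trans (mtri (pos c1) _ _) _.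
  by rewrite -addrA; apply: lerD => //; exact: cl_dist.
- apply: conn_cl; have cc : rnd e1 \in component hadj (nearcells Eo) (rnd e1).
    by rewrite finset.inE conn_refl //; case/and3P: c12.
  have cc2 : rnd e2 \in component hadj (nearcells Eo) (rnd e1) by rewrite finset.inE.
  apply: connS (conn_component (@hexadj_sym N) cc cc2).
  by apply/fintype.subsetP => z zc; rewrite finset.inE imset_f.
- move=> u v /imsetP[c1 c1S ->] /imsetP[c2 c2S ->]; apply: conn_cl; apply: connS (Sc _ _ c1S c2S).
  by apply/fintype.subsetP => z zc; rewrite finset.inE imset_f.
- rewrite -!imsetU; exact: imsetS.
- by rewrite imset_f.
- exact: le_lt_trans pull_energy en.
Qed.

End Stage.

(** What the limit uses of a tiling: [SQ z s t] means that [(s, t)] is in the square of [z], and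
    [SV s t] that it is in a square of a side of the board. *)
Record flat_stage (R : realType) (Z : metricType R) (q : 'I_5 -> Z) (Qj : set Z)
    (SQ : Z -> R -> R -> Prop) (SV : R -> R -> Prop) (wd ht : R) : Prop := FlatStage {
  stage_wd : 0 < wd;
  stage_ht : 0 < ht;
  stage_exists : forall z, Qj z -> exists s t, SQ z s t;
  stage_range : forall z s t, SQ z s t -> Qj z /\ (0 <= s <= wd) /\ (0 <= t <= ht);
  stage_onto : forall s t, 0 <= s < wd -> 0 <= t < ht -> exists z, SQ z s t;
  stage_edges : (forall t, 0 <= t < ht -> SV 0 t /\ SV wd t) /\
    (forall s, 0 <= s < wd -> SV s 0 /\ SV s ht);
  stage_five : forall s t, (forall i, SQ (q i) s t) -> False }.

Definition ring_estimate (R : realType) (Z : metricType R) (p : Z)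
    (SQ : Z -> R -> R -> Prop) (SV : R -> R -> Prop) (eps : R) (x : Z) (r r' : R) : Prop :=
  forall (Eo Ep : set Z) e1 e2 s0 t0 s1 t1 s' t',
  connected Eo -> connected Ep -> Ep p -> Eo e1 -> Eo e2 ->
  (forall z, Eo z -> mdist z x <= r / 2) /\ (forall z, Ep z -> 2 * r' <= mdist z x) \/
  (forall z, Eo z -> 2 * r' <= mdist z x) /\ (forall z, Ep z -> mdist z x <= r / 2) ->
  SQ e1 s0 t0 -> SQ e2 s1 t1 -> (exists e', Ep e' /\ SQ e' s' t') \/ SV s' t' ->
  Num.max `|s1 - s0| `|t1 - t0| <= eps * Num.max `|s' - s0| `|t' - t0|.

Definition ring_weight (R : realType) (Z : metricType R) (W : finType) (ctr : W -> Z) (rad : W -> R)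
    (x : Z) (r r' : R) (rho : W -> R) : Prop :=
  [/\ forall w, 0 <= rho w, forall w, rho w != 0 -> r <= mdist (ctr w) x <= r' &
    forall A w w', conn (touch ctr rad) A w w' ->
      mdist (ctr w) x <= r -> r' <= mdist (ctr w') x -> 1 <= \sum_(u in A) rho u].

Lemma stage_tiling (R : realType) (Z : metricType R) (N : nat) (pos : 'I_N.+1 * 'I_N.+1 -> Z) rnd
    (Qj : set Z) (p : Z) (delta rj : R) (W : finType) (ctr : W -> Z) (rad : W -> R) (e0 lam : R) (deg : nat)
    (q : 'I_5 -> Z) (mid : 'I_N.+1) (rows : 'I_5 -> 'I_N.+1) :
  let Lam := 3 * lam + 1 in
  let D0 := (4 * deg.+1%:R + 4) * (Lam * e0) in
  board pos rnd Qj p delta rj -> 1 <= lam ->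
  (forall (a : Z) (r : R), 0 < r -> forall x y, ball a r x -> ball a r y ->
    exists E : set Z, [/\ connected E, E x, E y & forall z, E z -> ball a (lam * r) z]) ->
  (forall w, delta < rad w < e0) -> 0 < delta -> (forall z, exists w, mdist z (ctr w) <= rad w) ->
  (forall w, (#|[set u | (mdist (ctr u) (ctr w) <= Lam * (rad u + rad w))%R]%SET| <= deg)%N) ->
  Lam * e0 <= rj -> 
  (forall i, q i = pos (mid, rows i)) ->
  (forall i j c c', i != j -> D0 < mdist (pos (c, rows i)) (pos (c', rows j))) ->
  exists SQ SV wd ht, flat_stage q Qj SQ SV wd ht /\
    forall eps c x r r' rho, loewner_bound eps c -> ring_weight ctr rad x r r' rho -> r < r' ->
      16 * (D0 + e0 + rj) <= r -> ((deg.+1 ^ deg.+2)%N%:R) ^+ 2 * (\sum_w rho w ^+ 2) < c ->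
      ring_estimate p SQ SV eps x r r'.
Proof.
move=> Lam D0 Bd lam1 LLC1 radP delta0 cover mult mesh qE sep.
have [a [aC aD aH]] := patch_partition pos rnd p rj mult.
have hs := @hexadj_sym N.
have clc := cl_conn aC.
have cadj_sym := cladj_sym (cl a) hs.
have [||A|m [D [E [wd [ht Tl]]]]] := @tiling_exists R (cluster a) (cladj (@hexadj N) (cl a)) (cl a @: hexleft N)
   (cl a @: hexright N) (cl a @: hexbot N) (cl a @: hextop N).
- exact: cadj_sym.
- move=> u v; have [/codomP[c uc] /codomP[d vd]] := (valP u, valP v).
  have -> : u = cl a c by exact: val_inj.
  have -> : v = cl a d by exact: val_inj.
  have /conn_cl : conn (@hexadj N) (cl a @^-1: [set: cluster a]%SET) c d.
    rewrite /conn !finset.inE /=; apply: connect_sub (board_connected c d) => x y xy.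
    by apply: connect1; rewrite /edges_within /= !finset.inE.
  move=> /and3P[_ _]; apply: connect_sub => x y /and3P[_ _ ?].
  exact: connect1.
- by rewrite !(joins_cl clc) finset.preimsetC hex_dual.
have [w0 _] := cover p.
exists (insquare rnd Qj m D E), (inside m D E), wd, ht; split.
  split.
  - exact: tiling_a Tl.
  - exact: tiling_b Tl.
  - exact: insquare_exists Tl.
  - by move=> z s t [Qz /(insq_range Tl)[]].
  - exact: (insquare_onto Bd Tl).
  - exact: inside_edges Tl.
  - move=> s t sq; apply: (five_squares Bd lam1 radP delta0 aH Tl w0 (mid := mid) sep (s := s) (t := t)) => i.
    by rewrite -qE.
move=> eps c x r r' rho Lb [rho0 rho_supp rho_chain] rr' small energy Eo Ep e1 e2 s0 t0 s1 t1 s' t'.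
move=> cEo cEp Epp E1 E2 separated sq0 sq1 target.
exact: (square_ring Bd lam1 LLC1 radP delta0 cover mult mesh aC aD aH Tl rho0 rho_supp rho_chain rr' small
  separated Epp cEp cEo Lb energy E1 E2 sq0 sq1 target).
Qed.

Record fine_covers (R : realType) (Z : metricType R) (W : nat -> finType)
    (ctr : forall n, W n -> Z) (rad : forall n, W n -> R) : Prop := FineCovers {
  covers_rad : forall n w, 0 < rad n w;
  covers_cover : forall n z, exists w, mdist z (ctr n w) <= rad n w;
  covers_mesh : forall e, 0 < e -> exists n0, forall n, (n0 <= n)%N -> forall w, rad n w < e;
  covers_mult : forall L, exists d, forall n w,
    (#|[set u | (mdist (ctr n u) (ctr n w) <= L * (rad n u + rad n w))%R]%SET| <= d)%N;
  covers_ring : forall eps, 0 < eps -> exists2 K, 1 < K & forall x r, 0 < r ->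
    exists n0, forall n, (n0 <= n)%N -> exists2 rho, ring_weight (ctr n) (rad n) x r (K * r) rho &
      \sum_w rho w ^+ 2 < eps }.

(** The separation [kap] of the rows is fixed before the mesh [delta]: the cover has to be fine
    compared with [kap], and [delta] fine compared with the cover. *)
Definition boards (R : realType) (Z : metricType R) (p : Z) (q : 'I_5 -> Z) : Prop :=
  forall eta : R, 0 < eta -> exists Qj rj kap, [/\ 0 < rj, rj < eta, 0 < kap &
    forall delta, 0 < delta -> exists N (pos : 'I_N.+1 * 'I_N.+1 -> Z) rnd mid rows,
      [/\ board pos rnd Qj p delta rj, forall i, q i = pos (mid, rows i) &
        forall i j c c', i != j -> kap <= mdist (pos (c, rows i)) (pos (c', rows j))]].

Lemma finite_lower (R : realType) (W : finType) (f : W -> R) : (forall w, 0 < f w) ->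
  exists2 d, 0 < d & forall w, d < f w.
Proof.
move=> f0; exists (\big[Order.min/1]_w (f w) / 2).
  by rewrite divr_gt0 //; elim/big_ind: _ => // x y x0 y0; rewrite lt_min x0.
move=> w; have h : \big[Order.min/1]_w f w <= f w by exact: bigmin_le_cond.
have h0 : 0 < \big[Order.min/1]_w (f w) by elim/big_ind: _ => // x y x0 y0; rewrite lt_min x0.
by apply: lt_le_trans h; rewrite ltr_pdivrMr // mulr_natr mulr2n ltrDl.
Qed.

Lemma tilings_exist (R : realType) (Z : metricType R) (p : Z) (q : 'I_5 -> Z) (lam : R)
    (W : nat -> finType) (ctr : forall n, W n -> Z) (rad : forall n, W n -> R) :
  1 <= lam ->
  (forall (a : Z) (r : R), 0 < r -> forall x y, ball a r x -> ball a r y ->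
    exists E : set Z, [/\ connected E, E x, E y & forall z, E z -> ball a (lam * r) z]) ->
  fine_covers ctr rad -> boards p q ->
  exists (Q : nat -> set Z) SQ SV wd ht, [/\
    forall j : nat, flat_stage q (Q j) (SQ j) (SV j) (wd j) (ht j),
    forall z, z <> p -> exists j0, forall j, (j0 <= j)%N -> Q j z,
    forall j i, Q j (q i) &
    forall eps, 0 < eps -> exists2 K, 1 < K & forall x r, 0 < r -> exists j0, forall j, (j0 <= j)%N ->
      ring_estimate p (SQ j) (SV j) eps x r (K * r)].
Proof.
move=> lam1 LLC1 cov brd.
pose Lam := 3 * lam + 1; have [deg degP] := covers_mult cov Lam.
pose eta (j : nat) : R := j.+1%:R^-1.
have eta0 j : 0 < eta j by rewrite invr_gt0 ltr0Sn.
pose B : R := (deg.+1 ^ deg.+2)%N%:R.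
have step j : exists t : set Z * (Z -> R -> R -> Prop) * (R -> R -> Prop) * R * R, let: (Q, SQ, SV, wd, ht) := t in
    [/\ flat_stage q Q SQ SV wd ht, forall z, eta j <= mdist z p -> Q z, forall i, Q (q i) &
    exists2 n, (j <= n)%N & forall eps c x r r' rho, loewner_bound eps c -> ring_weight (ctr n) (rad n) x r r' rho ->
      r < r' -> 32 * eta j <= r -> B ^+ 2 * (\sum_w rho w ^+ 2) < c -> ring_estimate p SQ SV eps x r r'].
  have [Q [rj [kap [rj0 rje kap0 bd]]]] := brd _ (eta0 j).
  (* [C * e0] is the sum [D0 + Lam * e0 + e0] of the errors. The bound [M] keeps it below [rj],
     below the separation of the rows, and so small that [32 * eta j <= r] implies the smallness
     condition of [stage_tiling]. *)
  pose C := (4 * deg.+1%:R + 4) * Lam + Lam + 1.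
  have L4 : 4 <= Lam by rewrite /Lam; move: lam1; lra.
  have d0 : 0 <= deg.+1%:R :> R by [].
  have C0 : 0 < C by rewrite /C; clear -L4 d0; nra.
  pose M := Num.min (Num.min rj (kap / 2)) (eta j - rj).
  have M0 : 0 < M by rewrite !lt_min rj0 subr_gt0 rje divr_gt0.
  pose e0 := M / C; have e00 : 0 < e0 by exact: divr_gt0.
  have Ce0 : C * e0 = M by rewrite /e0 mulrC divfK // gt_eqF.
  have [Mr Mk Me] : [/\ M <= rj, M <= kap / 2 & M <= eta j - rj].
    by split; rewrite /M !ge_min lexx ?orbT.
  pose D0 := (4 * deg.+1%:R + 4) * (Lam * e0).
  have D0E : D0 + Lam * e0 + e0 = M by rewrite -Ce0 /D0 /C; ring.
  have Le0 : 0 <= Lam * e0 by rewrite mulr_ge0 ?(ltW e00) //; clear -L4 d0; lra.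
  have D00 : 0 <= D0 by apply: mulr_ge0 Le0; clear -d0; lra.
  have [n0 n0P] := covers_mesh cov e00.
  pose n := maxn j n0.
  have [delta delta0 dr] := finite_lower (fun w : W n => covers_rad cov w).
  have [N [pos [rnd [mid [rows [Bd qE sep]]]]]] := bd _ delta0.
  have [||||SQ [SV [wd [ht [fs re]]]]] := stage_tiling (e0 := e0) (deg := deg) Bd lam1 LLC1 _ delta0 (covers_cover cov n) _ _ qE _.
  - by move=> w; rewrite dr n0P // leq_maxr.
  - exact: degP.
  - by rewrite -/Lam; clear -D0E D00 Le0 e00 Mr; lra.
  - move=> i i' c c' ii; apply: lt_le_trans (sep _ _ _ _ ii); rewrite -/Lam -/D0.
    by clear -D0E D00 Le0 e00 Mk kap0; lra.
  exists (Q, SQ, SV, wd, ht); split=> //.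
  - by move=> z h; apply: (board_far Bd); apply: le_trans (ltW rje) h.
  - by move=> i; rewrite qE; have [] := board_pos Bd (mid, rows i).
  - exists n; first exact: leq_maxl.
    move=> eps c x r r' rho Lb rw rr' rr en; apply: re Lb rw rr' _ en; rewrite -/Lam -/D0.
    by have := eta0 j; clear -D0E D00 Le0 e00 Me rr; lra.
have [F FP] := choice step.
exists (fun j => (F j).1.1.1.1), (fun j => (F j).1.1.1.2), (fun j => (F j).1.1.2), (fun j => (F j).1.2), (fun j => (F j).2).
have eta_lim e : 0 < e -> exists j0, forall j, (j0 <= j)%N -> eta j <= e.
  move=> e_gt0; exists (Num.truncn e^-1) => j jj; rewrite /eta.
  rewrite -[leRHS]invrK lef_pV2 ?posrE ?invr_gt0 //; apply: ltW.
  apply: lt_le_trans (truncnS_gt _) _; rewrite ler_nat ltnS //.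
split.
- by move=> j; have := FP j; case: (F j) => [[[[Q SQ] SV] wd] ht] [].
- move=> z zp; have zp0 : 0 < mdist z p by rewrite lt_neqAle mdist_ge0 andbT eq_sym; apply/eqP => /mdist_positivity.
  have [j0 j0P] := eta_lim _ zp0; exists j0 => j jj.
  by have := FP j; case: (F j) => [[[[Q SQ] SV] wd] ht] [_ + _ _] => /(_ z (j0P _ jj)).
- by move=> j i; have := FP j; case: (F j) => [[[[Q SQ] SV] wd] ht] [_ _ + _] => /(_ i).
- move=> eps eps0; have [c c0 Lb] := loewner eps0.
  have B0 : 0 < B ^+ 2 by rewrite exprn_gt0 // ltr0n expn_gt0.
  have [K K1 KP] := covers_ring cov (divr_gt0 c0 B0).
  exists K => // x r r0; have [n0 n0P] := KP x r r0.
  have r32 : 0 < r / 32 by exact: divr_gt0.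
  have [j1 j1P] := eta_lim _ r32; exists (maxn n0 j1) => j; rewrite geq_max => /andP[jn jj].
  have := FP j; case: (F j) => [[[[Q SQ] SV] wd] ht] [_ _ _ [n nj H]].
  have [rho rw en] := n0P n (leq_trans jn nj).
  apply: (H _ _ _ _ _ _ Lb rw).
  + by rewrite -[ltLHS]mul1r ltr_pM2r.
  + by rewrite mulrC -ler_pdivlMr // j1P.
  + by rewrite mulrC -ltr_pdivlMr.
Qed.

(** * Quasisymmetry from a weak condition *)

Section LocallyConstant.
Variables (R : realType) (Z : metricType R).

(** The points of [E] satisfying [P] form an open and closed subset of [E]. *)
Lemma connected_locally (E P : set Z) x : connected E -> E x -> P x ->
  (forall u, E u -> exists2 e : R, 0 < e & forall v, E v -> mdist u v < e -> (P u <-> P v)) ->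
  forall y, E y -> P y.
Proof.
move=> cE Ex Px loc.
have opn (S : set Z) : (forall u, E u -> exists2 e : R, 0 < e & forall v, E v -> mdist u v < e -> (S u <-> S v)) ->
    exists2 C, open C & E `&` S = E `&` C.
  move=> locS; exists (\bigcup_(t in [set t : Z * R | E t.1 /\ S t.1 /\ 0 < t.2 /\
     forall v, E v -> mdist t.1 v < t.2 -> S v]) (ball t.1 t.2)°).
    by apply: bigcup_open => t _; exact: open_interior.
  apply/seteqP; split=> v /= [Ev].
    move=> Sv; split=> //; have [e e0 eP] := locS v Ev; exists (v, e) => /=; last exact: nbhsx_ballx.
    by split=> //; split=> //; split=> // w Ew vw; apply/(eP w Ew vw).
  move=> [[u e] /= [_ [_ [_ h]]] /interior_subset]; rewrite ballEmdist /= => uv.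
  by split=> //; exact: h.
have [C oC CE] := opn P loc.
have [D oD DE] := opn (~` P) (fun u Eu => let: ex_intro2 e e0 eP := loc u Eu in
  ex_intro2 _ _ e e0 (fun v Ev uv => not_iff_compat (eP v Ev uv))).
suff BE : E `&` P = E by move=> y Ey; move: (Ey); rewrite -{1}BE => -[].
apply: cE; first by exists x.
  by exists C.
exists (~` D); first exact: open_closedC.
apply/seteqP; split=> v [Ev h]; split=> //.
  by move=> Dv; have [] : (E `&` ~` P) v by rewrite DE.
by apply: contrapT => nP; have [] : (E `&` D) v by rewrite -DE.
Qed.

Lemma connected_step (E P : set Z) x (e : R) : connected E -> E x -> P x -> 0 < e ->
  (forall u v, E u -> E v -> P u -> mdist u v < e -> P v) -> forall y, E y -> P y.
Proof.
move=> cE Ex Px e0 st; apply: (connected_locally cE Ex Px) => u Eu; exists e => // v Ev uv.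
by split=> [Pu|Pv]; [exact: st Eu Ev Pu uv|apply: st Ev Eu Pv _; rewrite metric_sym].
Qed.

Lemma connected_union (A B : set Z) x : connected A -> connected B -> A x -> B x -> connected (A `|` B).
Proof. by move=> cA cB Ax Bx; apply: connectedU => //; exists x. Qed.

End LocallyConstant.

(** The doubling condition in its packing form. *)
Definition doubling (R : realType) (Z : metricType R) : Prop :=
  forall t : R, exists N : nat, forall (x : Z) (r : R) (S : seq Z), 0 < r -> uniq S ->
    (forall u v, u \in S -> v \in S -> u != v -> r <= mdist u v) ->
    (forall u, u \in S -> mdist u x <= t * r) -> (size S <= N)%N.

Lemma last_take (T : Type) (x : T) p k : (k <= size p)%N -> last x (take k p) = nth x (x :: p) k.
Proof.
elim: p x k => [|y p IH] x [|k] //= kp; rewrite IH //.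
by apply: set_nth_default.
Qed.

Section Chains.
Variables (R : realType) (Z : metricType R).

Lemma connected_chain (E : set Z) x y (e : R) : connected E -> E x -> E y -> 0 < e ->
  exists p : seq Z, [/\ path (fun u v => mdist u v < e) x p, last x p = y & forall u, u \in p -> E u].
Proof.
move=> cE Ex Ey e0; move: y Ey; apply: (connected_step cE Ex _ e0).
  by exists [::].
move=> u v Eu Ev [p [pp lp sp]] uv; exists (rcons p v); split.
- by rewrite rcons_path pp lp.
- by rewrite last_rcons.
- by move=> w; rewrite mem_rcons inE => /orP[/eqP->|/sp].
Qed.

(* In a shortest chain the points of even index are separated. *)
Lemma short_chain (E : set Z) x y (r : R) (N : nat) : connected E -> E x -> E y -> 0 < r ->
  (forall (S : seq Z), uniq S -> (forall u v, u \in S -> v \in S -> u != v -> r <= mdist u v) ->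
    (forall u, u \in S -> E u) -> (size S <= N)%N) ->
  exists p : seq Z, [/\ path (fun u v => mdist u v < r) x p, last x p = y,
    forall u, u \in p -> E u & (size p <= N.*2)%N].
Proof.
move=> cE Ex Ey r0 sepN.
pose Q n := `[< exists p : seq Z, [/\ path (fun u v => mdist u v < r) x p, last x p = y,
   forall u, u \in p -> E u & size p = n] >].
have exQ : exists n, Q n.
  by have [p [pp lp sp]] := connected_chain cE Ex Ey r0; exists (size p); apply/asboolP; exists p.
have [n /asboolP[p [pp lp sp pn]] nmin] := ex_minnP exQ.
exists p; split=> //; rewrite leqNgt; apply/negP => big.
pose g i := nth x (x :: p) i.*2.
have gE i : E (g i).
  rewrite /g; case: (ltnP i.*2 (size (x :: p))) => [lt|ge]; last by rewrite nth_default.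
  by have := mem_nth x lt; rewrite inE => /orP[/eqP->|/sp].
have far i j : (i < j)%N -> (j.*2 <= size p)%N -> r <= mdist (g i) (g j).
  move=> ij jp; rewrite leNgt; apply/negP => close.
  have ip : (i.*2 <= size p)%N by apply: leq_trans jp; rewrite leq_double ltnW.
  pose p1 := take i.*2 p; pose p2 := drop j.*2.-1 p.
  have j0 : (0 < j)%N by apply: leq_ltn_trans ij.
  have gj : g j = nth x p j.*2.-1 by rewrite /g -{1}(@prednK j.*2) // double_gt0.
  have jp' : (j.*2.-1 < size p)%N by rewrite prednK // double_gt0.
  have p2E : p2 = g j :: drop j.*2 p.
    by rewrite /p2 (drop_nth x) // gj prednK // double_gt0.
  have l1 : last x p1 = g i by exact: last_take.
  have := nmin (size (p1 ++ p2)); rewrite leqNgt => /(_ _)/negP; apply.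
    apply/asboolP; exists (p1 ++ p2); split=> //.
    - rewrite cat_path; have := pp; rewrite -{1}(cat_take_drop i.*2 p) cat_path => /andP[-> _] /=.
      rewrite l1 p2E /= close /=; have := pp; rewrite -{1}(cat_take_drop j.*2 p) cat_path => /andP[_].
      by rewrite last_take.
    - rewrite last_cat; have := lp; rewrite -{1}(cat_take_drop j.*2.-1 p) last_cat -/p2 p2E //=.
    - by move=> u; rewrite mem_cat => /orP[/mem_take|/mem_drop]; exact: sp.
  rewrite size_cat size_take_min (minn_idPl ip) size_drop -pn; lia.
pose S := [seq g i | i <- iota 0 N.+1].
have inS u : u \in S -> exists2 i, (i <= N)%N & u = g i.
  by move=> /mapP[i]; rewrite mem_iota add0n => /andP[_ h] ->; exists i.
have ltp j : (j <= N)%N -> (j.*2 <= size p)%N.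
  by move=> jN; apply: leq_trans (ltnW big); rewrite leq_double.
have gi i j : (i <= N)%N -> (j <= N)%N -> g i = g j -> i = j.
  move=> iN jN gij; case: (ltngtP i j) => // lt.
    by have := far _ _ lt (ltp _ jN); rewrite gij mdistxx leNgt r0.
  by have := far _ _ lt (ltp _ iN); rewrite gij mdistxx leNgt r0.
have := sepN S; rewrite size_map size_iota ltnn => /(_ _ _ _)/negP; apply => //.
- rewrite map_inj_in_uniq ?iota_uniq // => i j; rewrite !mem_iota !add0n => /andP[_ h] /andP[_ h'].
  exact: gi.
- move=> u v /inS[i iN ->] /inS[j jN ->] uv; case: (ltngtP i j) => [lt|lt|e].
  + exact: far lt (ltp _ jN).
  + by rewrite metric_sym; exact: far lt (ltp _ iN).
  + by move: uv; rewrite e eqxx.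
- by move=> u /inS[i _ ->]; exact: gE.
Qed.

End Chains.

Section Quasisymmetry.
Variables (R : realType) (Z T : metricType R) (F : Z -> T) (lam : R).
Hypothesis lam1 : 1 <= lam.
Hypothesis LLC1 : forall (a : Z) (r : R), 0 < r -> forall x y, ball a r x -> ball a r y ->
  exists E : set Z, [/\ connected E, E x, E y & forall z, E z -> ball a (lam * r) z].
Hypothesis dbl : doubling Z.
Hypothesis small : forall eps, 0 < eps -> exists2 t, 0 < t & forall x y z,
  mdist x z <= t * mdist x y -> mdist (F x) (F z) <= eps * mdist (F x) (F y).

(** By the doubling condition [x] and [z] are joined by a chain of a bounded number of steps. A step
    from [a] is short compared with the distance from [a] to [x] or to [y], so by [small] it moves
    the image by at most [mdist (F x) (F a) + mdist (F x) (F y)]. In units of [mdist (F x) (F y)]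
    the distance from [F x] obeys [h -> 2 * h + 1]. *)
Lemma large : forall t : R, exists2 H : R, 0 <= H & forall x y z, mdist x z <= t * mdist x y ->
  mdist (F x) (F z) <= H * mdist (F x) (F y).
Proof.
have [t1 t10 t1P] := small ltr01 => t.
have [N NP] := dbl (`|2 * lam * (`|t| + 1) / (t1 / 4)|).
exists (2 ^+ N.*2); first exact: exprn_ge0.
move=> x y z xz; have [e|xy] := eqVneq x y.
  by subst y; move: xz; rewrite mdistxx mulr0 => h; have <- : x = z by [apply: mdist_positivity; apply/eqP; rewrite eq_le h mdist_ge0]; rewrite mdistxx mulr0.
set D := mdist x y in xz *; have D0 : 0 < D by rewrite mdist_gt0.
have nt : 0 <= `|t| by []. have tn := ler_norm t.
have rad0 : 0 < (`|t| + 1) * D by rewrite mulr_gt0 // ltr_wpDl.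
have bx : ball x ((`|t| + 1) * D) x by exact: ballxx.
have bz : ball x ((`|t| + 1) * D) z.
  by rewrite ballEmdist /=; apply: le_lt_trans xz _; rewrite ltr_pM2r //; move: tn; lra.
have [E [cE Ex Ez EB]] := LLC1 rad0 bx bz.
pose r := t1 / 4 * D; have r0 : 0 < r by rewrite mulr_gt0 // divr_gt0.
have [|p [pp lp _ pN]] := short_chain (N := N) cE Ex Ez r0.
  move=> S uS sep SE; apply: (NP x r S r0 uS sep) => u /SE/EB; rewrite ballEmdist /= metric_sym => h.
  apply: ltW; apply: lt_le_trans h _; apply: le_trans (ler_wpM2r (ltW r0) (ler_norm _)).
  rewrite /r [leRHS]mulrA divfK ?gt_eqF ?divr_gt0 //.
  have l0 : 0 <= lam by apply: le_trans lam1.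
  by rewrite mulrA ler_wpM2r ?(ltW D0) // -mulrA [leRHS]mulrC ler_peMr ?ler1n // mulr_ge0 // ltW // ltr_wpDl.
suff main q n : path (fun u v => mdist u v < r) x q -> size q = n ->
    mdist (F x) (F (last x q)) <= (2 ^+ n - 1) * mdist (F x) (F y).
  rewrite -lp; apply: le_trans (main p _ pp erefl) _; rewrite ler_wpM2r ?mdist_ge0 //.
  apply: le_trans (_ : 2 ^+ size p <= _); first by rewrite lerBlDr lerDl.
  by rewrite ler_weXn2l ?ler1n.
elim: n q => [|n IH] q.
  by move=> _ /size0nil -> /=; rewrite mdistxx expr0 subrr mul0r.
case/lastP: q => [//|q b]; rewrite rcons_path last_rcons size_rcons => /andP[pq qb] [sq].
have h1 := IH q pq sq; set a := last x q in h1 qb *.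
have [w hw wD] : exists2 w, w = x \/ w = y & D / 2 <= mdist a w.
  have tr := mtri a x y; rewrite [mdist x a]metric_sym -/D in tr.
  case: (lerP (D / 2) (mdist a x)) => h; first by exists x => //; left.
  by exists y; [right|move: tr h; lra].
have h2 : mdist (F a) (F b) <= mdist (F a) (F w).
  rewrite -[leRHS]mul1r; apply: t1P; apply: le_trans (ltW qb) _; rewrite /r.
  by move: wD t10 D0; nra.
have h3 : mdist (F a) (F w) <= mdist (F x) (F a) + mdist (F x) (F y).
  case: hw => ->; first by rewrite metric_sym lerDl mdist_ge0.
  by apply: le_trans (mtri (F x) _ _) _; rewrite metric_sym.
have h4 := mtri (F a) (F x) (F b); rewrite exprS.
move: h1 h2 h3 h4; move: (2 ^+ n) => X; lra.
Qed.

Hypothesis Zcompact : compact [set: Z].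
Hypothesis Zconn : connected [set: Z].
Hypothesis bounded : exists M : R, forall x y, mdist (F x) (F y) <= M.
Hypothesis nonconst : exists x y, F x <> F y.
Hypothesis onto : forall w, exists x, F x = w.

Lemma F_local x e : 0 < e -> exists2 d, 0 < d & forall z, mdist x z < d -> mdist (F x) (F z) < e.
Proof.
move=> e0; have [M MP] := bounded.
have M0 : 0 <= M by apply: le_trans (MP x x); exact: mdist_ge0.
have [y xy] : exists y, x <> y.
  have [a [b ab]] := nonconst; have [xa|xa] := pselect (x = a); last by exists a.
  by exists b => xb; apply: ab; rewrite -xa -xb.
have e2 : 0 < e / (M + 1) / 2 by rewrite !divr_gt0 // ltr_wpDl.
have [t t0 tP] := small e2; exists (t * mdist x y).
  by rewrite mulr_gt0 // mdist_gt0; exact/eqP.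
move=> z /ltW/tP h; apply: le_lt_trans h _; apply: le_lt_trans (ler_wpM2l (ltW e2) (MP x y)) _.
have M1 : 0 < M + 1 by rewrite ltr_wpDl.
have uE : e / (M + 1) * (M + 1) = e by rewrite divfK // gt_eqF.
have u0 : 0 < e / (M + 1) by exact: divr_gt0.
by move: uE u0; move: (e / (M + 1)) => u uE u0; nra.
Qed.

Lemma F_continuous : continuous F.
Proof.
move=> x; apply/cvg_ballP => e e0; have [d d0 dP] := F_local x e0.
apply/nbhs_ballP; exists d => // z; rewrite ballEmdist /= => xz.
by rewrite ballEmdist /=; exact: dP.
Qed.

(** If [F] took the value [F x] twice, the set where it does so would be open and closed: at a point
    of this set [small] applies with a second point of the set, which makes the right-hand side
    vanish. Then [F] would be constant. *)
Lemma F_injective : injective F.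
Proof.
move=> x y Fxy; apply: contrapT => xy; have [a [b]] := nonconst; apply.
suff con w : F w = F x by rewrite !con.
apply: (connected_locally (P := fun w => F w = F x) Zconn (x := x)) => // u _.
have [e1|e1] := pselect (F u = F x).
  have [w' uw Fw] : exists2 w', u <> w' & F w' = F x.
    by have [ux|ux] := pselect (u = x); [exists y; rewrite ?ux|exists x].
  have [t t0 tP] := small ltr01; exists (t * mdist u w').
    by rewrite mulr_gt0 // mdist_gt0; exact/eqP.
  move=> v _ /ltW/tP; rewrite e1 Fw mdistxx mulr0 => h; split=> // _.
  by apply/esym/mdist_positivity/eqP; rewrite eq_le h mdist_ge0.
have d0 : 0 < mdist (F u) (F x) by rewrite mdist_gt0; exact/eqP.
have [d dd0 dP] := F_local u d0; exists d => // v _ /dP h; split=> // Fv.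
by move: h; rewrite Fv ltxx.
Qed.

Lemma quasisymmetry_of_small : quasisymmetry F.
Proof.
have [G GF] := choice onto.
have FG : cancel F G by move=> x; apply: F_injective; rewrite GF.
split.
  exists G; split=> //; first exact: F_continuous.
  apply/continuous_closedP => A cA.
  have -> : G @^-1` A = F @` A.
    by apply/seteqP; split=> [w Aw|w [x Ax <-]]; [exists (G w)|rewrite /= FG].
  apply: compact_closed; first exact: metric_hausdorff.
  apply: continuous_compact; first exact/continuous_subspaceT/F_continuous.
  exact: subclosed_compact cA Zcompact _.
pose S t := [set u : R | exists x y z, [/\ x <> z, mdist x y <= t * mdist x z &
  u = mdist (F x) (F y) / mdist (F x) (F z)]].
have Fpos x z : x <> z -> 0 < mdist (F x) (F z).
  by move=> xz; rewrite mdist_gt0; apply/eqP => /F_injective.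
have Sub t (H : R) : (forall x y z, mdist x z <= t * mdist x y -> mdist (F x) (F z) <= H * mdist (F x) (F y)) ->
    ubound (S t) H.
  by move=> HP u [x [y [z [xz xy ->]]]]; rewrite ler_pdivrMr ?Fpos // HP.
have S0 t : 0 <= t -> S t 0.
  move=> t0; have [a [b ab]] := nonconst; exists a, a, b; rewrite !mdistxx mul0r; split=> //.
    by move=> e; apply: ab; rewrite e.
  by rewrite mulr_ge0 ?mdist_ge0.
have hasS t : 0 <= t -> has_sup (S t).
  by move=> t0; split; [exists 0; exact: S0|have [H _ HP] := large t; exists H; exact: Sub].
have sup0 t : 0 <= t -> 0 <= sup (S t) by move=> t0; apply: ub_le_sup (S0 t t0); exact: (hasS t t0).2.
(* The supremum is only nondecreasing; the summand [t] makes the function strictly increasing. *)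
exists (fun t => if t <= 0 then 0 else sup (S t) + t); split.
- by rewrite lexx.
- by move=> t t0; rewrite leNgt t0 /= ltr_wpDl // sup0 // ltW.
- move=> t t' t0 tt'; have t'0 := lt_trans t0 tt'; rewrite !leNgt t0 t'0 /= ler_ltD //.
  apply: ge_sup; first by exists 0; exact/S0/ltW.
  move=> u [x [y [z [xz xy uE]]]]; apply: ub_le_sup; first exact: (hasS _ (ltW t'0)).2.
  exists x, y, z; split=> //; apply: le_trans xy _; rewrite ler_wpM2r ?mdist_ge0 // ltW //.
- apply/cvgrPdist_lt => e e0; have e2 : 0 < e / 2 by exact: divr_gt0.
  have [t t0 tP] := small e2; pose d := Num.min t (e / 2).
  have d0 : 0 < d by rewrite lt_min t0 e2.
  near=> s; have s0 : 0 < s by near: s; exact: nbhs_right_gt.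
  have sd : s < d by near: s; exact: nbhs_right_lt.
  rewrite leNgt s0 /= sub0r normrN ger0_norm; last by rewrite addr_ge0 ?sup0 // ltW.
  have [st se] : s < t /\ s < e / 2 by move: sd; rewrite /d lt_min => /andP[].
  suff h : sup (S s) <= e / 2 by rewrite [e]splitr; exact: ler_ltD.
  apply: ge_sup; first by exists 0; exact/S0/ltW.
  apply: Sub => x y z xz; apply: tP; apply: le_trans xz _; rewrite ler_wpM2r ?mdist_ge0 //.
  exact: ltW.
- move=> x y z xz; have xz0 : 0 < mdist x z by rewrite mdist_gt0; exact/eqP.
  have q0 : 0 <= mdist x y / mdist x z by rewrite divr_ge0 ?mdist_ge0.
  case: ifP => [|/negbT]; rewrite ?(leNgt _ 0) ?negbK => q1.
    have xy : x = y.
      apply/mdist_positivity/eqP; move: q1; rewrite -leNgt ler_pdivrMr // mul0r => q1.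
      by rewrite eq_le q1 mdist_ge0.
    by rewrite -xy mdistxx mul0r ltxx.
  apply: le_trans (_ : sup (S (mdist x y / mdist x z)) <= _); last by rewrite lerDl.
  apply: ub_le_sup; first exact: (hasS _ q0).2.
  by exists x, y, z; split=> //; rewrite divfK // gt_eqF.
Unshelve. all: by end_near. Qed.

End Quasisymmetry.

(** * Stereographic projection *)

Section Stereographic.
Variable R : realType.
Notation plane := (R * R)%type.
Implicit Types a b : plane.

Definition vec3 (x y z : R) : 'rV[R]_3 := \row_(i < 3) [:: x; y; z]`_i.

Lemma sum3 (F : 'I_3 -> R) : \sum_i F i = F ord0 + F (lift ord0 ord0) + F (lift ord0 (lift ord0 ord0)).
Proof. by rewrite !big_ord_recl big_ord0 addr0 addrA. Qed.

Lemma vec3E x y z : (vec3 x y z 0 ord0 = x) * (vec3 x y z 0 (lift ord0 ord0) = y) *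
  (vec3 x y z 0 (lift ord0 (lift ord0 ord0)) = z).
Proof. by rewrite !mxE. Qed.

Definition sq2 a : R := a.1 ^+ 2 + a.2 ^+ 2.

Lemma sq2_ge0 a : 0 <= sq2 a. Proof. by rewrite addr_ge0 ?sqr_ge0. Qed.
Lemma sq2_gt0 a : 0 < 1 + sq2 a. Proof. by have := sq2_ge0 a; lra. Qed.

Definition stvec a := vec3 (2 * a.1 / (1 + sq2 a)) (2 * a.2 / (1 + sq2 a)) (1 - 2 / (1 + sq2 a)).

Lemma stvecP a : \sum_i stvec a 0 i ^+ 2 == 1.
Proof.
rewrite sum3 !vec3E; have := sq2_gt0 a; set k := 1 + sq2 a => k0.
have k1 : k != 0 by rewrite gt_eqF.
apply/eqP; have -> : (2 * a.1 / k) ^+ 2 + (2 * a.2 / k) ^+ 2 + (1 - 2 / k) ^+ 2 =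
  1 + 4 * (1 + (a.1 ^+ 2 + a.2 ^+ 2) - k) / k ^+ 2 by field.
by rewrite -/(sq2 a) -/k subrr mulr0 mul0r addr0.
Qed.

Lemma northP : \sum_i vec3 0 0 1 0 i ^+ 2 == 1.
Proof. by rewrite sum3 !vec3E !expr0n expr1n !add0r. Qed.

Definition st a : sphere2 R := exist (fun v : 'rV[R]_3 => is_true (\sum_i v 0 i ^+ 2 == 1)) (stvec a) (stvecP a).
Definition north : sphere2 R := exist (fun v : 'rV[R]_3 => is_true (\sum_i v 0 i ^+ 2 == 1)) (vec3 0 0 1) northP.

Lemma sphere_dist (x y : sphere2 R) : mdist x y ^+ 2 = \sum_i (val x 0 i - val y 0 i) ^+ 2.
Proof. by rewrite /mdist /= /euclid_dist sqr_sqrtr // sumr_ge0 // => i _; exact: sqr_ge0. Qed.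

Lemma st_dist a b : mdist (st a) (st b) ^+ 2 * ((1 + sq2 a) * (1 + sq2 b)) =
  4 * ((a.1 - b.1) ^+ 2 + (a.2 - b.2) ^+ 2).
Proof.
rewrite sphere_dist sum3 /= !vec3E.
have ka : 1 + sq2 a != 0 by rewrite gt_eqF ?sq2_gt0.
have kb : 1 + sq2 b != 0 by rewrite gt_eqF ?sq2_gt0.
have Ea : sq2 a = a.1 ^+ 2 + a.2 ^+ 2 by []. have Eb : sq2 b = b.1 ^+ 2 + b.2 ^+ 2 by [].
move: ka kb; rewrite Ea Eb => ka kb; field.
by rewrite ka kb.
Qed.

Lemma st_north a : mdist (st a) north ^+ 2 * (1 + sq2 a) = 4.
Proof.
rewrite sphere_dist sum3 /= !vec3E.
have ka : 1 + sq2 a != 0 by rewrite gt_eqF ?sq2_gt0.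
have Ea : sq2 a = a.1 ^+ 2 + a.2 ^+ 2 by [].
by move: ka; rewrite Ea => ka; field.
Qed.

Lemma st_onto (w : sphere2 R) : w <> north -> exists a, w = st a.
Proof.
case: w => v vP wN.
set x := v 0 ord0; set y := v 0 (lift ord0 ord0); set z := v 0 (lift ord0 (lift ord0 ord0)).
have vE : v = vec3 x y z.
  apply/rowP => i; rewrite mxE; case: i => [[|[|[|//]]] h] /=; congr (v _ _); exact/val_inj.
have e : x ^+ 2 + y ^+ 2 + z ^+ 2 = 1 by move: (eqP vP); rewrite sum3.
have z1 : 1 - z != 0.
  apply/eqP => z1; apply: wN; apply: val_inj => /=; rewrite vE.
  have zE : z = 1 by move: z1; lra.
  have xy : x ^+ 2 + y ^+ 2 = 0 by move: e; rewrite zE; lra.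
  have x0 : x = 0 by apply/eqP; rewrite -sqrf_eq0; apply/eqP; have := sqr_ge0 x; have := sqr_ge0 y; move: xy; lra.
  have y0 : y = 0 by apply/eqP; rewrite -sqrf_eq0; apply/eqP; have := sqr_ge0 x; have := sqr_ge0 y; move: xy; lra.
  by rewrite x0 y0 zE.
exists (x / (1 - z), y / (1 - z)); apply: val_inj => /=; rewrite vE /stvec /sq2 /=.
have k : 1 + ((x / (1 - z)) ^+ 2 + (y / (1 - z)) ^+ 2) = 2 / (1 - z).
  have -> : 1 + ((x / (1 - z)) ^+ 2 + (y / (1 - z)) ^+ 2) = ((1 - z) ^+ 2 + (x ^+ 2 + y ^+ 2)) / (1 - z) ^+ 2 by field.
  have -> : x ^+ 2 + y ^+ 2 = 1 - z ^+ 2 by move: e; lra.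
  by field.
by rewrite k; congr vec3; field.
Qed.

Definition pdist a b : R := Num.max `|a.1 - b.1| `|a.2 - b.2|.
(** Comparable to the square root of [1 + sq2 a], so that the chordal distance of [st a] and [st b]
    is comparable to [pdist a b / (hgt a * hgt b)], and that of [st a] and [north] to
    [1 / hgt a]. *)
Definition hgt a : R := 1 + pdist a (0, 0).

Lemma pdist_ge0 a b : 0 <= pdist a b. Proof. by rewrite le_max normr_ge0. Qed.
Lemma pdistC a b : pdist a b = pdist b a. Proof. by rewrite /pdist distrC [`|a.2 - _|]distrC. Qed.
Lemma hgt_ge1 a : 1 <= hgt a. Proof. by rewrite lerDl pdist_ge0. Qed.

Lemma pdist_tri b a c : pdist a c <= pdist a b + pdist b c.
Proof.
rewrite {1}/pdist ge_max; apply/andP; split.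
  by apply: le_trans (ler_distD b.1 _ _) _; apply: lerD; rewrite /pdist le_max lexx.
by apply: le_trans (ler_distD b.2 _ _) _; apply: lerD; rewrite /pdist le_max lexx orbT.
Qed.

Lemma hgt_tri a b : hgt a <= hgt b + pdist a b.
Proof. by rewrite /hgt -addrA lerD2l addrC; exact: pdist_tri. Qed.

Lemma max_sq (u v : R) : 0 <= u -> 0 <= v -> (Num.max u v ^+ 2 <= u ^+ 2 + v ^+ 2) /\
  (u ^+ 2 + v ^+ 2 <= 2 * Num.max u v ^+ 2).
Proof. by move=> u0 v0; case: (leP u v) => uv; split; nra. Qed.

Lemma pdist_sq a b : (pdist a b ^+ 2 <= (a.1 - b.1) ^+ 2 + (a.2 - b.2) ^+ 2) /\
  ((a.1 - b.1) ^+ 2 + (a.2 - b.2) ^+ 2 <= 2 * pdist a b ^+ 2).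
Proof.
have := max_sq (normr_ge0 (a.1 - b.1)) (normr_ge0 (a.2 - b.2)).
by rewrite !real_normK ?num_real.
Qed.

Lemma hgt_sq a : (hgt a ^+ 2 <= 2 * (1 + sq2 a)) /\ (1 + sq2 a <= 2 * hgt a ^+ 2).
Proof.
have [h1 h2] := pdist_sq a (0, 0); rewrite /= !subr0 -/(sq2 a) in h1 h2.
have m0 := pdist_ge0 a (0, 0); rewrite /hgt; move: h1 h2 m0; move: (pdist _ _) (sq2 a) => m s h1 h2 m0.
have := sqr_ge0 (m - 1); split; nra.
Qed.

Lemma st_upper a b : mdist (st a) (st b) * (hgt a * hgt b) <= 16 * pdist a b.
Proof.
have := st_dist a b; have [_ h1] := pdist_sq a b; have [h2 _] := hgt_sq a; have [h3 _] := hgt_sq b.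
have d0 := mdist_ge0 (st a) (st b); have ha := hgt_ge1 a; have hb := hgt_ge1 b; have p0 := pdist_ge0 a b.
move: d0 ha hb h1 h2 h3 p0; set d := mdist _ _; set D := pdist a b; set S := _ + (a.2 - b.2) ^+ 2.
move: (hgt a) (hgt b) (sq2_gt0 a) (sq2_gt0 b) => p q; move: (1 + sq2 a) (1 + sq2 b) => A B A0 B0 d0 hp hq h1 h2 h3 D0 e.
rewrite -ler_sqr ?nnegrE ?mulr_ge0 // ?(le_trans ler01) //.
have s1 : p ^+ 2 * q ^+ 2 <= 4 * (A * B).
  apply: le_trans (_ : (2 * A) * (2 * B) <= _); first by apply: ler_pM => //; exact: sqr_ge0.
  by rewrite le_eqVlt; apply/orP; left; apply/eqP; ring.
rewrite !exprMn; apply: le_trans (_ : d ^+ 2 * (4 * (A * B)) <= _).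
  by rewrite ler_wpM2l ?sqr_ge0.
have -> : d ^+ 2 * (4 * (A * B)) = 4 * (d ^+ 2 * (A * B)) by ring.
rewrite e; move: h1; have := sqr_ge0 D; move: (D ^+ 2) => D2; clear; lra.
Qed.

Lemma st_lower a b : pdist a b <= mdist (st a) (st b) * (hgt a * hgt b).
Proof.
have := st_dist a b; have [h1 _] := pdist_sq a b; have [_ h2] := hgt_sq a; have [_ h3] := hgt_sq b.
have d0 := mdist_ge0 (st a) (st b); have ha := hgt_ge1 a; have hb := hgt_ge1 b; have p0 := pdist_ge0 a b.
move: d0 ha hb h1 h2 h3 p0; set d := mdist _ _; set D := pdist a b; set S := _ + (a.2 - b.2) ^+ 2.
move: (hgt a) (hgt b) (sq2_gt0 a) (sq2_gt0 b) => p q; move: (1 + sq2 a) (1 + sq2 b) => A B A0 B0 d0 hp hq h1 h2 h3 D0 e.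
rewrite -ler_sqr ?nnegrE ?mulr_ge0 // ?(le_trans ler01) //.
have s1 : A * B <= 4 * (p ^+ 2 * q ^+ 2).
  apply: le_trans (_ : (2 * p ^+ 2) * (2 * q ^+ 2) <= _); first by apply: ler_pM => //; exact: ltW.
  by rewrite le_eqVlt; apply/orP; left; apply/eqP; ring.
rewrite !exprMn; have : d ^+ 2 * (A * B) <= d ^+ 2 * (4 * (p ^+ 2 * q ^+ 2)) by rewrite ler_wpM2l ?sqr_ge0.
have -> : d ^+ 2 * (4 * (p ^+ 2 * q ^+ 2)) = 4 * (d ^+ 2 * (p ^+ 2 * q ^+ 2)) by ring.
rewrite e; move: h1; clear; lra.
Qed.

Lemma north_upper a : mdist (st a) north * hgt a <= 4.
Proof.
have := st_north a; have [h2 _] := hgt_sq a.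
have d0 := mdist_ge0 (st a) north; have ha := hgt_ge1 a.
move: d0 ha h2; set d := mdist _ _; move: (hgt a) (sq2_gt0 a) => p; move: (1 + sq2 a) => A A0 d0 hp h2 e.
rewrite -ler_sqr ?nnegrE ?mulr_ge0 // ?(le_trans ler01) // exprMn.
apply: le_trans (_ : d ^+ 2 * (2 * A) <= _); first by rewrite ler_wpM2l ?sqr_ge0.
have -> : d ^+ 2 * (2 * A) = 2 * (d ^+ 2 * A) by ring.
by rewrite e; clear; lra.
Qed.

Lemma north_lower a : 1 <= mdist (st a) north * hgt a.
Proof.
have := st_north a; have [_ h2] := hgt_sq a.
have d0 := mdist_ge0 (st a) north; have ha := hgt_ge1 a.
move: d0 ha h2; set d := mdist _ _; move: (hgt a) (sq2_gt0 a) => p; move: (1 + sq2 a) => A A0 d0 hp h2 e.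
rewrite -ler_sqr ?nnegrE ?mulr_ge0 // ?(le_trans ler01) // exprMn expr1n.
have : d ^+ 2 * A <= d ^+ 2 * (2 * p ^+ 2) by rewrite ler_wpM2l ?sqr_ge0.
have -> : d ^+ 2 * (2 * p ^+ 2) = 2 * (d ^+ 2 * p ^+ 2) by ring.
by rewrite e; clear; lra.
Qed.

Lemma sphere_bounded (x y : sphere2 R) : mdist x y <= 4.
Proof.
rewrite -ler_sqr ?nnegrE ?mdist_ge0 // sphere_dist.
apply: le_trans (_ : \sum_i (2 * val x 0 i ^+ 2 + 2 * val y 0 i ^+ 2) <= _).
  apply: ler_sum => i _; move: (val x 0 i) (val y 0 i) => u v; have := sqr_ge0 (u + v); nra.
rewrite big_split /= -!mulr_sumr (eqP (valP x)) (eqP (valP y)); lra.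
Qed.

Lemma sphere_compact : compact [set: sphere2 R].
Proof.
pose A := [set v : 'rV[R]_3 | \sum_i v 0 i ^+ 2 = 1].
pose f (v : 'rV[R]_3) : sphere2 R := insubd north v.
have fA v : A v -> val (f v) = v by move=> Av; rewrite insubdK //; apply/eqP.
have -> : [set: sphere2 R] = f @` A.
  apply/seteqP; split=> // x _; exists (val x); first exact/eqP/(valP x).
  by rewrite /f valKd.
apply: continuous_compact.
  apply/subspace_continuousP => v Av; apply/cvg_ballP => e e0.
  rewrite /within /=; apply/nbhs_ballP; exists (e / 2) => /=; first exact: divr_gt0.
  move=> w vw Aw; rewrite ballEmdist /= -(ltr_sqr) ?nnegrE ?mdist_ge0 ?(ltW e0) //.
  rewrite sphere_dist !fA // sum3.
  have c i : (v 0 i - w 0 i) ^+ 2 <= (e / 2) ^+ 2.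
    case: vw => _ /(_ 0 i); rewrite /ball /= => h.
    by rewrite -[(v 0 i - w 0 i) ^+ 2]real_normK ?num_real // ler_sqr ?nnegrE ?normr_ge0 ?divr_ge0 ?(ltW e0) // ltW.
  have := c ord0; have := c (lift ord0 ord0); have := c (lift ord0 (lift ord0 ord0)).
  have e2 : 0 < e ^+ 2 by rewrite exprn_gt0.
  by rewrite exprMn exprVn; move: e2; lra.
apply: (subclosed_compact (B := [set v : 'rV[R]_3 | forall i, `[-1, 1]%classic (v ord0 i)])).
- have c1 i : continuous (fun v : 'rV[R]_3 => v 0 i) by exact: coord_continuous.
  have c2 i : continuous (fun v : 'rV[R]_3 => v 0 i * v 0 i).
    by move=> v; apply: (@continuousM R _ (fun v : 'rV[R]_3 => v 0 i) (fun v : 'rV[R]_3 => v 0 i)); exact: c1.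
  have cD (f1 f2 : 'rV[R]_3 -> R) : continuous f1 -> continuous f2 -> continuous (fun v => f1 v + f2 v).
    by move=> h1 h2 v; apply: (@continuousD R R _ f1 f2); [exact: h1|exact: h2].
  have cont : continuous (fun v : 'rV[R]_3 => \sum_i v 0 i ^+ 2).
    rewrite (_ : (fun v : 'rV[R]_3 => _) = (fun v => v 0 ord0 * v 0 ord0 + v 0 (lift ord0 ord0) * v 0 (lift ord0 ord0) +
      v 0 (lift ord0 (lift ord0 ord0)) * v 0 (lift ord0 (lift ord0 ord0)))); last first.
      by apply/funext => v; rewrite sum3 !expr2.
    by apply: (cD (fun v => _ + _)) (c2 _); apply: cD; exact: c2.
  have := @closed_comp _ _ (fun v : 'rV[R]_3 => \sum_i v 0 i ^+ 2) [set 1].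
  apply; first by move=> v _; exact: cont.
  exact: closed_eq.
- have := @rV_compact R 3 (fun=> `[-1, 1]%classic); apply => i; exact: segment_compact.
- move=> v Av i; rewrite /= in_itv /= -ler_norml -(ler_sqr) ?nnegrE ?normr_ge0 // real_normK ?num_real // expr1n.
  by rewrite -Av (bigD1 i) //= lerDl sumr_ge0 // => j _; exact: sqr_ge0.
Qed.

End Stereographic.

(** * The limit of the tilings *)

Section PlaneEstimates.
Variable R : realType.
Notation plane := (R * R)%type.
Implicit Types (x y z : plane) (eps : R).
Let o : plane := (0, 0).

Lemma st_near eps x z : 0 <= eps -> eps <= 2^-1 -> pdist z x <= eps * hgt x -> hgt x <= 2 * hgt z.
Proof. by move=> e0 e1 h; have := hgt_tri x z; have := hgt_ge1 x; rewrite pdistC; nra. Qed.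

Lemma st_small_north eps x z : 0 <= eps -> eps <= 2^-1 -> pdist z x <= eps * hgt x ->
  mdist (st x) (st z) <= 128 * eps * mdist (st x) (north R).
Proof.
move=> e0 e1 h; have hz := st_near e0 e1 h; have hx1 := hgt_ge1 x; have hz1 := hgt_ge1 z.
have up := st_upper x z; have lw := north_lower x; rewrite pdistC in up.
have d0 := mdist_ge0 (st x) (st z); have d1 := mdist_ge0 (st x) (north R).
have h1 : mdist (st x) (st z) * hgt z <= 16 * eps.
  rewrite -(@ler_pM2l _ (hgt x)); last by apply: lt_le_trans hx1.
  by rewrite mulrCA [hgt x * (16 * eps)]mulrC; move: up h; nra.
have h2 : mdist (st x) (st z) * hgt x <= 32 * eps by nra.
rewrite -(@ler_pM2r _ (hgt x)); last by apply: lt_le_trans hx1.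
by nra.
Qed.

(** If [hgt y] is at most twice [hgt x], the bound by [pdist y x] is enough; otherwise
    [hgt y <= 2 * pdist y x], and the bound by [hgt x] is used. *)
Lemma st_small eps x y z : 0 <= eps -> eps <= 2^-1 -> pdist z x <= eps * hgt x -> pdist z x <= eps * pdist y x ->
  mdist (st x) (st z) <= 128 * eps * mdist (st x) (st y).
Proof.
move=> e0 e1 h h'; have hz := st_near e0 e1 h; have hx1 := hgt_ge1 x; have hz1 := hgt_ge1 z; have hy1 := hgt_ge1 y.
have up := st_upper x z; have lw := st_lower x y; rewrite pdistC in up; rewrite pdistC in lw.
have hy := hgt_tri y x; have P0 := pdist_ge0 y x; have P1 := pdist_ge0 z x.
have d0 := mdist_ge0 (st x) (st z); have d1 := mdist_ge0 (st x) (st y).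
have key : pdist z x * hgt y <= 4 * eps * (pdist y x * hgt x).
  case: (lerP (hgt y) (2 * hgt x)) => c; first by nra.
  have : hgt y <= 2 * pdist y x by lra.
  by nra.
have hx0 : 0 < hgt x by apply: lt_le_trans hx1.
have hy0 : 0 < hgt y by apply: lt_le_trans hy1.
rewrite -(@ler_pM2r _ (hgt x * (hgt x * hgt y))) ?mulr_gt0 //.
have a1 : mdist (st x) (st z) * (hgt x * hgt x) <= 32 * pdist z x by nra.
have a2 : mdist (st x) (st z) * (hgt x * hgt x) * hgt y <= 32 * (pdist z x * hgt y) by nra.
have a3 : pdist y x * hgt x <= mdist (st x) (st y) * (hgt x * hgt y) * hgt x by nra.
have -> : mdist (st x) (st z) * (hgt x * (hgt x * hgt y)) = mdist (st x) (st z) * (hgt x * hgt x) * hgt y by ring.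
apply: le_trans a2 _; apply: le_trans (_ : 128 * eps * (pdist y x * hgt x) <= _); first by lra.
have -> : 128 * eps * mdist (st x) (st y) * (hgt x * (hgt x * hgt y)) =
  128 * eps * (mdist (st x) (st y) * (hgt x * hgt y) * hgt x) by ring.
by rewrite ler_wpM2l // mulr_ge0.
Qed.

Lemma st_big eps x y : 0 <= eps -> 1 <= eps * pdist x o -> pdist y o <= eps * pdist x o ->
  mdist (st x) (north R) * hgt y <= 8 * eps.
Proof.
move=> e0 h1 h2; have up := north_upper x; have d0 := mdist_ge0 (st x) (north R).
have hy : hgt y <= 2 * eps * hgt x by rewrite /hgt -/o; nra.
by have := hgt_ge1 y; nra.
Qed.

(** On the scale [1 / hgt y] of the distance from [st y] to the pole, both [u] and [w] are close to
    the pole. *)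
Lemma st_far eps (u w : sphere2 R) y : 0 <= eps -> eps <= 16^-1 ->
  mdist u (north R) * hgt y <= 8 * eps -> mdist w (north R) * hgt y <= 8 * eps ->
  mdist u w <= 128 * eps * mdist u (st y).
Proof.
move=> e0 e1 h1 h2; have hy := hgt_ge1 y; have lw := north_lower y.
have t1 := mtri (north R) u w; rewrite [mdist (north R) w]metric_sym in t1.
have t2 := mtri u (st y) (north R); rewrite [mdist (st y) u]metric_sym in t2.
have a1 : mdist u w * hgt y <= 16 * eps by nra.
have a2 : 2^-1 <= mdist u (st y) * hgt y by nra.
rewrite -(@ler_pM2r _ (hgt y)); last by apply: lt_le_trans hy.
by nra.
Qed.

End PlaneEstimates.

(** * Normalization of the tilings and their limit along an ultrafilter *)

Section Limit.
Variables (R : realType) (Z : metricType R) (p : Z) (q : 'I_5 -> Z) (lam M : R).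
Variables (Q : nat -> set Z) (SQ : nat -> Z -> R -> R -> Prop) (SV : nat -> R -> R -> Prop) (wd ht : nat -> R).
Hypothesis lam1 : 1 <= lam.
Hypothesis LLC1 : forall (a : Z) (r : R), 0 < r -> forall x y, ball a r x -> ball a r y ->
  exists E : set Z, [/\ connected E, E x, E y & forall z, E z -> ball a (lam * r) z].
Hypothesis LLC2 : forall (a : Z) (r : R), 0 < r -> forall x y, ~ ball a r x -> ~ ball a r y ->
  exists E : set Z, [/\ connected E, E x, E y & forall z, E z -> ~ ball a (r / lam) z].
Hypothesis dM : forall x y : Z, mdist x y <= M.
Hypothesis Zcompact : compact [set: Z].
Hypothesis flat : forall j, flat_stage q (Q j) (SQ j) (SV j) (wd j) (ht j).
Hypothesis Qcover : forall z, z <> p -> exists j0, forall j, (j0 <= j)%N -> Q j z.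
Hypothesis Qq : forall j i, Q j (q i).
Hypothesis qp : forall i, q i <> p.
Hypothesis rings : forall eps, 0 < eps -> exists2 K, 1 < K & forall x r, 0 < r -> exists j0, forall j, (j0 <= j)%N ->
      ring_estimate p (SQ j) (SV j) eps x r (K * r).

Definition spot j z : R * R :=
  if pselect (exists st : R * R, SQ j z st.1 st.2) is left e then sval (cid e) else (0, 0).

Lemma spotP j z : Q j z -> SQ j z (spot j z).1 (spot j z).2.
Proof.
move=> /(stage_exists (flat j))[s [t h]]; rewrite /spot; case: pselect => [e|]; first by case: cid.
by case; exists (s, t).
Qed.

Let x0 := q ord0.
Definition theta j := \big[Order.max/0]_i pdist (spot j (q i)) (spot j x0).

Lemma theta_ge j i : pdist (spot j (q i)) (spot j x0) <= theta j.
Proof. by rewrite /theta; exact: le_bigmax_cond. Qed.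

Lemma pdist0 (a b : R * R) : pdist a b <= 0 -> a = b.
Proof.
rewrite /pdist ge_max !normr_le0 !subr_eq0 => /andP[/eqP h1 /eqP h2].
by case: a b h1 h2 => [? ?] [? ?] /= -> ->.
Qed.

(** [stage_five] forbids that all reference points have the same spot. *)
Lemma theta_gt0 j : 0 < theta j.
Proof.
rewrite ltNge; apply/negP => h.
apply: (stage_five (flat j) (s := (spot j x0).1) (t := (spot j x0).2)) => i.
have -> : spot j x0 = spot j (q i) by apply/esym/pdist0; exact: le_trans (theta_ge j i) h.
exact: spotP.
Qed.

Lemma theta_max j : exists i, theta j = pdist (spot j (q i)) (spot j x0).
Proof.
have := theta_gt0 j; rewrite /theta; elim/big_rec: _ => [|i y _ IH]; first by rewrite ltxx.
by rewrite /Num.max; case: ifP => [_|_ _]; [exact: IH|exists i].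
Qed.

Definition hat j z : R * R :=
  (((spot j z).1 - (spot j x0).1) / theta j, ((spot j z).2 - (spot j x0).2) / theta j).

Lemma scale_pdist j (a b : R * R) (c : R * R) :
  pdist ((a.1 - c.1) / theta j, (a.2 - c.2) / theta j) ((b.1 - c.1) / theta j, (b.2 - c.2) / theta j) =
  pdist a b / theta j.
Proof.
have t0 := theta_gt0 j; rewrite /pdist /= -!mulrBl !normrM.
have -> : `|(theta j)^-1| = (theta j)^-1 by rewrite ger0_norm // invr_ge0 ltW.
have e (u v w : R) : u - w - (v - w) = u - v by ring.
by rewrite !e maxr_pMl // invr_ge0 ltW.
Qed.

Lemma hat_dist j x y : pdist (hat j x) (hat j y) = pdist (spot j x) (spot j y) / theta j.
Proof. exact: scale_pdist. Qed.

Lemma hat_x0 j : hat j x0 = (0, 0).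
Proof. by rewrite /hat !subrr !mul0r. Qed.

Lemma ring_hat eps : 0 < eps -> exists2 K, 1 < K & forall x r, 0 < r -> exists j0, forall j, (j0 <= j)%N ->
  forall Eo Ep e1 e2 e', connected Eo -> connected Ep -> Ep p -> Eo e1 -> Eo e2 -> Ep e' ->
  (forall z, Eo z -> mdist z x <= r / 2) /\ (forall z, Ep z -> 2 * (K * r) <= mdist z x) \/
  (forall z, Eo z -> 2 * (K * r) <= mdist z x) /\ (forall z, Ep z -> mdist z x <= r / 2) ->
  Q j e1 -> Q j e2 -> Q j e' -> pdist (hat j e2) (hat j e1) <= eps * pdist (hat j e') (hat j e1).
Proof.
move=> eps0; have [K K1 KP] := rings eps0; exists K => // x r r0; have [j0 j0P] := KP x r r0.
exists j0 => j jj Eo Ep e1 e2 e' c1 c2 h1 h2 h3 h4 sep q1 q2 q3.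
rewrite !hat_dist mulrA ler_pM2r ?invr_gt0 ?theta_gt0 //.
apply: (j0P j jj Eo Ep e1 e2) (spotP q1) (spotP q2) _ => //.
by left; exists e'; split=> //; exact: spotP.
Qed.

Let UF : exists G : set_system nat, UltraFilter G /\ \oo `<=` G.
Proof. exact: ultraFilterLemma. Qed.
(** Along an ultrafilter the images of all points of [Z] converge at once in the compact sphere, and
    if at each stage one of finitely many indices is distinguished, a fixed one is distinguished
    almost always. *)
Definition ultra := sval (cid UF).
Let ultraU : UltraFilter ultra. Proof. by rewrite /ultra; case: cid => ? []. Qed.
#[local] Existing Instance ultraU.
Let ultra_oo : \oo `<=` ultra. Proof. by rewrite /ultra; case: cid => ? []. Qed.

Lemma ultraI (A B : set nat) : ultra A -> ultra B -> ultra (A `&` B).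
Proof. exact: filterI. Qed.
Lemma ultraS (A B : set nat) : (forall j, A j -> B j) -> ultra A -> ultra B.
Proof. exact: filterS. Qed.
Lemma ultra_ex (A : set nat) : ultra A -> exists j, A j.
Proof. exact: filter_ex. Qed.
Lemma ultra_all (A : 'I_5 -> set nat) : (forall i, ultra (A i)) -> ultra (fun j => forall i, A i j).
Proof. exact: filter_forall. Qed.

Lemma ultra_ge j0 (P : set nat) : (forall j, (j0 <= j)%N -> P j) -> ultra P.
Proof. by move=> h; apply: ultra_oo; exists j0. Qed.

Lemma ultra_Q z : z <> p -> ultra (fun j => Q j z).
Proof. by move=> /Qcover[j0]; exact: ultra_ge. Qed.

Lemma theta_index : exists i, ultra (fun j => theta j = pdist (spot j (q i)) (spot j x0)).
Proof.
apply: contrapT => no.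
have all_ i : ultra (fun j => theta j <> pdist (spot j (q i)) (spot j x0)).
  have [h|//] := in_ultra_setVsetC (fun j => theta j = pdist (spot j (q i)) (spot j x0)) ultraU.
  by case: no; exists i.
have /ultra_ex[j h] := ultra_all all_.
by have [i e] := theta_max j; exact: (h i e).
Qed.

Let i1 := sval (cid theta_index).
Let x1 := q i1.

Lemma hat_x1 : ultra (fun j => pdist (hat j x1) (hat j x0) = 1).
Proof.
have h : ultra (fun j => theta j = pdist (spot j (q i1)) (spot j x0)) by rewrite /i1; case: cid.
apply: ultraS h => j e; rewrite hat_dist -e divff // gt_eqF ?theta_gt0 //.
Qed.

Lemma x01 : x0 <> x1.
Proof.
move=> e; have /ultra_ex[j] := hat_x1; rewrite -e hat_x0 /pdist /= subrr normr0 maxxx => /eqP.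
by rewrite eq_sym oner_eq0.
Qed.


Lemma x1p : x1 <> p. Proof. exact: qp. Qed.
Lemma x0p : x0 <> p. Proof. exact: qp. Qed.

Lemma pos_dist (T : metricType R) (a b : T) : a <> b -> 0 < mdist a b.
Proof. by move=> ab; rewrite mdist_gt0; exact/eqP. Qed.

Lemma ultra_lim (T : metricType R) (f : nat -> T) : compact [set: T] ->
  exists w, forall e, 0 < e -> ultra (fun j => mdist (f j) w < e).
Proof.
move=> cT; have [w [_ cw]] := cT (f @ ultra) _ filterT.
exists w => e e0; have [//|h] := in_ultra_setVsetC (fun j => mdist (f j) w < e) ultraU.
have [|y [/= h1 h2]] := cw (~` ball w e) (ball w e) _ (nbhsx_ballx _ _ e0); last by [].
by apply: ultraS h => j; rewrite /setC /= ballEmdist /= metric_sym.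
Qed.

Definition chart j z : sphere2 R := if z == p then north R else st (hat j z).

Lemma limit_exists : exists F : Z -> sphere2 R, forall z e, 0 < e -> ultra (fun j => mdist (chart j z) (F z) < e).
Proof.
have [F FP] := choice (fun z => ultra_lim (fun j => chart j z) (@sphere_compact R)).
by exists F.
Qed.

Definition limit_map := sval (cid limit_exists).
Notation F := limit_map.
Lemma limitP z e : 0 < e -> ultra (fun j => mdist (chart j z) (F z) < e).
Proof. by rewrite /F; case: cid => F0 /= h; exact: h. Qed.

Lemma limit_ineq (c : R) x y z : 0 <= c -> ultra (fun j => mdist (chart j x) (chart j z) <= c * mdist (chart j x) (chart j y)) ->
  mdist (F x) (F z) <= c * mdist (F x) (F y).
Proof.
move=> c0 h; apply/ler_addgt0Pr => e e0; have e1 : 0 < e / (2 * (c + 1)) by rewrite divr_gt0 // mulr_gt0 // ltr_wpDl.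
have /ultra_ex[j [[[h1 h2] h3] h4]] := ultraI (ultraI (ultraI h (limitP x e1)) (limitP y e1)) (limitP z e1).
have eE : e / (2 * (c + 1)) * (2 * (c + 1)) = e by rewrite divfK // gt_eqF // mulr_gt0 // ltr_wpDl.
move: h1 h2 h3 h4 e1 eE; rewrite /=.
have t1 := mtri (chart j x) (F x) (F z); have t2 := mtri (chart j z) (chart j x) (F z).
have t3 := mtri (F x) (chart j x) (chart j y); have t4 := mtri (F y) (F x) (chart j y).
rewrite [mdist (F x) (chart j x)]metric_sym in t1 t3; rewrite [mdist (F y) (chart j y)]metric_sym in t4.
move: t1 t2 t3 t4; move: (e / _) => u; nra.
Qed.

Lemma limit_p : F p = north R.
Proof.
apply/mdist_positivity/eqP; rewrite eq_le mdist_ge0 andbT; apply/ler_addgt0Pr => e e0.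
have /ultra_ex[j] := limitP p e0; rewrite /chart eqxx add0r metric_sym => /ltW //.
Qed.

Lemma limit_x0 : F x0 = st (0, 0).
Proof.
apply/mdist_positivity/eqP; rewrite eq_le mdist_ge0 andbT; apply/ler_addgt0Pr => e e0.
have /ultra_ex[j] := limitP x0 e0; rewrite /chart hat_x0; case: eqP => [/x0p//|_].
by rewrite add0r metric_sym => /ltW.
Qed.

Lemma limit_nonconst : exists x y, F x <> F y.
Proof.
exists x0, p; rewrite limit_x0 limit_p => e; have := north_lower ((0, 0) : R * R).
by rewrite e mdistxx mul0r ler10.
Qed.

(** One of the reference points stays away from [x], and can then be joined to [p] outside small
    balls around [x]. *)
Lemma reference_far x : exists2 q0, q0 = x0 \/ q0 = x1 & mdist x0 x1 / 2 <= mdist x q0.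
Proof.
have t := mtri x x0 x1; rewrite [mdist x0 x]metric_sym in t.
case: (lerP (mdist x0 x1 / 2) (mdist x x0)) => h; first by exists x0 => //; left.
by exists x1; [right|move: t h; lra].
Qed.

Lemma reference_hgt q0 x : q0 = x0 \/ q0 = x1 -> ultra (fun j => pdist (hat j q0) (hat j x) <= hgt (hat j x)).
Proof.
move=> hq; apply: ultraS hat_x1 => j h; have t := pdist_tri (hat j x0) (hat j q0) (hat j x).
apply: le_trans t _; rewrite /hgt [pdist (hat j x0) (hat j x)]pdistC hat_x0 lerD2r.
case: hq => ->; last by rewrite -[X in pdist _ X](hat_x0 j) h.
by rewrite hat_x0 /pdist subrr normr0 maxxx.
Qed.

Let kap := mdist x0 x1 / 2.
Let kap' := Num.min (mdist p x0) (mdist p x1).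
Let kap0 : 0 < kap. Proof. by rewrite divr_gt0 // pos_dist //; exact: x01. Qed.
Let kap'0 : 0 < kap'. Proof. by rewrite lt_min !pos_dist //; apply/nesym; first [exact: x0p|exact: x1p]. Qed.
Let lam0 : 0 < lam. Proof. exact: lt_le_trans lam1. Qed.

(** When [p] is not too close to [x], the ring between the scales [s ^+ 2 * D] and [s * D] around
    [x] separates a connected set through [x] and [z] from sets joining [p] to [y] and to a
    reference point. The ring estimate with [y] compares [z] with [y], the one with the reference
    point compares [z] with the height, as [st_small] requires. *)
Lemma case_near e K x y z s : 0 < e -> e <= 2^-1 -> 0 < s -> s <= 2^-1 -> s * (M + 1) <= kap -> 1 < K ->
  8 * K * lam ^+ 2 * s <= 1 -> x <> y -> mdist x z <= s ^+ 2 * mdist x y -> s * mdist x y <= mdist x p ->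
  (forall x r, 0 < r -> exists j0, forall j, (j0 <= j)%N ->
  forall Eo Ep e1 e2 e', connected Eo -> connected Ep -> Ep p -> Eo e1 -> Eo e2 -> Ep e' ->
  (forall z, Eo z -> mdist z x <= r / 2) /\ (forall z, Ep z -> 2 * (K * r) <= mdist z x) \/
  (forall z, Eo z -> 2 * (K * r) <= mdist z x) /\ (forall z, Ep z -> mdist z x <= r / 2) ->
  Q j e1 -> Q j e2 -> Q j e' -> pdist (hat j e2) (hat j e1) <= e * pdist (hat j e') (hat j e1)) ->
  ultra (fun j => mdist (chart j x) (chart j z) <= 128 * e * mdist (chart j x) (chart j y)).
Proof.
move=> e0 e1 s0 s1 sM K1 Ks xy xz xp rh; set D := mdist x y in xz xp *.
have D0 : 0 < D by exact: pos_dist.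
have sD : 0 < s * D by rewrite mulr_gt0.
have s2D : s ^+ 2 * D < s * D by move: s0 s1; rewrite ltr_pM2r // expr2; nra.
have s2D0 : 0 < s ^+ 2 * D by rewrite mulr_gt0 // exprn_gt0.
have xp' : x <> p by move=> eq0; move: xp; rewrite eq0 mdistxx leNgt sD.
have zp' : z <> p by move=> eq0; move: xz; rewrite eq0 => xz; move: (le_lt_trans (le_trans xp xz) s2D); rewrite ltxx.
have [q0 hq q0far] := reference_far x.
have MD : D <= M by exact: dM.
have q0p : q0 <> p by case: hq => ->; [exact: x0p|exact: x1p].
have qsD : s * D <= mdist x q0 by apply: le_trans q0far; apply: le_trans sM; rewrite ler_pM2l //; move: MD; lra.
have b1 : ball x (2 * (s ^+ 2 * D)) x by apply: ballxx; rewrite mulr_gt0.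
have b2 : ball x (2 * (s ^+ 2 * D)) z by rewrite ballEmdist /=; move: xz s2D0; lra.
have [E0 [cE0 E0x E0z E0b]] := LLC1 (mulr_gt0 (ltr0Sn _ 1) s2D0) b1 b2.
have n1 : ~ ball x (s * D) p by rewrite ballEmdist /= => h; move: xp; rewrite leNgt h.
have n2 : ~ ball x (s * D) y.
  by rewrite ballEmdist /= -/D -{1}[D]mul1r ltr_pM2r // => h; move: s1 h; lra.
have n3 : ~ ball x (s * D) q0 by rewrite ballEmdist /= => h; move: qsD; rewrite leNgt h.
have [E1 [cE1 E1p E1y E1b]] := LLC2 sD n1 n2.
have [E2 [cE2 E2p E2q E2b]] := LLC2 sD n1 n3.
pose r := 4 * lam * (s ^+ 2 * D).
have r0 : 0 < r by rewrite !mulr_gt0.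
have [j0 j0P] := rh x r r0.
have K2 : 2 * (K * r) <= s * D / lam.
  rewrite ler_pdivlMr //; have -> : 2 * (K * r) * lam = (8 * K * lam ^+ 2 * s) * (s * D) by rewrite /r; ring.
  by rewrite -[leRHS]mul1r ler_pM2r.
have sepa : (forall z, E0 z -> mdist z x <= r / 2) /\ (forall z, (E1 `|` E2) z -> 2 * (K * r) <= mdist z x).
  split=> [u /E0b|u [/E1b|/E2b]]; rewrite ballEmdist /= metric_sym.
  - by rewrite /r => /ltW h; apply: le_trans h _; rewrite le_eqVlt; apply/orP; left; apply/eqP; field.
  - by move=> /negP; rewrite -leNgt; exact: le_trans.
  - by move=> /negP; rewrite -leNgt; exact: le_trans.
have cE : connected (E1 `|` E2) by exact: connected_union cE1 cE2 E1p E2p.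
have key w : (E1 `|` E2) w -> w <> p -> ultra (fun j => pdist (hat j z) (hat j x) <= e * pdist (hat j w) (hat j x)).
  move=> Ew wp; have := ultraI (ultraI (ultra_Q xp') (ultra_Q zp')) (ultraI (ultra_Q wp) (ultra_ge (P := fun j => (j0 <= j)%N) (fun _ h => h))).
  apply: ultraS => j [[h1 h2] [h3 h4]].
  by apply: (j0P j h4 E0 (E1 `|` E2)) => //; [left|left].
have kq := key q0 (or_intror E2q) q0p.
have hh := ultraI kq (reference_hgt x hq).
have ch w j : w <> p -> chart j w = st (hat j w) by rewrite /chart; case: eqP.
have e00 := ltW e0.
have [yp|yp] := pselect (y = p).
  apply: ultraS hh => j [h1 h2]; rewrite yp (ch x) // (ch z) // /chart eqxx; apply: st_small_north => //.
  by apply: le_trans h1 _; rewrite ler_pM2l.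
have ky := key y (or_introl E1y) yp.
apply: ultraS (ultraI hh ky) => j [[h1 h2] h3]; rewrite !ch //; apply: st_small => //.
by apply: le_trans h1 _; rewrite ler_pM2l.
Qed.

(** When [p] is close to [x], the roles change: connected sets through [p], [x] and [z] near [p] are
    separated from sets joining [y] to both reference points. The estimates show that [x] and [z],
    unless equal to [p], are far out in the plane compared with [1] and with [y], hence close to the
    pole as seen from [y]. *)
Lemma case_far e K x y z s c0 : 0 < e -> e <= 16^-1 -> 0 < s -> s <= 2^-1 -> 0 < c0 -> c0 <= 2^-1 ->
  c0 * (M + 1) <= kap' -> 1 < K ->
  8 * K * lam ^+ 2 * s <= c0 -> x <> y -> mdist x z <= s ^+ 2 * mdist x y -> mdist x p < s * mdist x y ->
  (forall x r, 0 < r -> exists j0, forall j, (j0 <= j)%N ->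
  forall Eo Ep e1 e2 e', connected Eo -> connected Ep -> Ep p -> Eo e1 -> Eo e2 -> Ep e' ->
  (forall z, Eo z -> mdist z x <= r / 2) /\ (forall z, Ep z -> 2 * (K * r) <= mdist z x) \/
  (forall z, Eo z -> 2 * (K * r) <= mdist z x) /\ (forall z, Ep z -> mdist z x <= r / 2) ->
  Q j e1 -> Q j e2 -> Q j e' -> pdist (hat j e2) (hat j e1) <= e * pdist (hat j e') (hat j e1)) ->
  ultra (fun j => mdist (chart j x) (chart j z) <= 128 * e * mdist (chart j x) (chart j y)).
Proof.
move=> e0 e1 s0 s1 c00 c01 cM K1 Ks xy xz xp rh; set D := mdist x y in xz xp *.
have D0 : 0 < D by exact: pos_dist.
have sD : 0 < s * D by rewrite mulr_gt0.
have s2D : s ^+ 2 * D < s * D by move: s0 s1; rewrite ltr_pM2r // expr2; nra.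
have MD : D <= M by exact: dM.
have cD : 0 < c0 * D by rewrite mulr_gt0.
have hD : s * D <= D / 2 by move: s1 D0; nra.
have cD2 : c0 * D <= D / 2 by move: c01 D0; nra.
have yfar : c0 * D <= mdist p y.
  by have := mtri p x y; rewrite -/D; move: xp hD cD2; lra.
have yp : y <> p by move=> eq0; move: yfar; rewrite eq0 mdistxx leNgt cD.
have xfar i : i = x0 \/ i = x1 -> c0 * D <= mdist p i.
  move=> hi; have : c0 * D <= kap' by apply: le_trans cM; rewrite ler_pM2l //; move: MD; lra.
  by rewrite /kap' le_min => /andP[h1 h2]; case: hi => ->.
have dbl0 : 0 < 2 * (s * D) by rewrite mulr_gt0.
have b0 : ball p (2 * (s * D)) p by exact: ballxx.
have b1 : ball p (2 * (s * D)) x by rewrite ballEmdist /= metric_sym; move: xp sD; lra.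
have b2 : ball p (2 * (s * D)) z.
  by rewrite ballEmdist /=; have := mtri x p z; rewrite [mdist p x]metric_sym; move: xp xz s2D; lra.
have [E1 [cE1 E1p E1x E1b]] := LLC1 dbl0 b0 b1.
have [E2 [cE2 E2p E2z E2b]] := LLC1 dbl0 b0 b2.
have nb w : c0 * D <= mdist p w -> ~ ball p (c0 * D) w by rewrite ballEmdist /= leNgt => /negP.
have [E3 [cE3 E3y E3x E3b]] := LLC2 cD (nb _ yfar) (nb _ (xfar _ (or_introl erefl))).
have [E4 [cE4 E4y E4x E4b]] := LLC2 cD (nb _ yfar) (nb _ (xfar _ (or_intror erefl))).
pose r := 4 * lam * (s * D).
have r0 : 0 < r by rewrite !mulr_gt0.
have [j0 j0P] := rh p r r0.
have K2 : 2 * (K * r) <= c0 * D / lam.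
  rewrite ler_pdivlMr //; have -> : 2 * (K * r) * lam = (8 * K * lam ^+ 2 * s) * D by rewrite /r; ring.
  by rewrite ler_pM2r.
have sepa : (forall z, (E3 `|` E4) z -> 2 * (K * r) <= mdist z p) /\ (forall z, (E1 `|` E2) z -> mdist z p <= r / 2).
  split=> [u [/E3b|/E4b]|u [/E1b|/E2b]]; rewrite ballEmdist /= metric_sym.
  - by move=> /negP; rewrite -leNgt; exact: le_trans.
  - by move=> /negP; rewrite -leNgt; exact: le_trans.
  - by rewrite /r => /ltW h; apply: le_trans h _; rewrite le_eqVlt; apply/orP; left; apply/eqP; field.
  - by rewrite /r => /ltW h; apply: le_trans h _; rewrite le_eqVlt; apply/orP; left; apply/eqP; field.
have cEp : connected (E1 `|` E2) by exact: connected_union cE1 cE2 E1p E2p.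
have cEo : connected (E3 `|` E4) by exact: connected_union cE3 cE4 E3y E4y.
have ch w j : w <> p -> chart j w = st (hat j w) by rewrite /chart; case: eqP.
have big w : (E1 `|` E2) w -> ultra (fun j => mdist (chart j w) (north R) * hgt (hat j y) <= 8 * e).
  move=> Ew; have [wp|wp] := pselect (w = p).
    by apply: (ultra_ge (j0 := 0%N)) => j _; rewrite wp /chart eqxx mdistxx mul0r mulr_ge0 // ltW.
  have := ultraI (ultraI (ultraI (ultra_Q yp) (ultra_Q wp)) (ultraI (ultra_Q x0p) (ultra_Q x1p)))
    (ultraI hat_x1 (ultra_ge (P := fun j => (j0 <= j)%N) (fun _ h => h))).
  apply: ultraS => j [[[h1 h2] [h3 h4]] [h5 h6]]; rewrite ch //.
  apply: st_big; first exact: ltW.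
    rewrite -h5 -[X in _ <= e * pdist _ X](hat_x0 j).
    by apply: (j0P j h6 (E3 `|` E4) (E1 `|` E2)) => //; [left|left|right|right].
  rewrite -(hat_x0 j).
  by apply: (j0P j h6 (E3 `|` E4) (E1 `|` E2)) => //; [left|left|left|right].
apply: ultraS (ultraI (big x (or_introl E1x)) (big z (or_intror E2z))) => j [h1 h2].
by rewrite (ch y) //; apply: st_far => //; exact: ltW.
Qed.

Lemma limit_small eps : 0 < eps -> exists2 t, 0 < t & forall x y z,
  mdist x z <= t * mdist x y -> mdist (F x) (F z) <= eps * mdist (F x) (F y).
Proof.
(* [128] is the constant of [st_small] and [st_far], and [16^-1] the smallness asked for by
   [st_far]. *)
move=> eps0; pose e := Num.min (eps / 128) 16^-1.
have e0 : 0 < e by rewrite lt_min divr_gt0 //= invr_gt0.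
have e1 : e <= 16^-1 by rewrite ge_min lexx orbT.
have e2 : 128 * e <= eps by rewrite mulrC -ler_pdivlMr // ge_min lexx.
have [K K1 KP] := ring_hat e0.
have M0 : 0 <= M by apply: le_trans (dM p p); exact: mdist_ge0.
have M1 : 0 < M + 1 by rewrite ltr_wpDl.
pose c0 := Num.min 2^-1 (kap' / (M + 1)).
have c00 : 0 < c0 by rewrite lt_min invr_gt0 ltr0Sn divr_gt0.
have C0 : 0 < 8 * K * lam ^+ 2 by rewrite !mulr_gt0 ?exprn_gt0 // (lt_trans _ K1).
pose s := Num.min 2^-1 (Num.min (kap / (M + 1)) (c0 / (8 * K * lam ^+ 2))).
have s0 : 0 < s by rewrite !lt_min invr_gt0 ltr0Sn (divr_gt0 kap0 M1) (divr_gt0 c00 C0).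
have s1 : s <= 2^-1 by rewrite ge_min lexx.
have s2 : s * (M + 1) <= kap by rewrite -ler_pdivlMr // !ge_min lexx orbT.
have s3 : 8 * K * lam ^+ 2 * s <= c0 by rewrite mulrC -ler_pdivlMr // !ge_min lexx !orbT.
have c1 : c0 <= 2^-1 by rewrite ge_min lexx.
have c2 : c0 * (M + 1) <= kap' by rewrite -ler_pdivlMr // ge_min lexx orbT.
exists (s ^+ 2); first by rewrite exprn_gt0.
move=> x y z xz; have [xy|xy] := pselect (x = y).
  move: xz; rewrite -xy mdistxx mulr0 => xz; have <- : x = z by apply/mdist_positivity/eqP; rewrite eq_le xz mdist_ge0.
  by rewrite mdistxx mulr0.
apply: le_trans (_ : 128 * e * mdist (F x) (F y) <= _); last by rewrite ler_wpM2r ?mdist_ge0.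
apply: limit_ineq; first by rewrite mulr_ge0 // ltW.
case: (lerP (s * mdist x y) (mdist x p)) => h.
  apply: (case_near (K := K) (s := s)) => //; first by apply: le_trans e1 _; lra.
  by apply: le_trans s3 _; apply: le_trans c1 _; lra.
exact: (case_far (K := K) (s := s) (c0 := c0)).
Qed.


Lemma reference_continuum : exists E : set Z, [/\ connected E, E x0, E x1 & forall z, E z -> ~ ball p (kap' / lam) z].
Proof.
by apply: (LLC2 kap'0); rewrite ballEmdist /= => h; have : kap' <= kap' by []; rewrite {2}/kap' le_min !leNgt h ?andbF.
Qed.

(** A ring around [p] with [Ep] reduced to [p]: the squares of the sides replace a point of [Ep]. In
    units of [theta j] the edges of the rectangle recede to infinity. *)
Lemma theta_edge e : 0 < e -> exists j0, forall j, (j0 <= j)%N -> forall s t, SV j s t ->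
  pdist (spot j x1) (spot j x0) <= e * pdist (s, t) (spot j x0).
Proof.
move=> e0; have [K K1 KP] := rings e0; have [E [cE E0 E1 Eb]] := reference_continuum.
have K0 : 0 < K by exact: lt_trans K1.
pose r := kap' / (2 * K * lam).
have r0 : 0 < r by rewrite divr_gt0 // !mulr_gt0.
have [j0 j0P] := KP p r r0; exists j0 => j jj s t sv.
apply: (j0P j jj E [set p] x0 x1 _ _ _ _ s t) => //; last by right.
- exact: connected1.
- right; split=> [z /Eb|z ->]; last by rewrite mdistxx divr_ge0 // ltW.
  rewrite ballEmdist /= metric_sym => /negP; rewrite -leNgt; apply: le_trans.
  by rewrite le_eqVlt /r; apply/orP; left; apply/eqP; field; rewrite !gt_eqF.
- exact/spotP/Qq.
- exact/spotP/Qq.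
Qed.

Lemma near_edge (a h eta : R) : 0 < h -> 0 <= a <= h -> 0 < eta -> exists2 t, 0 <= t < h & `|t - a| < eta.
Proof.
move=> h0 /andP[a0 ah] eta0; pose t := Num.max 0 (a - eta / 2).
have e2 : 0 < eta / 2 by exact: divr_gt0.
exists t; first by rewrite le_max lexx /= gt_max h0 /=; move: ah e2; lra.
rewrite ltr_norml /t; case: (leP 0 (a - eta / 2)) => c; apply/andP; split; move: c a0 eta0; lra.
Qed.

Lemma theta_room e : 0 < e -> ultra (fun j => [/\ theta j <= e * (spot j x0).1, theta j <= e * (spot j x0).2,
  theta j <= e * (wd j - (spot j x0).1) & theta j <= e * (ht j - (spot j x0).2)]).
Proof.
move=> e0; have [j0 j0P] := theta_edge e0.
have h := ultraI hat_x1 (ultra_ge (P := fun j => (j0 <= j)%N) (fun _ h => h)).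
apply: ultraS h => j [h1 jj]; have {}h1 : pdist (spot j x1) (spot j x0) = theta j.
  by move: h1; rewrite hat_dist => /(congr1 (fun u => u * theta j)); rewrite divfK ?gt_eqF ?theta_gt0 // mul1r.
have t0 := theta_gt0 j; have te : 0 < theta j / e by exact: divr_gt0.
have [Qx [/andP[a0 a1] /andP[b0 b1]]] := stage_range (flat j) (spotP (Qq j ord0)); rewrite -/x0 in a0 a1 b0 b1.
have [sv1 sv2] := stage_edges (flat j).
(* [stage_edges] leaves out the last point of each edge, so the coordinate of [spot j x0] is
   replaced by a nearby [t]; the error is too small to attain the maximum in [pdist]. *)
have [t tP td] := near_edge (stage_ht (flat j)) (introT andP (conj b0 b1)) te.
have [s sP sd] := near_edge (stage_wd (flat j)) (introT andP (conj a0 a1)) te.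
have fin (u v : R) : `|v| < theta j / e -> theta j <= e * Num.max `|u| `|v| -> theta j <= e * `|u|.
  move=> hv; case: (leP `|u| `|v|) => // uv hm; exfalso; move: hv; rewrite ltr_pdivlMr // mulrC => hv.
  by move: (le_lt_trans hm hv); rewrite ltxx.
have [l1 r1] := sv1 t tP; have [l2 r2] := sv2 s sP.
split.
- have := j0P j jj _ _ l1; rewrite h1 /pdist /= => /(fin _ _ td); rewrite sub0r normrN ger0_norm //.
- have := j0P j jj _ _ l2; rewrite h1 /pdist /= maxC => /(fin _ _ sd); rewrite sub0r normrN ger0_norm //.
- have := j0P j jj _ _ r1; rewrite h1 /pdist /= => /(fin _ _ td); rewrite ger0_norm // subr_ge0 //.
- have := j0P j jj _ _ r2; rewrite h1 /pdist /= maxC => /(fin _ _ sd); rewrite ger0_norm // subr_ge0 //.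
Qed.

Definition place j (w : R * R) : R * R := ((spot j x0).1 + theta j * w.1, (spot j x0).2 + theta j * w.2).

Lemma place_dist j w z : pdist (place j w) (spot j z) = theta j * pdist w (hat j z).
Proof.
have t0 := theta_gt0 j; rewrite -[spot j z](_ : place j (hat j z) = _); last first.
  by rewrite /place /hat /= ![theta j * _]mulrC !divfK ?gt_eqF // ![_ + (_ - _)]addrC !subrK; case: (spot j z).
have e (u v c : R) : c + theta j * u - (c + theta j * v) = theta j * (u - v) by ring.
by rewrite /pdist /place /= !e !normrM [`|theta j|]ger0_norm ?ltW // maxr_pMr // ltW.
Qed.

Lemma place_covered w : exists zz : nat -> Z, ultra (fun j => SQ j (zz j) (place j w).1 (place j w).2).
Proof.
have ex j : exists z, (exists z', SQ j z' (place j w).1 (place j w).2) -> SQ j z (place j w).1 (place j w).2.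
  have [[z h]|h] := pselect (exists z', SQ j z' (place j w).1 (place j w).2); first by exists z.
  by exists p => /h.
have [zz zzP] := choice ex; exists zz.
pose n := pdist w (0, 0); have n0 : 0 <= n by exact: pdist_ge0.
have e0 : 0 < (n + 2)^-1 by rewrite invr_gt0 ltr_wpDl.
apply: ultraS (theta_room e0) => j [h1 h2 h3 h4]; apply: zzP; have t0 := theta_gt0 j.
have [w1 w2] : `|w.1| <= n /\ `|w.2| <= n.
  by rewrite /n /pdist /= !subr0 !le_max !lexx orbT.
move: w1 w2; rewrite !ler_norml => /andP[w1 w1'] /andP[w2 w2'].
have n2 : 0 < n + 2 by rewrite ltr_wpDl.
move: h1 h2 h3 h4; rewrite !(mulrC (n + 2)^-1) !ler_pdivlMr // => h1 h2 h3 h4.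
by apply: (stage_onto (flat j)); rewrite /place /=; apply/andP; split; nra.
Qed.

(** Points whose squares contain the position of [om] converge to some [zi]. If [zi] were [p], the
    ring estimate around [p] would bound the reference distance [theta j] by a small multiple of the
    distance to the position of [om], which is a fixed multiple of [theta j]. Otherwise rings around
    [zi] show that [om] is close to [hat j zi] relative to its height. *)
Lemma limit_onto w : exists x, F x = w.
Proof.
have [->|wN] := pselect (w = north R); first by exists p; exact: limit_p.
have [om ->] := st_onto wN; have [zz zzP] := place_covered om.
have [zi ziP] := ultra_lim zz Zcompact.
have Kpos (K : R) : 1 < K -> 0 < K by exact: lt_trans.
have [zip|zip] := pselect (zi = p).
  exfalso; subst zi; pose n := pdist om (0, 0); have n0 : 0 <= n by exact: pdist_ge0.
  have e0 : 0 < (n + 1)^-1 by rewrite invr_gt0 ltr_wpDl.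
  have [K K1 KP] := rings e0; have [E [cE E0 E1 Eb]] := reference_continuum.
  have K0 := Kpos K K1; pose r := kap' / (2 * K * lam).
  have r0 : 0 < r by rewrite divr_gt0 // !mulr_gt0.
  have r1 : 0 < r / (2 * lam) by rewrite divr_gt0 // mulr_gt0.
  have [j0 j0P] := KP p r r0.
  have /ultra_ex[j [[h1 h2] [h3 h4]]] := ultraI (ultraI zzP (ziP _ r1)) (ultraI hat_x1 (ultra_ge (P := fun j => (j0 <= j)%N) (fun _ h => h))).
  have b1 : ball p (r / (2 * lam)) (zz j) by rewrite ballEmdist /= metric_sym.
  have [E' [cE' Ep Ez Eb']] := LLC1 r1 (ballxx _ r1) b1.
  have := j0P j h4 E E' x0 x1 _ _ _ _ (place j om).1 (place j om).2 cE cE' Ep E0 E1 _ (spotP (Qq _ _)) (spotP (Qq _ _)) (or_introl (ex_intro _ (zz j) (conj Ez h1))).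
  have sepa : (forall z : Z, E z -> 2 * (K * r) <= mdist z p) /\ (forall z : Z, E' z -> mdist z p <= r / 2).
    split=> [z /Eb|z /Eb']; rewrite ballEmdist /= metric_sym.
      move=> /negP; rewrite -leNgt; apply: le_trans.
      by rewrite le_eqVlt /r; apply/orP; left; apply/eqP; field; rewrite !gt_eqF.
    move=> /ltW h; apply: le_trans h _.
    by rewrite le_eqVlt; apply/orP; left; apply/eqP; field; rewrite !gt_eqF.
  move=> /(_ (or_intror sepa)).
  rewrite -[Num.max _ _]/(pdist (spot j x1) (spot j x0)) -[Num.max `|(place j om).1 - _| _]/(pdist (place j om) (spot j x0)).
  rewrite place_dist hat_x0 -/n; move: h3; rewrite hat_dist => h3.
  have t0 := theta_gt0 j; have -> : pdist (spot j x1) (spot j x0) = theta j.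
    by move: h3 => /(congr1 (fun u => u * theta j)); rewrite divfK ?gt_eqF // mul1r.
  rewrite mulrCA -[leLHS]mulr1 ler_pM2l // mulrC ler_pdivlMr ?ltr_wpDl // mul1r; lra.
exists zi; apply/mdist_positivity/eqP; rewrite eq_le mdist_ge0 andbT; apply/ler_addgt0Pr => eps eps0; rewrite add0r.
pose e := Num.min 2^-1 (eps / 2 / 8 / 64).
have e0 : 0 < e by rewrite lt_min invr_gt0 ltr0Sn !divr_gt0.
have e1 : e <= 2^-1 by rewrite ge_min lexx.
have e2 : 8 * (64 * e) <= eps / 2.
  by have : e <= eps / 2 / 8 / 64 by [rewrite ge_min lexx orbT]; move: (e) => u; lra.
have [K K1 KP] := rings e0; have K0 := Kpos K K1.
have [q0 hq q0far] := reference_far zi.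
have q0p : q0 <> p by case: hq => ->; [exact: x0p|exact: x1p].
pose d := Num.min kap (mdist zi p).
have d0 : 0 < d by rewrite lt_min kap0 pos_dist.
pose r := d / (2 * K * lam).
have r0 : 0 < r by rewrite divr_gt0 // !mulr_gt0.
have r1 : 0 < r / (2 * lam) by rewrite divr_gt0 // mulr_gt0.
have [j0 j0P] := KP zi r r0.
have nb u : d <= mdist zi u -> ~ ball zi d u by rewrite ballEmdist /= leNgt => /negP.
have n1 : ~ ball zi d p by apply: nb; rewrite ge_min lexx orbT.
have n2 : ~ ball zi d q0 by apply: nb; apply: le_trans q0far; rewrite ge_min lexx.
have [E' [cE' Ep Eq Eb']] := LLC2 d0 n1 n2.
have eps2 : 0 < eps / 2 by exact: divr_gt0.
have /ultra_ex[j [[[h1 h2] [h3 h4]] [[h5 h6] h7]]] := ultraI (ultraI (ultraI zzP (ziP _ r1)) (ultraI (limitP zi eps2)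
  (ultra_ge (P := fun j => (j0 <= j)%N) (fun _ h => h)))) (ultraI (ultraI (ultra_Q zip) (ultra_Q q0p)) (reference_hgt zi hq)).
have b1 : ball zi (r / (2 * lam)) (zz j) by rewrite ballEmdist /= metric_sym.
have [E [cE Ezi Ez Eb]] := LLC1 r1 (ballxx _ r1) b1.
have := j0P j h4 E E' zi (zz j) (spot j zi).1 (spot j zi).2 (place j om).1 (place j om).2 (spot j q0).1 (spot j q0).2
  cE cE' Ep Ezi Ez _ (spotP h5) h1 (or_introl (ex_intro _ q0 (conj Eq (spotP h6)))).
have sepa : (forall z : Z, E z -> mdist z zi <= r / 2) /\ (forall z : Z, E' z -> 2 * (K * r) <= mdist z zi).
  split=> [z /Eb|z /Eb']; rewrite ballEmdist /= metric_sym.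
    move=> /ltW h; apply: le_trans h _.
    by rewrite le_eqVlt; apply/orP; left; apply/eqP; field; rewrite !gt_eqF.
  move=> /negP; rewrite -leNgt; apply: le_trans.
  by rewrite le_eqVlt /r; apply/orP; left; apply/eqP; field; rewrite !gt_eqF.
move=> /(_ (or_introl sepa)).
rewrite -[Num.max _ _]/(pdist (place j om) (spot j zi)) -[Num.max `|(spot j q0).1 - _| _]/(pdist (spot j q0) (spot j zi)).
have t0 := theta_gt0 j; have -> : pdist (spot j q0) (spot j zi) = theta j * pdist (hat j q0) (hat j zi).
  by rewrite hat_dist mulrC divfK // gt_eqF.
rewrite place_dist mulrCA ler_pM2l // => key.
have key2 : pdist om (hat j zi) <= e * hgt (hat j zi) by apply: le_trans key _; rewrite ler_pM2l.
have := st_small_north (ltW e0) e1 key2; have := sphere_bounded (st (hat j zi)) (north R).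
have cz : chart j zi = st (hat j zi) by rewrite /chart; case: eqP.
have t := mtri (st (hat j zi)) (F zi) (st om); rewrite [mdist (F zi) (st (hat j zi))]metric_sym in t.
rewrite cz in h3; move: h3 e0 e2 t; move: (mdist (st _) (north R)) (mdist_ge0 (st (hat j zi)) (north R)) => B B0.
move: (mdist (st (hat j zi)) (F zi)) (mdist (F zi) (st om)) (mdist (st (hat j zi)) (st om)) => u v v' h3 e0 e2 t h8 h9.
have : e * B <= e * 4 by rewrite ler_pM2l.
move: h3 e2 t h9; lra.
Qed.

Theorem limit_quasisymmetry : connected [set: Z] -> doubling Z -> quasisymmetry F.
Proof.
move=> cZ dZ; apply: (quasisymmetry_of_small lam1 LLC1 dZ limit_small Zcompact cZ _ limit_nonconst limit_onto).
by exists 4 => x y; exact: sphere_bounded.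
Qed.

End Limit.

(** * Large squares *)

Lemma compact_uniform (R : realType) (Z T : metricType R) (f : Z -> T) : compact [set: Z] -> continuous f ->
  forall e, 0 < e -> exists2 d, 0 < d & forall x y, mdist x y < d -> mdist (f x) (f y) < e.
Proof.
move=> cZ cf e e0; apply: contrapT => no.
have ex (n : nat) : exists t : Z * Z, mdist t.1 t.2 < n.+1%:R^-1 /\ e <= mdist (f t.1) (f t.2).
  apply: contrapT => h; apply: no; exists n.+1%:R^-1; first by rewrite invr_gt0 ltr0Sn.
  move=> x y xy; rewrite ltNge; apply/negP => fe; apply: h; exists (x, y); split=> //.
have [s sP] := choice ex.
have [w [_ cw]] := cZ ((fun n => (s n).1) @ \oo) _ filterT.
have e2 : 0 < e / 2 by exact: divr_gt0.
have /cvg_ballP/(_ _ e2)/nbhs_ballP[r /= r0 rP] := cf w.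
have r2 : 0 < r / 2 by exact: divr_gt0.
pose n0 := Num.truncn (r / 2)^-1.
have [|y [[n /= nn ny] yb]] := cw [set y | exists2 n, (n0 <= n)%N & (s n).1 = y] (ball w (r / 2)) _ (nbhsx_ballx _ _ r2).
  by exists n0 => // n /= nn; exists n.
have [h1 h2] := sP n; rewrite ny in h1 h2.
have h3 : mdist y (s n).2 < r / 2.
  apply: lt_le_trans h1 _; rewrite -[leRHS]invrK lef_pV2 ?posrE ?invr_gt0 //; apply: ltW.
  by apply: lt_le_trans (truncnS_gt _) _; rewrite ler_nat ltnS.
have b1 : ball w r y by move: yb; rewrite !ballEmdist /=; lra.
have b2 : ball w r (s n).2.
  by move: yb; rewrite !ballEmdist /=; have := mtri y w (s n).2; lra.
have := rP _ b1; have := rP _ b2; rewrite !ballEmdist /= => g1 g2.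
have := mtri (f w) (f y) (f (s n).2); rewrite [mdist (f y) (f w)]metric_sym; lra.
Qed.

Lemma hexadj_near (N : nat) (c d : 'I_N.+1 * 'I_N.+1) : @hexadj N c d ->
  [/\ (c.1 <= d.1.+1)%N, (d.1 <= c.1.+1)%N, (c.2 <= d.2.+1)%N & (d.2 <= c.2.+1)%N].
Proof.
rewrite /hexadj /hexnat /hexup /hexpt /= => /orP[|] h; split; lia.
Qed.

Lemma hexadj_row (N : nat) (a a' b : 'I_N.+1) : (a <= a'.+1)%N -> (a' <= a.+1)%N -> a = a' \/ @hexadj N (a, b) (a', b).
Proof.
move=> h1 h2; case: (ltngtP a a') => h; last by left; exact: val_inj.
  by right; rewrite /hexadj /hexnat /hexup /hexpt /=; lia.
by right; rewrite /hexadj /hexnat /hexup /hexpt /=; lia.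
Qed.

Lemma hexadj_col (N : nat) (a b b' : 'I_N.+1) : (b <= b'.+1)%N -> (b' <= b.+1)%N -> b = b' \/ @hexadj N (a, b) (a, b').
Proof.
move=> h1 h2; case: (ltngtP b b') => h; last by left; exact: val_inj.
  by right; rewrite /hexadj /hexnat /hexup /hexpt /=; lia.
by right; rewrite /hexadj /hexnat /hexup /hexpt /=; lia.
Qed.

(** * Lattice coordinates of a square *)

Section Lattice.
Variables (R : realType) (j L : nat).
Hypothesis L0 : (0 < L)%N.
Let N := (2 * j * L)%N.

Definition coord (a : 'I_N.+1) : R := a%:R / L%:R - j%:R.
(** Rounding down, clipped to the board, so that points outside the square go to its sides. *)
Definition index_ (t : R) : 'I_N.+1 := inord (minn N (Num.truncn ((t + j%:R) * L%:R))).

Let l0 : 0 < L%:R :> R. Proof. by rewrite ltr0n. Qed.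

Lemma index_coord a : index_ (coord a) = a.
Proof.
rewrite /index_ /coord subrK divfK ?gt_eqF // natrK; apply: val_inj => /=.
have aN : (a <= N)%N by rewrite -ltnS.
by rewrite (minn_idPr aN) inordK.
Qed.

Lemma index_val t : index_ t = minn N (Num.truncn ((t + j%:R) * L%:R)) :> nat.
Proof. by rewrite /index_ inordK // ltnS geq_minl. Qed.

Lemma truncn_neg (u : R) : u <= 0 -> Num.truncn u = 0%N.
Proof. by move=> u0; apply/truncn0Pn; rewrite -ltNge; apply: le_lt_trans u0 _. Qed.

Lemma truncn_step (u v : R) : v < u + 1 -> (Num.truncn v <= (Num.truncn u).+1)%N.
Proof.
move=> vu; have [v0|v0] := leP 0 v; last by rewrite truncn_neg // ltW.
rewrite truncn_le_nat; apply: lt_trans vu _.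
by rewrite -[in ltRHS]natr1 ltrD2r; exact: truncnS_gt.
Qed.

Lemma index_near t t' : `|t' - t| < L%:R^-1 -> (index_ t <= (index_ t').+1)%N /\ (index_ t' <= (index_ t).+1)%N.
Proof.
rewrite ltr_norml => /andP[h1 h2]; rewrite !index_val.
have s (u v : R) : u - v < L%:R^-1 -> (u + j%:R) * L%:R < (v + j%:R) * L%:R + 1.
  move=> h; have : (u - v) * L%:R < 1 by rewrite -ltr_pdivlMr // div1r.
  by rewrite !mulrDl mulNr; lra.
have := truncn_step (s t t' _); have := truncn_step (s t' t h2) => a1 a2.
have {}a2 := a2 ltac:(move: h1; lra).
by split; move: a1 a2; rewrite /minn; do 2 case: ifP; lia.
Qed.

Lemma index_bound t t' : `|t| <= j%:R -> `|t' - t| < L%:R^-1 -> `|coord (index_ t') - t| <= 2 / L%:R.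
Proof.
rewrite ler_norml ltr_norml => /andP[t1 t2] /andP[h1 h2].
have Li : 0 < L%:R^-1 :> R by rewrite invr_gt0.
set u := (t' + j%:R) * L%:R.
have uE : u / L%:R = t' + j%:R by rewrite mulfK // gt_eqF.
have NE : N%:R / L%:R = 2 * j%:R :> R by rewrite /N !natrM mulfK // gt_eqF.
have low : t + j%:R - 2 / L%:R <= (index_ t')%:R / L%:R.
  rewrite index_val -/u /minn; case: ifP => _; first by rewrite NE; move: t2 Li; lra.
  have : u / L%:R < (Num.truncn u).+1%:R / L%:R by rewrite ltr_pM2r //; exact: truncnS_gt.
  by rewrite uE -natr1 mulrDl mul1r; move: h1 Li; lra.
have upp : (index_ t')%:R / L%:R <= t + j%:R + 2 / L%:R.
  rewrite index_val -/u; have [u0|u0] := leP 0 u.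
    apply: le_trans (_ : (Num.truncn u)%:R / L%:R <= _); first by rewrite ler_pM2r // ler_nat geq_minr.
    have : (Num.truncn u)%:R / L%:R <= u / L%:R by rewrite ler_pM2r ?invr_gt0 // truncn_le.
    by rewrite uE; move: h2 Li; lra.
  have -> : Num.truncn u = 0%N by rewrite truncn_neg // ltW.
  by rewrite minn0 mul0r; move: t1 Li; lra.
rewrite /coord ler_norml; apply/andP; split; move: low upp; lra.
Qed.

Lemma index_max t : j%:R < t -> index_ t = ord_max.
Proof.
move=> h; apply: val_inj; rewrite [LHS]index_val /=; apply/minn_idPl.
rewrite truncn_ge_nat; last by rewrite mulr_ge0 ?(ltW l0) // addr_ge0 // (le_trans _ (ltW h)).
have : 2 * j%:R * L%:R <= (t + j%:R) * L%:R by rewrite ler_pM2r //; move: h; lra.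
by rewrite /N !natrM.
Qed.

Lemma index_min t : t < - j%:R -> index_ t = ord0.
Proof.
move=> h; apply: val_inj; rewrite [LHS]index_val /=.
have -> : Num.truncn ((t + j%:R) * L%:R) = 0%N; last by rewrite minn0.
by rewrite truncn_neg // mulr_le0_ge0 ?(ltW l0) //; move: h; lra.
Qed.

Lemma coord_bound a : `|coord a| <= j%:R.
Proof.
have NE : N%:R / L%:R = 2 * j%:R :> R by rewrite /N !natrM mulfK // gt_eqF.
have aN : (a%:R : R) / L%:R <= 2 * j%:R by rewrite -NE ler_pM2r ?invr_gt0 // ler_nat -ltnS.
have a0 : 0 <= (a%:R : R) / L%:R by rewrite divr_ge0 // ltW.
by rewrite /coord ler_norml; move: aN a0; lra.
Qed.

Lemma index_out t : j%:R < `|t| -> (index_ t == ord0) || (index_ t == ord_max).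
Proof.
rewrite ltr_normr => /orP[/index_max ->|h]; first by rewrite eqxx orbT.
by rewrite index_min ?eqxx // ltrNr.
Qed.

Lemma coord_side (a : 'I_N.+1) : (a == ord0) || (a == ord_max) -> j%:R <= `|coord a|.
Proof.
have NE : N%:R / L%:R = 2 * j%:R :> R by rewrite /N !natrM mulfK // gt_eqF.
case/orP => /eqP ->; rewrite /coord /=; first by rewrite mul0r sub0r normrN ger0_norm.
rewrite NE; apply: le_trans (ler_norm _); lra.
Qed.

Lemma coord_adj (a b : 'I_N.+1) : (a <= b.+1)%N -> (b <= a.+1)%N -> `|coord a - coord b| <= L%:R^-1.
Proof.
move=> h1 h2; rewrite /coord opprB addrA subrK -mulrBl normrM [`|L%:R^-1|]ger0_norm; last by rewrite invr_ge0 ltW.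
rewrite -[leRHS]mul1r ler_pM2r ?invr_gt0 // ler_norml.
have := h1; rewrite -(ler_nat R) -natr1 => g1; have := h2; rewrite -(ler_nat R) -natr1 => g2.
by apply/andP; split; move: g1 g2; lra.
Qed.

Lemma coord_int (k : nat) (a : 'I_N.+1) : a = ((j + k) * L)%N :> nat -> coord a = k%:R.
Proof. by rewrite /coord => ->; rewrite natrM mulfK ?gt_eqF // natrD addrAC subrr add0r. Qed.

End Lattice.

(** * Boards from a homeomorphism with the sphere *)

Section Boards.
Variables (R : realType) (Z : metricType R) (h : Z -> sphere2 R) (g : sphere2 R -> Z).
Hypothesis hg : cancel h g.
Hypothesis gh : cancel g h.
Hypothesis hC : continuous h.
Hypothesis gC : continuous g.
Hypothesis Zcompact : compact [set: Z].

Let p : Z := g (north R).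
Let phi (w : R * R) : Z := g (st w).

Lemma phi_p w : phi w <> p.
Proof.
move=> /(congr1 h); rewrite !gh => e; have := north_lower w.
by rewrite e mdistxx mul0r ler10.
Qed.

Lemma phi_inj w w' : phi w = phi w' -> w = w'.
Proof.
move=> /(congr1 h); rewrite !gh => e; have := st_lower w w'; rewrite e mdistxx mul0r.
exact: pdist0.
Qed.

Lemma phi_onto z : z <> p -> exists w, phi w = z.
Proof.
move=> zp; have [|w hw] := @st_onto _ (h z); last by exists w; rewrite /phi -hw hg.
by move=> e; apply: zp; rewrite /p -e hg.
Qed.

(** Inverse of [phi]; the value at [p] is a default. *)
Definition psi z : R * R := if pselect (exists w, phi w = z) is left e then sval (cid e) else (0, 0).

Lemma psiK z : z <> p -> phi (psi z) = z.
Proof. by move=> /phi_onto e; rewrite /psi; case: pselect => // e'; case: cid. Qed.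

Lemma phiK w : psi (phi w) = w.
Proof. by apply: phi_inj; apply: psiK; exact: phi_p. Qed.

Lemma phi_uniform e : 0 < e -> exists2 d, 0 < d & forall w w', pdist w w' < d -> mdist (phi w) (phi w') < e.
Proof.
move=> e0; have [d d0 dP] := compact_uniform (@sphere_compact R) gC e0.
exists (d / 16); first exact: divr_gt0.
move=> w w' ww; apply: dP; have := st_upper w w'; have := hgt_ge1 w; have := hgt_ge1 w'.
have := mdist_ge0 (st w) (st w'); move: ww; move: (mdist _ _) (hgt w) (hgt w') (pdist _ _) => m a b c h0 m0 b1 a1 h1.
have ab : 1 <= a * b by nra.
have : m <= m * (a * b) by rewrite ler_peMr.
move: h1 h0; lra.
Qed.

Lemma phi_far e : 0 < e -> exists M, forall w, M <= pdist w (0, 0) -> mdist (phi w) p < e.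
Proof.
move=> e0; have [d d0 dP] := compact_uniform (@sphere_compact R) gC e0.
exists (8 / d) => w ww; apply: dP; have := north_upper w; have m0 := mdist_ge0 (st w) (north R).
have h1 : 8 / d < hgt w by apply: le_lt_trans ww _; rewrite ltrDr.
move=> h2; rewrite ltNge; apply/negP => h3.
have : 8 < d * hgt w by rewrite mulrC -ltr_pdivrMr.
have : d * hgt w <= mdist (st w) (north R) * hgt w by rewrite ler_wpM2r // (le_trans ler01) // hgt_ge1.
move: h2; lra.
Qed.

(** Uniform continuity of [h] passes to [psi] where the height is at most [1 + M], since there
    [st_lower] lets the chordal distance control [pdist]. *)
Lemma psi_uniform (M eta : R) : 0 < M -> 0 < eta -> exists2 e, 0 < e & forall u v, u <> p -> pdist (psi u) (0, 0) <= M ->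
  mdist u v < e -> v <> p /\ pdist (psi v) (psi u) < eta.
Proof.
move=> M0 eta0; have M1 : 0 < 1 + M by rewrite addr_gt0.
pose s := Num.min ((1 + M)^-1 / 2) (eta / 2 / (1 + M) ^+ 2).
have s0 : 0 < s by rewrite lt_min !divr_gt0 ?invr_gt0 ?exprn_gt0.
have [e e0 eP] := compact_uniform Zcompact hC s0; exists e => // u v up uM /eP uv.
have hu : hgt (psi u) <= 1 + M by rewrite /hgt lerD2l.
have hu1 := hgt_ge1 (psi u).
have huE : h u = st (psi u) by rewrite -{1}(psiK up) /phi gh.
have [s1 s2] : mdist (h u) (h v) < (1 + M)^-1 / 2 /\ mdist (h u) (h v) < eta / 2 / (1 + M) ^+ 2.
  by apply/andP; rewrite -lt_min.
have s1' : mdist (h u) (h v) * (1 + M) < 2^-1.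
  by rewrite -ltr_pdivlMr // mulrC.
have vp : v <> p.
  move=> vp; have := north_lower (psi u); rewrite -huE; move: s1'; rewrite vp /p gh => s1' h1.
  have := mdist_ge0 (h u) (north R); move: s1' h1; nra.
split=> //; have hvE : h v = st (psi v) by rewrite -{1}(psiK vp) /phi gh.
have := st_lower (psi u) (psi v); rewrite -huE -hvE pdistC.
have c0 := pdist_ge0 (psi v) (psi u).
have := hgt_tri (psi v) (psi u); have hv1 := hgt_ge1 (psi v).
have m0 := mdist_ge0 (h u) (h v).
have s2' : mdist (h u) (h v) * (1 + M) ^+ 2 < eta / 2 by rewrite -ltr_pdivlMr // exprn_gt0.
move: s1' s2' m0 hu hu1 hv1 c0; move: (mdist (h u) (h v)) (hgt (psi u)) (hgt (psi v)) (pdist _ _) => m b a c s1' s2' m0 ha a1 b1 c0 t1 t2.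
have q1 : m * (b * a) <= m * (1 + M) * (1 + M + c).
  rewrite -mulrA ler_wpM2l // ler_pM ?(le_trans ler01) //.
  by apply: le_trans t1 _; rewrite lerD2r.
have q2 : m * (1 + M) * c <= c / 2 by nra.
have q3 : m * (1 + M) * (1 + M) < eta / 2 by move: s2'; rewrite expr2 mulrA.
move: t2 q1 q2 q3; rewrite (mulrDr (m * (1 + M)) (1 + M) c); lra.
Qed.

Let q (i : 'I_5) : Z := phi (0, i%:R).

Lemma boards_exist : boards p q.
Proof.
move=> eta eta0.
pose rj := eta / 2; have rj0 : 0 < rj by exact: divr_gt0.
have [M0 M0P] := phi_far rj0.
(* At least [5], so that the rows at heights [0] to [4] are on the board. *)
pose j := maxn 5 (Num.truncn M0).+1.
have jM : M0 <= j%:R.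
  by apply: ltW; apply: lt_le_trans (truncnS_gt _) _; rewrite ler_nat leq_maxr.
have j5 : (5 <= j)%N by exact: leq_maxl.
have j0 : 0 < j%:R :> R by rewrite ltr0n; apply: leq_trans j5.
pose Qj : set Z := [set z | z <> p /\ pdist (psi z) (0, 0) <= j%:R].
have half : 0 < 2^-1 :> R by rewrite invr_gt0.
have [kap kap0 kapP] := psi_uniform j0 half.
exists Qj, rj, kap; split=> //; first by rewrite /rj; move: eta0; lra.
move=> delta delta0; have [d d0 dP] := phi_uniform delta0.
(* The error [2 / L%:R] of [index_bound] has to be less than [d]. *)
pose L := (Num.truncn (3 / d)).+1; have L0 : (0 < L)%N by [].
have l0 : 0 < L%:R :> R by rewrite ltr0n.
have Ld : 2 / L%:R < d.
  rewrite ltr_pdivrMr // mulrC -ltr_pdivrMr //; apply: le_lt_trans (truncnS_gt (3 / d)).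
  by rewrite ler_pM2r ?invr_gt0 // ler_nat.
pose N := (2 * j * L)%N.
pose pt (c : 'I_N.+1 * 'I_N.+1) : R * R := (coord R c.1, coord R c.2).
pose pos c := phi (pt c).
pose cell (w : R * R) : 'I_N.+1 * 'I_N.+1 := (index_ j L w.1, index_ j L w.2).
pose rnd z := cell (psi z).
have Li : 0 < L%:R^-1 :> R by rewrite invr_gt0.
have inQ w : pdist w (0, 0) <= j%:R <-> `|w.1| <= j%:R /\ `|w.2| <= j%:R.
  by rewrite /pdist /= !subr0 ge_max; split=> [/andP|[-> ->]].
have ptQ c : pdist (pt c) (0, 0) <= j%:R by apply/inQ; split; exact: coord_bound.
have cellpt c : cell (pt c) = c by case: c => c1 c2; rewrite /cell /pt /= !index_coord.
have cellnear w (t1 t2 : R) : pdist w (0, 0) <= j%:R -> `|t1 - w.1| < L%:R^-1 -> `|t2 - w.2| < L%:R^-1 ->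
    mdist (pos (index_ j L t1, index_ j L t2)) (phi w) < delta.
  move=> /inQ[w1 w2] h1 h2; apply: dP; apply: le_lt_trans Ld; rewrite /pdist /pt /= ge_max.
  by rewrite !index_bound.
pose mid : 'I_N.+1 := inord ((j + 0) * L).
pose rows (i : 'I_5) : 'I_N.+1 := inord ((j + i) * L).
have rowsN (i : nat) : (i < 5)%N -> ((j + i) * L < N.+1)%N.
  by move=> i5; rewrite ltnS /N leq_mul2r mul2n -addnn leq_add2l (leq_trans (ltnW i5)) // orbT.
have crows i : coord R (rows i) = i%:R by apply: coord_int => //; rewrite inordK // rowsN.
have cmid : coord R mid = 0 by apply: (coord_int R L0 (k := 0)); rewrite inordK // rowsN.
exists N, pos, rnd, mid, rows; split.
- split.
  + move=> c c' /hexadj_near[a1 a2 a3 a4]; apply: dP; apply: le_lt_trans Ld; rewrite /pdist /pt /= ge_max.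
    by apply/andP; split; apply: (@le_trans _ _ L%:R^-1); rewrite ?coord_adj //; move: Li; lra.
  + move=> z [zp zj]; rewrite -[X in mdist _ X](psiK zp); apply: cellnear => //; by rewrite subrr normr0.
  + by move=> c; rewrite /rnd /pos phiK cellpt; split=> //; split; [exact: phi_p|rewrite phiK].
  + move=> E e0 e1 cE E0 E1 Q0; apply: contrapT => /not_orP[n1 n2].
    have [e epos eP] := psi_uniform j0 Li.
    (* A small step along [E] changes each lattice index by at most one, and the cell with only the
       first index changed links the two roundings. A step leaving the square ends in a cell of the
       sides, which [n2] excludes. *)
    suff [Q1 c1] : Qj e1 /\ conn (@hexadj N) (nearcells pos delta E) (rnd e0) (rnd e1) by apply: n1.
    apply: (connected_step (P := fun z => Qj z /\ conn (@hexadj N) (nearcells pos delta E) (rnd e0) (rnd z)) cE E0 _ epos) => //.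
      split=> //; apply: conn_refl; rewrite finset.inE; apply/asboolP; exists e0 => //.
      have [zp zj] := Q0; rewrite -[X in mdist _ X](psiK zp); apply: cellnear => //; by rewrite subrr normr0.
    move=> u v Eu Ev [[up uj] cu] uv; have [vp near] := eP u v up uj uv.
    have [near1 near2] : `|(psi v).1 - (psi u).1| < L%:R^-1 /\ `|(psi v).2 - (psi u).2| < L%:R^-1.
      by move: near; rewrite /pdist gt_max => /andP.
    have cu' : conn (@hexadj N) (nearcells pos delta E) (rnd e0) (rnd v).
      have inA c : mdist (pos c) u < delta -> c \in nearcells pos delta E.
        by move=> h1; rewrite finset.inE; apply/asboolP; exists u.
      have [a1 a2] := index_near j L0 near1; have [b1 b2] := index_near j L0 near2.
      have z1 : `|(psi u).1 - (psi u).1| < L%:R^-1 by rewrite subrr normr0.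
      have z2 : `|(psi u).2 - (psi u).2| < L%:R^-1 by rewrite subrr normr0.
      have in1 : rnd u \in nearcells pos delta E by apply: inA; rewrite -[X in mdist _ X](psiK up); exact: cellnear.
      have in2 : (index_ j L (psi v).1, index_ j L (psi u).2) \in nearcells pos delta E.
        by apply: inA; rewrite -[X in mdist _ X](psiK up); exact: cellnear.
      have in3 : rnd v \in nearcells pos delta E by apply: inA; rewrite -[X in mdist _ X](psiK up); exact: cellnear.
      apply: conn_trans cu _; apply: (@conn_trans _ _ _ (index_ j L (psi v).1, index_ j L (psi u).2)).
        have [e'|ad] := hexadj_row (index_ j L (psi u).2) a1 a2; last exact: conn1.
        by move: in1; rewrite /rnd /cell e' => in1; exact: conn_refl.
      have [e'|ad] := hexadj_col (index_ j L (psi v).1) b1 b2; last exact: conn1.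
      by move: in3; rewrite /rnd /cell -e' => in3; exact: conn_refl.
    split=> //; split=> //; rewrite leNgt; apply/negP => out; apply: n2; exists (rnd v) => //.
    move: out; rewrite /pdist /= !subr0 lt_max /rnd /cell /hexsides !finset.inE /=.
    by move=> /orP[] /(index_out L0); rewrite -!orbA => /orP[] ->; rewrite ?orbT.
  + move=> s sS; apply: M0P; apply: le_trans jM _; rewrite /pdist /pt /= !subr0 le_max.
    move: sS; rewrite /hexsides !finset.inE -!orbA orbA => /orP[] /(coord_side R L0) ->; by rewrite ?orbT.
  + move=> z zr; have zp : z <> p by move=> zp; move: zr; rewrite zp mdistxx leNgt rj0.
    split=> //; rewrite leNgt; apply/negP => out; move: zr; rewrite leNgt => /negP; apply.
    by rewrite -(psiK zp); apply: M0P; apply: le_trans jM (ltW out).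
  + by case.
- by move=> i; rewrite /q /pos /pt /= crows cmid.
- move=> i i' c c' ii; rewrite leNgt; apply/negP => close.
  have [||_] := kapP _ _ _ _ close; [exact: phi_p|by rewrite phiK|].
  rewrite !phiK /pdist gt_max => /andP[_]; rewrite /pt /= !crows.
  have : (i < i')%N || (i' < i)%N by rewrite -neq_ltn; apply: contra ii => /eqP e; apply/eqP/val_inj.
  move=> /orP[]; rewrite -(ler_nat R) -natr1 => h1; rewrite ltr_norml => /andP[h2 h3]; move: h1 h2 h3; lra.
Qed.

End Boards.

Import Defs.

(** * Walks in the hyperbolic filling *)

Section Graph.
Variables (R : realType) (Z : metricType R) (X : hyperbolic_filling Z) (z0 : Z).
Hypothesis diam1 : forall x y : Z, mdist x y <= 1.
Notation V := (vertex X).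
Notation vp := (@vertex_point R Z X).
Let s := scale X.
Notation lev := (@level R Z X).
Notation cen := (@vcenter R Z X z0).
Implicit Types v w x y : V.

Definition adjb : rel V := fun v w => `[< adjacent v w >].

Lemma adjb_sym : symmetric adjb.
Proof. by move=> v w; apply/asboolP/asboolP; exact: adjacent_sym. Qed.

Lemma s_gt1 : 1 < s. Proof. exact: scale_gt1. Qed.
Lemma s_gt0 : 0 < s. Proof. exact: lt_trans s_gt1. Qed.
Lemma sV_gt0 k : 0 < s ^- k. Proof. by rewrite invr_gt0 exprn_gt0 // s_gt0. Qed.

Lemma sV_le k l : (k <= l)%N -> s ^- l <= s ^- k.
Proof.
move=> kl; rewrite lef_pV2 ?posrE ?exprn_gt0 ?s_gt0 // ler_weXn2l //; exact/ltW/s_gt1.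
Qed.

Lemma sVS k : s * s ^- k.+1 = s ^- k.
Proof. by rewrite exprS invfM mulrA divff ?mul1r // gt_eqF // s_gt0. Qed.

Lemma sV1 k : s ^- k <= 1.
Proof. by rewrite -[leRHS]invr1 -(expr0 s) sV_le. Qed.

(** [1 - sval x w] is the distance from [x] to an end point [w] of its edge. A step inside an edge
    changes it by at most its length, and passing a vertex trades a full unit for one edge of the
    walk. *)
Lemma chain_walk (x y : realization X) l : chain x y l -> forall v0, y = vp v0 -> forall w, 0 < sval x w ->
  exists p, [/\ path adjb w p, last w p = v0 & (size p)%:R <= l + 1 - sval x w].
Proof.
elim=> [{}x v0 -> w|{}x {}y z {}l m [u [v [t [t' [uv /andP[t0 t1] /andP[t'0 t'1] [xE yE lE]]]]]] _ IH v0 zv w].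
  rewrite /= /seg subr0 mul1r mul0r addr0; have [->|_] := eqVneq w v0; last by rewrite ltxx.
  by move=> _; exists [::]; split=> //; rewrite add0r subrr.
have uv' : u != v by case: uv => /eqP.
have Yu : sval y u = 1 - t' by rewrite yE /seg eqxx (negbTE uv') mulr1 mulr0 addr0.
have Yv : sval y v = t' by rewrite yE /seg eqxx eq_sym (negbTE uv') mulr1 mulr0 add0r.
have ext a b : adjacent a b -> 0 < sval y b -> sval y b = 1 ->
    exists p, [/\ path adjb a p, last a p = v0 & (size p)%:R <= m + 1].
  move=> ab yb0 yb; have [p [pp lp sp]] := IH v0 zv b yb0; exists (b :: p); split=> //=.
    by rewrite pp andbT; apply/asboolP.
  by move: sp; rewrite yb -natr1; lra.
rewrite xE /seg; have [->|wu] := eqVneq w u.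
  rewrite (negbTE uv') mulr1 mulr0 addr0 => tpos.
  case: (ltP 0 (1 - t')) => h.
    have [|p [pp lp sp]] := IH v0 zv u; first by rewrite Yu.
    exists p; split=> //; apply: le_trans sp _; rewrite Yu lE.
    by have := ler_norm (t' - t); rewrite distrC; lra.
  have t'E : t' = 1 by move: h t'1; lra.
  have [||p [pp lp sp]] := ext u v uv; rewrite ?Yv ?t'E //.
  exists p; split=> //; apply: le_trans sp _; rewrite lE t'E.
  by have := ler_norm (1 - t); rewrite distrC; lra.
have [->|wv] := eqVneq w v; last by rewrite !mulr0 addr0 ltxx.
rewrite mulr0 add0r mulr1 => tpos.
case: (ltP 0 t') => h.
  have [|p [pp lp sp]] := IH v0 zv v; first by rewrite Yv.
  exists p; split=> //; apply: le_trans sp _; rewrite Yv lE.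
  by have := ler_norm (t - t'); lra.
have t'E : t' = 0 by move: h t'0; lra.
have [||p [pp lp sp]] := ext v u (adjacent_sym uv); rewrite ?Yu ?t'E ?subr0 //.
exists p; split=> //; apply: le_trans sp _; rewrite lE t'E subr0.
by have := ler_norm t; lra.
Qed.

Lemma graph_dist_walk v w (m : nat) : mdist (vp v) (vp w) < m.+1%:R ->
  exists p, [/\ path adjb v p, last v p = w & (size p <= m)%N].
Proof.
move=> h; have [l /= vl lm] : exists2 l, [set l | chain (vp v) (vp w) l] l & l < m.+1%:R.
  apply: contrapT => no; move: h; rewrite ltNge => /negP; apply; apply: lb_le_inf; first exact: chain_connected.
  by move=> l hl; rewrite leNgt; apply/negP => hm; apply: no; exists l.
have one : sval (vp v) v = 1 by rewrite /= /seg eqxx subr0 mul1r mul0r addr0.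
have [|p [pp lp sp]] := chain_walk vl erefl (w := v); first by rewrite one.
exists p; split=> //; rewrite -ltnS -(ltr_nat R); apply: le_lt_trans sp _.
by rewrite one; move: lm; lra.
Qed.

Let C1 := 2 + 2 * s.
Lemma C1_ge0 : 0 < C1. Proof. by have := s_gt0; rewrite /C1; lra. Qed.

Lemma adjacent_near v w : adjacent v w -> mdist (cen v) (cen w) <= C1 * s ^- lev v.
Proof.
have s0 := s_gt0; have sg1 := s_gt1.
case: v w => [|k z k0 Nz] [|k' z' k'0 Nz'] [] //= _.
- by move=> _ _ _; rewrite expr0 invr1 mulr1; apply: le_trans (diam1 _ _) _; rewrite /C1; lra.
- move=> k1 _ _; have -> : k = 1%N by apply/eqP; rewrite eqn_leq k1.
  apply: le_trans (diam1 _ _) _; rewrite expr1 /C1 mulrDl mulfK ?gt_eqF //.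
  have : 0 < 2 / s by rewrite divr_gt0. lra.
- move=> kk kk' [y [/=]]; rewrite !ballEmdist /= /vradius /= -/s => h1 h2.
  have h3 : s ^- k' <= s * s ^- k.
    by rewrite -[leLHS]sVS ler_wpM2l ?sV_le // ltW.
  have := mtri y z z'; rewrite [mdist y z']metric_sym /C1; move: h1 h2 h3; clear; lra.
Qed.

Lemma adjacent_level v w : adjacent v w -> (lev v <= (lev w).+1)%N /\ (lev w <= (lev v).+1)%N.
Proof. by case. Qed.

(** The scale [s ^- lev v] grows by at most the factor [s] per step, hence the crude factor
    [s ^+ size p]. *)
Lemma walk_geom v p : path adjb v p -> [/\ (lev (last v p) <= lev v + size p)%N,
  (lev v <= lev (last v p) + size p)%N &
  mdist (cen v) (cen (last v p)) <= C1 * (size p)%:R * s ^+ size p * s ^- lev v].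
Proof.
have s0 := s_gt0; have s1 := s_gt1; have c0 := C1_ge0.
elim: p v => [|u p IH] v /=; first by rewrite mdistxx !addn0 mulr0 !mul0r.
move=> /andP[/asboolP vu /IH[h1 h2 h3]]; have [g1 g2] := adjacent_level vu; split.
- by apply: leq_trans h1 _; lia.
- by apply: leq_trans g1 _; lia.
apply: le_trans (mtri (cen u) _ _) _; have h4 := adjacent_near vu.
have h5 : s ^- lev u <= s * s ^- lev v.
  by case: (lev v) g1 => [|k] g1; [apply: le_trans (sV1 _) _; rewrite expr0 invr1 mulr1 ltW|rewrite sVS sV_le].
rewrite -natr1 exprS; move: (size p) h3 => n h3.
have sn : 1 <= s ^+ n by rewrite exprn_ege1 // ltW.
have k0 := sV_gt0 (lev v).
have n0 : 0 <= n%:R :> R by [].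
have e1 : C1 * n%:R * s ^+ n * s ^- lev u <= C1 * n%:R * s ^+ n * (s * s ^- lev v).
  by apply: ler_wpM2l h5; rewrite !mulr_ge0 // ?(ltW c0) // exprn_ge0 // ltW.
have e2 : C1 * s ^- lev v <= C1 * (s * s ^+ n) * s ^- lev v.
  rewrite -mulrA; apply: ler_wpM2l; first exact: ltW.
  rewrite -[leLHS]mul1r; apply: ler_wpM2r; first exact: ltW.
  by rewrite -[1]mulr1 ler_pM // ltW.
have -> : C1 * (n%:R + 1) * (s * s ^+ n) * s ^- lev v =
  C1 * n%:R * s ^+ n * (s * s ^- lev v) + C1 * (s * s ^+ n) * s ^- lev v by ring.
by rewrite addrC lerD // ?(le_trans h3) // (le_trans h4).
Qed.

Lemma near_vertex (z : Z) k : exists2 v, lev v = k & mdist z (cen v) <= s ^- k /\ ((0 < k)%N -> mdist z (cen v) < s ^- k).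
Proof.
case: k => [|k]; first by exists (root X) => //; split=> //; rewrite expr0 invr1 diam1.
have [w Nw zw] := net_cover X z (ltn0Sn k).
by exists (node (ltn0Sn k) Nw) => //; split=> //; exact: ltW.
Qed.

(** For fixed [z] these vertices form a vertical ray towards [z]. *)
Definition xi (z : Z) k : V := s2val (cid2 (near_vertex z k)).
Lemma lev_xi z k : lev (xi z k) = k. Proof. by rewrite /xi; case: cid2. Qed.
Lemma xi_near z k : mdist z (cen (xi z k)) <= s ^- k.
Proof. by rewrite /xi; case: cid2 => ? /= _ []. Qed.
Lemma xi_lt z k : (0 < k)%N -> mdist z (cen (xi z k)) < s ^- k.
Proof. by rewrite /xi; case: cid2 => ? /= _ [_]. Qed.

Lemma vball_cen v z : mdist z (cen v) < 2 * s ^- lev v -> vball v z.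
Proof. by case: v => [|k z' k0 Nz] //=; rewrite ballEmdist /= metric_sym. Qed.

Lemma adjacent_of v w z : v <> w -> (lev v <= (lev w).+1)%N -> (lev w <= (lev v).+1)%N ->
  mdist z (cen v) < 2 * s ^- lev v -> mdist z (cen w) < 2 * s ^- lev w -> adjacent v w.
Proof. by move=> vw h1 h2 zv zw; split=> //; exists z; split; exact: vball_cen. Qed.

Lemma xi_lt2 z k : mdist z (cen (xi z k)) < 2 * s ^- k.
Proof.
apply: le_lt_trans (xi_near z k) _; rewrite ltr_pMl ?sV_gt0 // ltr1n //.
Qed.

Lemma xi_adj z k : adjacent (xi z k.+1) (xi z k).
Proof.
apply: (adjacent_of (z := z)); rewrite ?lev_xi ?ltnS ?leqnSn // ?xi_lt2 //.
- by move=> /(congr1 lev); rewrite !lev_xi => /eqP; rewrite gtn_eqF.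
- by rewrite ltnW // ltnW.
Qed.

Lemma cen_adj v k : lev v = k.+1 -> adjacent v (xi (cen v) k).
Proof.
move=> vk; apply: (adjacent_of (z := cen v)); rewrite ?lev_xi ?vk //.
- by move=> /(congr1 lev); rewrite lev_xi vk => /eqP; rewrite gtn_eqF.
- by rewrite ltnW // ltnW.
- by rewrite mdistxx mulr_gt0 // sV_gt0.
- exact: xi_lt2.
Qed.

Lemma level0 v : lev v = 0%N -> v = root X.
Proof. by case: v => //= k z k0 Nz e; exfalso; rewrite e in k0. Qed.

Lemma walk_up v k : (k <= lev v)%N -> exists p, [/\ path adjb v p, size p = (lev v - k)%N,
  lev (last v p) = k & mdist (cen v) (cen (last v p)) < 2 * s ^- k /\ ((0 < k)%N -> mdist (cen v) (cen (last v p)) < s ^- k)].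
Proof.
move=> kv; have [kE|kE] := eqVneq k (lev v).
  exists [::]; rewrite /= mdistxx kE subnn; split=> //.
  by rewrite mulr_gt0 ?sV_gt0 //; split=> // _; exact: sV_gt0.
have {kE}kv : (k < lev v)%N by rewrite ltn_neqAle kE.
have up n : (k <= n)%N -> exists p, [/\ path adjb (xi (cen v) n) p, size p = (n - k)%N & last (xi (cen v) n) p = xi (cen v) k].
  elim: n => [|n IH]; first by rewrite leqn0 => /eqP->; exists [::].
  rewrite leq_eqVlt => /orP[/eqP->|]; first by exists [::]; rewrite subnn.
  rewrite ltnS => kn; have [p [pp sp lp]] := IH kn; exists (xi (cen v) n :: p); split=> //=.
    by rewrite pp andbT; apply/asboolP; exact: xi_adj.
  by rewrite sp subSn.
case vE : (lev v) kv => [//|n] kn; have [p [pp sp lp]] := up n kn.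
exists (xi (cen v) n :: p); split=> /=.
- by rewrite pp andbT; apply/asboolP; exact: cen_adj.
- by rewrite sp subSn.
- by rewrite lp lev_xi.
- by rewrite lp xi_lt2; split=> // k0; exact: xi_lt.
Qed.

Lemma rev_walk v p : path adjb v p -> exists q, [/\ path adjb (last v p) q, last (last v p) q = v & size q = size p].
Proof.
elim: p v => [|u p IH] v /=; first by exists [::].
move=> /andP[vu /IH[q [pq lq sq]]]; exists (rcons q v); split.
- by rewrite rcons_path pq lq adjb_sym.
- by rewrite last_rcons.
- by rewrite size_rcons sq.
Qed.

(** Both vertices climb to level [k], where their ancestors are equal or adjacent because the
    centres are within [s ^- k]. *)
Lemma short_walk v w k : (k <= lev v)%N -> (k <= lev w)%N -> mdist (cen v) (cen w) <= s ^- k ->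
  exists p, [/\ path adjb v p, last v p = w & (size p <= (lev v - k) + (lev w - k) + 1)%N].
Proof.
move=> kv kw vw; have [p [pp sp lp [np np']]] := walk_up kv; have [q [pq sq lq [nq nq']]] := walk_up kw.
have [q' [pq' lq' sq']] := rev_walk pq.
have [e|ne] := pselect (last v p = last w q).
  exists (p ++ q'); split; first by rewrite cat_path pp e.
    by rewrite last_cat e.
  by rewrite size_cat sp sq' sq; lia.
have ad : adjacent (last v p) (last w q).
  have [k0|k0] := posnP k.
    by exfalso; apply: ne; rewrite (level0 (etrans lp k0)) (level0 (etrans lq k0)).
  apply: (adjacent_of (z := cen v)); rewrite ?lp ?lq //.
  by have := nq' k0; have := mtri (cen w) (cen v) (cen (last w q)); move: vw; lra.
exists (p ++ last w q :: q'); split.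
- by rewrite cat_path pp /= pq' andbT; apply/asboolP.
- by rewrite last_cat /=.
- by rewrite size_cat /= sp sq' sq; lia.
Qed.

Lemma level_separated v w : lev v = lev w -> v <> w -> s ^- lev v <= mdist (cen v) (cen w).
Proof.
case: v w => [|k z k0 Nz] [|k' z' k'0 Nz'] //=; first by move=> e; exfalso; rewrite -e in k'0.
  by move=> e; exfalso; rewrite e in k0.
move=> e; subst k'; move=> ne; have [sep _] := net_maximal X k0; apply: sep => // zz; apply: ne; subst z'.
by rewrite (Prop_irrelevance Nz Nz') (bool_irrelevance k0 k'0).
Qed.

End Graph.

(** * A homogeneous metric on the vertices *)

Lemma compact_bounded (R : realType) (Y : metricType R) (K : set Y) y0 : compact K ->
  exists B : R, forall y, K y -> mdist y0 y <= B.
Proof.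
move=> cK; apply: contrapT => no.
have ex (n : nat) : exists y, K y /\ n%:R < mdist y0 y.
  apply: contrapT => h; apply: no; exists n%:R => y Ky; rewrite leNgt; apply/negP => hy.
  by apply: h; exists y.
have [t tP] := choice ex.
have FK : (t @ \oo) K by exists 0%N => // n _; exact: (tP n).1.
have [w [_ cw]] := cK (t @ \oo) _ FK.
pose n0 := (Num.truncn (mdist y0 w + 1)).+1.
have [|y [[n /= nn ny] yb]] := cw [set y | exists2 n, (n0 <= n)%N & t n = y] (ball w 1) _ (nbhsx_ballx w 1 ltr01).
  by exists n0 => // n /= nn; exists n.
have [_ h] := tP n; rewrite ny in h; move: yb; rewrite ballEmdist /= => yb.
have h2 : mdist y0 w + 1 < n%:R.
  by apply: lt_le_trans (truncnS_gt _) _; rewrite ler_nat.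
have := mtri w y0 y; move: h h2 yb; lra.
Qed.

(* [d v w] is the length of a shortest chain of steps of bounded size in [Y] from
   the image of [v] to the image of [w]. Isometries of [Y] preserve it, so that
   cocompactness yields the last field, which a metric on the filling itself
   would not satisfy. *)
Record level_metric (R : realType) (Z : metricType R) (X : hyperbolic_filling Z)
    (d : vertex X -> vertex X -> nat) (c : nat) : Prop := LevelMetric {
  lm_sym : forall v w, d v w = d w v;
  lm_refl : forall v, d v v = 0;
  lm_tri : forall v u w, (d v w <= d v u + d u w)%N;
  lm_adj : forall v w, adjacent v w -> (d v w <= 1)%N;
  lm_walk : forall v w, exists p, [/\ path (@adjb R Z X) v p, last v p = w & (size p <= c * (d v w).+1)%N];
  lm_geodesic : forall v w, exists x : nat -> vertex X, [/\ x 0 = v, x (d v w).+1 = w &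
    forall i j, (i <= j <= (d v w).+1)%N -> (d (x i) (x j) <= (j - i) + c)%N /\ ((j - i) <= d (x i) (x j) + c)%N];
  lm_homogeneous : forall v, exists F : vertex X -> vertex X,
    (forall x y, (d (F x) (F y) <= d x y + c)%N /\ (d x y <= d (F x) (F y) + c)%N) /\
    (d (F v) (root X) <= c)%N }.

(** * The chain metric of [Y] on the vertices *)

Section ChainMetric.
Variables (R : realType) (Z : metricType R) (X : hyperbolic_filling Z) (Y : metricType R) (f : realization X -> Y).
Variables (C D : R) (G : set (Y -> Y)).
Hypothesis C0 : 0 < C.
Hypothesis D0 : 0 < D.
Hypothesis fqi : forall x x', C^-1 * mdist x x' - D <= mdist (f x) (f x') /\ mdist (f x) (f x') <= C * mdist x x' + D.
Hypothesis fonto : forall y, exists x, mdist (f x) y <= D.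
Hypothesis Gsub : isometry_subgroup G.
Hypothesis Gco : cocompact_action G.
Notation V := (vertex X).
Notation vp := (@vertex_point R Z X).
Let phi (v : V) : Y := f (vp v).

Lemma near_realization (x : realization X) : exists u, mdist x (vp u) <= 1.
Proof.
have [u [v [t [uv /andP[t0 t1] xE]]]] := svalP x; exists u.
case: uv => [uv|uv].
  have -> : x = vp u by apply: realization_ext; rewrite xE /= uv; apply/funext => w; rewrite /seg; ring.
  by rewrite mdistxx.
apply: le_trans (_ : `|t - 0| + 0 <= _); last by rewrite subr0 addr0 ger0_norm.
apply: graph_dist_le; apply: chain_cons (chain_nil _).
exists u, v, t, 0; rewrite lexx ler01 t0 t1; split=> //; split=> //.
by apply/funext => w; rewrite /= /seg; ring.
Qed.

(** [D'] bounds the distance from a point of [Y] to the image of some vertex; [c0] is large enough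
    for chains to contain the images of adjacent vertices and detours to such nearby images. *)
Let D' := D + C + D.
Let c0 := 2 * D' + C.

Let D'0 : 0 < D'. Proof. by rewrite !addr_gt0. Qed.

Lemma near_phi_ex y : exists v, mdist (phi v) y <= D'.
Proof.
have [x xy] := fonto y; have [u xu] := near_realization x; exists u.
apply: le_trans (mtri (f x) _ _) _; have [_ h] := fqi (vp u) x; rewrite /D' lerD //.
  by apply: le_trans h _; rewrite addrC lerD2l -[leRHS]mulr1 ler_pM2l // metric_sym.
Qed.

Definition near_phi y : V := sval (cid (near_phi_ex y)).
Lemma near_phiP y : mdist (phi (near_phi y)) y <= D'. Proof. by rewrite /near_phi; case: cid. Qed.

Lemma phi_adj v w : adjacent v w -> mdist (phi v) (phi w) <= c0.
Proof.
move=> vw; have [_ h] := fqi (vp v) (vp w); apply: le_trans h _.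
have : mdist (vp v) (vp w) <= 1 by rewrite -[1]addr0; apply: graph_dist_le; exact: chain_cons (adjacent_step vw) (chain_nil _).
move=> h; have : C * mdist (vp v) (vp w) <= C * 1 by rewrite ler_pM2l.
by rewrite /c0 /D' mulr1; move: C0 D0; lra.
Qed.

Definition close : rel Y := fun a b => mdist a b <= c0.

Lemma close_sym : symmetric close. Proof. by move=> a b; rewrite /close metric_sym. Qed.

Lemma walk_close v p : path (@adjb R Z X) v p -> path close (phi v) (map phi p).
Proof.
elim: p v => [//|u p IH] v /= /andP[/asboolP vu pp]; rewrite IH // andbT.
exact: phi_adj.
Qed.

Lemma close_rev y p : path close y p -> exists q, [/\ path close (last y p) q, last (last y p) q = y & size q = size p].
Proof.
elim: p y => [|u p IH] v /=; first by exists [::].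
move=> /andP[vu /IH[q [pq lq sq]]]; exists (rcons q v); split.
- by rewrite rcons_path pq lq close_sym.
- by rewrite last_rcons.
- by rewrite size_rcons sq.
Qed.

Lemma walk_of_dist B : exists m : nat, forall v w, mdist (phi v) (phi w) <= B ->
  exists p, [/\ path (@adjb R Z X) v p, last v p = w & (size p <= m)%N].
Proof.
exists (Num.truncn (C * (B + D))) => v w vw; apply: graph_dist_walk.
apply: le_lt_trans (truncnS_gt _); have [h _] := fqi (vp v) (vp w).
rewrite -ler_pdivrMl //; move: h vw; rewrite /phi; lra.
Qed.

Lemma chain_ex y y' : exists p, path close y p /\ last y p = y'.
Proof.
have [m mP] := walk_of_dist (mdist (phi (near_phi y)) (phi (near_phi y'))).
have [p [pp lp _]] := mP _ _ (lexx _).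
have n1 := near_phiP y; have n2 := near_phiP y'.
exists (phi (near_phi y) :: rcons (map phi p) y'); rewrite /= last_rcons; split=> //.
rewrite rcons_path walk_close // last_map lp /close; apply/andP; split.
  by rewrite metric_sym /c0; move: D'0 C0 n1; lra.
by rewrite /c0; move: D'0 C0 n2; lra.
Qed.

Definition joined n y y' := `[< exists p, [/\ path close y p, last y p = y' & (size p <= n)%N] >].

Lemma joined_ex y y' : exists n, joined n y y'.
Proof. by have [p [pp lp]] := chain_ex y y'; exists (size p); apply/asboolP; exists p. Qed.

Definition dY y y' := ex_minn (joined_ex y y').

Lemma dY_path y y' : exists p, [/\ path close y p, last y p = y' & (size p = dY y y')%N].
Proof.
rewrite /dY; case: ex_minnP => n /asboolP[p [pp lp sp]] mn; exists p; split=> //.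
by apply/eqP; rewrite eqn_leq sp mn //; apply/asboolP; exists p.
Qed.

Lemma dY_le y p : path close y p -> (dY y (last y p) <= size p)%N.
Proof. by move=> pp; rewrite /dY; case: ex_minnP => n _; apply; apply/asboolP; exists p. Qed.

Lemma dY_sym y y' : dY y y' = dY y' y.
Proof.
have le a b : (dY b a <= dY a b)%N.
  have [p [pp lp sp]] := dY_path a b; have [q [pq lq sq]] := close_rev pp.
  by rewrite -sp -sq -{1}lp -{2}lq; exact: dY_le.
by apply/eqP; rewrite eqn_leq !le.
Qed.

Lemma dY_tri y u y' : (dY y y' <= dY y u + dY u y')%N.
Proof.
have [p [pp lp <-]] := dY_path y u; have [q [pq lq <-]] := dY_path u y'.
have := @dY_le y (p ++ q); rewrite cat_path pp lp pq last_cat lp lq size_cat; exact.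
Qed.

Lemma dY_refl y : dY y y = 0%N.
Proof. by apply/eqP; rewrite -leqn0; exact: (@dY_le y [::]). Qed.

Lemma dY_close y y' : mdist y y' <= c0 -> (dY y y' <= 1)%N.
Proof. by move=> h; have := @dY_le y [:: y']; rewrite /= /close h; exact. Qed.

Lemma near_phi_dY y : (dY (phi (near_phi y)) y <= 1)%N.
Proof. by apply: dY_close; have := near_phiP y; rewrite /c0; move: D'0 C0; lra. Qed.

Lemma dY_isometry (g g' : Y -> Y) y y' : (forall a b, mdist (g a) (g b) = mdist a b) ->
  (dY (g y) (g y') <= dY y y')%N.
Proof.
move=> gi; have [p [pp lp <-]] := dY_path y y'.
rewrite -lp -last_map -(size_map g); apply: dY_le; elim: p y {lp} pp => [//|u p IH] v /= /andP[vu pp].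
by rewrite IH // andbT /close gi.
Qed.

Lemma dY_nth y p i j : path close y p -> (i <= j)%N -> (j <= size p)%N ->
  (dY (nth y (y :: p) i) (nth y (y :: p) j) <= j - i)%N.
Proof.
move=> pp; elim: j => [|j IH]; first by rewrite leqn0 => /eqP->; rewrite dY_refl.
rewrite leq_eqVlt => /orP[/eqP->|]; first by rewrite dY_refl.
rewrite ltnS => ij jp; apply: leq_trans (dY_tri _ (nth y (y :: p) j) _) _.
rewrite subSn // -[X in (_ <= X)%N]addn1 leq_add //; first by apply: IH => //; exact: ltnW.
by apply: dY_close; have /(pathP y) := pp; exact.
Qed.

Lemma chain_walk_bound : exists M : nat, forall p y v w, path close y p -> mdist (phi v) y <= D' -> mdist (phi w) (last y p) <= D' ->
  exists q, [/\ path (@adjb R Z X) v q, last v q = w & (size q <= M * (size p).+1)%N].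
Proof.
have [M MP] := walk_of_dist (2 * D' + c0); exists M.
have c00 : 0 <= c0 by rewrite /c0; move: D'0 C0; lra.
elim=> [|u p IH] y v w /=.
  move=> _ h1 h2; rewrite muln1; apply: MP; have := mtri y (phi v) (phi w).
  by rewrite [mdist y _]metric_sym; move: h1 h2 c00; lra.
move=> /andP[yu pp] h1 h2; have h3 := near_phiP u.
have [q [pq lq sq]] := IH u (near_phi u) w pp h3 h2.
have [|q' [pq' lq' sq']] := MP v (near_phi u).
  have := mtri y (phi v) (phi (near_phi u)); have := mtri u y (phi (near_phi u)).
  by rewrite [mdist u (phi _)]metric_sym; move: h1 h3 yu; rewrite /close; lra.
exists (q' ++ q); rewrite cat_path pq' lq' pq last_cat lq' lq size_cat; split=> //.
by rewrite mulnS leq_add.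
Qed.

Lemma level_metric_exists : exists (d : V -> V -> nat) c, level_metric d c.
Proof.
have [M MP] := chain_walk_bound.
have [K [cK KY]] := Gco; have [B BP] := compact_bounded (phi (root X)) cK.
have [M2 M2P] := walk_of_dist (D' + B).
pose d v w := dY (phi v) (phi w).
exists d, (maxn M (maxn 3 M2.+1)).
have wl v p : path (@adjb R Z X) v p -> (d v (last v p) <= size p)%N.
  by move=> pp; rewrite /d -(size_map phi) -last_map; exact/dY_le/walk_close.
split.
- by move=> v w; exact: dY_sym.
- by move=> v; exact: dY_refl.
- by move=> v u w; exact: dY_tri.
- by move=> v w vw; exact/dY_close/phi_adj.
- move=> v w; have [p [pp lp sp]] := dY_path (phi v) (phi w).
  have [||q [pq lq sq]] := MP p (phi v) v w pp; rewrite ?lp ?mdistxx ?(ltW D'0) //.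
  exists q; split=> //; apply: leq_trans sq _; rewrite sp leq_mul2r leq_maxl orbT //.
- move=> v w; have [p0 [pp0 lp0 sp0]] := dY_path (phi v) (phi w); rewrite -/(d v w) in sp0.
  (* The end point is repeated: [d v w] vanishes when [v] and [w] have the same image, and the extra
     step keeps [x 0 = v] compatible with [x (d v w).+1 = w]. *)
  pose p := rcons p0 (phi w).
  have pp : path close (phi v) p by rewrite rcons_path pp0 lp0 /close mdistxx /c0; move: D'0 C0; lra.
  have sp : size p = (d v w).+1 by rewrite size_rcons sp0.
  have lp : last (phi v) p = phi w by rewrite last_rcons.
  pose y i := nth (phi v) (phi v :: p) i.
  pose x i := if i == 0%N then v else if i == (d v w).+1 then w else near_phi (y i).
  have y0 : y 0%N = phi v by [].
  have yn : y (d v w).+1 = phi w by rewrite /y -sp -lp -last_nth.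
  have xy i : (dY (phi (x i)) (y i) <= 1)%N.
    rewrite /x; case: eqP => [->|_]; first by rewrite y0 dY_refl.
    by case: eqP => [->|_]; [rewrite yn dY_refl|exact: near_phi_dY].
  exists x; split=> //; first by rewrite /x eqxx.
  move=> i j /andP[ij jn]; have up := dY_nth pp ij; rewrite -/(y i) -/(y j) sp in up.
  have u1 := up jn; have t1 := dY_tri (phi (x i)) (y i) (phi (x j)); have t2 := dY_tri (y i) (y j) (phi (x j)).
  have t3 := dY_tri (y i) (phi (x i)) (y j); have t4 := dY_tri (phi (x i)) (phi (x j)) (y j).
  have x1 := xy i; have x2 := xy j; rewrite [dY (y j) (phi _)]dY_sym in t2; rewrite [dY (y i) (phi _)]dY_sym in t3.
  have l1 := dY_nth pp (leq0n i); rewrite -/(y i) sp -/(y 0%N) y0 in l1.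
  have l2 := dY_nth pp jn; rewrite -/(y j) sp leqnn -/(y (d v w).+1) yn in l2.
  have t5 := dY_tri (phi v) (y i) (phi w); have t6 := dY_tri (y i) (y j) (phi w).
  have il : (i <= (d v w).+1)%N by exact: leq_trans ij jn.
  have {}l1 := l1 il; have {}l2 := l2 isT.
  rewrite /d in u1 t1 t2 t3 t4 t5 t6 l1 l2 jn il *.
  set m := maxn _ _; have m2 : (3 <= m)%N by rewrite /m !leq_max leqnn orbT.
  by clear -u1 t1 t2 t3 t4 t5 t6 l1 l2 jn il ij m2 x1 x2; split; lia.
- move=> v; have [g Gg [k Kk gk]] : (\bigcup_(g in G) (g @` K)) (phi v) by rewrite -KY.
  have [GI _ _ Ginv] := Gsub; have [h [Gh c1 c2]] := Ginv g Gg.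
  have hi := (GI h Gh).1; have gi := (GI g Gg).1.
  (* The isometry [h] moves [phi v] into the compact set, hence to a bounded distance from the image
     of the root. *)
  exists (fun x => near_phi (h (phi x))); split.
    move=> x y; have n1 := near_phi_dY (h (phi x)); have n2 := near_phi_dY (h (phi y)).
    have e1 := dY_isometry h (phi x) (phi y) hi; have e2 := dY_isometry h (h (phi x)) (h (phi y)) gi; rewrite !c2 in e2.
    rewrite /d; set a := phi (near_phi _) in n1 *; set b := phi (near_phi _) in n2 *.
    have t1 := dY_tri a (h (phi x)) b; have t2 := dY_tri (h (phi x)) (h (phi y)) b.
    have t3 := dY_tri (h (phi x)) a (h (phi y)); have t4 := dY_tri a b (h (phi y)).
    rewrite [dY (h (phi y)) b]dY_sym in t2; rewrite [dY (h (phi x)) a]dY_sym in t3.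
    set m := maxn _ _; have m2 : (3 <= m)%N by rewrite /m !leq_max leqnn orbT.
    by clear -n1 n2 e1 e2 t1 t2 t3 t4 m2; split; lia.
  have hk : h (phi v) = k by rewrite -gk c1.
  have [|p [pp lp sp]] := M2P (near_phi (h (phi v))) (root X).
    have := near_phiP (h (phi v)); have := BP k Kk; rewrite hk.
    by have := mtri k (phi (near_phi k)) (phi (root X)); rewrite [mdist k _]metric_sym; lra.
  have := wl _ _ pp; rewrite lp => w1; apply: leq_trans w1 _; apply: leq_trans sp _.
  by rewrite !leq_max leqnSn !orbT.
Qed.

End ChainMetric.

(** * Stability of quasigeodesics *)

Section Morse.
Variables (R : realType) (Z : metricType R) (X : hyperbolic_filling Z) (z0 : Z).
Hypothesis diam1 : forall x y : Z, mdist x y <= 1.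
Notation V := (vertex X).
Let s := scale X.
Notation lev := (@level R Z X).
Notation cen := (@vcenter R Z X z0).
Variables (d : V -> V -> nat) (c : nat).
Hypothesis Lm : level_metric d c.
Notation rt := (root X).
Implicit Types (v w x y : V).

Let s1 : 1 < s := s_gt1 X.
Let s0 : 0 < s := s_gt0 X.
Let sV k : 0 < s ^- k := sV_gt0 X k.

Lemma spow_ge (B : R) : exists U : nat, B <= s ^+ U.
Proof.
have bern n : 1 + n%:R * (s - 1) <= s ^+ n.
  elim: n => [|n IH]; first by rewrite mul0r addr0 expr0.
  rewrite exprS -natr1; have n0 : 0 <= n%:R :> R by [].
  have : s * (1 + n%:R * (s - 1)) <= s * s ^+ n by rewrite ler_pM2l.
  have := mulr_ge0 n0 (sqr_ge0 (s - 1)).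
  have -> : s * (1 + n%:R * (s - 1)) = (1 + (n%:R + 1) * (s - 1)) + n%:R * (s - 1) ^+ 2 by ring.
  move: (s * s ^+ n) (n%:R * _ ^+ 2) ((n%:R + 1) * _) => ? ? ?; lra.
exists (Num.truncn (B / (s - 1))).+1; apply: le_trans (bern _).
have sp : 0 < s - 1 by rewrite subr_gt0.
have : B / (s - 1) < (Num.truncn (B / (s - 1))).+1%:R by exact: truncnS_gt.
rewrite ltr_pdivrMr //; lra.
Qed.

Lemma sVD k l : s ^- (k + l) * s ^+ l = s ^- k.
Proof. by rewrite exprD invfM -mulrA mulVf ?mulr1 // expf_neq0 // gt_eqF. Qed.

Lemma sV_shift k l m : (l <= k + m)%N -> s ^- k <= s ^+ m * s ^- l.
Proof.
move=> h; rewrite -(sVD k m) mulrC ler_wpM2l //; first exact/exprn_ge0/ltW.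
exact: sV_le.
Qed.

Lemma lev_of_sV k l m : s ^- k <= s ^+ m * s ^- l -> (l <= k + m)%N.
Proof.
move=> h; rewrite leqNgt; apply/negP => lt; have := sV_le X lt; rewrite -/s => h2.
have : s ^+ m * s ^- l <= s ^+ m * s ^- (k + m).+1 by rewrite ler_wpM2l // exprn_ge0 // ltW.
have : s ^+ m * s ^- (k + m).+1 = s ^- k.+1 by rewrite -addSn mulrC sVD.
have := sVS X k; rewrite -/s; have := sV k.+1; move: h s1; nra.
Qed.

Lemma walk_d v p : path (@adjb R Z X) v p -> (d v (last v p) <= size p)%N.
Proof.
elim: p v => [|u p IH] v /=; first by rewrite (lm_refl Lm).
move=> /andP[/asboolP /(lm_adj Lm) h1 /IH h2]; apply: leq_trans (lm_tri Lm v u _) _; lia.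
Qed.

Lemma short_d v w k : (k <= lev v)%N -> (k <= lev w)%N -> mdist (cen v) (cen w) <= s ^- k ->
  (d v w <= (lev v - k) + (lev w - k) + 1)%N.
Proof.
move=> kv kw vw; have [p [pp lp sp]] := short_walk diam1 kv kw vw.
by have := walk_d pp; rewrite lp => h; exact: leq_trans h sp.
Qed.

Lemma lev_lip v w : (lev w <= lev v + c * (d v w).+1)%N.
Proof.
have [p [pp lp sp]] := lm_walk Lm v w; have [h _ _] := walk_geom z0 diam1 pp.
by rewrite lp in h; apply: leq_trans h _; rewrite leq_add2l.
Qed.

Lemma cen_near (r : nat) : exists2 K : R, 0 < K & forall v w, (d v w <= r)%N -> mdist (cen v) (cen w) <= K * s ^- lev v.
Proof.
pose n := (c * r.+1)%N; pose K := (2 + 2 * s) * n.+1%:R * s ^+ n.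
have c1 : 0 < 2 + 2 * s by move: s0; lra.
exists K; first by rewrite !mulr_gt0 // exprn_gt0.
move=> v w dr; have [p [pp lp sp]] := lm_walk Lm v w; have [_ _ h] := walk_geom z0 diam1 pp.
rewrite lp -/s in h; apply: le_trans h _; rewrite ler_wpM2r ?(ltW (sV _)) //.
have sn : (size p <= n)%N by apply: leq_trans sp _; rewrite leq_mul2l ltnS dr orbT.
apply: ler_pM; rewrite ?mulr_ge0 ?exprn_ge0 ?(ltW c1) ?(ltW s0) //.
  by rewrite ler_wpM2l ?(ltW c1) // ler_nat (leq_trans sn).
by rewrite ler_weXn2l // ltW.
Qed.

Lemma d_root v : (d rt v <= (lev v).+1)%N.
Proof.
have := @short_d rt v 0 (leq0n _) (leq0n _); rewrite expr0 invr1 => /(_ (diam1 _ _)).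
by have -> : lev rt = 0%N by []; rewrite sub0n subn0 add0n addn1.
Qed.

(** Climbing from [w] to the level of [v], and from both a bounded number of levels further, brings
    the two together. *)
Lemma deep_dist (B : R) : exists U : nat, forall v w, (lev v <= lev w)%N -> mdist (cen v) (cen w) <= B * s ^- lev v ->
  (d v w <= (lev w - lev v) + U)%N.
Proof.
have [U BU] := spow_ge B; exists (2 * U + 1)%N => v w h1 vw.
pose k := (lev v - U)%N.
have kv : (k <= lev v)%N by exact: leq_subr.
have kw : (k <= lev w)%N by rewrite /k; lia.
have : mdist (cen v) (cen w) <= s ^- k.
  rewrite /k; case: (leqP U (lev v)) => h.
    apply: le_trans vw _; apply: le_trans (_ : s ^+ U * s ^- lev v <= _); first by rewrite ler_wpM2r // ltW.
    by rewrite -[in leLHS](subnK h) mulrC sVD.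
  by have -> : (lev v - U = 0)%N by [lia]; rewrite expr0 invr1.
move=> /(short_d kv kw) h; apply: leq_trans h _; rewrite /k; lia.
Qed.

Lemma near_pow (U : nat) v w : (lev v <= lev w + U)%N -> (lev w <= lev v + U)%N ->
  mdist (cen v) (cen w) <= s ^+ U * s ^- lev v -> (d v w <= 3 * U + 1)%N.
Proof.
move=> h1 h2 vw; pose k := (lev v - U)%N.
have kv : (k <= lev v)%N by exact: leq_subr.
have kw : (k <= lev w)%N by rewrite /k; lia.
have : mdist (cen v) (cen w) <= s ^- k.
  rewrite /k; case: (leqP U (lev v)) => h.
    by apply: le_trans vw _; rewrite -[in leLHS](subnK h) mulrC sVD.
  by have -> : (lev v - U = 0)%N by [lia]; rewrite expr0 invr1.
move=> /(short_d kv kw) h; apply: leq_trans h _; rewrite /k; lia.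
Qed.

Lemma near_dist (B : R) (k0 : nat) : exists R0 : nat, forall v w, mdist (cen v) (cen w) <= B * s ^- lev v ->
  (lev w <= lev v + k0)%N -> (lev v <= lev w + k0)%N -> (d v w <= R0)%N.
Proof.
have [U BU] := spow_ge B; exists (3 * (U + k0) + 1)%N => v w vw h1 h2.
apply: near_pow; [lia|lia|apply: le_trans vw _].
by rewrite ler_wpM2r ?(ltW (sV _)) // (le_trans BU) // ler_weXn2l ?leq_addr // ltW.
Qed.

Definition quasigeodesic (A n : nat) (x : nat -> V) :=
  (forall i, (i < n)%N -> (d (x i) (x i.+1) <= A)%N) /\
  (forall i j, (i <= j <= n)%N -> (j - i <= A * d (x i) (x j) + A)%N).

Lemma step_path A n (x : nat -> V) i j : quasigeodesic A n x -> (i <= j <= n)%N -> (d (x i) (x j) <= A * (j - i))%N.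
Proof.
move=> [st _] /andP[]; elim: j => [|j IH]; first by rewrite leqn0 => /eqP->; rewrite (lm_refl Lm).
rewrite leq_eqVlt => /orP[/eqP->|]; first by rewrite (lm_refl Lm).
rewrite ltnS => ij jn; apply: leq_trans (lm_tri Lm _ (x j) _) _.
by rewrite subSn // mulnS addnC leq_add ?st // IH // ltnW.
Qed.

(** Bernoulli's inequality gives a small [e] with [s^-1 <= (1 - e) ^+ A]: a block of [A] factors
    [1 - e] costs at most one level. *)
Lemma shrink_pow (A : nat) : (0 < A)%N -> exists2 e : R, 0 < e <= 2^-1 & forall T, s ^- (T %/ A).+1 <= (1 - e) ^+ T.
Proof.
move=> A0; pose e := Num.min 2^-1 ((1 - s^-1) / A%:R).
have a0 : 0 < A%:R :> R by rewrite ltr0n.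
have si : s^-1 < 1 by rewrite invf_lt1.
have e0 : 0 < e by rewrite lt_min invr_gt0 ltr0Sn divr_gt0 // subr_gt0.
have e1 : e <= 2^-1 by rewrite ge_min lexx.
have e2 : A%:R * e <= 1 - s^-1 by rewrite mulrC -ler_pdivlMr // ge_min lexx orbT.
have eh : 0 < 1 - e by move: e1; lra.
have bern n : 1 - n%:R * e <= (1 - e) ^+ n.
  elim: n => [|n IH]; first by rewrite mul0r subr0 expr0.
  rewrite exprS -natr1; have n0 : 0 <= n%:R :> R by [].
  have : (1 - e) * (1 - n%:R * e) <= (1 - e) * (1 - e) ^+ n by rewrite ler_pM2l.
  have := mulr_ge0 n0 (sqr_ge0 e).
  have -> : (1 - e) * (1 - n%:R * e) = (1 - (n%:R + 1) * e) + n%:R * e ^+ 2 by ring.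
  move: ((1 - e) * (1 - e) ^+ n) (n%:R * _ ^+ 2) ((n%:R + 1) * _) => ? ? ?; lra.
exists e; first by rewrite e0 e1.
move=> T; have h1 : s^-1 <= (1 - e) ^+ A by have := bern A; move: e2; lra.
apply: le_trans (_ : ((1 - e) ^+ A) ^+ (T %/ A).+1 <= _).
  by rewrite -exprVn; apply: lerXn2r; rewrite ?nnegrE ?invr_ge0 ?exprn_ge0 // ltW.
rewrite -exprM; apply: ler_wiXn2l; rewrite ?(ltW eh) //; first by move: e0; lra.
by rewrite ltnW // mulnC ltn_ceil.
Qed.

(* While [x] is far from [z] relative to its radius, the distance of its center to
   [z] changes by a factor of at most [1 - e] in each step. The end points of such
   an excursion are then joined by a walk of length about [m], the logarithm of
   the total factor, and [m] is a small multiple of the duration of the excursion. *)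
Lemma morse (A : nat) (B0 : R) : exists2 B1 : R, 0 < B1 & forall (n : nat) (x : nat -> V) (z : Z), quasigeodesic A n x ->
  mdist (cen (x 0%N)) z <= B0 * s ^- lev (x 0%N) -> mdist (cen (x n)) z <= B0 * s ^- lev (x n) ->
  forall i, (i <= n)%N -> mdist (cen (x i)) z <= B1 * s ^- lev (x i).
Proof.
(* The factor [6] in [A'] makes the term [3 * A * m] in the bound on the duration of an excursion at
   most about half of the duration, so that it can be absorbed. *)
have [C2 C20 C2P] := cen_near A; pose L := (c * A.+1)%N; pose A' := (6 * A).+1.
have [e /andP[e0 e1] eP] := shrink_pow (ltn0Sn (6 * A)).
pose B := Num.max 1 (Num.max B0 (C2 / e)).
have B1 : 1 <= B by rewrite le_max lexx.
have BB0 : B0 <= B by rewrite !le_max lexx orbT.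
have BC : C2 <= e * B by rewrite mulrC -ler_pdivrMr // !le_max lexx !orbT.
pose B' := (B + C2) * s ^+ L.
have sL : 1 <= s ^+ L by rewrite exprn_ege1 // ltW.
have B'B : B <= B' by rewrite /B' -[leLHS]mulr1 ler_pM //; move: B1 C20; lra.
have [U UP] := spow_ge (2 * s ^+ L * B').
pose T1 := (2 * (A * (3 * U + L + 2) + 3 * A))%N.
pose R1 := (A * T1.+1)%N; have [K K0 KP] := cen_near R1; pose L1 := (c * R1.+1)%N.
exists ((B + K) * s ^+ L1); first by rewrite mulr_gt0 ?exprn_gt0 //; move: B1 K0; lra.
move=> n x z qg x0z xnz i iN.
pose D j := mdist (cen (x j)) z; pose near j := D j <= B * s ^- lev (x j).
have weaken j : D j <= B0 * s ^- lev (x j) -> near j by move=> h; apply: le_trans h _; rewrite ler_wpM2r // ltW.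
have near0 : near 0%N by exact: weaken.
have nearn : near n by exact: weaken.
(* [p] is the last index up to [i], and [q] the first one from [i] on, at which [x] is near [z]; the
   excursion takes place between them. *)
have ex1 : exists j, near j && (j <= i)%N by exists 0%N; rewrite near0.
have [p /andP[pn pli] pmax] := ex_maxnP ex1 (m := i) (fun j h => proj2 (andP h)).
suff ipT : (i - p <= T1.+1)%N.
  have dR : (d (x p) (x i) <= R1)%N.
    by apply: leq_trans (step_path qg (introT andP (conj pli iN))) _; rewrite leq_mul2l ipT orbT.
  have h1 := KP _ _ dR; have h2 := lev_lip (x p) (x i).
  have h3 : (lev (x i) <= lev (x p) + L1)%N by apply: leq_trans h2 _; rewrite leq_add2l leq_mul2l ltnS dR orbT.
  have h4 := sV_shift h3; have h5 := mtri (cen (x p)) (cen (x i)) z; rewrite [mdist (cen (x i)) (cen (x p))]metric_sym in h5.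
  apply: le_trans h5 _; apply: le_trans (_ : (B + K) * s ^- lev (x p) <= _).
    by rewrite mulrDl addrC lerD.
  by rewrite -mulrA ler_wpM2l //; move: B1 K0; lra.
have [pieq|pli'] := eqVneq p i; first by rewrite pieq subnn.
have {pli' pli}pli : (p < i)%N by rewrite ltn_neqAle pli' pli.
have ex2 : exists j, near j && (i <= j)%N by exists n; rewrite nearn iN.
have [q /andP[qn iq] qmin] := ex_minnP ex2.
have qN : (q <= n)%N by apply: qmin; rewrite nearn iN.
have far j : (p < j)%N -> (j < q)%N -> B * s ^- lev (x j) < D j.
  move=> pj jq; rewrite ltNge; apply/negP => h; case: (leqP j i) => ji.
    by have := pmax j; rewrite /near h ji => /(_ isT); rewrite leqNgt pj.
  by have := qmin j; rewrite /near h (ltnW ji) => /(_ isT); rewrite leqNgt jq.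
have [st lw] := qg.
have stepD j : (j < n)%N -> mdist (cen (x j)) (cen (x j.+1)) <= C2 * s ^- lev (x j) by move=> jn; apply: C2P; exact: st.
have stepL j : (j < n)%N -> (lev (x j.+1) <= lev (x j) + L)%N /\ (lev (x j) <= lev (x j.+1) + L)%N.
  move=> jn; have h := st j jn; split.
    by apply: leq_trans (lev_lip (x j) (x j.+1)) _; rewrite leq_add2l leq_mul2l ltnS h orbT.
  by apply: leq_trans (lev_lip (x j.+1) (x j)) _; rewrite leq_add2l leq_mul2l ltnS (lm_sym Lm) h orbT.
have ratio j : (p < j)%N -> (j < q)%N -> (1 - e) * D j <= D j.+1 /\ (1 - e) * D j.+1 <= D j.
  move=> pj jq; have f := far j pj jq; have jn : (j < n)%N by exact: leq_trans jq qN.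
  have h1 := stepD j jn; have t1 := mtri (cen (x j)) (cen (x j.+1)) z; have t2 := mtri (cen (x j.+1)) (cen (x j)) z.
  rewrite [mdist (cen (x j.+1)) (cen (x j))]metric_sym in t1; rewrite -/(D j) -/(D j.+1) in t1 t2.
  have k0 := sV (lev (x j)).
  have h2 : C2 * s ^- lev (x j) <= e * D j.
    apply: le_trans (_ : e * B * s ^- lev (x j) <= _); first by rewrite ler_wpM2r // ltW.
    by rewrite -mulrA ler_pM2l // ltW.
  have D0 : 0 <= D j by exact: mdist_ge0.
  by move: h1 h2 t1 t2 e0 e1 D0; move: (D j) (D j.+1) (mdist _ _) (C2 * _) => a b m k; split; nra.
pose a := p.+1.
have aq : (a <= q)%N by exact: leq_trans pli iq.
have chainD b : (a <= b)%N -> (b <= q)%N -> (1 - e) ^+ (b - a) * D a <= D b /\ (1 - e) ^+ (b - a) * D b <= D a.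
  elim: b => [|b IH]; first by rewrite leqn0 => /eqP e'; exfalso; move: e'; rewrite /a.
  rewrite leq_eqVlt => /orP[/eqP<-|]; first by rewrite subnn expr0 !mul1r.
  rewrite ltnS => ab bq; have [h1 h2] := IH ab (ltnW bq); have [r1 r2] := ratio b ab bq.
  have eh : 0 <= 1 - e by move: e1; lra.
  rewrite subSn // exprS -!mulrA; split.
    by apply: le_trans r1; rewrite ler_wpM2l.
  apply: le_trans h2; rewrite mulrCA ler_wpM2l // exprn_ge0 //.
have [g1 g2] := chainD q aq (leqnn q).
set m := ((q - a) %/ A').+1; have mP := eP (q - a)%N; rewrite -/A' -/m in mP.
have Dpos b : 0 <= D b by exact: mdist_ge0.
have {}g1 : s ^- m * D a <= D q by apply: le_trans g1; rewrite ler_wpM2r.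
have {}g2 : s ^- m * D q <= D a by apply: le_trans g2; rewrite ler_wpM2r.
have sm : 0 < s ^+ m by rewrite exprn_gt0.
have sm1 : 1 <= s ^+ m by rewrite exprn_ege1 // ltW.
have {}g1 : D a <= s ^+ m * D q by rewrite -ler_pdivrMl.
have {}g2 : D q <= s ^+ m * D a by rewrite -ler_pdivrMl.
have pn' : (p < n)%N by exact: leq_trans pli iN.
have B'0 : 0 < B' by move: B1 B'B; lra.
have xa : D a <= B' * s ^- lev (x a).
  have [_ l2] := stepL p pn'; have [l1 _] := stepL p pn'.
  have h1 := stepD p pn'; have t1 := mtri (cen (x p)) (cen (x a)) z.
  rewrite [mdist (cen (x a)) (cen (x p))]metric_sym in t1.
  apply: le_trans t1 _; apply: le_trans (_ : (B + C2) * s ^- lev (x p) <= _); first by rewrite mulrDl addrC lerD.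
  by rewrite /B' -mulrA ler_wpM2l //; [move: B1 C20; lra|exact: sV_shift].
have xq : D q <= B' * s ^- lev (x q) by apply: le_trans qn _; rewrite ler_wpM2r // ltW.
have aiq : (a < q)%N.
  rewrite ltn_neqAle aq andbT; apply/eqP => aq'; have : (q <= i)%N by rewrite -aq'.
  move=> qi; have : near i by have -> : i = q by apply/eqP; rewrite eqn_leq iq qi.
  by move=> ni; have := pmax i; rewrite ni leqnn => /(_ isT); rewrite leqNgt pli.
have la : s ^- lev (x a) <= D a.
  by have := far a (leqnn _) aiq; have := sV (lev (x a)); move: B1; move: (s ^- _) (D a) => k Da; nra.
have lq : s ^- lev (x q) <= 2 * s ^+ L * D q.
  have q0 : (0 < q)%N by exact: leq_ltn_trans aiq.
  have qp : (p < q.-1)%N by rewrite -ltnS prednK.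
  have qq : (q.-1 < q)%N by rewrite prednK.
  have f := far q.-1 qp qq; have [r1 _] := ratio q.-1 qp qq; rewrite prednK // in r1.
  have qn1 : (q.-1 < n)%N by exact: leq_trans qq qN.
  have [l1 l2] := stepL q.-1 qn1; rewrite prednK // in l1 l2.
  have h := sV_shift l2; have k0 := sV (lev (x q.-1)).
  apply: le_trans h _; rewrite -mulrA mulrCA ler_pM2l ?exprn_gt0 //.
  have f2 : s ^- lev (x q.-1) <= D q.-1 by apply: le_trans (ltW f); rewrite ler_peMl // ltW.
  have f3 : 0 <= (2^-1 - e) * D q.-1 by rewrite mulr_ge0 // subr_ge0.
  by move: f2 f3 r1; move: (s ^- _) (D q.-1) (D q) => k u v; lra.
have lev1 : (lev (x a) <= lev (x q) + (U + m))%N.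
  apply: lev_of_sV; apply: le_trans lq _; rewrite exprD.
  apply: le_trans (_ : 2 * s ^+ L * (s ^+ m * (B' * s ^- lev (x a))) <= _).
    by rewrite ler_wpM2l // ?mulr_ge0 ?exprn_ge0 ?(ltW s0) //; apply: le_trans g2 _; rewrite ler_pM2l.
  have -> : 2 * s ^+ L * (s ^+ m * (B' * s ^- lev (x a))) = (2 * s ^+ L * B') * (s ^+ m * s ^- lev (x a)) by ring.
  by rewrite -[leRHS]mulrA ler_wpM2r // mulr_ge0 ?(ltW sm) // ltW.
have BU : B' <= s ^+ U by apply: le_trans UP; move: B'0 sL; nra.
have lev2 : (lev (x q) <= lev (x a) + (U + m))%N.
  apply: lev_of_sV; apply: le_trans la _; rewrite exprD.
  apply: le_trans g1 _; apply: le_trans (_ : s ^+ m * (B' * s ^- lev (x q)) <= _); first by rewrite ler_pM2l.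
  by rewrite mulrA mulrC [s ^+ U * _]mulrC [leRHS]mulrC ler_wpM2l ?(ltW (sV _)) // ler_wpM2l // ltW.
have dist1 : mdist (cen (x a)) (cen (x q)) <= s ^+ (U + m) * s ^- lev (x a).
  have t := mtri z (cen (x a)) (cen (x q)); rewrite [mdist z _]metric_sym -/(D a) -/(D q) in t.
  apply: le_trans t _; apply: le_trans (_ : 2 * s ^+ m * D a <= _).
    by move: g2 sm1 (Dpos a); move: (D a) (D q) (s ^+ m) => u v w; nra.
  rewrite exprD; apply: le_trans (_ : 2 * s ^+ m * (B' * s ^- lev (x a)) <= _).
    by rewrite ler_wpM2l // mulr_ge0 // ltW.
  have -> : 2 * s ^+ m * (B' * s ^- lev (x a)) = (2 * B') * (s ^+ m * s ^- lev (x a)) by ring.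
  rewrite -[leRHS]mulrA ler_wpM2r ?mulr_ge0 ?(ltW sm) ?(ltW (sV _)) //.
  by apply: le_trans UP; move: B'0 sL; nra.
have dq : (d (x a) (x q) <= 3 * U + 3 * m + 1)%N.
  have := near_pow lev1 lev2 dist1; rewrite mulnDr.
  by [].
have lwq := lw a q; rewrite aq qN in lwq; have {lwq}lwq := lwq isT.
have mdiv : (6 * A * ((q - a) %/ A') <= q - a)%N.
  by apply: leq_trans (leq_trunc_div (q - a) A'); rewrite mulnC leq_mul2l /A' leqnSn orbT.
have fin : (q - a <= T1)%N.
  have : (q - a <= A * (3 * U + 3 * m + 1) + A)%N by apply: leq_trans lwq _; rewrite leq_add2r leq_mul2l dq orbT.
  rewrite /T1 /m; move: mdiv; move: (_ %/ _)%N => t; clear; nia.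
by move: fin; rewrite /a; move: iq pli; clear; lia.
Qed.

End Morse.

Definition recenters (R : realType) (Z : metricType R) (X : hyperbolic_filling Z)
    (d : vertex X -> vertex X -> nat) (c : nat) (F : vertex X -> vertex X) (v : vertex X) :=
  (forall x y, (d (F x) (F y) <= d x y + c)%N /\ (d x y <= d (F x) (F y) + c)%N) /\
  (d (F v) (root X) <= c)%N.

Lemma discrete_ivt (f : nat -> nat) (n k L : nat) : (f 0 <= k + L)%N ->
  (forall i, (i < n)%N -> (f i.+1 <= f i + L)%N) -> (k <= f n)%N ->
  exists2 i, (i <= n)%N & (k <= f i <= k + L)%N.
Proof.
move=> f0; elim: n => [|n IH] st kn; first by exists 0%N; rewrite ?kn.
case: (leqP k (f n)) => h.
  have [|i iN iP] := IH _ h; first by move=> i ilt; apply: st; exact: leqW.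
  by exists i => //; exact: leqW.
exists n.+1 => //; rewrite kn /=; apply: leq_trans (st n (leqnn _)) _; rewrite leq_add2r; exact: ltnW.
Qed.

(** * Images under recentring maps *)

Section Image.
Variables (R : realType) (Z : metricType R) (X : hyperbolic_filling Z) (z0 : Z).
Hypothesis diam1 : forall x y : Z, mdist x y <= 1.
Notation V := (vertex X).
Let s := scale X.
Notation lev := (@level R Z X).
Notation cen := (@vcenter R Z X z0).
Variables (d : V -> V -> nat) (c : nat).
Hypothesis Lm : level_metric d c.
Notation rt := (root X).
Implicit Types (v w x y : V).

Let s1 : 1 < s := s_gt1 X.
Let s0 : 0 < s := s_gt0 X.
Let sV k : 0 < s ^- k := sV_gt0 X k.

Lemma step_lev (A : nat) v w : (d v w <= A)%N -> (lev w <= lev v + c * A.+1)%N.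
Proof. by move=> h; apply: leq_trans (lev_lip z0 diam1 Lm v w) _; rewrite leq_add2l leq_mul2l ltnS h orbT. Qed.

(** A geodesic from the root to [w] follows the centre of [w] by [morse] and passes the level of [v]
    at a vertex close to [v], so that [v] is almost on it. *)
Lemma level_add (B : R) : exists Rr : nat, forall v w, (lev v <= lev w)%N ->
  mdist (cen v) (cen w) <= B * s ^- lev v -> (d rt v + d v w <= d rt w + Rr)%N.
Proof.
have [B1 B10 B1P] := morse z0 diam1 Lm c.+1 1; pose L := (c * c.+2)%N.
have [R0 R0P] := near_dist z0 diam1 Lm (B + B1) L.
exists (R0 + R0 + c + c + 1)%N => v w vw dvw; have [x [x0 xn xd]] := lm_geodesic Lm rt w.
set n := (d rt w).+1 in xn xd.
have qg : quasigeodesic d c.+1 n x.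
  split=> [i iN|i j ij]; last by have [_ h] := xd i j ij; apply: leq_trans h _; nia.
  by have [h _] := xd i i.+1 (introT andP (conj (leqnSn i) iN)); apply: leq_trans h _; lia.
have mors i : (i <= n)%N -> mdist (cen (x i)) (cen w) <= B1 * s ^- lev (x i).
  apply: (B1P n x (cen w) qg).
    by rewrite x0 [lev rt]/= expr0 invr1 mulr1.
  by rewrite xn mdistxx mul1r ltW.
have [||| i iN /andP[l1 l2]] := @discrete_ivt (fun i => lev (x i)) n (lev v) L.
- by rewrite x0.
- by move=> i iN; apply: step_lev; apply: (proj1 qg).
- by rewrite xn.
have h : (d v (x i) <= R0)%N.
  apply: R0P => //; last by apply: leq_trans l1 _; exact: leq_addr.
  have := mors i iN; have := mtri (cen w) (cen v) (cen (x i)); rewrite [mdist (cen w) (cen (x i))]metric_sym.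
  have : B1 * s ^- lev (x i) <= B1 * s ^- lev v by rewrite ler_wpM2l ?sV_le // ltW.
  by rewrite mulrDl; move: dvw; lra.
have [a1 _] := xd 0%N i iN; have [a2 _] := xd i n (introT andP (conj iN (leqnn n))).
rewrite x0 subn0 in a1; rewrite xn in a2.
have t1 := lm_tri Lm rt (x i) v; have t2 := lm_tri Lm v (x i) w; rewrite (lm_sym Lm (x i) v) in t1.
have : (d rt v + d v w <= (i + c + R0) + (R0 + (n - i + c)))%N by apply: leq_add; [apply: leq_trans t1 _|apply: leq_trans t2 _]; apply: leq_add.
rewrite /n in iN *; move: iN; clear; lia.
Qed.

Lemma image_deep (L : nat) : exists T0 : nat, forall v F w, recenters d c F v ->
  (lev v + T0 <= lev w)%N -> (L <= lev (F w))%N.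
Proof.
exists (c * (L + 2 * c + 2).+1).+1 => v F w [Fd Fr] lw.
have h1 := lev_lip z0 diam1 Lm v w; have [_ h2] := Fd v w.
have h3 := lm_tri Lm (F v) rt (F w); have h4 := d_root z0 diam1 Lm (F w).
have h5 : (L + 2 * c + 2 <= d v w)%N.
  rewrite leqNgt; apply/negP => h; have : (c * (d v w).+1 <= c * (L + 2 * c + 2).+1)%N by rewrite leq_mul2l ltnS (ltnW h) orbT.
  by move: lw h1; clear; lia.
by move: h2 h3 h4 h5 Fr; clear; lia.
Qed.

Lemma root_lev F v : recenters d c F v -> (lev (F v) <= c * c.+1)%N.
Proof. by move=> [_ h]; rewrite (lm_sym Lm) in h; exact: step_lev h. Qed.

(** The image of the vertical path from [v] to [w] is a quasigeodesic that starts near the root,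
    because [F] recentres [v]. By [morse] its centres follow that of [F w]; the vertex [y] is taken
    where the image passes level [k]. *)
Lemma image_near (B : R) : exists2 B1 : R, 0 < B1 & exists L : nat, forall k, exists T0 : nat,
  forall v F w, recenters d c F v -> (c * c.+1 <= k)%N -> (lev v + T0 <= lev w)%N ->
  mdist (cen w) (cen v) <= B * s ^- lev v ->
  exists y, [/\ mdist (cen y) (cen w) <= (`|B| + 1) * s ^- lev y, (lev v <= lev y)%N, (k <= lev (F y) <= k + L)%N &
    mdist (cen (F y)) (cen (F w)) <= B1 * s ^- lev (F y)].
Proof.
pose Bb := `|B| + 1; have Bb1 : 1 <= Bb by rewrite lerDr.
have [r0 r0P] := near_dist z0 diam1 Lm (2 * Bb) 1.
pose A := (r0 + c + c * c.+1 + 1)%N; pose L := (c * A.+1)%N.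
have [B1 B10 B1P] := morse z0 diam1 Lm A (s ^+ (c * c.+1)).
exists B1 => //; exists L => k; have [T0 T0P] := image_deep k; exists T0.+1 => v F w Fv ck lw dvw; have [Fd Fr] := Fv.
pose T := (lev w - lev v)%N; have lvw : (lev v < lev w)%N by apply: leq_trans lw; rewrite addnS ltnS leq_addr.
pose y i := if i == 0%N then v else if (i < T)%N then xi X z0 diam1 (cen w) (lev v + i) else w.
have ylev i : (i <= T)%N -> lev (y i) = (lev v + i)%N.
  rewrite /y; case: eqP => [->|_ iT]; first by rewrite addn0.
  case: ltnP => h; first by rewrite lev_xi.
  by have -> : i = T by [apply/eqP; rewrite eqn_leq iT]; rewrite /T subnKC // ltnW.
have ynear i : (i <= T)%N -> mdist (cen (y i)) (cen w) <= Bb * s ^- lev (y i).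
  move=> iT; rewrite /y; case: eqP => [_|_].
    rewrite metric_sym; apply: le_trans dvw _; rewrite ler_wpM2r ?(ltW (sV _)) //.
    by apply: le_trans (ler_norm B) _; rewrite /Bb lerDl.
  case: ltnP => h; last by rewrite mdistxx mulr_ge0 ?(ltW (sV _)) //; move: Bb1; lra.
  rewrite metric_sym lev_xi; apply: le_trans (xi_near X z0 diam1 (cen w) (lev v + i)) _.
  by rewrite ler_peMl // ltW.
have ystep i : (i < T)%N -> (d (y i) (y i.+1) <= r0)%N.
  move=> iT; have e1 := ylev i (ltnW iT); have e2 := ylev i.+1 iT.
  apply: r0P; rewrite ?e1 ?e2; [|by rewrite addnS addn1|by rewrite -addnA leq_add2l addn1 leqW].
  have h1 := ynear _ (ltnW iT); have h2 := ynear _ iT; rewrite e1 in h1; rewrite e2 in h2.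
  have h3 : Bb * s ^- (lev v + i.+1) <= Bb * s ^- (lev v + i) by rewrite ler_wpM2l ?sV_le ?leq_add2l //; move: Bb1; lra.
  have := mtri (cen w) (cen (y i)) (cen (y i.+1)); rewrite [mdist (cen w) _]metric_sym.
  by move: h1 h2 h3; rewrite -mulrA; move: (_ * _) (Bb * _) => ? ?; lra.
have qg : quasigeodesic d A T (fun i => F (y i)).
  split=> [i iT|i j /andP[ij jT]].
    by have [h _] := Fd (y i) (y i.+1); apply: leq_trans h _; have := ystep i iT; rewrite /A; lia.
  have := lev_lip z0 diam1 Lm (y i) (y j); rewrite !ylev // ?(leq_trans ij jT) //.
  have [_ h] := Fd (y i) (y j) => h2.
  have h3 : (j - i <= c * (d (y i) (y j)).+1)%N by move: h2; clear; lia.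
  apply: leq_trans h3 _; apply: leq_trans (_ : c * (d (F (y i)) (F (y j)) + c).+1 <= _)%N.
    by rewrite leq_mul2l ltnS h orbT.
  by rewrite /A; move: (d (F _) _) => m; clear; nia.
have yT : y T = w.
  by rewrite /y ltnn; case: eqP => // /eqP; rewrite /T subn_eq0 leqNgt lvw.
have mors i : (i <= T)%N -> mdist (cen (F (y i))) (cen (F w)) <= B1 * s ^- lev (F (y i)).
  apply: (B1P T (fun i => F (y i)) (cen (F w)) qg).
    apply: le_trans (diam1 _ _) _; have := root_lev Fv; rewrite {1}/y /= => h.
    have := @sV_shift _ _ X 0 _ _ h; by rewrite expr0 invr1; apply: le_trans.
  by rewrite yT mdistxx mulr_ge0 ?exprn_ge0 ?(ltW (sV _)) ?(ltW s0).
have [||| i iN /andP[l1 l2]] := @discrete_ivt (fun i => lev (F (y i))) T k L.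
- apply: leq_trans (root_lev Fv) _; apply: leq_trans ck _; exact: leq_addr.
- by move=> i iT; apply: step_lev; apply: (proj1 qg).
- by rewrite yT; apply: T0P Fv _; apply: leq_trans lw; rewrite leq_add2l.
exists (y i); split => //; [exact: ynear|by rewrite ylev // leq_addr|by rewrite l1|exact: mors].
Qed.

(** Suppose that the images get close. On the vertical paths to [w1] and [w2] take vertices whose
    images pass level [k]; these images are close, hence so are the vertices. Since [w1] and [w2]
    are separated at the scale of [v], the vertices are only boundedly many levels below [v], where
    the images have bounded level, less than [k]. *)
Lemma separated_images (B b : R) : 0 < b -> exists T0 : nat, exists2 e : R, 0 < e & forall v F w1 w2,
  recenters d c F v -> (lev v + T0 <= lev w1)%N -> (lev v + T0 <= lev w2)%N ->
  mdist (cen w1) (cen v) <= B * s ^- lev v -> mdist (cen w2) (cen v) <= B * s ^- lev v ->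
  b * s ^- lev v <= mdist (cen w1) (cen w2) -> e <= mdist (cen (F w1)) (cen (F w2)).
Proof.
move=> b0; pose Bb := `|B| + 1; have Bb1 : 1 <= Bb by rewrite lerDr.
have [B1 B10 [L nearL]] := image_near B.
have [R0 R0P] := near_dist z0 diam1 Lm ((2 * B1 + 1) * s ^+ L) L.
have [K K0 KP] := cen_near z0 diam1 Lm (R0 + c); pose M := (c * (R0 + c).+1)%N.
have [U UP] := deep_dist z0 diam1 Lm (2 * Bb).
have [I IP] := spow_ge X ((Bb + K + Bb * s ^+ M) / b).
pose k := (c * c.+1 + c * (I + U + c).+1).+1; have [T0 T0P] := nearL k.
exists T0; exists (s ^- k) => // v F w1 w2 Fv l1 l2 vw1 vw2 far.
rewrite leNgt; apply/negP => close.
have ck : (c * c.+1 <= k)%N by rewrite /k leqW // leq_addr.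
have [y1 [y1w vy1 /andP[ky1 y1k] Fy1]] := T0P _ _ _ Fv ck l1 vw1.
have [y2 [y2w vy2 /andP[ky2 y2k] Fy2]] := T0P _ _ _ Fv ck l2 vw2.
have [Fd Fr] := Fv.
have dF : (d (F y1) (F y2) <= R0)%N.
  apply: R0P; [|by apply: leq_trans y2k _; rewrite leq_add2r|by apply: leq_trans y1k _; rewrite leq_add2r].
  apply: le_trans (_ : (2 * B1 + 1) * s ^- k <= _).
    have t1 := mtri (cen (F w1)) (cen (F y1)) (cen (F y2)); have t2 := mtri (cen (F w2)) (cen (F w1)) (cen (F y2)).
    rewrite [mdist (cen (F w2)) (cen (F y2))]metric_sym in t2.
    have f1 : B1 * s ^- lev (F y1) <= B1 * s ^- k by rewrite ler_wpM2l ?sV_le // ltW.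
    have f2 : B1 * s ^- lev (F y2) <= B1 * s ^- k by rewrite ler_wpM2l ?sV_le // ltW.
    rewrite mulrDl mul1r -mulrA; move: t1 t2 f1 f2 Fy1 Fy2 (ltW close); clear; lra.
  rewrite -mulrA ler_wpM2l //; first by move: B10; lra.
  exact: sV_shift.
have dy : (d y1 y2 <= R0 + c)%N by apply: leq_trans (proj2 (Fd _ _)) _; rewrite leq_add2r.
have ly : (lev y1 <= lev y2 + M)%N by apply: step_lev; rewrite (lm_sym Lm).
have h1 := KP _ _ dy; have h2 := sV_shift X ly; rewrite -/s in h2.
have h3 : b * s ^- lev v <= (Bb + K + Bb * s ^+ M) * s ^- lev y1.
  apply: le_trans far _; have t1 := mtri (cen y1) (cen w1) (cen w2); have t2 := mtri (cen y2) (cen y1) (cen w2).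
  rewrite [mdist (cen w1) (cen y1)]metric_sym in t1.
  have h4 : Bb * s ^- lev y2 <= Bb * s ^+ M * s ^- lev y1 by rewrite -mulrA ler_wpM2l //; move: Bb1; lra.
  move: t1 t2 h1 h4 y1w y2w; rewrite -/Bb -/s; clear; lra.
have lv : (lev y1 <= lev v + I)%N.
  apply: (@lev_of_sV _ _ X); rewrite -/s -(ler_pM2l b0); apply: le_trans h3 _.
  by rewrite mulrA ler_wpM2r ?(ltW (sV _)) // [b * _]mulrC -ler_pdivrMr.
have dv : (d v y1 <= I + U)%N.
  have : mdist (cen v) (cen y1) <= 2 * Bb * s ^- lev v.
    have h4 : Bb * s ^- lev y1 <= Bb * s ^- lev v by rewrite ler_wpM2l ?sV_le //; move: Bb1; lra.
    have h5 : B * s ^- lev v <= Bb * s ^- lev v by rewrite ler_wpM2r ?(ltW (sV _)) // (le_trans (ler_norm B)) // lerDl.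
    have := mtri (cen w1) (cen v) (cen y1); rewrite [mdist (cen v) (cen w1)]metric_sym [mdist (cen w1) (cen y1)]metric_sym.
    rewrite -mulrA; move: h4 h5 vw1 y1w; rewrite -/Bb; move: (Bb * _) (B * _) (Bb * _) => ? ? ?; lra.
  by move=> /(UP _ _ vy1) h; apply: leq_trans h _; rewrite leq_add2r leq_subLR.
have dFv : (d (F v) (F y1) <= I + U + c)%N by apply: leq_trans (proj1 (Fd _ _)) _; rewrite leq_add2r.
have := step_lev dFv; have := root_lev Fv; move: ky1; rewrite /k; clear; lia.
Qed.
End Image.

(** * Counting vertices *)

Lemma size_fibers (T T' : eqType) (f : T -> T') (S : seq T) (S' : seq T') (n : nat) :
  (forall x, x \in S -> f x \in S') -> (forall y, (size [seq x <- S | f x == y] <= n)%N) ->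
  (size S <= size S' * n)%N.
Proof.
elim: S' S => [|y S' IH] S fS fib.
  by case: S fS {fib} => // x S /(_ x); rewrite mem_head => /(_ isT).
rewrite /= mulSn -(count_predC (fun x => f x == y)) leq_add //; first by rewrite -size_filter.
rewrite -size_filter; apply: IH => [x|z].
  by rewrite mem_filter => /andP[/= fy /fS]; rewrite inE (negbTE fy).
apply: leq_trans (fib z); rewrite !size_filter count_filter; apply: sub_count => x /= /andP[] //.
Qed.

(** A longest list without repetition of elements of [P] contains all of them. *)
Lemma bounded_enum (T : eqType) (P : T -> Prop) (n : nat) :
  (forall S : seq T, uniq S -> (forall x, x \in S -> P x) -> (size S <= n)%N) ->
  exists S : seq T, [/\ uniq S, forall x, x \in S <-> P x & (size S <= n)%N].
Proof.
move=> bd; pose Q m := exists S : seq T, [/\ uniq S, forall x, x \in S -> P x & size S = m].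
have exQ : exists m, `[< Q m >] by exists 0%N; apply/asboolP; exists [::].
have bQ m : `[< Q m >] -> (m <= n)%N by move=> /asboolP[S [uS SP <-]]; exact: bd.
case: (ex_maxnP exQ bQ) => m /asboolP[S [uS SP sS]] mmax.
exists S; split=> // [x|]; last exact: bd.
split=> [|Px]; first exact: SP.
apply/negPn/negP => xS; have : (m.+1 <= m)%N; last by rewrite ltnn.
apply: mmax; apply/asboolP; exists (x :: S); split => //=; [by rewrite xS| |by rewrite sS].
by move=> y; rewrite inE => /orP[/eqP->|/SP].
Qed.

Section Count.
Variables (R : realType) (Z : metricType R) (X : hyperbolic_filling Z) (z0 : Z).
Hypothesis diam1 : forall x y : Z, mdist x y <= 1.
Notation V := (vertex X).
Let s := scale X.
Notation lev := (@level R Z X).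
Notation cen := (@vcenter R Z X z0).
Variables (d : V -> V -> nat) (c : nat).
Hypothesis Lm : level_metric d c.
Hypothesis dbl : doubling Z.
Notation rt := (root X).
Implicit Types (v w x y : V).

Let s1 : 1 < s := s_gt1 X.
Let s0 : 0 < s := s_gt0 X.
Let sV k : 0 < s ^- k := sV_gt0 X k.

Lemma level_ball_count (t : R) : exists N : nat, forall (z : Z) k (S : seq V), uniq S ->
  (forall v, v \in S -> lev v = k /\ mdist (cen v) z <= t * s ^- k) -> (size S <= N)%N.
Proof.
have [N NP] := dbl t; exists N => z k S uS SP; rewrite -(size_map cen).
have sep u v : u \in S -> v \in S -> u <> v -> s ^- k <= mdist (cen u) (cen v).
  move=> /SP[uk _] /SP[vk _] uv; rewrite -uk; apply: level_separated => //; by rewrite uk.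
apply: (NP z (s ^- k)) => //.
- rewrite map_inj_in_uniq // => u v uS' vS uv; apply: contrapT => /(sep _ _ uS' vS).
  by rewrite uv mdistxx leNgt sV.
- move=> _ _ /mapP[u uS' ->] /mapP[v vS ->] uv; apply: sep => // e; by rewrite e eqxx in uv.
- by move=> _ /mapP[u uS' ->]; have [_] := SP u uS'.
Qed.

(** Every vertex of level [k.+1] has a parent of level [k], and a parent has at most [N]
    children. *)
Lemma level_enum : exists N : nat, forall k, exists S : seq V,
  [/\ uniq S, forall v, v \in S <-> lev v = k & (size S <= N ^ k)%N].
Proof.
have [N NP] := level_ball_count s; exists N; elim=> [|k [S [uS SP sS]]].
  exists [:: rt]; split => // v; rewrite inE; split => [/eqP-> //|/level0 ->]; exact: eqxx.
apply: bounded_enum => S' uS' S'P.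
pose f v := xi X z0 diam1 (cen v) k.
apply: leq_trans (_ : size S * N <= _)%N; last by rewrite expnSr leq_mul2r sS orbT.
apply: (@size_fibers _ _ f) => [v /S'P vk|y].
  by apply/SP; rewrite /f lev_xi.
apply: (NP (cen y) k.+1); first exact: filter_uniq.
move=> v; rewrite mem_filter => /andP[/eqP fy /S'P vk]; split=> //.
by rewrite -/s sVS -fy; apply: xi_near.
Qed.

Lemma upto_enum : exists N : nat, forall n, exists S : seq V,
  [/\ uniq S, forall v, v \in S <-> (d rt v <= n)%N & (size S <= N ^ n.+1)%N].
Proof.
have [N NP] := level_enum; exists ((2 * N.+1) ^ c.+1)%N => n.
pose m := (c * n.+1)%N.
apply: bounded_enum => S uS SP.
have lm v : v \in S -> (lev v <= m)%N by move=> /SP h; have := step_lev z0 diam1 Lm h.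
have sz : (size S <= m.+1 * N.+1 ^ m)%N.
  rewrite -(size_iota 0 m.+1); apply: (@size_fibers _ _ lev) => [v /lm vm|k].
    by rewrite mem_iota add0n ltnS vm.
  have [T [uT TP sT]] := NP k; case: (leqP k m) => km.
    have Nk : (N ^ k <= N.+1 ^ m)%N.
      by apply: leq_trans (leq_pexp2l (ltn0Sn N) km); case: k {TP sT km} => // k; rewrite leq_exp2r.
    apply: leq_trans (leq_trans sT Nk); apply: uniq_leq_size; first exact: filter_uniq.
    by move=> v; rewrite mem_filter => /andP[/eqP vk _]; apply/TP.
  suff -> : [seq x <- S | lev x == k] = [::] by [].
  apply/eqP; rewrite -[_ == _]negbK -has_filter; apply/negP => /hasP[v /lm vm /eqP vk].
  by move: km; rewrite -vk ltnNge vm.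
apply: leq_trans sz _; apply: leq_trans (_ : 2 ^ m.+1 * N.+1 ^ m.+1 <= _)%N.
  by apply: leq_mul; [exact: ltnW (ltn_expl _ _)|exact: leq_pexp2l].
by rewrite -expnMn -expnM leq_pexp2l // mulSn /m -[X in (X <= _)%N]add1n leq_add.
Qed.

Lemma near_enum (A : nat) : exists N : nat, forall y, exists S : seq V,
  [/\ uniq S, forall x, x \in S <-> (d x y <= A)%N & (size S <= N)%N].
Proof.
pose L := (c * A.+1)%N; have [K K0 KP] := cen_near z0 diam1 Lm A.
have [N NP] := level_ball_count (K * s ^+ L); exists ((2 * L).+1 * N)%N => y.
apply: bounded_enum => S uS SP.
rewrite -(size_iota (lev y - L) (2 * L).+1); apply: (@size_fibers _ _ lev) => [v /SP vy|k].
  have h1 := step_lev z0 diam1 Lm vy; rewrite (lm_sym Lm) in vy; have h2 := step_lev z0 diam1 Lm vy.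
  by rewrite mem_iota -/L in h1 h2 *; move: h1 h2; clear; lia.
apply: (NP (cen y) k); first exact: filter_uniq.
move=> v; rewrite mem_filter => /andP[/eqP vk /SP vy]; split=> //.
rewrite (lm_sym Lm) in vy; rewrite metric_sym; apply: le_trans (KP _ _ vy) _.
by rewrite -mulrA ler_wpM2l ?(ltW K0) // sV_shift // -vk; exact: step_lev vy.
Qed.
End Count.

(** * Weights on the vertices *)

Lemma sum_subset (R : realType) (T : eqType) (h : T -> R) (l l' : seq T) : (forall x, 0 <= h x) ->
  uniq l -> {subset l <= l'} -> \sum_(x <- l) h x <= \sum_(x <- l') h x.
Proof.
move=> h0; elim: l l' => [|x l IH] l' /=; first by rewrite big_nil sumr_ge0.
move=> /andP[xl ul] ll'; have xl' : x \in l' by apply: ll'; rewrite mem_head.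
rewrite (perm_big _ (perm_to_rem xl')) !big_cons lerD2l; apply: IH => // y yl.
have : y \in x :: rem x l' by rewrite -(perm_mem (perm_to_rem xl')); apply: ll'; rewrite inE yl orbT.
by rewrite inE => /orP[/eqP yx|//]; rewrite -yx yl in xl.
Qed.

Lemma metric_ball_open (R : realType) (Z : metricType R) (x : Z) (r : R) : open (ball x r).
Proof.
rewrite openE => y; rewrite ballEmdist /= => xy; apply/nbhs_ballP.
exists (r - mdist x y) => [|z]; first by rewrite /= subr_gt0.
rewrite !ballEmdist /= => yz; have := mtri y x z; move: yz; lra.
Qed.

Section Weights.
Variables (R : realType) (Z : metricType R) (X : hyperbolic_filling Z).
Notation V := (vertex X).

Definition weak_square (t0 : V -> R) := (forall x, 0 <= t0 x) /\ exists2 C : R, 0 < C &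
  forall lam, 0 < lam -> forall S : seq V, uniq S -> (forall x, x \in S -> lam < t0 x) -> (size S)%:R <= C / lam ^+ 2.

(** A bi-infinite path is split at [0] into two rays. That its weight is at least [1] is expressed
    through the bounds [B] of its partial sums, which avoids infinite sums. *)
Definition crossing_weight (t0 : V -> R) (e : R) := forall (r l : nat -> V) a b B,
  (forall i, adjacent (r i) (r i.+1)) -> (forall i, adjacent (l i) (l i.+1)) -> r 0 = l 0 ->
  path_converges l a -> path_converges r b -> e <= mdist a b ->
  (forall N, \sum_(i <- iota 0 N) t0 (r i) + \sum_(i <- iota 0 N) t0 (l i) <= B) -> 1 <= B.

Section VertexSup.
Variables (tau : edge X -> R) (C : R).
Hypothesis tau0 : forall e, 0 <= tau e.
Hypothesis C0 : 0 < C.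
Hypothesis wk : forall lam, 0 < lam -> (counting [set e | (lam < tau e)%R] <= (C / lam ^+ 2)%:E)%E.

Lemma edge_count lam (E : seq (edge X)) : 0 < lam -> uniq E -> (forall e, e \in E -> lam < tau e) ->
  (size E)%:R <= C / lam ^+ 2.
Proof.
move=> l0 uE EP; have := wk l0; rewrite /counting; case: asboolP => // fin.
rewrite lee_fin; apply: le_trans; rewrite ler_nat; apply: uniq_leq_size => // e /EP h.
by rewrite in_fset_set // inE.
Qed.

Lemma tau_bounded : forall e, tau e <= C + 1.
Proof.
move=> e; rewrite leNgt; apply/negP => h.
have c1 : 0 < C + 1 by move: C0; lra.
have := @edge_count (C + 1) [:: e] c1 isT.
have P : forall e0 : edge X, e0 \in [:: e] -> C + 1 < tau e0 by move=> e0; rewrite inE => /eqP->.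
move=> /(_ P); rewrite ler_pdivlMr ?exprn_gt0 // mul1r expr2; move: C0; nra.
Qed.

(** The element [0] keeps the set nonempty even without edges at [x]. *)
Definition vsup (x : V) : R := sup ([set tau e | e in [set e | sval e x]] `|` [set 0]).

Lemma vsup_has x : has_sup ([set tau e | e in [set e | sval e x]] `|` [set 0]).
Proof.
split; first by exists 0; right.
exists (C + 1) => _ [[e _ <-]|->]; [exact: tau_bounded|by move: C0; lra].
Qed.

Lemma vsup_ge0 x : 0 <= vsup x.
Proof. by apply: ub_le_sup; [exact: (proj2 (vsup_has x))|right]. Qed.

Lemma vsup_ge x e : sval e x -> tau e <= vsup x.
Proof. by move=> ex; apply: ub_le_sup; [exact: (proj2 (vsup_has x))|left; exists e]. Qed.

(** Each vertex chooses an edge of large weight, and an edge is chosen by at most its two ends. *)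
Lemma vsup_count lam (S : seq V) : 0 < lam -> uniq S -> (forall x, x \in S -> lam < vsup x) ->
  (size S)%:R <= 2 * C / lam ^+ 2.
Proof.
move=> l0 uS SP.
have ex' x : x \in S -> exists e : edge X, sval e x /\ lam < tau e.
  move=> xS; have [_ [[e ex <-]|->] h] := sup_gt (proj1 (vsup_has x)) (SP x xS); first by exists e.
  by move: h; rewrite ltNge (ltW l0).
have [->|[y yS]] : S = [::] \/ exists y, y \in S.
  by case: (S) => [|y S']; [left|right; exists y; rewrite mem_head].
  by rewrite mulr_ge0 ?invr_ge0 ?exprn_ge0 ?mulr_ge0 // ltW.
have [e0 _] := ex' y yS.
have ex x : exists e : edge X, x \in S -> sval e x /\ lam < tau e.
  case: (pselect (x \in S)) => [/ex'[e eP]|nx]; first by exists e.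
  by exists e0 => /nx.
have [f fP] := choice ex.
have h1 : (size S <= size (undup (map f S)) * 2)%N.
  apply: (@size_fibers _ _ f) => [x xS|e]; first by rewrite mem_undup map_f.
  have [u [v [_ euv]]] := svalP e.
  apply: (@uniq_leq_size _ _ [:: u; v]); first exact: filter_uniq.
  move=> x; rewrite mem_filter => /andP[/eqP fx /fP[h _]].
  by move: h; rewrite fx euv /= !inE => -[->|->]; rewrite eqxx ?orbT.
have h2 : (size (undup (map f S)))%:R <= C / lam ^+ 2.
  apply: edge_count => //; first exact: undup_uniq.
  by move=> e; rewrite mem_undup => /mapP[x /fP[_ h] ->].
apply: le_trans (_ : (size (undup (map f S)) * 2)%:R <= _); first by rewrite ler_nat.
by rewrite natrM mulrC -mulrA ler_pM2l.
Qed.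
End VertexSup.

Lemma wcap_weight (A B : set Z) : (wcap X 2 A B < +oo)%E -> exists tau C, [/\ admissible A B tau, 0 < C &
  forall lam, 0 < lam -> (counting [set e : edge X | (lam < tau e)%R] <= (C / lam ^+ 2)%:E)%E].
Proof.
move=> /ereal_inf_lt[_ [tau adm <-] fin].
have : (weak_norm 2 tau < +oo)%E.
  rewrite ltey; apply/eqP => e; move: fin; rewrite e poweRyr ?ltxx //.
move=> /ereal_inf_lt[_ [C [C0 CP] <-] _].
exists tau, (C `^ 2); split => //; first exact: powR_gt0.
by move=> lam l0; have := CP lam l0; rewrite [lam `^ 2]powR_mulrn // ltW.
Qed.

Variables (z0 : Z).
Hypothesis diam1 : forall x y : Z, mdist x y <= 1.
Hypothesis dbl : doubling Z.
Let s := scale X.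
Notation lev := (@level R Z X).
Notation cen := (@vcenter R Z X z0).

Lemma bi_sum (r l : nat -> V) (g : int -> R) (t0 : V -> R) (A : seq int) (B : R) : uniq A ->
  (forall k, 0 <= g k) -> (forall x, 0 <= t0 x) ->
  (forall n, g (Posz n) <= t0 (r n)) -> (forall n, g (Negz n) <= t0 (l n)) ->
  (forall N, \sum_(i <- iota 0 N) t0 (r i) + \sum_(i <- iota 0 N) t0 (l i) <= B) ->
  \sum_(k <- A) g k <= B.
Proof.
move=> uA g0 t00 gr gl bd; pose N := (\max_(k <- A) absz k).+1.
have kN k : k \in A -> (absz k < N)%N by move=> kA; rewrite ltnS; apply: leq_bigmax_seq.
apply: le_trans (bd N); apply: le_trans (_ : \sum_(k <- map Posz (iota 0 N) ++ map Negz (iota 0 N)) g k <= _).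
  apply: sum_subset => //; case=> n /kN nA; rewrite mem_cat; apply/orP.
    by left; apply/mapP; exists n => //; rewrite mem_iota.
  by right; apply/mapP; exists n => //; rewrite mem_iota; exact: ltnW nA.
by rewrite big_cat !big_map; apply: lerD; apply: ler_sum.
Qed.

Lemma admissible_bi (A B : set Z) (tau : edge X -> R) (t0 : V -> R) (r l : nat -> V) a b M :
  admissible A B tau -> (forall x, 0 <= t0 x) -> (forall e x, sval e x -> tau e <= t0 x) ->
  (forall i, adjacent (r i) (r i.+1)) -> (forall i, adjacent (l i) (l i.+1)) -> r 0 = l 0 ->
  path_converges l a -> path_converges r b -> A a -> B b ->
  (forall N, \sum_(i <- iota 0 N) t0 (r i) + \sum_(i <- iota 0 N) t0 (l i) <= M) -> 1 <= M.
Proof.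
move=> [tau0 adm] t00 tt0 rr ll rl la rb Aa Bb bd.
(* [Negz n] is [- (n + 1)], hence the shift in [l]; the common start belongs to [r]. *)
pose pv (k : int) := match k with Posz n => r n | Negz n => l n.+1 end.
have pe (k : int) : exists e : edge X, sval e = [set pv k; pv (k + 1)].
  have adj : adjacent (pv k) (pv (k + 1)).
    case: k => [n|[|n]]; first by have -> : (Posz n + 1)%R = Posz n.+1 by [lia]; exact: rr.
      by rewrite /= rl; apply: adjacent_sym; exact: ll.
    by have -> : Negz n.+1 + 1 = Negz n by [lia]; apply: adjacent_sym; exact: ll.
  have ise : is_edge [set pv k; pv (k + 1)] by exists (pv k), (pv (k + 1)).
  by exists (exist _ _ ise).
have [pe' pe'E] := choice pe.
pose g := BiinfinitePath pe'E.
have joins : path_joins g A B.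
  exists a, b; split; last by left.
  split; last exact: rb.
  have -> : (fun n : nat => pvertex g (- n%:Z)) = l; last exact: la.
  by apply/funext => -[|n] /=; [rewrite rl|].
have := adm g joins => h; have : ((\esum_(k in [set: int]) (tau (pedge g k))%:E) <= M%:E)%E.
  apply: ub_ereal_sup => _ [F [finF _] <-].
  rewrite fsbig_finite // sumEFin lee_fin; apply: (@bi_sum r l _ t0) => //; first exact: finmap.fset_uniq.
  - by move=> n; apply: tt0; rewrite pe'E; left.
  - case=> [|n]; apply: tt0; rewrite pe'E; right.
      by have -> : Negz 0 + 1 = 0 by [lia]; rewrite /= rl.
    by have -> : Negz n.+1 + 1 = Negz n by [lia].
by move=> h2; have := le_trans h h2; rewrite lee_fin.
Qed.

(** The centres of one fine level give finitely many separated pairs of balls of radius [e / 8].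
    Limits at distance at least [e] lie in the balls of such a pair, whose weight is a summand of
    [t0]. *)
Lemma weights_exist (e : R) : 0 < e -> (forall A B, positively_separated A B -> (wcap X 2 A B < +oo)%E) ->
  exists2 t0, weak_square t0 & crossing_weight t0 e.
Proof.
move=> e0 fin; have [k kP] := spow_ge X (16 / e).
have sk0 := sV_gt0 X k.
have ske : s ^- k <= e / 16.
  by rewrite -[leRHS]invf_div lef_pV2 ?posrE ?exprn_gt0 ?divr_gt0 // s_gt0.
have [N NP] := level_enum X z0 diam1 dbl; have [S [uS SP _]] := NP k.
pose P := [seq p <- [seq (u, v) | u <- S, v <- S] | e / 2 <= mdist (cen p.1) (cen p.2)].
have ex (p : V * V) : exists tC : (edge X -> R) * R, e / 2 <= mdist (cen p.1) (cen p.2) ->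
    [/\ admissible (ball (cen p.1) (e / 8)) (ball (cen p.2) (e / 8)) tC.1, 0 < tC.2 &
    forall lam, 0 < lam -> (counting [set x : edge X | (lam < tC.1 x)%R] <= (tC.2 / lam ^+ 2)%:E)%E].
  case: (leP (e / 2) (mdist (cen p.1) (cen p.2))) => h; last by exists (fun=> 0, 0).
  have [|t [C [h1 h2 h3]]] := @wcap_weight (ball (cen p.1) (e / 8)) (ball (cen p.2) (e / 8)); last by exists (t, C).
  apply: fin; split.
  - exact: metric_ball_open.
  - exact: metric_ball_open.
  - by exists (cen p.1); apply: ballxx; lra.
  - by exists (cen p.2); apply: ballxx; lra.
  apply: lt_le_trans (_ : e / 4 <= _); first by lra.
  apply: lb_le_inf.
    by exists (mdist (cen p.1) (cen p.2)); exists (cen p.1); [apply: ballxx; lra|exists (cen p.2) => //; apply: ballxx; lra].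
  move=> _ [a + [b + <-]]; rewrite !ballEmdist /= => ha hb.
  have := mtri a (cen p.1) (cen p.2); have := mtri b a (cen p.2); rewrite [mdist b _]metric_sym; lra.
have [tC tCP] := choice ex.
have PP p : p \in P -> e / 2 <= mdist (cen p.1) (cen p.2) by rewrite mem_filter => /andP[].
pose m p := vsup (tC p).1.
have m0 p x : p \in P -> 0 <= m p x by move=> /PP/tCP[[t0 _] C0 h]; apply: (vsup_ge0 C0 h).
pose t0 x := \sum_(p <- P) m p x.
exists t0.
  split=> [x|]; first by rewrite /t0 big_seq sumr_ge0 // => p /m0.
  pose n := (size P).+1%:R : R; have n0 : 0 < n by rewrite ltr0Sn.
  pose D := \sum_(p <- P) (2 * (tC p).2).
  have D0 : 0 <= D by rewrite /D big_seq sumr_ge0 // => p /PP/tCP[_ C0 _]; rewrite mulr_ge0 // ltW.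
  exists (D * n ^+ 2 + 1); first by rewrite ltr_wpDl // mulr_ge0 // exprn_ge0 // ltW.
  (* A sum of at most [n] terms that exceeds [lam] has a term exceeding [lam / n]. *)
  move=> lam l0 T uT TP; pose mu := lam / n; have mu0 : 0 < mu by rewrite divr_gt0.
  have big x : x \in T -> 1 <= \sum_(p <- P) (mu < m p x)%R%:R :> R.
    move=> /TP; rewrite leNgt; apply: contraL => small; rewrite -leNgt /t0.
    have no p : p \in P -> m p x <= mu.
      move=> pP; rewrite leNgt; apply/negP => h; move: small; rewrite ltNge => /negP; apply.
      by rewrite (perm_big _ (perm_to_rem pP)) big_cons h lerDl sumr_ge0.
    apply: le_trans (_ : \sum_(p <- P) mu <= _); first by rewrite big_seq [leRHS]big_seq; exact: ler_sum.
    rewrite big_const_seq count_predT iter_addr_0 -mulr_natr /mu mulrAC ler_pdivrMr // ler_pM2l //.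
    by rewrite /n ler_nat.
  apply: le_trans (_ : \sum_(p <- P) \sum_(x <- T) (mu < m p x)%R%:R <= _).
    rewrite exchange_big -sum1_size natr_sum big_seq [leRHS]big_seq; exact: ler_sum.
  apply: le_trans (_ : \sum_(p <- P) (2 * (tC p).2) / mu ^+ 2 <= _).
    rewrite big_seq [leRHS]big_seq; apply: ler_sum => p /PP/tCP[[tau0 _] C0 wk].
    have := @vsup_count (tC p).1 _ C0 wk mu [seq x <- T | (mu < m p x)%R] mu0 (filter_uniq _ uT).
    rewrite size_filter -sum1_count natr_sum big_mkcond /= => h; apply: le_trans (h _).
      by apply: ler_sum => x _; case: ifP.
    by move=> x; rewrite mem_filter => /andP[].
  rewrite -mulr_suml -/D /mu expr_div_n invf_div mulrA ler_pM2r ?invr_gt0 ?exprn_gt0 //.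
  by rewrite lerDl.
move=> r l a b B rr ll rl la rb ab bd.
pose p := (xi X z0 diam1 a k, xi X z0 diam1 b k).
have na := xi_near X z0 diam1 a k; have nb := xi_near X z0 diam1 b k.
have pe : e / 2 <= mdist (cen p.1) (cen p.2).
  have := mtri (cen p.1) a b; have := mtri (cen p.2) (cen p.1) b; rewrite [mdist (cen p.2) b]metric_sym /=.
  move: na nb ske ab e0; rewrite /s; lra.
have pP : p \in P.
  rewrite mem_filter pe /=; apply/allpairsP; exists p; split => //; apply/SP; exact: lev_xi.
have [adm C0 wk] := tCP p pe; have [tau0 _] := adm.
apply: (@admissible_bi _ _ _ t0 r l a b B adm) => //.
- by move=> x; rewrite /t0 big_seq sumr_ge0 // => q /m0.
- move=> x v xv; apply: le_trans (vsup_ge C0 wk xv) _.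
  rewrite /t0 (perm_big _ (perm_to_rem pP)) big_cons lerDl big_seq sumr_ge0 // => q /mem_rem; exact: m0.
- by rewrite ballEmdist /= metric_sym; apply: le_lt_trans na _; move: ske e0; rewrite /s; lra.
- by rewrite ballEmdist /= metric_sym; apply: le_lt_trans nb _; move: ske e0; rewrite /s; lra.
Qed.

End Weights.

(** * Descending paths of small weight *)

(** Otherwise the points at distance less than [t] from [x] would form an open and closed set. *)
Lemma exists_at_distance (R : realType) (Z : metricType R) (x y : Z) (t : R) :
  connected [set: Z] -> 0 <= t -> t <= mdist x y -> exists z, mdist x z = t.
Proof.
move=> cZ t0 txy; apply: contrapT => no.
have ne z : mdist x z != t by apply/eqP => h; apply: no; exists z.
have : mdist x y < t; last by rewrite ltNge txy.
apply: (connected_locally (E := [set: Z]) (P := fun z => mdist x z < t) (x := x)) => //.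
  by rewrite mdistxx lt_neqAle t0 andbT; have := ne x; rewrite mdistxx.
move=> u _; exists `|mdist x u - t|; first by rewrite normr_gt0 subr_eq0 ne.
move=> v _ uv; have h1 := mtri u x v; have h2 := mtri v x u; rewrite [mdist v u]metric_sym in h2.
case: (ltgtP (mdist x u) t) => h; last by move: (ne u); rewrite h eqxx.
  by split=> // _; move: uv; rewrite ltr0_norm ?subr_lt0 //; lra.
by split=> // h3; exfalso; move: uv; rewrite gtr0_norm ?subr_gt0 //; lra.
Qed.

Lemma cauchy_limit (R : realType) (Z : metricType R) (u : nat -> Z) (r : nat -> R) : compact [set: Z] ->
  (forall n m, (n <= m)%N -> mdist (u n) (u m) <= r n) -> exists a, forall n, mdist (u n) a <= r n.
Proof.
move=> cZ h; have [|a [_ ca]] := cZ (u @ \oo) _; first exact: filterT.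
exists a => n; apply/ler_addgt0Pr => e e0.
have [|y [[m /= nm um] ya]] := ca [set y | exists2 m, (n <= m)%N & u m = y] (ball a e) _ (nbhsx_ballx a e e0).
  by exists n => // m /= nm; exists m.
move: ya; rewrite ballEmdist /= -um => ya; have := h n m nm; have := mtri (u m) (u n) a.
by rewrite [mdist (u m) a]metric_sym; move: ya; lra.
Qed.

Lemma sum_geometric (R : realType) (h N : nat) : (0 < h)%N ->
  \sum_(i <- iota 0 N) (2 : R) ^- (i %/ h) <= 2 * h%:R.
Proof.
move=> h0; have pos i : 0 <= (2 : R) ^- (i %/ h) by rewrite invr_ge0 exprn_ge0.
apply: le_trans (_ : \sum_(i <- iota 0 (N * h)) (2 : R) ^- (i %/ h) <= _).
  apply: (sum_subset (h := fun i => 2 ^- (i %/ h))) => //; first exact: iota_uniq.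
  by move=> i; rewrite !mem_iota /= !add0n => iN; apply: leq_trans iN _; rewrite leq_pmulr.
have : \sum_(i <- iota 0 (N * h)) (2 : R) ^- (i %/ h) <= 2 * h%:R - 2 * h%:R * 2 ^- N.
  elim: N => [|N IH]; first by rewrite mul0n big_nil expr0 invr1 mulr1 subrr.
  rewrite mulSn addnC iotaD big_cat /= add0n.
  have -> : \sum_(i <- iota (N * h) h) (2 : R) ^- (i %/ h) = h%:R * 2 ^- N.
    rewrite (eq_big_seq (fun=> 2 ^- N)); last first.
      move=> i; rewrite mem_iota => /andP[i1 i2]; congr (2 ^- _).
      by apply/eqP; rewrite eqn_leq leq_divRL // i1 andbT -ltnS ltn_divLR // mulSn addnC.
    by rewrite big_const_seq count_predT size_iota iter_addr_0 mulr_natl.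
  have e : (2 : R) ^- N = 2 * 2 ^- N.+1 by rewrite exprS invfM mulrA divff // mul1r.
  by move: IH; rewrite e; move: (2 ^- N.+1) => q; lra.
move=> h1; apply: le_trans h1 _; rewrite gerDl oppr_le0 !mulr_ge0 // invr_ge0 exprn_ge0 //.
Qed.

Section Tails.
Variables (R : realType) (Z : metricType R) (X : hyperbolic_filling Z) (z0 : Z).
Hypothesis diam1 : forall x y : Z, mdist x y <= 1.
Notation V := (vertex X).
Let s := scale X.
Notation lev := (@level R Z X).
Notation cen := (@vcenter R Z X z0).
Implicit Types (v w x y : V).
Variable t0 : V -> R.
Hypothesis t0w : weak_square t0.

Let s1 : 1 < s := s_gt1 X.
Let s0 : 0 < s := s_gt0 X.
Let sV k : 0 < s ^- k := sV_gt0 X k.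
Let t0_ge0 x : 0 <= t0 x := proj1 t0w x.

Lemma weight_bounded : exists2 M : R, 0 < M & forall x, t0 x <= M.
Proof.
have [_ [C C0 CP]] := t0w; exists (C + 1); first by move: C0; lra.
move=> x; rewrite leNgt; apply/negP => h.
have c1 : 0 < C + 1 by move: C0; lra.
have P : forall y, y \in [:: x] -> C + 1 < t0 y by move=> y; rewrite inE => /eqP->.
have := CP _ c1 [:: x] isT P; rewrite ler_pdivlMr ?exprn_gt0 // mul1r expr2; move: C0; nra.
Qed.

(** Dyadic decomposition: by the weak bound the number of values between [M * 2 ^- i.+1] and
    [M * 2 ^- i] is inversely proportional to their square, which leaves the power [q] of [2 ^- i].
    Values up to [M * 2 ^- m] are counted trivially. *)
Lemma layered_sum (q : nat) : exists C M : R, [/\ 0 < C, 0 < M, forall x, t0 x <= M & forall (S : seq V) m, uniq S ->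
  \sum_(x <- S) t0 x ^+ q.+2 <= C * \sum_(i < m) (2 ^- i) ^+ q + (size S)%:R * (M * 2 ^- m) ^+ q.+2].
Proof.
have [M M0 MP] := weight_bounded; have [_ [C C0 CP]] := t0w.
exists (4 * C * M ^+ q), M; split=> //; first by rewrite !mulr_gt0 // exprn_gt0.
have g0 i : 0 < M * 2 ^- i by rewrite mulr_gt0 // invr_gt0 exprn_gt0.
move=> S m uS; rewrite (bigID (fun x => M * 2 ^- m < t0 x)) /=; apply: lerD; last first.
  apply: le_trans (_ : \sum_(x <- S) (M * 2 ^- m) ^+ q.+2 <= _).
    rewrite big_mkcond; apply: ler_sum => x _; case: ifPn => [|_]; last exact: exprn_ge0 (ltW (g0 m)).
    by rewrite -leNgt => xm; apply: lerXn2r; rewrite ?nnegrE ?t0_ge0 // ltW.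
  by rewrite big_const_seq count_predT iter_addr_0 mulr_natl.
elim: m => [|m IH].
  by rewrite big1 ?big_ord0 ?mulr0 // => x; rewrite expr0 invr1 mulr1 ltNge MP.
rewrite (bigID (fun x => M * 2 ^- m < t0 x)) big_ord_recr /= mulrDr; apply: lerD.
  apply: le_trans IH; rewrite big_mkcond [leRHS]big_mkcond; apply: ler_sum => x _.
  by case: ifP => [/andP[_ ->] //|_]; case: ifP => // _; exact: exprn_ge0.
pose S' := [seq x <- S | (M * 2 ^- m.+1 < t0 x) && ~~ (M * 2 ^- m < t0 x)].
rewrite -big_filter -/S'.
have h1 : (size S')%:R <= C / (M * 2 ^- m.+1) ^+ 2.
  by apply: CP; [exact: g0|exact: filter_uniq|move=> x; rewrite mem_filter => /andP[/andP[]]].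
apply: le_trans (_ : \sum_(x <- S') (M * 2 ^- m) ^+ q.+2 <= _).
  rewrite big_seq [leRHS]big_seq; apply: ler_sum => x; rewrite mem_filter -leNgt => /andP[/andP[_ xm] _].
  by apply: lerXn2r; rewrite ?nnegrE ?t0_ge0 // ltW.
rewrite big_const_seq count_predT iter_addr_0 -[leLHS]mulr_natl.
apply: le_trans (_ : C / (M * 2 ^- m.+1) ^+ 2 * (M * 2 ^- m) ^+ q.+2 <= _); first by rewrite ler_wpM2r // exprn_ge0 // ltW.
have gE : M * 2 ^- m.+1 = M * 2 ^- m / 2 by rewrite exprSr invfM mulrA.
rewrite gE -[leRHS]mulrA -exprMn; have gn : M * 2 ^- m != 0 by rewrite gt_eqF.
move: gn; move: (M * 2 ^- m) => g gn; rewrite expr2 ![_ ^+ q.+2]exprS ![_ ^+ q.+1]exprS; move: (g ^+ q) => G.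
by rewrite le_eqVlt; apply/orP; left; apply/eqP; field.
Qed.

Lemma half_pow (m p : nat) : ((2 : R) ^- m) ^+ p = ((2 ^ p) ^ m)%:R^-1.
Proof. by rewrite !natrX -exprM mulnC exprM exprVn. Qed.

(** For [q = 0] all dyadic layers contribute equally: the energy of [4 ^ m] vertices grows like [m],
    the logarithm of their number. *)
Lemma sum_squares : exists C : R, 0 < C /\ forall (S : seq V) m, uniq S -> (size S <= 4 ^ m)%N ->
  \sum_(x <- S) t0 x ^+ 2 <= C * m.+1%:R.
Proof.
have [C [M [C0 M0 MP h]]] := layered_sum 0; exists (C + M ^+ 2); split; first by rewrite ltr_wpDr // exprn_ge0 // ltW.
move=> S m uS Sm; apply: le_trans (h S m uS) _.
have -> : \sum_(i < m) (2 ^- i) ^+ 0 = m%:R :> R by rewrite (eq_bigr (fun=> 1)) // sumr_const card_ord.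
have h1 : (size S)%:R * (M * 2 ^- m) ^+ 2 <= M ^+ 2.
  by rewrite exprMn mulrCA ler_piMr ?exprn_ge0 ?(ltW M0) // half_pow ler_pdivrMr ?ltr0n ?expn_gt0 // mul1r ler_nat.
have h2 : 0 <= M ^+ 2 * m%:R by rewrite mulr_ge0 ?exprn_ge0 // ltW.
by rewrite -natr1; move: h1 h2 C0; move: (_ * _ ^+ 2) (M ^+ 2) => a b; lra.
Qed.

(** For [q = 1] the dyadic layers form a convergent geometric series. *)
Lemma sum_cubes : exists T : R, forall (S : seq V), uniq S -> \sum_(x <- S) t0 x ^+ 3 <= T.
Proof.
have [C [M [C0 M0 MP h]]] := layered_sum 1; exists (2 * C + M ^+ 3).
move=> S uS; pose m := size S; apply: le_trans (h S m uS) _; apply: lerD.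
  rewrite mulrC ler_pM2r //.
  suff : forall m : nat, \sum_(i < m) (2 ^- i) ^+ 1 <= 2 - 2 * 2 ^- m :> R.
    by move=> /(_ m) h1; apply: le_trans h1 _; rewrite gerDl oppr_le0 mulr_ge0 // invr_ge0 exprn_ge0.
  elim=> [|i IH]; first by rewrite big_ord0 expr0 invr1 mulr1 subrr.
  have e : (2 : R) ^- i = 2 * 2 ^- i.+1 by rewrite exprS invfM mulrA divff // mul1r.
  by rewrite big_ord_recr /= expr1; move: IH; rewrite e; move: (2 ^- i.+1) => q; lra.
rewrite exprMn mulrCA ler_piMr ?exprn_ge0 ?(ltW M0) // half_pow ler_pdivrMr ?ltr0n ?expn_gt0 // mul1r ler_nat.
by rewrite ltnW // ltn_expl.
Qed.

Definition cone x v := (lev x <= lev v)%N /\ mdist (cen x) (cen v) <= 2 * s ^- lev x.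

Let cubes x := [set t | exists S : seq V, [/\ uniq S, forall v, v \in S -> cone x v & \sum_(v <- S) t0 v ^+ 3 = t]].
Definition cone_cubes x : R := sup (cubes x).

Let cubes_has x : has_sup (cubes x).
Proof.
have [T TP] := sum_cubes; split; first by exists 0, [::]; rewrite big_nil.
by exists T => _ [S [uS _ <-]]; exact: TP.
Qed.

Lemma cone_cubes_ge x S : uniq S -> (forall v, v \in S -> cone x v) -> \sum_(v <- S) t0 v ^+ 3 <= cone_cubes x.
Proof. by move=> uS SP; apply: ub_le_sup; [exact: (proj2 (cubes_has x))|exists S]. Qed.

Lemma cone_cube x v : cone x v -> t0 v ^+ 3 <= cone_cubes x.
Proof.
move=> xv; rewrite -[leLHS](big_seq1 +%R v (fun v => t0 v ^+ 3)).
by apply: cone_cubes_ge => // w; rewrite inE => /eqP->.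
Qed.

(** A finite set carries the whole sum of the cubes up to [e], and a cone starting below this set is
    disjoint from it. *)
Lemma cone_cubes_small (e : R) : 0 < e -> exists L : nat, forall x, (L <= lev x)%N -> cone_cubes x <= e.
Proof.
move=> e0; pose A := [set t | exists S : seq V, uniq S /\ \sum_(v <- S) t0 v ^+ 3 = t].
have hA : has_sup A.
  have [T TP] := sum_cubes; split; first by exists 0, [::]; rewrite big_nil.
  by exists T => _ [S [uS <-]]; exact: TP.
have [_ [S [uS <-]] Sl] := sup_adherent e0 hA.
exists (\max_(v <- S) lev v).+1 => x xL; apply: sup_le_ub; first exact: (proj1 (cubes_has x)).
move=> _ [S' [uS' S'x <-]].
have : \sum_(v <- S ++ S') t0 v ^+ 3 <= sup A.
  apply: ub_le_sup; first exact: (proj2 hA).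
  exists (S ++ S'); split=> //; rewrite cat_uniq uS uS' andbT /=; apply/hasPn => v /S'x[xv _].
  apply/negP => vS; have := @leq_bigmax_seq _ S xpredT lev v vS isT; rewrite leqNgt => /negP; apply.
  exact: leq_trans xv.
by rewrite big_cat /=; move: Sl; lra.
Qed.

(* One of [n] disjoint cones carries at most an [n]-th part of the sum of the
   cubes. With [n = 8] the weight is halved in each step of a descent. *)
Lemma small_child (n : nat) (y : nat -> V) x : 
  (forall i v, (i < n)%N -> cone (y i) v -> cone x v) ->
  (forall i j v, (i < j < n)%N -> cone (y i) v -> cone (y j) v -> False) -> (0 < n)%N ->
  exists2 i, (i < n)%N & n%:R * cone_cubes (y i) <= cone_cubes x.
Proof.
move=> sub disj n0; apply: contrapT => no.
pose q := cone_cubes x / n%:R.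
have nn : 0 < n%:R :> R by rewrite ltr0n.
have big i : (i < n)%N -> exists S : seq V, [/\ uniq S, forall v, v \in S -> cone (y i) v & q < \sum_(v <- S) t0 v ^+ 3].
  move=> iN; have : q < cone_cubes (y i).
    rewrite ltNge; apply/negP => h; apply: no; exists i => //.
    by rewrite mulrC -ler_pdivlMr.
  by move=> /(sup_gt (proj1 (cubes_has (y i))))[_ [S [uS SP <-]] h]; exists S.
have : forall m, (m <= n)%N -> exists S : seq V, [/\ uniq S, forall v, v \in S -> exists2 i, (i < m)%N & cone (y i) v &
    if m == 0%N then 0 <= \sum_(v <- S) t0 v ^+ 3 else m%:R * q < \sum_(v <- S) t0 v ^+ 3].
  elim=> [|m IH] mN; first by exists [::]; split=> //; rewrite /= big_nil.
  have [S [uS SP Sq]] := IH (ltnW mN); have [S' [uS' SP' Sq']] := big m mN.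
  exists (S ++ S'); split.
  - rewrite cat_uniq uS uS' andbT /=; apply/hasPn => v /SP' mv; apply/negP => /SP[i im iv].
    by apply: (disj i m v) => //; rewrite im.
  - move=> v; rewrite mem_cat => /orP[/SP[i im iv]|/SP' mv]; first by exists i => //; exact: ltnW.
    by exists m.
  - rewrite big_cat /= -natr1 mulrDl mul1r; move: Sq Sq'; case: eqP => [->|_]; first by rewrite mul0r; lra.
    by lra.
move=> /(_ n (leqnn n))[S [uS SP]]; rewrite -[n == 0%N]negbK -lt0n n0 /= => h.
have h2 : \sum_(v <- S) t0 v ^+ 3 <= cone_cubes x by apply: cone_cubes_ge => // v /SP[i iN iv]; exact: sub iN iv.
by move: h; rewrite /q mulrCA divff ?mulr1 ?gt_eqF // ltNge h2.
Qed.

Hypothesis Zcon : connected [set: Z].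
Hypothesis Zcompact : compact [set: Z].
Hypothesis far : forall x : Z, exists y : Z, 4^-1 <= mdist x y.

Lemma descend : exists2 h : nat, (0 < h)%N & forall x, exists y : nat -> V, [/\ y 0%N = x,
  forall j, (j < h)%N -> adjacent (y j) (y j.+1), forall j, (j <= h)%N -> lev (y j) = (lev x + j)%N /\ cone x (y j),
  forall v, cone (y h) v -> cone x v & 8 * cone_cubes (y h) <= cone_cubes x].
Proof.
(* The distances of the eight points [z i] from [cen x] differ by at least [q / 32], and the cones
   starting [h] levels further down stay within [3 * (q / 256)] of these points, so they are
   disjoint. *)
have [h' hP] := spow_ge X 256; pose h := h'.+1.
have sh : s ^- h <= 256^-1.
  apply: le_trans (_ : s ^- h' <= _); first exact: sV_le.
  by rewrite lef_pV2 ?posrE ?exprn_gt0.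
exists h => // x; set k := lev x; set q := s ^- k; have q0 : 0 < q := sV k.
have q1 : q <= 1 := sV1 X k.
have ex (i : nat) : exists z, (i < 8)%N -> mdist (cen x) z = i.+1%:R * q / 32.
  have [y xy] := far (cen x); case: (ltnP i 8) => i8; last by exists y.
  have i8' : i.+1%:R <= 8 :> R by rewrite (ler_nat _ i.+1 8).
  have [||z zP] := @exists_at_distance _ _ (cen x) y (i.+1%:R * q / 32) Zcon; last by exists z.
    by rewrite !mulr_ge0 // ?ltW // invr_ge0.
  have : i.+1%:R * q <= 8 * q by rewrite ler_wpM2r // ltW.
  by move: xy q1; lra.
have [z zP] := choice ex.
pose y i j := if j == 0%N then x else xi X z0 diam1 (z i) (k + j).
have ylev i j : lev (y i j) = (k + j)%N by rewrite /y; case: eqP => [->|_]; [rewrite addn0|rewrite lev_xi].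
have zx i : (i < 8)%N -> mdist (cen x) (z i) <= q / 4.
  move=> i8; rewrite zP //; have : i.+1%:R * q <= 8 * q by rewrite ler_wpM2r ?(ltW q0) // (ler_nat _ i.+1 8).
  lra.
have yz i j : (0 < j)%N -> mdist (z i) (cen (y i j)) <= s ^- (k + j).
  by rewrite /y; case: j => // j _; exact: xi_near.
have sk j : s ^- (k + j) <= q by apply: sV_le; exact: leq_addr.
have ycone i j : (i < 8)%N -> cone x (y i j).
  move=> i8; split; first by rewrite ylev leq_addr.
  case: j => [|j]; first by rewrite /y /= mdistxx mulr_ge0 // ltW.
  have := mtri (z i) (cen x) (cen (y i j.+1)); have := zx i i8; have := yz i j.+1 isT; have := sk j.+1.
  rewrite -/k -/q; move: (s ^- _) q0 => p; lra.
have yh i v : cone (y i h) v -> mdist (z i) (cen v) <= 3 * (q / 256) /\ (k + h <= lev v)%N.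
  move=> [h1 h2]; rewrite ylev in h1 h2; split=> //.
  have := mtri (cen (y i h)) (z i) (cen v); have := yz i h isT.
  have : s ^- (k + h) <= q / 256 by rewrite exprD invfM ler_pM2l.
  by move: h2; rewrite -/s; move: (s ^- _) => p; lra.
have sub i v : (i < 8)%N -> cone (y i h) v -> cone x v.
  move=> i8 /yh[h1 h2]; split; first by apply: leq_trans h2; exact: leq_addr.
  have := mtri (z i) (cen x) (cen v); have := zx i i8; move: h1; rewrite -/k -/q; move: q0; lra.
have [|||i i8 small] := @small_child 8 (fun i => y i h) x.
- exact: sub.
- move=> i j v /andP[ij j8] /yh[h1 _] /yh[h2 _]; have i8 := ltn_trans ij j8.
  have e1 := zP i i8; have e2 := zP j j8.
  have h3 := mtri (z i) (cen x) (z j); have h4 := mtri (cen v) (z i) (z j); rewrite [mdist (cen v) (z j)]metric_sym in h4.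
  have h5 : i.+2%:R * q <= j.+1%:R * q by rewrite ler_wpM2r ?(ltW q0) // ler_nat.
  have h6 : i.+2%:R * q = i.+1%:R * q + q by rewrite -[i.+2%:R]natr1 mulrDl mul1r.
  by move: e1 e2 h1 h2 h3 h4 h5 h6 q0; move: (i.+2%:R * q) (i.+1%:R * q) (j.+1%:R * q) => a b c; lra.
- by [].
exists (y i); split => //; last by move=> v; exact: sub.
- move=> j jh; apply: (@adjacent_of _ _ _ z0 _ _ (z i)); rewrite ?ylev.
  + by move=> e; have := ylev i j.+1; rewrite -e ylev => /eqP; rewrite eqn_add2l ltn_eqF.
  + by rewrite addnS ltnW // ltnW.
  + by rewrite addnS.
  + rewrite metric_sym -/s; case: j jh => [|j] jh.
      by rewrite /y /= addn0 -/q; have := zx i i8; move: q0; lra.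
    by apply: le_lt_trans; [rewrite metric_sym; exact: yz|rewrite ltr_pMl // ltr1n].
  + by apply: le_lt_trans; [exact: yz|rewrite ltr_pMl // ltr1n].
- by move=> j _; split; [exact: ylev|exact: ycone].
Qed.

(** Each block of [h] steps divides the sum of the cubes by [8], hence the bound on single weights
    by [2]; the weight of the ray is dominated by a geometric series of blocks. *)
Lemma tails : exists2 D : R, 0 < D & forall e, 0 < e -> exists L : nat, forall x, (L <= lev x)%N ->
  exists (y : nat -> V) (a : Z), [/\ y 0%N = x, forall i, adjacent (y i) (y i.+1), path_converges y a,
    mdist (cen x) a <= D * s ^- lev x & forall N, \sum_(i <- iota 0 N) t0 (y i) <= e].
Proof.
have [h h0 hP] := descend; pose D := 4 * s ^+ h; have D0 : 0 < D by rewrite mulr_gt0 // exprn_gt0.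
exists D => // e e0; have hR : 0 < h%:R :> R by rewrite ltr0n.
pose sg := e / (2 * h%:R); have sg0 : 0 < sg by rewrite divr_gt0 // mulr_gt0.
have [L LP] := @cone_cubes_small (sg ^+ 3) (exprn_gt0 _ sg0).
exists L => x xL; have [Y YP] := choice hP.
pose W m := iter m (fun v => Y v h) x; pose y n := Y (W (n %/ h)%N) (n %% h)%N.
have Wlev m : lev (W m) = (lev x + m * h)%N.
  elim: m => [|m IH]; first by rewrite addn0.
  by have [_ _ /(_ h (leqnn h))[l _] _ _] := YP (W m); rewrite /= l IH -addnA mulSn [(h + _)%N]addnC.
have Wcube m : cone_cubes (W m) <= (sg / 2 ^+ m) ^+ 3.
  elim: m => [|m IH]; first by rewrite expr0 divr1; exact: LP.
  have [_ _ _ _ h8] := YP (W m); rewrite -[Y _ _]/(W m.+1) in h8.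
  have -> : (sg / 2 ^+ m.+1) ^+ 3 = (sg / 2 ^+ m) ^+ 3 / 8.
    by rewrite [2 ^+ m.+1]exprSr invfM mulrA expr_div_n; congr (_ / _); rewrite !exprS expr0; lra.
  by move: h8 IH; lra.
have yE m j : (j <= h)%N -> y (m * h + j)%N = Y (W m) j.
  rewrite leq_eqVlt => /orP[/eqP->|jh]; last by rewrite /y divnMDl // divn_small // addn0 modnMDl modn_small.
  rewrite /y -mulSnr mulnK // modnMl; have [-> _ _ _ _] := YP (W m.+1); by [].
have ydiv n : y n = Y (W (n %/ h)%N) (n %% h)%N by [].
have mh n : (n %% h < h)%N by rewrite ltn_mod.
have ylev n : lev (y n) = (lev x + n)%N.
  have [_ _ /(_ _ (ltnW (mh n)))[l _] _ _] := YP (W (n %/ h)%N).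
  by rewrite ydiv l Wlev -addnA -divn_eq.
have ycone n : cone (W (n %/ h)%N) (y n).
  by have [_ _ /(_ _ (ltnW (mh n)))[_ l] _ _] := YP (W (n %/ h)%N).
have Wcone m m' v : (m <= m')%N -> cone (W m') v -> cone (W m) v.
  move=> mm; rewrite -(subnK mm); elim: (m' - m)%N => [//|k IH] /= hv.
  by apply: IH; have [_ _ _ cc _] := YP (W (k + m)%N); exact: cc.
have yy n n' : (n <= n')%N -> mdist (cen (y n)) (cen (y n')) <= D * s ^- lev (y n).
  move=> nn; have [_ h1] := ycone n; have [_ h2] := Wcone _ _ _ (leq_div2r h nn) (ycone n').
  have h3 : s ^- lev (W (n %/ h)%N) <= s ^+ h * s ^- lev (y n).
    by apply: sV_shift; rewrite ylev Wlev -addnA leq_add2l {1}(divn_eq n h) leq_add2l ltnW.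
  have := mtri (cen (W (n %/ h)%N)) (cen (y n)) (cen (y n')); rewrite [mdist (cen (y n)) (cen (W _))]metric_sym.
  by rewrite /D -mulrA -/s in h1 h2 h3 *; move: h1 h2 h3; move: (s ^- lev (W _)) (s ^+ h * _) => p q; lra.
have [a aP] := @cauchy_limit _ _ (fun n => cen (y n)) (fun n => D * s ^- lev (y n)) Zcompact yy.
have small (r : R) : 0 < r -> exists n0 : nat, forall n, (n0 <= n)%N -> (D + 2) * s ^- lev (y n) < r.
  move=> r0; have D2 : 0 < D + 2 by move: D0; lra.
  have [U UP] := spow_ge X ((D + 2) / r + 1); exists U => n nU.
  have : s ^- lev (y n) <= s ^- U by apply: sV_le; rewrite ylev; apply: leq_trans nU _; exact: leq_addl.
  have : (D + 2) / s ^+ U < r.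
    by rewrite ltr_pdivrMr ?exprn_gt0 // mulrC -ltr_pdivrMr //; move: UP; rewrite -/s; lra.
  move=> h1 h2; apply: le_lt_trans h1; by rewrite ler_pM2l.
exists y, a; split.
- by rewrite -[0%N]/(0 * h + 0)%N yE //; have [-> _ _ _ _] := YP (W 0%N).
- move=> i; have [_ ad _ _ _] := YP (W (i %/ h)%N); have := ad _ (mh i).
  rewrite -!yE ?(ltnW (mh i)) ?mh // addnS -divn_eq; by [].
- split.
    apply/cvg_ballP => r r0; have [n0 n0P] := small r r0; exists n0.+1 => // n /= nn.
    have ln : (0 < lev (y n))%N by rewrite ylev; apply: leq_trans (leq_addl _ _); apply: leq_ltn_trans nn.
    have -> : vcenter a (y n) = cen (y n) by move: ln; case: (y n).
    rewrite ballEmdist /= metric_sym; apply: le_lt_trans (aP n) _; apply: le_lt_trans (n0P n (ltnW nn)).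
    by rewrite ler_wpM2r ?(ltW (sV _)) // lerDl.
  apply/cvg_ballP => r r0; have [n0 n0P] := small r r0; exists n0 => // n /= nn.
  rewrite /ball /= sub0r normrN ger0_norm; last by rewrite mulr_ge0 // ltW.
  by apply: le_lt_trans (n0P n nn); rewrite ler_wpM2r ?(ltW (sV _)) // lerDr ltW.
- by have := aP 0%N; rewrite -[0%N]/(0 * h + 0)%N yE //; have [-> _ _ _ _] := YP (W 0%N).
- move=> N; apply: le_trans (_ : \sum_(i <- iota 0 N) sg * 2 ^- (i %/ h) <= _).
    apply: ler_sum => i _; have h1 := le_trans (cone_cube (ycone i)) (Wcube _).
    rewrite leNgt; apply/negP => h2; move: h1; rewrite leNgt => /negP; apply.
    by rewrite ltrXn2r // mulr_ge0 ?invr_ge0 ?exprn_ge0 // ltW.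
  rewrite -mulr_sumr; apply: le_trans (_ : sg * (2 * h%:R) <= _); first by rewrite ler_pM2l // sum_geometric.
  by rewrite /sg mulfVK // gt_eqF // mulr_gt0.
Qed.
End Tails.

(** * Weights on the layers of the filling *)

Section PathCrossing.
Variables (R : realType) (T : eqType) (e : rel T) (f : T -> R).

Lemma first_exceed (x : T) (p : seq T) (r : R) : path e x p -> r <= f (last x p) ->
  exists p1, [/\ path e x p1, subseq (x :: p1) (x :: p), r <= f (last x p1) & forall u, u \in belast x p1 -> f u < r].
Proof.
elim: p x => [|y p IH] x; first by move=> _ h; exists [::].
move=> /= /andP[xy yp] rl; case: (leP r (f x)) => fx; first by exists [::]; rewrite /= eqxx.
have [p1 [pp sp rp bp]] := IH y yp rl; exists (y :: p1); split=> //=.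
- by rewrite xy.
- by rewrite eqxx.
- by move=> u; rewrite inE => /orP[/eqP->|/bp].
Qed.

Lemma last_below (x : T) (p : seq T) (r : R) : path e x p -> f x <= r -> r < f (last x p) ->
  exists u y p1, [/\ e u y, f u <= r & [/\ path e y p1, last y p1 = last x p, subseq (y :: p1) (x :: p), u \in x :: p &
    forall u, u \in y :: p1 -> r < f u]].
Proof.
move=> xp fx rl; have : exists2 u, u \in x :: p & f u <= r by exists x; rewrite ?mem_head.
elim: p x {fx} xp rl => [|y p IH] x xp rl [u].
  by rewrite inE => /eqP->; rewrite leNgt rl.
move=> ux fu; move: xp rl => /= /andP[xy yp] rl.
case: (pselect (exists2 u, u \in y :: p & f u <= r)) => [h|no].
  have [u' [y' [p1 [h1 h2 [h3 h4 h5 h6 h7]]]]] := IH y yp rl h; exists u', y', p1; split=> //; split=> //.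
    exact: (subseq_trans h5 (subseq_cons _ _)).
  by rewrite inE h6 orbT.
exists x, y, p; split=> //.
  by move: ux; rewrite inE => /orP[/eqP<- //|uy]; exfalso; apply: no; exists u.
split=> //; [exact: (subseq_cons (y :: p) x)|exact: mem_head|].
by move=> w wy; rewrite ltNge; apply/negP => h; apply: no; exists w.
Qed.
End PathCrossing.

Lemma sum_sqr_le (R : realType) (T : Type) (l : seq T) (a : T -> R) :
  (\sum_(x <- l) a x) ^+ 2 <= (size l)%:R * \sum_(x <- l) a x ^+ 2.
Proof.
elim: l => [|x l IH]; first by rewrite !big_nil expr0n mul0r.
rewrite !big_cons /= -natr1; set A := \sum_(_ <- _) _ in IH *; set B := \sum_(_ <- _) _ in IH *.
set m := (size l)%:R in IH *; have m0 : 0 <= m :> R by [].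
have B0 : 0 <= B by apply: sumr_ge0 => y _; exact: sqr_ge0.
have : 2 * a x * A <= m * a x ^+ 2 + B.
  have [m1|mpos] := eqVneq m 0.
    have A0 : A = 0.
      by apply/eqP; rewrite -sqrf_eq0 eq_le sqr_ge0 andbT; move: IH; rewrite m1 mul0r.
    by rewrite A0 m1 mulr0 mul0r add0r.
  have mp : 0 < m by rewrite lt_neqAle eq_sym mpos.
  rewrite -(ler_pM2l mp); have := sqr_ge0 (m * a x - A).
  have : A ^+ 2 <= m * B by exact: IH.
  move: (a x) => t; clear; move=> h1 h2; nra.
by move: IH m0; clear; move: (a x) => t; nra.
Qed.

(** * Layers of the chain metric *)

Section Layers.
Variables (R : realType) (Z : metricType R) (X : hyperbolic_filling Z) (z0 : Z).
Hypothesis diam1 : forall x y : Z, mdist x y <= 1.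
Notation V := (vertex X).
Let s := scale X.
Notation lev := (@level R Z X).
Notation cen := (@vcenter R Z X z0).
Variables (d : V -> V -> nat) (c : nat).
Hypothesis Lm : level_metric d c.
Notation rt := (root X).
Notation ll := (d rt).
Implicit Types (v w x y u : V).

Let s1 : 1 < s := s_gt1 X.
Let s0 : 0 < s := s_gt0 X.
Let sV k : 0 < s ^- k := sV_gt0 X k.

(** The depth [ll] and the level are only coarsely related. For vertices with close centres,
    [level_add] and [deep_dist] turn a large difference of depths into a difference of levels. *)
Lemma deep_near (B : R) (T : nat) : exists N0 : nat, forall v u, (ll v + N0 <= ll u)%N ->
  mdist (cen v) (cen u) <= B * (s ^- lev v + s ^- lev u) -> (lev v + T <= lev u)%N.
Proof.
have [Rr RrP] := level_add z0 diam1 Lm (2 * `|B|); have [U UP] := deep_dist z0 diam1 Lm (2 * `|B|).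
exists (Rr + T + U).+1 => v u llu vu; rewrite leqNgt; apply/negP => lt.
have vu' : mdist (cen v) (cen u) <= `|B| * (s ^- lev v + s ^- lev u).
  by apply: le_trans vu _; rewrite ler_wpM2r ?addr_ge0 ?(ltW (sV _)) // ler_norm.
have B0 : 0 <= `|B| by [].
case: (leqP (lev v) (lev u)) => h.
  have h1 : mdist (cen v) (cen u) <= 2 * `|B| * s ^- lev v.
    apply: le_trans vu' _; rewrite mulrDr mulrC -mulrA mulr_natl mulr2n lerD //; first by rewrite mulrC.
    by rewrite ler_wpM2l // sV_le.
  have := UP v u h h1; have := lm_tri Lm rt v u; move: lt llu; clear; lia.
have h1 : mdist (cen u) (cen v) <= 2 * `|B| * s ^- lev u.
  rewrite metric_sym; apply: le_trans vu' _; rewrite mulrDr -mulrA mulr_natl mulr2n lerD //.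
  by rewrite ler_wpM2l // sV_le // ltnW.
have := RrP u v (ltnW h) h1; move: llu; clear; lia.
Qed.

(** By [level_add] the distance of two such vertices is at most the difference of their depths plus
    a constant, and here the depths are equal. *)
Lemma same_layer (B : R) : exists R1 : nat, forall u w, ll u = ll w ->
  mdist (cen u) (cen w) <= B * (s ^- lev u + s ^- lev w) -> (d u w <= R1)%N.
Proof.
have [Rr RrP] := level_add z0 diam1 Lm (2 * `|B|); exists Rr.
have main u w : (lev u <= lev w)%N -> ll u = ll w -> mdist (cen u) (cen w) <= B * (s ^- lev u + s ^- lev w) -> (d u w <= Rr)%N.
  move=> h lluw uw; have h1 : mdist (cen u) (cen w) <= 2 * `|B| * s ^- lev u.
    apply: le_trans uw _; apply: le_trans (_ : `|B| * (s ^- lev u + s ^- lev w) <= _).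
      by rewrite ler_wpM2r ?addr_ge0 ?(ltW (sV _)) // ler_norm.
    by rewrite mulrDr -mulrA mulr_natl mulr2n lerD // ler_wpM2l // sV_le.
  by have := RrP u w h h1; rewrite lluw leq_add2l.
move=> u w lluw uw; case: (leqP (lev u) (lev w)) => h; first exact: main.
by rewrite (lm_sym Lm); apply: main; rewrite 1?metric_sym 1?addrC //; exact: ltnW.
Qed.

Definition layer_touch : rel V := fun u w => mdist (cen u) (cen w) <= 2 * (s ^- lev u + s ^- lev w).

Lemma layer_touch_sym : symmetric layer_touch.
Proof. by move=> u w; rewrite /layer_touch metric_sym addrC. Qed.

Definition crossing_adm (n : nat) (z : Z) (a b : R) (sg : V -> R) := forall w p,
  uniq (w :: p) -> path layer_touch w p -> (forall u, u \in w :: p -> ll u = n) ->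
  mdist (cen w) z <= a -> b <= mdist (cen (last w p)) z -> 1 <= \sum_(u <- w :: p) sg u.

Lemma layer_step (T : nat) (B : R) : exists N0 : nat, forall v u w, (ll v + N0 <= ll u)%N -> ll u = ll w ->
  mdist (cen v) (cen u) <= B * s ^- lev v -> layer_touch u w ->
  [/\ (lev v + T <= lev u)%N, (lev v + T <= lev w)%N & mdist (cen u) (cen w) <= s ^- (lev v + T)].
Proof.
have [R1 R1P] := same_layer 2; pose M := (c * R1.+1)%N; have [U4 U4P] := spow_ge X 4.
have [N0 N0P] := deep_near `|B| (T + M + U4); exists N0 => v u w llu lluw vu uw.
have h1 : (lev v + (T + M + U4) <= lev u)%N.
  apply: N0P => //; apply: le_trans vu _; rewrite mulrDr; apply: le_trans (_ : `|B| * s ^- lev v <= _).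
    by rewrite ler_wpM2r ?(ltW (sV _)) // ler_norm.
  by rewrite lerDl mulr_ge0 // ltW.
have h2 := R1P u w lluw uw; rewrite (lm_sym Lm) in h2; have h3 := step_lev z0 diam1 Lm h2; rewrite -/M in h3.
split; [move: h1; clear; lia|move: h1 h3; clear; lia|].
apply: le_trans uw _.
have h4 : (lev v + T + U4 <= lev u)%N by move: h1; clear; lia.
have h5 : (lev v + T + U4 <= lev w)%N by move: h1 h3; clear; lia.
have := sV_le X h4; have := sV_le X h5; rewrite -/s => a1 a2.
have h6 : 4 * s ^- (lev v + T + U4) <= s ^- (lev v + T).
  by rewrite -[leRHS](sVD _ _ U4) mulrC ler_pM2l.
by move: a1 a2 h6; lra.
Qed.
End Layers.

(** * Admissible weights around a vertex *)

Section Base.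
Variables (R : realType) (Z : metricType R) (X : hyperbolic_filling Z) (z0 : Z).
Hypothesis diam1 : forall x y : Z, mdist x y <= 1.
Notation V := (vertex X).
Let s := scale X.
Notation lev := (@level R Z X).
Notation cen := (@vcenter R Z X z0).
Variables (d : V -> V -> nat) (c : nat).
Hypothesis Lm : level_metric d c.
Notation rt := (root X).
Notation ll := (d rt).
Implicit Types (v w x y u : V).
Hypothesis dbl : doubling Z.
Hypothesis Zcon : connected [set: Z].
Hypothesis Zcompact : compact [set: Z].
Hypothesis far : forall x : Z, exists y : Z, 4^-1 <= mdist x y.
Variables (t0 : V -> R) (e : R) (T0 : nat).
Hypothesis t0w : weak_square t0.
Hypothesis e0 : 0 < e.
Hypothesis t0c : crossing_weight t0 (e / 2).
Hypothesis sep : forall v F w1 w2,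
  recenters d c F v -> (lev v + T0 <= lev w1)%N -> (lev v + T0 <= lev w2)%N ->
  mdist (cen w1) (cen v) <= 7 * s ^- lev v -> mdist (cen w2) (cen v) <= 7 * s ^- lev v ->
  3 * s ^- lev v <= mdist (cen w1) (cen w2) -> e <= mdist (cen (F w1)) (cen (F w2)).
Notation adm := (@crossing_adm R Z X z0 d).
Notation tch := (@layer_touch R Z X z0).

Let s1 : 1 < s := s_gt1 X.
Let s0 : 0 < s := s_gt0 X.
Let sV k : 0 < s ^- k := sV_gt0 X k.
Let t0_ge0 x : 0 <= t0 x := proj1 t0w x.

Lemma near_walk (r : nat) x y : (d x y <= r)%N -> exists p, [/\ path (@adjb R Z X) x p, last x p = y, uniq p &
  forall u, u \in p -> (d u x <= c * r.+1)%N].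
Proof.
move=> xy; have [p [pp lp sp]] := lm_walk Lm x y.
have pp0 := pp; case/shortenP: pp lp => p' pp' up' sub lp; exists p'; split=> //.
  by move: up' => /= /andP[].
move=> u /sub up; have {sp}sp : (size p <= c * r.+1)%N by apply: leq_trans sp _; rewrite leq_mul2l ltnS xy orbT.
apply: leq_trans sp; rewrite (lm_sym Lm); clear sub; move: pp0; case/splitPr: p / up => p1 p2.
rewrite -cat_rcons cat_path => /andP[pp1 _]; have := walk_d Lm pp1; rewrite last_rcons size_rcons size_cat => h.
by apply: leq_trans h _; rewrite size_rcons leq_addr.
Qed.

(** Consecutive images are joined by walks inside the neighbourhoods [nb], whose weights dominate
    those of the walks. *)
Lemma walk_images (F : V -> V) (r : nat) (nb : V -> seq V) w p :
  (forall y x, (d x y <= c * (r + c).+1)%N -> x \in nb y) ->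
  (forall x y, (d (F x) (F y) <= d x y + c)%N) -> path (fun u u' => (d u u' <= r)%N) w p ->
  exists q, [/\ path (@adjb R Z X) (F w) q, last (F w) q = F (last w p) &
    \sum_(x <- q) t0 x <= \sum_(u <- w :: p) \sum_(x <- nb (F u)) t0 x].
Proof.
move=> nbP Fd; have nn u : 0 <= \sum_(x <- nb (F u)) t0 x by exact: sumr_ge0.
elim: p w => [|u p IH] w; first by move=> _; exists [::]; rewrite big_nil big_seq1.
move=> /= /andP[wu /IH[q [pq lq sq]]].
have [q1 [pq1 lq1 uq1 sub]] := @near_walk (r + c) (F w) (F u) (leq_trans (Fd w u) (leq_add wu (leqnn c))).
exists (q1 ++ q); split.
- by rewrite cat_path pq1 lq1.
- by rewrite last_cat lq1.
- rewrite big_cat big_cons; apply: lerD; last exact: sq.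
  by apply: sum_subset => // x /sub h; exact: nbP.
Qed.

Lemma extend_walk x p (y : nat -> V) a (b : R) : path (@adjb R Z X) x p -> y 0%N = last x p ->
  (forall i, adjacent (y i) (y i.+1)) -> path_converges y a -> (forall N, \sum_(i <- iota 0 N) t0 (y i) <= b) ->
  exists r : nat -> V, [/\ r 0%N = x, forall i, adjacent (r i) (r i.+1), path_converges r a &
    forall N, \sum_(i <- iota 0 N) t0 (r i) <= t0 x + \sum_(v <- p) t0 v + b].
Proof.
elim: p x => [|z p IH] x.
  move=> _ y0 ya yc yb; exists y; split=> // N; rewrite big_nil addr0.
  by apply: le_trans (yb N) _; rewrite lerDr.
move=> /= /andP[/asboolP xz pp] y0 ya yc yb; have [r [r0 ra [rc1 rc2] rb]] := IH z pp y0 ya yc yb.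
pose r' i := if i is j.+1 then r j else x; exists r'; split=> //.
- by case=> [|i] //=; rewrite r0.
- by split=> P; [move=> /rc1|move=> /rc2] => -[N _ NP]; exists N.+1 => // -[|n] //= nn; exact: NP.
- case=> [|N].
    have := yb 0%N; rewrite !big_nil => b0; rewrite !addr_ge0 // big_cons addr_ge0 // sumr_ge0 //.
  rewrite /= big_cons (_ : iota 1 N = map S (iota 0 N)) ?big_map ?big_cons; last exact: (iotaDl 1 0 N).
  by rewrite -!addrA lerD2l addrA; exact: rb.
Qed.

Let R1 : nat := projT1 (cid (same_layer z0 diam1 Lm 2)).
Let A := (c * (R1 + c).+1)%N.
Let nb y : seq V := projT1 (cid (projT2 (cid (near_enum z0 diam1 Lm dbl A)) y)).
Let NA : nat := projT1 (cid (near_enum z0 diam1 Lm dbl A)).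
Let nbP y : [/\ uniq (nb y), forall x, x \in nb y <-> (d x y <= A)%N & (size (nb y) <= NA)%N].
Proof. exact: (projT2 (cid (projT2 (cid (near_enum z0 diam1 Lm dbl A)) y))). Qed.

Definition recenter v : V -> V := projT1 (cid (lm_homogeneous Lm v)).
Lemma recenterP v : recenters d c (recenter v) v.
Proof. exact: (projT2 (cid (lm_homogeneous Lm v))). Qed.

(* Images under [recenter v] of vertices separated by a ring around [v] have
   centers at a definite distance, for which the weight [t0] is admissible. *)
Definition pulled v u : R := \sum_(x <- nb (recenter v u)) t0 x.

(** A crossing from radius [3] to radius [6], stopped there, stays within radius [7]. The factor [2]
    makes up for the start and the two completing rays, which carry at most [8^-1] each. *)
Definition base_weight v u : R := if mdist (cen u) (cen v) <= 7 * s ^- lev v then 2 * pulled v u else 0.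

Lemma pulled_ge0 v u : 0 <= pulled v u.
Proof. exact: sumr_ge0. Qed.

Lemma base_weight_ge0 v u : 0 <= base_weight v u.
Proof. by rewrite /base_weight; case: ifP => // _; rewrite mulr_ge0 // pulled_ge0. Qed.

(** By [sep] the images of the ends of a crossing are at distance at least [e]. The walk through the
    images is prolonged at both ends by rays of small weight; their limits are still at distance at
    least [e / 2], so that [t0c] applies. *)
Lemma base_adm : exists N0 : nat, forall v n, (ll v + N0 <= n)%N ->
  adm n (cen v) (3 * s ^- lev v) (6 * s ^- lev v) (base_weight v).
Proof.
have [D D0 DP] := tails z0 diam1 t0w Zcon Zcompact far.
have [L LP] := DP 8^-1 ltac:(by rewrite invr_gt0).
have [L' L'P] := spow_ge X (4 * D / e).
have [T1 T1P] := image_deep z0 diam1 Lm (maxn L L').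
have [N0 N0P] := layer_step z0 diam1 Lm (T0 + T1) 6.
have [N2 N2P] := deep_near z0 diam1 Lm 7 (T0 + T1).
exists (maxn N0 N2) => v n vn w p uwp pwp lwp wv pv; set q := s ^- lev v in wv pv *.
have q0 : 0 < q := sV (lev v).
pose f u := mdist (cen u) (cen v).
have [p1 [pp1 sp1 lp1 bp1]] := first_exceed (f := f) pwp pv.
have u1 : uniq (w :: p1) := subseq_uniq sp1 uwp.
have l1 u : u \in w :: p1 -> ll u = n by move=> h; apply: lwp; exact: (mem_subseq sp1).
apply: le_trans (_ : \sum_(u <- w :: p1) base_weight v u <= _); last first.
  by apply: sum_subset => //; [exact: base_weight_ge0|move=> u; exact: (mem_subseq sp1)].
have vn0 : (ll v + N0 <= n)%N by apply: leq_trans vn; rewrite leq_add2l leq_maxl.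
have vn2 : (ll v + N2 <= n)%N by apply: leq_trans vn; rewrite leq_add2l leq_maxr.
have inball u : u \in w :: p1 -> f u <= 7 * q.
  rewrite lastI mem_rcons inE => /orP[/eqP->|/bp1 h]; last by move: h q0; rewrite -/q; lra.
  case: (lastP p1) pp1 bp1 l1 => [|p2 z]; first by rewrite /= /f => _ _ _; move: wv q0; lra.
  rewrite rcons_path last_rcons => /andP[_ tz] bp l2.
  have fl : f (last w p2) < 6 * q by apply: bp; rewrite belast_rcons mem_last.
  have e1 : ll (last w p2) = n by apply: l2; rewrite -rcons_cons mem_rcons inE mem_last orbT.
  have e2 : ll z = n by apply: l2; rewrite -rcons_cons mem_rcons mem_head.
  have [|||_ _ h] := N0P v (last w p2) z _ _ _ tz; rewrite ?e1 ?e2 //; first by rewrite metric_sym; exact: ltW.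
  have : s ^- (lev v + (T0 + T1)) <= q by apply: sV_le; exact: leq_addr.
  have := mtri (cen (last w p2)) (cen z) (cen v); rewrite [mdist (cen z) (cen (last w p2))]metric_sym -/(f z).
  by move: fl h; rewrite -/s /f; lra.
have deep u : u \in w :: p1 -> (lev v + (T0 + T1) <= lev u)%N.
  move=> uw; apply: N2P; first by rewrite (l1 u uw).
  rewrite metric_sym; apply: le_trans (inball u uw) _; rewrite mulrDr lerDl mulr_ge0 // ltW //.
have -> : \sum_(u <- w :: p1) base_weight v u = 2 * \sum_(u <- w :: p1) pulled v u.
  rewrite mulr_sumr; apply: eq_big_seq => u uw; rewrite /base_weight; have := inball u uw.
  by rewrite /f => ->.
pose F := recenter v; have FP := recenterP v; have [Fd _] := FP.
have pd : path (fun u u' => (d u u' <= R1)%N) w p1.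
  apply: (@sub_in_path _ (fun u => u \in w :: p1) tch) pp1; last exact/allP.
  move=> u u' /l1 h1 /l1 h2 uu; apply: (projT2 (cid (same_layer z0 diam1 Lm 2))); by rewrite ?h1 ?h2.
have [qq [pq lq sq]] := @walk_images F R1 nb w p1 (fun y x => match nbP y with And3 _ h _ => proj2 (h x) end) (fun x y => proj1 (Fd x y)) pd.
set wl := last w p1 in lq lp1 *.
have wlin : wl \in w :: p1 by exact: mem_last.
have Fdeep u : u \in w :: p1 -> (maxn L L' <= lev (F u))%N.
  by move=> /deep h; apply: T1P FP _; apply: leq_trans h; rewrite leq_add2l leq_addl.
have [yl [al [yl0 yla ylc ald ylb]]] := LP (F w) (leq_trans (leq_maxl _ _) (Fdeep w (mem_head _ _))).
have [yr [ar [yr0 yra yrc ard yrb]]] := LP (F wl) (leq_trans (leq_maxl _ _) (Fdeep wl wlin)).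
have yr0' : yr 0%N = last (F w) qq by rewrite yr0 lq.
have [r [r0 ra rc rb]] := extend_walk pq yr0' yra yrc yrb.
have dF : e <= mdist (cen (F w)) (cen (F wl)).
  apply: (sep FP); rewrite -/q.
  - by apply: leq_trans (deep w (mem_head _ _)); rewrite leq_add2l leq_addr.
  - by apply: leq_trans (deep wl wlin); rewrite leq_add2l leq_addr.
  - exact: inball (mem_head _ _).
  - exact: inball.
  - have := mtri (cen w) (cen wl) (cen v); rewrite [mdist (cen wl) (cen w)]metric_sym.
    by move: lp1 wv; rewrite /f; lra.
have Dl u : u \in w :: p1 -> D * s ^- lev (F u) <= e / 4.
  move=> /Fdeep h; have := sV_le X (leq_trans (leq_maxr _ _) h); rewrite -/s => h1.
  apply: le_trans (_ : D * s ^- L' <= _); first by rewrite ler_pM2l.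
  rewrite ler_pdivrMr ?exprn_gt0 // mulrC -ler_pdivrMr ?divr_gt0 //; apply: le_trans L'P.
  by rewrite invf_div mulrA [D * _]mulrC.
have dlim : e / 2 <= mdist al ar.
  have := mtri al (cen (F w)) (cen (F wl)); have := mtri ar al (cen (F wl)); rewrite [mdist ar _]metric_sym.
  move: dF ald ard (Dl w (mem_head _ _)) (Dl wl wlin); rewrite -/s; lra.
have rl : r 0%N = yl 0%N by rewrite r0 yl0.
have := t0c ra yla rl ylc rc dlim (B := t0 (F w) + \sum_(x <- qq) t0 x + 8^-1 + 8^-1).
have tF : t0 (F w) <= 8^-1 by have := ylb 1%N; rewrite big_seq1 yl0.
have {}sq : \sum_(x <- qq) t0 x <= \sum_(u <- w :: p1) pulled v u by exact: sq.
move=> h; have : 1 <= t0 (F w) + \sum_(x <- qq) t0 x + 8^-1 + 8^-1.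
  by apply: h => N; have := rb N; have := ylb N; lra.
by move: tF sq; lra.
Qed.

(** Recentring carries the part of layer [n] near [v] to the layers close to [n - ll v], and each
    vertex there belongs to the neighbourhoods of a bounded number of images. *)
Lemma base_energy : exists (c1 N0 : nat) (E : R), 0 < E /\ forall v n (S Lk : seq V), (ll v + N0 <= n)%N ->
  uniq S -> (forall u, u \in S -> ll u = n) ->
  (forall x, (n - ll v <= ll x + c1)%N -> (ll x <= (n - ll v) + c1)%N -> x \in Lk) ->
  \sum_(u <- S) base_weight v u ^+ 2 <= E * \sum_(x <- Lk) t0 x ^+ 2.
Proof.
have [Rr RrP] := level_add z0 diam1 Lm 7; have [N0 N0P] := deep_near z0 diam1 Lm 7 0.
have [N1 N1P] := near_enum z0 diam1 Lm dbl (A + A + c).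
exists (Rr + c + c + A)%N, N0, (4 * NA.+1%:R * N1.+1%:R); split; first by rewrite !mulr_gt0.
move=> v n S Lk vn uS SP LkP; have [Fd Fr] := recenterP v; set F := recenter v in Fd Fr.
pose S' := [seq u <- S | mdist (cen u) (cen v) <= 7 * s ^- lev v].
have uS' : uniq S' by exact: filter_uniq.
have nbLk u x : u \in S' -> x \in nb (F u) -> x \in Lk.
  rewrite mem_filter => /andP[uv /SP lu] xu; have [_ /(_ x)[/(_ xu) dxu _] _] := nbP (F u).
  have lvu : (lev v <= lev u)%N.
    rewrite -[lev v]addn0; apply: N0P; first by rewrite lu.
    by rewrite metric_sym; apply: le_trans uv _; rewrite mulrDr lerDl mulr_ge0 // ltW.
  rewrite metric_sym in uv; have h1 := RrP v u lvu uv; rewrite lu in h1.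
  have [h2 h3] := Fd v u; have t1 := lm_tri Lm rt v u; rewrite lu in t1.
  have t2 := lm_tri Lm rt (F v) x; have t3 := lm_tri Lm (F v) (F u) x; rewrite (lm_sym Lm (F u) x) in t3.
  have t4 := lm_tri Lm (F v) x (F u); have t5 := lm_tri Lm (F v) rt x.
  have t6 := lm_sym Lm rt (F v).
  by apply: LkP; move: h1 h2 h3 t1 t2 t3 t4 t5 t6 dxu Fr; clear; lia.
have step1 u : u \in S' -> base_weight v u ^+ 2 <= 4 * NA.+1%:R * \sum_(x <- Lk) (d x (F u) <= A)%:R * t0 x ^+ 2.
  move=> uS1; have := uS1; rewrite mem_filter => /andP[uv _]; rewrite /base_weight uv exprMn -mulrA.
  have -> : (2 : R) ^+ 2 = 4 by rewrite expr2; lra.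
  rewrite ler_pM2l //; apply: le_trans (sum_sqr_le _ _) _.
  have [unb nbi nbs] := nbP (F u).
  apply: ler_pM => //; [by apply: sumr_ge0 => x _; exact: exprn_ge0|by rewrite ler_nat leqW|].
  rewrite (eq_big_seq (fun x => (d x (F u) <= A)%:R * t0 x ^+ 2)); last first.
    by move=> x /nbi ->; rewrite mul1r.
  by apply: sum_subset => // [x|x]; [rewrite mulr_ge0 ?exprn_ge0|exact: nbLk].
have -> : \sum_(u <- S) base_weight v u ^+ 2 = \sum_(u <- S') base_weight v u ^+ 2.
  rewrite /S' big_filter [RHS]big_mkcond; apply: eq_bigr => u _; rewrite /base_weight; case: ifP => // _.
  by rewrite expr0n.
apply: le_trans (_ : \sum_(u <- S') 4 * NA.+1%:R * \sum_(x <- Lk) (d x (F u) <= A)%:R * t0 x ^+ 2 <= _).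
  by rewrite big_seq [leRHS]big_seq; apply: ler_sum => u; exact: step1.
rewrite -mulr_sumr -[leRHS]mulrA ler_pM2l ?mulr_gt0 // exchange_big /= mulr_sumr; apply: ler_sum => x _.
rewrite -mulr_suml ler_wpM2r ?exprn_ge0 //.
rewrite -natr_sum ler_nat.
have -> : (\sum_(u <- S') (d x (F u) <= A) = size [seq u <- S' | d x (F u) <= A])%N.
  by rewrite size_filter -sum1_count [RHS]big_mkcond; apply: eq_bigr => u _; case: (_ <= _)%N.
set W := [seq u <- S' | _]; case E : W => [//|u0 W']; rewrite -E.
have [l [ul lP sl]] := N1P u0; apply: leq_trans (leqW sl); apply: uniq_leq_size; first exact: filter_uniq.
have : u0 \in W by rewrite E mem_head.
rewrite mem_filter => /andP[h0 _] u; rewrite mem_filter => /andP[h1 _]; apply/lP.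
have [_ h2] := Fd u u0; have h3 := lm_tri Lm (F u) x (F u0); rewrite (lm_sym Lm (F u) x) in h3.
by move: h0 h1 h2 h3; clear; lia.
Qed.
End Base.

Lemma path_suffix (T : eqType) (e : rel T) (x u : T) (p : seq T) : path e x p -> u \in x :: p ->
  exists q, [/\ path e u q, last u q = last x p & subseq (u :: q) (x :: p)].
Proof.
move=> + up; case/splitPl: up => p1 p2 lp; rewrite cat_path lp => /andP[_ pp]; exists p2; split=> //.
  by rewrite last_cat lp.
by rewrite -cat_cons (lastI x p1) lp cat_rcons; exact: suffix_subseq.
Qed.

Lemma path_to_start (T : eqType) (e : rel T) (x u : T) (p : seq T) : symmetric e -> path e x p -> uniq (x :: p) ->
  u \in x :: p -> exists q, [/\ path e u q, last u q = x, uniq (u :: q) & {subset u :: q <= x :: p}].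
Proof.
move=> se xp ux ui; have rp : path e (last x p) (rev (belast x p)).
  by rewrite rev_path; apply: sub_path xp => a b; rewrite se.
have rE : last x p :: rev (belast x p) = rev (x :: p) by rewrite [x :: p]lastI rev_rcons.
have [|q [pq lq sq]] := path_suffix (u := u) rp; first by rewrite rE mem_rev.
exists q; split=> //.
- by rewrite lq; case: (p) => //= y p'; rewrite rev_cons last_rcons.
- by apply: subseq_uniq sq _; rewrite rE rev_uniq.
- by move=> y /(mem_subseq sq); rewrite rE mem_rev.
Qed.

(** * Composition of weights at two scales *)

Section Two.
Variables (R : realType) (Z : metricType R) (X : hyperbolic_filling Z) (z0 : Z).
Hypothesis diam1 : forall x y : Z, mdist x y <= 1.
Notation V := (vertex X).
Let s := scale X.
Notation lev := (@level R Z X).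
Notation cen := (@vcenter R Z X z0).
Variables (d : V -> V -> nat) (c : nat).
Hypothesis Lm : level_metric d c.
Notation rt := (root X).
Notation ll := (d rt).
Implicit Types (v w x y u : V).
Hypothesis dbl : doubling Z.
Notation adm := (@crossing_adm R Z X z0 d).
Notation tch := (@layer_touch R Z X z0).

Let s1 : 1 < s := s_gt1 X.
Let s0 : 0 < s := s_gt0 X.
Let sV k : 0 < s ^- k := sV_gt0 X k.

(** Along the vertical ray to [z] the depth is unbounded and grows by at most one per step, so it
    takes the value [m]. *)
Lemma layer_cover (m : nat) (z : Z) : exists2 w, ll w = m & mdist z (cen w) <= s ^- lev w.
Proof.
pose f k := ll (xi X z0 diam1 z k).
have ex : exists k, (m <= f k)%N.
  exists (c * m.+1).+1; rewrite leqNgt; apply/negP => h.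
  have := lev_lip z0 diam1 Lm rt (xi X z0 diam1 z (c * m.+1).+1); rewrite lev_xi add0n -/(f _).
  by rewrite leqNgt ltnS leq_mul2l ltnS (ltnW h) orbT.
case: (ex_minnP ex) => k km kmin; exists (xi X z0 diam1 z k); last by rewrite lev_xi; exact: xi_near.
apply/eqP; rewrite eqn_leq km andbT; case: k km kmin => [|k] km kmin.
  have -> : xi X z0 diam1 z 0 = rt by apply: level0; rewrite lev_xi.
  by rewrite (lm_refl Lm).
have fk : (f k < m)%N by rewrite ltnNge; apply/negP => /kmin; rewrite ltnn.
apply: leq_trans fk; have := lm_adj Lm (xi_adj X z0 diam1 z k); have := lm_tri Lm rt (xi X z0 diam1 z k) (xi X z0 diam1 z k.+1).
by rewrite /f (lm_sym Lm (xi X z0 diam1 z k.+1)); clear; lia.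
Qed.

Lemma layer_enum (n : nat) : exists S : seq V, uniq S /\ forall v, v \in S <-> ll v = n.
Proof.
have [N NP] := upto_enum z0 diam1 Lm dbl; have [S [uS SP _]] := NP n.
exists [seq v <- S | ll v == n]; split; first exact: filter_uniq.
move=> v; rewrite mem_filter; split=> [/andP[/eqP]//|vn]; rewrite vn eqxx /=; apply/SP; by rewrite vn.
Qed.

Lemma truncate_crossing (B : R) : exists N0 : nat, forall v n w p, (ll v + N0 <= n)%N -> 
  path tch w p -> (forall u, u \in w :: p -> ll u = n) ->
  mdist (cen w) (cen v) <= B * s ^- lev v -> B * s ^- lev v <= mdist (cen (last w p)) (cen v) ->
  exists p1, [/\ path tch w p1, subseq (w :: p1) (w :: p), B * s ^- lev v <= mdist (cen (last w p1)) (cen v) &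
    forall u, u \in w :: p1 -> mdist (cen u) (cen v) <= (B + 1) * s ^- lev v].
Proof.
have [N0 N0P] := layer_step z0 diam1 Lm 0 B; exists N0 => v n w p vn pwp lwp wv pv.
pose f u := mdist (cen u) (cen v); have q0 := sV (lev v).
have [p1 [pp1 sp1 lp1 bp1]] := first_exceed (f := f) pwp pv.
have l1 u : u \in w :: p1 -> ll u = n by move=> h; apply: lwp; exact: (mem_subseq sp1).
exists p1; split=> // u.
rewrite mulrDl mul1r lastI mem_rcons inE => /orP[/eqP->|/bp1 h]; last by move: h q0; rewrite /f; lra.
case: (lastP p1) pp1 bp1 l1 => [|p2 z]; first by rewrite /= => _ _ _; move: wv q0; lra.
rewrite rcons_path last_rcons => /andP[_ tz] bp l2.
have fl : f (last w p2) < B * s ^- lev v by apply: bp; rewrite belast_rcons mem_last.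
have e1 : ll (last w p2) = n by apply: l2; rewrite -rcons_cons mem_rcons inE mem_last orbT.
have e2 : ll z = n by apply: l2; rewrite -rcons_cons mem_rcons mem_head.
have [|||_ _ h] := N0P v (last w p2) z _ _ _ tz; rewrite ?e1 ?e2 //; first by rewrite metric_sym; exact: ltW.
rewrite addn0 in h; have := mtri (cen (last w p2)) (cen z) (cen v); rewrite [mdist (cen z) (cen (last w p2))]metric_sym.
by move: fl h; rewrite -/s /f; lra.
Qed.

Variables (bw : V -> V -> R) (bb : nat -> R) (E : R) (Nb : nat).
Hypothesis E0 : 0 < E.
Hypothesis bb0 : forall k, 0 <= bb k.
Hypothesis bw0 : forall v u, 0 <= bw v u.
Hypothesis bws : forall v u, bw v u != 0 -> mdist (cen u) (cen v) <= 7 * s ^- lev v.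
Hypothesis bwa : forall v n, (ll v + Nb <= n)%N -> adm n (cen v) (3 * s ^- lev v) (6 * s ^- lev v) (bw v).
Hypothesis bwe : forall v n (S : seq V), (ll v + Nb <= n)%N -> uniq S -> (forall u, u \in S -> ll u = n) ->
  \sum_(u <- S) bw v u ^+ 2 <= E * bb (n - ll v).

(* Where [bb] is large, [bw v] has large energy. Two steps through a layer [m]
   with [m - ll v] and [n - m] both good avoid this for all large [n]. *)
Lemma two_scale : exists (N0 : nat) (C : R), 0 < C /\ forall v m n, (ll v + N0 <= m)%N -> (m + N0 <= n)%N ->
  exists rho : V -> R, [/\ forall u, 0 <= rho u, adm n (cen v) (2 * s ^- lev v) (8 * s ^- lev v) rho &
    forall S, uniq S -> (forall u, u \in S -> ll u = n) -> \sum_(u <- S) rho u ^+ 2 <= C * (bb (m - ll v) * bb (n - m))].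
Proof.
have [Nt NtP] := truncate_crossing 8; have [Ns NsP] := layer_step z0 diam1 Lm 0 1.
have [T TP] := spow_ge X 2; have [Nd NdP] := deep_near z0 diam1 Lm 9 T.
have [R2 R2P] := same_layer z0 diam1 Lm 7; have [N2 N2P] := near_enum z0 diam1 Lm dbl R2.
pose N0 := (Nb + Nt + Ns + Nd)%N; exists N0, (N2.+1%:R * (E * E)); split; first by rewrite !mulr_gt0.
move=> v m n vm mn; set q := s ^- lev v; have q0 : 0 < q := sV (lev v).
have vm_le k : (k <= N0)%N -> (ll v + k <= m)%N by move=> h; apply: leq_trans vm; rewrite leq_add2l.
have mn_le k : (k <= N0)%N -> (m + k <= n)%N by move=> h; apply: leq_trans mn; rewrite leq_add2l.
have vn_le k : (k <= N0)%N -> (ll v + k <= n)%N.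
  by move=> h; apply: leq_trans (vm_le k h) _; apply: leq_trans mn; exact: leq_addr.
have kb : (Nb <= N0)%N by rewrite /N0; clear; lia.
have kt : (Nt <= N0)%N by rewrite /N0; clear; lia.
have ks : (Ns <= N0)%N by rewrite /N0; clear; lia.
have kd : (Nd <= N0)%N by rewrite /N0; clear; lia.
have [Lm_ [uLm LmP]] := layer_enum m.
(* The composition: each vertex [w] of the layer [m] spreads its weight [bw v w] over the layer [n]
   by [bw w]. *)
pose rho u := \sum_(w <- Lm_) bw v w * bw w u.
exists rho; split.
- by move=> u; apply: sumr_ge0 => w _; rewrite mulr_ge0.
- move=> w0 p uwp pwp lwp wv pv.
  have [|p1 [pp1 sp1 lp1 ball1]] := NtP v n w0 p (vn_le _ kt) pwp lwp _ pv.
    by apply: le_trans wv _; rewrite ler_wpM2r ?(ltW q0) //; lra.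
  have u1 : uniq (w0 :: p1) := subseq_uniq sp1 uwp.
  have l1 u : u \in w0 :: p1 -> ll u = n by move=> h; apply: lwp; exact: (mem_subseq sp1).
  apply: le_trans (_ : \sum_(u <- w0 :: p1) rho u <= _); last first.
    apply: sum_subset => //; last by move=> u; exact: (mem_subseq sp1).
    by move=> u; apply: sumr_ge0 => w _; rewrite mulr_ge0.
  have cover u : exists w, ll w = m /\ mdist (cen u) (cen w) <= s ^- lev w.
    by have [w wm uw] := layer_cover m (cen u); exists w.
  have [g gP] := choice cover.
  have gl u : ll (g u) = m by have [] := gP u.
  have gn u : mdist (cen u) (cen (g u)) <= s ^- lev (g u) by have [] := gP u.
  have gd u : u \in w0 :: p1 -> s ^- lev (g u) <= q / 2.
    move=> uin; have h : (lev v + T <= lev (g u))%N.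
      apply: NdP; first by rewrite gl vm_le.
      have := mtri (cen u) (cen v) (cen (g u)); rewrite [mdist (cen v) (cen u)]metric_sym.
      by have := ball1 u uin; have := gn u; have := sV (lev (g u)); rewrite -/q; lra.
    apply: le_trans (sV_le X h) _; rewrite -/s exprD invfM ler_pM2l // lef_pV2 ?posrE ?exprn_gt0 //.
  have gv u : u \in w0 :: p1 -> mdist (cen (g u)) (cen v) <= mdist (cen u) (cen v) + q / 2 /\
      mdist (cen u) (cen v) <= mdist (cen (g u)) (cen v) + q / 2.
    move=> uin; have h1 := gd u uin; have h2 := gn u.
    have := mtri (cen u) (cen (g u)) (cen v); have := mtri (cen (g u)) (cen u) (cen v).
    by rewrite [mdist (cen (g u)) (cen u)]metric_sym; lra.
  have pg : path tch (g w0) (map g p1).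
    rewrite path_map; apply: (@sub_in_path _ (fun u => u \in w0 :: p1) tch) pp1; last exact/allP.
    move=> a b ain bin ab; rewrite /relpre /layer_touch /=.
    have [||| _ _ h] := NsP (g a) a b _ _ _ ab; rewrite ?gl ?l1 ?mn_le //.
      by rewrite metric_sym mul1r.
    rewrite addn0 in h; have := mtri (cen a) (cen (g a)) (cen (g b)); have := mtri (cen b) (cen a) (cen (g b)).
    rewrite [mdist (cen (g a)) (cen a)]metric_sym; have := gn a; have := gn b; have := sV (lev (g b)).
    by move: h; rewrite -/s; lra.
  have lastE : last (g w0) (map g p1) = g (last w0 p1) by rewrite last_map.
  case/shortenP: pg lastE => p' pp' up' sub lastE.
  have gin w : w \in g w0 :: p' -> exists2 u, u \in w0 :: p1 & w = g u.
    rewrite inE => /orP[/eqP->|/sub/mapP[u up ->]]; first by exists w0; rewrite ?mem_head.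
    by exists u; rewrite // inE up orbT.
  (* The fine path passes close to [w]. Its ends are far apart at the scale of [w], so one of them
     is outside the ring around [w], and the part of the path leading to it crosses this ring. *)
  have one w : w \in g w0 :: p' -> 1 <= \sum_(u <- w0 :: p1) bw w u.
    move=> /gin[u uin ->]; set w' := g u; have wq := gd u uin; rewrite -/w' in wq.
    have far : 6 * s ^- lev w' <= mdist (cen w0) (cen w') \/ 6 * s ^- lev w' <= mdist (cen (last w0 p1)) (cen w').
      case: (leP (6 * s ^- lev w') (mdist (cen w0) (cen w'))) => h; [by left|right].
      have := mtri (cen w0) (cen (last w0 p1)) (cen v); have := mtri (cen w') (cen (last w0 p1)) (cen w0).
      by rewrite [mdist (cen w') (cen w0)]metric_sym; move: h wq lp1 wv; rewrite -/q; lra.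
    have near : mdist (cen u) (cen w') <= 3 * s ^- lev w' by have := gn u; have := sV (lev w'); rewrite -/w'; lra.
    have wn : (ll w' + Nb <= n)%N by rewrite gl mn_le.
    have fin r : path tch u r -> uniq (u :: r) -> {subset u :: r <= w0 :: p1} ->
        6 * s ^- lev w' <= mdist (cen (last u r)) (cen w') -> 1 <= \sum_(u <- w0 :: p1) bw w' u.
      move=> pr ur sr lr; apply: le_trans (_ : \sum_(u <- u :: r) bw w' u <= _); last by apply: sum_subset.
      by apply: (bwa wn) => // a ain; apply: l1; exact: sr.
    case: far => h.
      by have [r [pr lr ur sr]] := path_to_start (@layer_touch_sym _ _ X z0) pp1 u1 uin; apply: (fin r) => //; rewrite lr.
    have [r [pr lr sr]] := path_suffix pp1 uin; apply: (fin r) => //; [exact: subseq_uniq sr u1|exact: mem_subseq|by rewrite lr].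
  have -> : \sum_(u <- w0 :: p1) rho u = \sum_(w <- Lm_) bw v w * \sum_(u <- w0 :: p1) bw w u.
    by rewrite /rho exchange_big; apply: eq_bigr => w _; rewrite mulr_sumr.
  apply: le_trans (_ : \sum_(w <- g w0 :: p') bw v w * \sum_(u <- w0 :: p1) bw w u <= _); last first.
    apply: sum_subset => // w; first by rewrite mulr_ge0 // sumr_ge0.
    by move=> /gin[u _ ->]; apply/LmP.
  apply: le_trans (_ : \sum_(w <- g w0 :: p') bw v w <= _); last first.
    by rewrite big_seq [leRHS]big_seq; apply: ler_sum => w /one h; rewrite ler_peMr.
  apply: (bwa (vm_le _ kb)) => //.
  + by move=> u /gin[u' _ ->].
  + by have [h _] := gv w0 (mem_head _ _); move: h wv; rewrite -/q; lra.
  + rewrite lastE; have [_ h] := gv (last w0 p1) (mem_last _ _); move: h lp1; rewrite -/q; move: q0; lra.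
- move=> S uS SP.
  (* Only a bounded number of [w] have [u] in the support of [bw w], so the square of the sum is
     controlled by the sum of the squares. *)
  have sq u : rho u ^+ 2 <= N2.+1%:R * \sum_(w <- Lm_) bw v w ^+ 2 * bw w u ^+ 2.
    pose l := [seq w <- Lm_ | bw w u != 0].
    have -> : rho u = \sum_(w <- l) bw v w * bw w u.
      rewrite /l big_filter [RHS]big_mkcond; apply: eq_bigr => w _.
      by case: ifPn => // /negPn/eqP->; rewrite mulr0.
    apply: le_trans (sum_sqr_le _ _) _; apply: ler_pM => //; first by apply: sumr_ge0 => w _; exact: sqr_ge0.
      rewrite ler_nat; case El : l => [//|w1 l']; rewrite -El.
      have [k [uk kP sk]] := N2P w1; apply: leq_trans (leqW sk); apply: uniq_leq_size; first exact: filter_uniq.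
      have : w1 \in l by rewrite El mem_head.
      rewrite mem_filter => /andP[/bws h1 /LmP l1] w; rewrite mem_filter => /andP[/bws h2 /LmP l2]; apply/kP/R2P.
        by rewrite l1 l2.
      have := mtri (cen u) (cen w) (cen w1); rewrite [mdist (cen w) (cen u)]metric_sym; move: h1 h2; rewrite -/s; lra.
    rewrite (eq_bigr (fun w => bw v w ^+ 2 * bw w u ^+ 2)); last by move=> w _; rewrite exprMn.
    apply: sum_subset; [by move=> w; rewrite mulr_ge0 ?sqr_ge0|exact: filter_uniq|].
    by move=> w; rewrite mem_filter => /andP[].
  apply: le_trans (_ : \sum_(u <- S) N2.+1%:R * \sum_(w <- Lm_) bw v w ^+ 2 * bw w u ^+ 2 <= _).
    by apply: ler_sum => u _; exact: sq.
  rewrite -mulr_sumr -mulrA ler_pM2l // exchange_big /=.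
  apply: le_trans (_ : \sum_(w <- Lm_) bw v w ^+ 2 * (E * bb (n - m)) <= _).
    rewrite big_seq [leRHS]big_seq; apply: ler_sum => w /LmP wm; rewrite -mulr_sumr ler_wpM2l ?sqr_ge0 //.
    by rewrite -wm; apply: bwe => //; rewrite wm mn_le.
  rewrite -mulr_suml mulrACA [leRHS]mulrC [leRHS]mulrC; apply: le_trans (_ : (E * bb (m - ll v)) * (E * bb (n - m)) <= _).
    rewrite ler_wpM2r ?mulr_ge0 ?(ltW E0) //; apply: bwe => //; first exact: vm_le.
    by move=> u /LmP.
  by rewrite le_eqVlt; apply/orP; left; apply/eqP; ring.
Qed.
End Two.

Lemma sum_lt_ord (n k : nat) : (\sum_(a < n) (a < k)%N <= k)%N.
Proof.
suff -> : (\sum_(a < n) (a < k)%N = minn n k)%N by exact: geq_minr.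
elim: n => [|n IH]; first by rewrite big_ord0 min0n.
by rewrite big_ord_recr /= IH; case: (ltnP n k); lia.
Qed.

Lemma sum_rev_ord (R : realType) (f : nat -> R) (N : nat) : \sum_(a < N.+1) f (N - a)%N = \sum_(a < N.+1) f a.
Proof.
rewrite (reindex_inj rev_ord_inj) /=; apply: eq_bigr => i _; rewrite subSS subKn //; exact: leq_ord.
Qed.

(** Without a good splitting [key] holds for all [a]. In the sum over [a] the averages account for
    at most [2 * C * N.+1%:R] and the excluded ends for at most [16 * C * N0%:R], together less than
    [8 * C * N.+1%:R]. *)
Lemma good_split (R : realType) (bb : nat -> R) (C : R) (N0 : nat) : 0 < C -> (forall k, 0 <= bb k) ->
  (forall N, \sum_(a < N.+1) bb a <= C * N.+1%:R) ->
  forall N, (3 * N0 <= N)%N -> exists a b, [/\ (a + b = N)%N, (N0 <= a)%N, (N0 <= b)%N, bb a <= 8 * C & bb b <= 8 * C].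
Proof.
move=> C0 bb0 avg N NN; apply: contrapT => no.
have key (a : 'I_N.+1) : 8 * C <= (bb a + bb (N - a)%N) + 8 * C * ((a < N0)%N%:R + (N - a < N0)%N%:R).
  have aN : (a <= N)%N by exact: leq_ord.
  have c8 : 0 < 8 * C by rewrite mulr_gt0.
  have b1 := bb0 a; have b2 := bb0 (N - a)%N.
  case: (ltnP a N0) => h1; first by case: (_ < _)%N; rewrite /=; move: b1 b2 c8; lra.
  case: (ltnP (N - a) N0) => h2; first by rewrite /=; move: b1 b2 c8; lra.
  rewrite addr0 mulr0 addr0 leNgt; apply/negP => h; apply: no; exists (a : nat), (N - a)%N.
  by split; rewrite ?subnKC //; move: h b1 b2; lra.
have : \sum_(a < N.+1) (8 * C) <= \sum_(a < N.+1) ((bb a + bb (N - a)%N) + 8 * C * ((a < N0)%N%:R + (N - a < N0)%N%:R)).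
  by apply: ler_sum => a _; exact: key.
rewrite sumr_const card_ord big_split big_split /= sum_rev_ord -mulr_sumr big_split /=.
rewrite (sum_rev_ord (fun a => (a < N0)%N%:R : R)) -natr_sum -[_ *+ _]mulr_natr.
have h1 : (\sum_(a < N.+1) (a < N0)%N)%:R <= N0%:R :> R by rewrite ler_nat sum_lt_ord.
have h2 := avg N; have h3 : 3 * N0%:R <= N%:R :> R by rewrite -natrM ler_nat.
have h4 : (\sum_(a < N.+1) (a < N0)%N)%:R * C <= N0%:R * C by rewrite ler_wpM2r // ltW.
have h5 : 3 * N0%:R * C <= N%:R * C by rewrite ler_wpM2r // ltW.
have h6 : 0 <= N%:R * C by rewrite mulr_ge0 // ltW.
move: h2; rewrite -natr1; move: h4 h5 h6 C0; move: (\sum_(_ < _) bb _) ((\sum_(_ < _) _)%:R) => x y; move: (N%:R) (N0%:R) => NN' N0'.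
by move=> h4 h5 h6 C0' h2; lra.
Qed.

(** * Weights of small energy for wide rings *)

Section Ring.
Variables (R : realType) (Z : metricType R) (X : hyperbolic_filling Z) (z0 : Z).
Hypothesis diam1 : forall x y : Z, mdist x y <= 1.
Notation V := (vertex X).
Let s := scale X.
Notation lev := (@level R Z X).
Notation cen := (@vcenter R Z X z0).
Variables (d : V -> V -> nat) (c : nat).
Hypothesis Lm : level_metric d c.
Notation rt := (root X).
Notation ll := (d rt).
Implicit Types (v w u : V).
Hypothesis dbl : doubling Z.
Notation adm := (@crossing_adm R Z X z0 d).
Notation tch := (@layer_touch R Z X z0).

Let s1 : 1 < s := s_gt1 X.
Let s0 : 0 < s := s_gt0 X.
Let sV k : 0 < s ^- k := sV_gt0 X k.

Lemma window_enum (c1 k : nat) : exists S : seq V, uniq S /\ forall v, v \in S <-> (k <= ll v + c1)%N /\ (ll v <= k + c1)%N.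
Proof.
have [N NP] := upto_enum z0 diam1 Lm dbl; have [S [uS SP _]] := NP (k + c1)%N.
exists [seq v <- S | (k <= ll v + c1)%N]; split; first exact: filter_uniq.
by move=> v; rewrite mem_filter; split=> [/andP[-> /SP]//|[-> h]] /=; apply/SP.
Qed.

(** The number of vertices up to depth [N] is at most exponential in [N], so by [sum_squares] their
    energy is at most linear in [N]; each vertex is counted in a bounded number of windows. *)
Lemma window_average (t0 : V -> R) (c1 : nat) (Lk : nat -> seq V) : weak_square t0 ->
  (forall k, uniq (Lk k) /\ forall v, v \in Lk k <-> (k <= ll v + c1)%N /\ (ll v <= k + c1)%N) ->
  exists2 C : R, 0 < C & forall N, \sum_(a < N.+1) \sum_(x <- Lk a) t0 x ^+ 2 <= C * N.+1%:R.
Proof.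
move=> t0w LkP; have [C [C0 CP]] := sum_squares t0w; have [Nu NuP] := upto_enum z0 diam1 Lm dbl.
exists ((2 * c1).+1%:R * (C * (Nu * c1.+1 + 1)%N%:R)).
  by rewrite !mulr_gt0 // ltr0n addn1.
move=> N; have [U [uU UP sU]] := NuP (N + c1)%N.
have t2 x : 0 <= t0 x ^+ 2 by exact: sqr_ge0.
have cnt x : (\sum_(a < N.+1) ((a <= ll x + c1) && (ll x <= a + c1)) <= (2 * c1).+1)%N.
  rewrite -(big_mkord xpredT (fun a => nat_of_bool ((a <= ll x + c1) && (ll x <= a + c1))%N)) -big_mkcond sum1_count -size_filter.
  rewrite -(size_iota (ll x - c1) (2 * c1).+1); apply: uniq_leq_size; first by rewrite filter_uniq // iota_uniq.
  by move=> a; rewrite mem_filter !mem_iota => /andP[/andP[h1 h2] _]; move: h1 h2; clear; lia.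
apply: le_trans (_ : \sum_(a < N.+1) \sum_(x <- U) ((a <= ll x + c1) && (ll x <= a + c1))%N%:R * t0 x ^+ 2 <= _).
  apply: ler_sum => a _; have [uLk LP] := LkP a.
  rewrite (eq_big_seq (fun x => ((a <= ll x + c1) && (ll x <= a + c1))%N%:R * t0 x ^+ 2)); last first.
    by move=> x /LP[h1 h2]; rewrite h1 h2 mul1r.
  apply: sum_subset => // [x|x /LP[_ h]]; first by rewrite mulr_ge0.
  by apply/UP; apply: leq_trans h _; rewrite leq_add2r; exact: leq_ord.
rewrite exchange_big /=; apply: le_trans (_ : \sum_(x <- U) (2 * c1).+1%:R * t0 x ^+ 2 <= _).
  apply: ler_sum => x _; rewrite -mulr_suml ler_wpM2r // -natr_sum ler_nat; exact: cnt.
rewrite -mulr_sumr -mulrA ler_pM2l // -mulrA.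
have sz : (size U <= 4 ^ (Nu * (N + c1).+1))%N.
  by apply: leq_trans sU _; rewrite expnM leq_exp2r // ltnW // ltn_expl.
apply: le_trans (CP U _ uU sz) _; rewrite ler_pM2l // -natrM ler_nat; clear; nia.
Qed.

Lemma layer_deep (e : R) : 0 < e -> exists n0 : nat, forall n u, (n0 <= n)%N -> ll u = n -> s ^- lev u <= e.
Proof.
move=> e0; have [U UP] := spow_ge X e^-1; exists U.+1 => n u nU un.
apply: le_trans (_ : s ^- U <= _).
  by apply: sV_le; have := d_root z0 diam1 Lm u; rewrite un => h; rewrite -ltnS; exact: leq_trans nU h.
by rewrite -[leRHS]invrK lef_pV2 ?posrE ?exprn_gt0 ?invr_gt0.
Qed.

Variables (bb : nat -> R) (C A : R) (N0 : nat).
Hypothesis bb0 : forall k, 0 <= bb k.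
Hypothesis A0 : 0 < A.
Hypothesis C0 : 0 < C.
Hypothesis avg : forall N, \sum_(a < N.+1) bb a <= A * N.+1%:R.
Hypothesis two : forall v m n, (ll v + N0 <= m)%N -> (m + N0 <= n)%N ->
  exists rho : V -> R, [/\ forall u, 0 <= rho u, adm n (cen v) (2 * s ^- lev v) (8 * s ^- lev v) rho &
    forall S, uniq S -> (forall u, u \in S -> ll u = n) -> \sum_(u <- S) rho u ^+ 2 <= C * (bb (m - ll v) * bb (n - m))].

Let M := C * (8 * A * (8 * A)).

(** [good_split] finds an intermediate layer for which both factors of the energy in [two] are at
    most [8 * A]. The bound [M] depends neither on the ring nor on the layer. *)
Lemma annulus_weight (x : Z) (k : nat) : exists n0 : nat, forall n, (n0 <= n)%N -> exists sg : V -> R,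
  [/\ forall u, 0 <= sg u, forall u, sg u != 0 -> s ^- k / 2 < mdist (cen u) x <= 10 * s ^- k,
    adm n x (s ^- k / 2) (9 * s ^- k) sg &
    forall S, uniq S -> (forall u, u \in S -> ll u = n) -> \sum_(u <- S) sg u ^+ 2 <= M].
Proof.
set q := s ^- k; have q0 : 0 < q := sV k.
pose v := xi X z0 diam1 x k; have vk : lev v = k by exact: lev_xi.
have vx : mdist x (cen v) <= q by exact: xi_near.
have q8 : 0 < q / 8 by rewrite divr_gt0.
have [n1 n1P] := layer_deep q8; exists (n1 + (ll v + 3 * N0))%N => n nn.
have [|a [b [ab Na Nb ga gb]]] := @good_split R bb A N0 A0 bb0 avg (n - ll v)%N; first by move: nn; clear; lia.
have step u w : ll u = n -> ll w = n -> tch u w -> mdist (cen u) (cen w) <= q / 2.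
  have nn1 : (n1 <= n)%N by move: nn; clear; lia.
  move=> /(n1P n _ nn1) h1 /(n1P n _ nn1) h2; rewrite /layer_touch -/s; lra.
have [||rho [rho0 rhoa rhoe]] := two (v := v) (m := (ll v + a)%N) (n := n); rewrite ?leq_add2l //.
  by move: nn ab Nb; clear; lia.
exists (fun u => if q / 2 < mdist (cen u) x <= 10 * q then rho u else 0); split.
- by move=> u; case: ifP.
- by move=> u; case: ifP => //; rewrite eqxx.
- move=> w p uwp pwp lwp wx px; pose f u := mdist (cen u) x.
  have [p1 [pp1 sp1 lp1 bp1]] := first_exceed (f := f) pwp px.
  have l1 u : u \in w :: p1 -> ll u = n by move=> h; apply: lwp; exact: (mem_subseq sp1).
  have ball1 u : u \in w :: p1 -> f u <= 10 * q.
    rewrite lastI mem_rcons inE => /orP[/eqP->|/bp1 h]; last by move: h q0; lra.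
    case: (lastP p1) pp1 bp1 l1 => [|p2 z]; first by rewrite /= /f => _ _ _; move: wx q0; lra.
    rewrite rcons_path last_rcons => /andP[_ tz] bp l2.
    have fl : f (last w p2) < 9 * q by apply: bp; rewrite belast_rcons mem_last.
    have e1 : ll (last w p2) = n by apply: l2; rewrite -rcons_cons mem_rcons inE mem_last orbT.
    have e2 : ll z = n by apply: l2; rewrite -rcons_cons mem_rcons mem_head.
    have h := step _ _ e1 e2 tz; have := mtri (cen (last w p2)) (cen z) x; rewrite [mdist (cen z) (cen (last w p2))]metric_sym.
    by move: fl h q0; rewrite /f; lra.
  have [||u [y [p2 [uy fu [pp2 lp2 sp2 uin bel]]]]] := last_below (f := f) (r := q / 2) pp1.
  + exact: wx.
  + by apply: lt_le_trans lp1; move: q0; lra.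
  have sub2 : subseq (y :: p2) (w :: p) by exact: subseq_trans sp1.
  have yin z : z \in y :: p2 -> z \in w :: p1 by exact: (mem_subseq sp2).
  apply: le_trans (_ : \sum_(z <- y :: p2) rho z <= _).
    apply: rhoa; rewrite ?vk -/q //.
    + exact: subseq_uniq sub2 uwp.
    + by move=> z /yin/l1.
    + have h := step u y (l1 u uin) (l1 y (yin y (mem_head _ _))) uy.
      have := mtri x (cen y) (cen v); have := mtri (cen u) (cen y) x; rewrite [mdist (cen y) (cen u)]metric_sym.
      by move: fu h vx; rewrite /f; lra.
    + rewrite lp2; have := mtri (cen v) (cen (last w p1)) x; rewrite [mdist (cen v) x]metric_sym.
      by move: lp1 vx; rewrite /f; lra.
  rewrite (eq_big_seq (fun u => if q / 2 < mdist (cen u) x <= 10 * q then rho u else 0)); last first.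
    by move=> z zin /=; have := bel z zin; have := ball1 z (yin z zin); rewrite /f => -> ->.
  apply: sum_subset => //; [by move=> z; case: ifP|exact: subseq_uniq sub2 uwp|exact: mem_subseq].
- move=> S uS SP; apply: le_trans (_ : \sum_(u <- S) rho u ^+ 2 <= _).
    by apply: ler_sum => u _; case: ifP => // _; rewrite expr0n exprn_ge0.
  apply: le_trans (rhoe S uS SP) _; rewrite /M ler_pM2l //.
  have -> : (ll v + a - ll v = a)%N by [rewrite addKn]; have -> : (n - (ll v + a) = b)%N by rewrite subnDA -ab addKn.
  exact: ler_pM.
Qed.

(* Serial rule: averaging [j] weights supported in disjoint rings divides the
   energy by [j]. *)
Lemma ring_weights (eps : R) : 0 < eps -> exists2 K : R, 1 < K & forall x r, 0 < r -> exists n0 : nat,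
  forall n, (n0 <= n)%N -> exists rho : V -> R, [/\ forall u, 0 <= rho u,
    forall u, rho u != 0 -> r <= mdist (cen u) x <= K * r, adm n x r (K * r) rho &
    forall S, uniq S -> (forall u, u \in S -> ll u = n) -> \sum_(u <- S) rho u ^+ 2 < eps].
Proof.
move=> eps0; have M0 : 0 < M by rewrite /M !mulr_gt0.
pose j := (Num.truncn (M / eps)).+1; have j0 : 0 < j%:R :> R by rewrite ltr0n.
have jP : M / j%:R < eps by rewrite ltr_pdivrMr // mulrC -ltr_pdivrMr // truncnS_gt.
(* [20] makes the rings disjoint, by [10 * q i' <= q i / 2], and [K] leaves room for [j] of them. *)
have [h hP] := spow_ge X 20; pose K := 20 * s ^+ (1 + j * h).
have sp k : 1 <= s ^+ k by rewrite exprn_ege1 // ltW.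
have K1 : 1 < K by have := sp (1 + j * h)%N; rewrite /K; lra.
(* When [K * r] exceeds the diameter there is no crossing, and the weight [0] is admissible. *)
exists K => // x r r0; case: (ltP 1 (K * r)) => Kr.
  exists 0%N => n _; exists (fun=> 0); split=> //.
  - by move=> u; rewrite eqxx.
  - by move=> w p _ _ _ _ h1; exfalso; have := diam1 (cen (last w p)) x; move: h1 Kr; lra.
  - by move=> S _ _; rewrite big1 // => u _; rewrite expr0n.
have Kr0 : 0 < K * r by rewrite mulr_gt0 //; move: K1; lra.
have ex : exists k, 10 * s ^- k <= K * r.
  have [U UP] := spow_ge X (10 / (K * r)); exists U.
  by rewrite ler_pdivrMr ?exprn_gt0 // mulrC -ler_pdivrMr.
case: (ex_minnP ex) => k0 k0P k0min.
have k0big : K * r < 10 * (s * s ^- k0).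
  case: (k0) k0P k0min => [|k] kP kmin; first by move: kP; rewrite expr0 invr1; move: Kr; lra.
  rewrite sVS ltNge; apply/negP => /kmin; by rewrite ltnn.
pose kk i := (k0 + i * h)%N; pose q i := s ^- kk i.
have qdec i i' : (i < i')%N -> 10 * q i' <= q i / 2.
  move=> ii; have : q i' <= s ^- (kk i + h) by apply: sV_le; rewrite /kk -addnA leq_add2l -mulSnr leq_mul2r ii orbT.
  have := sVD X (kk i) h; rewrite -/s -/(q i) => e1 e2.
  have : 20 * s ^- (kk i + h) <= q i by rewrite -e1 [leRHS]mulrC ler_pM2r.
  by move: e2; lra.
have q0i i : q i <= s ^- k0 by apply: sV_le; exact: leq_addr.
have qpos i : 0 < q i by exact: sV.
have qr i : (i < j)%N -> r <= q i / 2.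
  move=> ij; have : s ^- (k0 + j * h) <= q i by apply: sV_le; rewrite leq_add2l leq_mul2r (ltnW ij) orbT.
  have e1 := sVD X k0 (j * h); rewrite -/s in e1; have := k0big; rewrite -e1 /K exprD expr1.
  set P := s ^+ (j * h); set Q := s ^- (k0 + _) => k1 k2.
  have : (s * P) * (20 * r) < (s * P) * (10 * Q) by move: k1; lra.
  by rewrite ltr_pM2l ?mulr_gt0 ?exprn_gt0 // => k3; move: k2 k3; lra.
have [n0 n0P] := choice (fun i => annulus_weight x (kk i)).
exists (\max_(i < j) n0 i) => n nn.
have exs (i : 'I_j) := n0P i n (leq_trans (leq_bigmax i) nn).
have [sg sgP] := choice exs.
have sg0 i u : 0 <= sg i u by have [] := sgP i.
have sgs i u : sg i u != 0 -> q i / 2 < mdist (cen u) x <= 10 * q i by have [_ hh _ _] := sgP i; exact: hh.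
have jV : 0 <= j%:R^-1 :> R by rewrite invr_ge0 ltW.
exists (fun u => j%:R^-1 * \sum_(i < j) sg i u); split.
- by move=> u; rewrite mulr_ge0 // sumr_ge0.
- move=> u; rewrite mulf_eq0 negb_or => /andP[_ nz].
  have [i si] : exists i, sg i u != 0.
    apply: contrapT => no; move: nz; rewrite big1 ?eqxx // => i _.
    by apply/eqP/negPn/negP => si; apply: no; exists i.
  have /andP[h1 h2] := sgs i u si; have := qr i (ltn_ord i); have := q0i i; move: h1 h2 k0P => h1 h2 h3 h4 h5.
  by apply/andP; split; lra.
- move=> w p uwp pwp lwp wx px; rewrite -mulr_sumr exchange_big /=.
  rewrite mulrC ler_pdivlMr // mul1r -[leLHS]/(_%:R) -[in leLHS](card_ord j) -sumr_const; apply: ler_sum => i _.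
  have [_ _ ha _] := sgP i; apply: ha => //; first by apply: le_trans wx _; exact: qr.
  by apply: le_trans px; have := q0i i; have := qpos i; move: k0P; rewrite -/(q i); lra.
- move=> S uS SP; apply: le_lt_trans jP.
  have sq u : (j%:R^-1 * \sum_(i < j) sg i u) ^+ 2 <= j%:R^-1 ^+ 2 * \sum_(i < j) sg i u ^+ 2.
    rewrite exprMn ler_wpM2l ?exprn_ge0 //.
    have [[i si]|no] := pselect (exists i, sg i u != 0); last first.
      by rewrite big1 ?expr0n ?sumr_ge0 // => i _; [exact: exprn_ge0|apply/eqP/negPn/negP => si; apply: no; exists i].
    rewrite (bigD1 i) //= [\sum_(_ < _ | _) _]big1 ?addr0; last first.
      move=> i' ii; apply/eqP/negPn/negP => si'; have /andP[a1 a2] := sgs i u si; have /andP[b1 b2] := sgs i' u si'.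
      case: (ltngtP (i : nat) i') => cmp; [| |by move: ii; rewrite -(inj_eq val_inj) /= cmp eqxx].
        by have := qdec _ _ cmp; move: a1 b2; lra.
      by have := qdec _ _ cmp; move: a2 b1; lra.
    by rewrite (bigD1 i) //= lerDl sumr_ge0 // => i' _; exact: exprn_ge0.
  apply: le_trans (_ : \sum_(u <- S) j%:R^-1 ^+ 2 * \sum_(i < j) sg i u ^+ 2 <= _); first exact: ler_sum.
  rewrite -mulr_sumr exchange_big /=; apply: le_trans (_ : j%:R^-1 ^+ 2 * \sum_(i < j) M <= _).
    by rewrite ler_wpM2l ?exprn_ge0 //; apply: ler_sum => i _; have [_ _ _ he] := sgP i; exact: he.
  rewrite sumr_const card_ord -[M *+ j]mulr_natr le_eqVlt; apply/orP; left; apply/eqP.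
  by move: j0; move: (j%:R) => t t0; field; rewrite gt_eqF.
Qed.
End Ring.

(** * Covers with small modulus of rings *)

Section Covers.
Variables (R : realType) (Z : metricType R) (X : hyperbolic_filling Z) (z0 : Z).
Hypothesis diam1 : forall x y : Z, mdist x y <= 1.
Notation V := (vertex X).
Let s := scale X.
Notation lev := (@level R Z X).
Notation cen := (@vcenter R Z X z0).
Variables (d : V -> V -> nat) (c : nat).
Hypothesis Lm : level_metric d c.
Notation rt := (root X).
Notation ll := (d rt).
Implicit Types (v w u : V).
Hypothesis dbl : doubling Z.
Hypothesis Zcon : connected [set: Z].
Hypothesis Zcompact : compact [set: Z].
Hypothesis far : forall x : Z, exists y : Z, 4^-1 <= mdist x y.
Hypothesis fin : forall A B, positively_separated A B -> (wcap X 2 A B < +oo)%E.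
Notation adm := (@crossing_adm R Z X z0 d).

Lemma finite_wcap_rings (eps : R) : 0 < eps -> exists2 K : R, 1 < K & forall x r, 0 < r -> exists n0 : nat,
  forall n, (n0 <= n)%N -> exists rho : V -> R, [/\ forall u, 0 <= rho u,
    forall u, rho u != 0 -> r <= mdist (cen u) x <= K * r, adm n x r (K * r) rho &
    forall S, uniq S -> (forall u, u \in S -> ll u = n) -> \sum_(u <- S) rho u ^+ 2 < eps].
Proof.
have [T0 [e e0 sep]] := separated_images z0 diam1 Lm 7 (ltr0Sn R 2).
have e2 : 0 < e / 2 by rewrite divr_gt0.
have [t0 t0w t0c] := weights_exist z0 diam1 dbl e2 fin.
have [Na NaP] := base_adm diam1 Lm dbl Zcon Zcompact far t0w e0 t0c sep.
have [c1 [Ne [E [E0 EP]]]] := base_energy z0 diam1 Lm dbl t0w.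
have [Lk LkP] := choice (window_enum z0 diam1 Lm dbl c1).
have [A A0 avg] := window_average z0 diam1 Lm dbl t0w LkP.
pose bb k := \sum_(x <- Lk k) t0 x ^+ 2.
have bb0 k : 0 <= bb k by apply: sumr_ge0 => x _; exact: sqr_ge0.
pose bw := base_weight z0 diam1 Lm dbl t0.
have bw0 v u : 0 <= bw v u by apply: base_weight_ge0.
have bws v u : bw v u != 0 -> mdist (cen u) (cen v) <= 7 * s ^- lev v.
  by rewrite /bw /base_weight; case: ifP => // _; rewrite eqxx.
have bwa v n : (ll v + (Na + Ne) <= n)%N -> adm n (cen v) (3 * s ^- lev v) (6 * s ^- lev v) (bw v).
  by move=> h; apply: NaP; apply: leq_trans h; rewrite leq_add2l leq_addr.
have bwe v n (S : seq V) : (ll v + (Na + Ne) <= n)%N -> uniq S -> (forall u, u \in S -> ll u = n) ->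
    \sum_(u <- S) bw v u ^+ 2 <= E * bb (n - ll v)%N.
  move=> h uS SP; apply: (EP v n) => //; first by apply: leq_trans h; rewrite leq_add2l leq_addl.
  by move=> x h1 h2; have [_ /(_ x) h3] := LkP (n - ll v)%N; apply/h3.
have [N0 [C [C0 two]]] := two_scale diam1 Lm dbl E0 bb0 bw0 bws bwa bwe.
exact: (ring_weights diam1 Lm bb0 A0 C0 avg two).
Qed.

(** The covers are the layers of the chain metric, with radii given by the levels of their
    vertices. *)
Lemma fine_covers_exist : exists (W : nat -> finType) (ctr : forall n, W n -> Z) (rad : forall n, W n -> R), fine_covers ctr rad.
Proof.
have [S SP] := choice (layer_enum z0 diam1 Lm dbl).
pose W n : finType := seq_sub (S n).
have uS n : uniq (S n) by have [] := SP n.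
have SI n v : v \in S n <-> ll v = n by have [_ h] := SP n; exact: h.
have Wl n (w : W n) : ll (ssval w) = n by apply/SI; exact: ssvalP.
exists W, (fun n (w : W n) => cen (ssval w)), (fun n (w : W n) => s ^- lev (ssval w)); split.
- by move=> n w; exact: sV_gt0.
- move=> n z; have [w wn zw] := layer_cover z0 diam1 Lm n z.
  have wS : w \in S n by apply/SI.
  by exists (SeqSub wS).
- move=> e e0; have e2 : 0 < e / 2 by rewrite divr_gt0.
  have [n0 n0P] := layer_deep z0 diam1 Lm e2; exists n0 => n nn w.
  by apply: le_lt_trans (n0P n _ nn (Wl n w)) _; move: e0; lra.
- move=> L; have [R1 R1P] := same_layer z0 diam1 Lm L; have [N NP] := near_enum z0 diam1 Lm dbl R1.
  exists N => n w; have [l [ul lP sl]] := NP (ssval w); apply: leq_trans sl.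
  rewrite cardE -(size_map (@ssval _ _)); apply: uniq_leq_size.
    by rewrite map_inj_uniq ?enum_uniq //; exact: val_inj.
  move=> _ /mapP[u + ->]; rewrite mem_enum finset.inE => uw; apply/lP/R1P => //.
  by rewrite !Wl.
- move=> eps eps0; have [K K1 KP] := finite_wcap_rings eps0; exists K => // x r r0.
  have [n0 n0P] := KP x r r0; exists n0 => n nn; have [rho [rho0 rhos rhoa rhoe]] := n0P n nn.
  exists (fun w : W n => rho (ssval w)).
    split; [by move=> w; exact: rho0|by move=> w; exact: rhos|].
    move=> A w w' /and3P[wA w'A /connectP[p pp lp]] wx w'x.
    case/shortenP: pp lp => p' pp' up' _ lp.
    have := rhoa (ssval w) (map (@ssval _ _) p'); rewrite -map_cons last_map -lp => h.
    apply: le_trans (h _ _ _ wx w'x) _.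
    + by rewrite map_inj_uniq //; exact: val_inj.
    + rewrite path_map; apply: sub_path pp' => a b /and3P[_ _]; by [].
    + by move=> _ /mapP[u _ ->]; exact: Wl.
    rewrite big_map big_uniq //= big_mkcond [leRHS]big_mkcond; apply: ler_sum => u _.
    case: ifP => [uin|_]; last by case: ifP.
    suff -> : u \in A by [].
    move: uin; rewrite inE => /orP[/eqP->//|].
    elim: p' w wA pp' {up' lp h wx} => // a p' IH w wA /= /andP[/and3P[_ aA _] pp]; rewrite inE => /orP[/eqP->//|].
    exact: IH aA pp.
  rewrite -(big_enum _ _ _ (fun w : W n => rho (ssval w) ^+ 2)) /= -(big_map (@ssval _ _) xpredT (fun u => rho u ^+ 2)); apply: rhoe.
    by rewrite map_inj_uniq ?enum_uniq //; exact: val_inj.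
  by move=> _ /mapP[u _ ->]; exact: Wl.
Qed.
End Covers.

(** * Conclusion *)

(** Otherwise the complements of finite unions of balls of radius [e] would generate a proper filter
    without cluster point. *)
Lemma compact_finite_cover (R : realType) (Z : metricType R) (e : R) : compact [set: Z] -> 0 < e ->
  exists l : seq Z, forall z, exists2 u, u \in l & mdist u z < e.
Proof.
move=> cZ e0; apply: contrapT => no.
pose F := [set A : set Z | exists l : seq Z, forall z, (forall u, u \in l -> e <= mdist u z) -> A z].
have FP : ProperFilter F.
  split.
    move=> [l lP]; apply: no; exists l => z; apply: contrapT => h; apply: (lP z) => u ul.
    by rewrite leNgt; apply/negP => uz; apply: h; exists u.
  split; first by exists [::].
    move=> A B [l lA] [l' lB]; exists (l ++ l') => z h; split; [apply: lA|apply: lB] => u ul; apply: h.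
      by rewrite mem_cat ul.
    by rewrite mem_cat ul orbT.
  by move=> A B AB [l lA]; exists l => z /lA/AB.
have [|a [_ ca]] := cZ F FP; first by exists [::].
have [|z [az]] := ca [set z | e <= mdist a z] (ball a e) _ (nbhsx_ballx a e e0).
  by exists [:: a] => z h; apply: h; rewrite mem_head.
by rewrite ballEmdist /= ltNge; move: az => /= ->.
Qed.

(** Balls are measurable for [mu], so disjoint balls can be split off one after the other. *)
Lemma separated_measure (R : realType) (Z : metricType R) (mu : {outer_measure set Z -> \bar R}) (m r : R) (S : seq Z) (U : set Z) : borel_regular mu -> uniq S -> 0 <= m ->
  (forall u v, u \in S -> v \in S -> u != v -> ball u r `&` ball v r = set0) ->
  (forall u, u \in S -> (m%:E <= mu (ball u r))%E) -> (forall u, u \in S -> ball u r `<=` U) ->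
  (((size S)%:R * m)%:E <= mu U)%E.
Proof.
move=> [bor _]; elim: S U => [|u S IH] U /=; first by move=> *; rewrite mul0r; exact: outer_measure_ge0.
move=> /andP[uS uniqS] m0 disj mS SU.
have cB : mu.-caratheodory (ball u r) by apply: bor; apply: sub_sigma_algebra; exact: metric_ball_open.
rewrite (cB U) -natr1 mulrDl mul1r addrC EFinD; apply: leeD.
  by rewrite setIC (setIidl (SU u (mem_head _ _))); apply: mS; exact: mem_head.
apply: IH => //.
- by move=> v w vS wS; apply: disj; rewrite inE ?vS ?wS orbT.
- by move=> v vS; apply: mS; rewrite inE vS orbT.
- move=> v vS y vy; split; first by apply: (SU v) => //; rewrite inE vS orbT.
  move=> uy; have vu : u != v by apply/eqP => e; rewrite e vS in uS.
  have : (ball u r `&` ball v r) y by split.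
  by rewrite disj // ?mem_head // inE vS orbT.
Qed.

Lemma ahlfors_doubling (R : realType) (Q : R) (Z : metricType R) (mu : {outer_measure set Z -> \bar R}) :
  diam Z = 1%:E -> compact [set: Z] -> borel_regular mu -> ahlfors_regular Q mu -> doubling Z.
Proof.
move=> dZ cZ bor [k [C [k0 C0 reg]]] t; pose T := `|t| + 1; have T1 : 1 <= T by rewrite lerDr.
have T0 : 0 < T by move: T1; lra.
have e0 : 0 < (2 * T)^-1 by rewrite invr_gt0 mulr_gt0.
have [l lP] := compact_finite_cover cZ e0.
have kQ : 0 < k * 2^-1 `^ Q by rewrite mulr_gt0 // powR_gt0 // invr_gt0.
pose N2 := (Num.truncn (C * T `^ Q / (k * 2^-1 `^ Q))).+1.
exists (size l + N2)%N => x r S r0 uS sepS nearS.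
(* Ahlfors regularity speaks of radii up to the diameter. When [T * r] is larger, [r] is bounded
   below, and a finite cover by small balls bounds the number of separated points. *)
case: (ltP 1 (T * r)) => Tr.
  have rT : T^-1 < r by rewrite -[T^-1]mul1r ltr_pdivrMr // mulrC.
  have [f fP] := choice (fun z => match lP z with ex_intro2 u ul uz => ex_intro (fun u => u \in l /\ mdist u z < (2 * T)^-1) u (conj ul uz) end).
  apply: leq_trans (leq_addr _ _); rewrite -[size l]muln1; apply: (@size_fibers _ _ f).
    by move=> z _; have [] := fP z.
  move=> y; set S' := [seq z <- S | f z == y].
  have uS' : uniq S' by exact: filter_uniq.
  have S'P z : z \in S' -> z \in S /\ mdist y z < (2 * T)^-1.
    by rewrite mem_filter => /andP[/eqP <- zS]; have [] := fP z.
  case: S' uS' S'P => [//|a [//|b S']] /= /andP[]; rewrite inE negb_or => /andP[ab _] _ SP.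
  have [aS ya] := SP a (mem_head _ _); have [bS yb] : b \in S /\ mdist y b < (2 * T)^-1 by apply: SP; rewrite !inE eqxx orbT.
  have h := sepS a b aS bS ab; have := mtri y a b; rewrite [mdist a y]metric_sym.
  by move: ya yb rT h; rewrite invfM; move: (T^-1) => q; lra.
apply: leq_trans (leq_addl _ _).
have rle1 : r <= 1 by apply: le_trans Tr; rewrite ler_peMl // ltW.
have r20 : 0 < r / 2 by rewrite divr_gt0.
have := @separated_measure R Z mu (k * (r / 2) `^ Q) (r / 2) S (ball x (T * r)) bor uS.
have [_ up] : ((k * (T * r) `^ Q)%:E <= mu (ball x (T * r)))%E /\ (mu (ball x (T * r)) <= (C * (T * r) `^ Q)%:E)%E.
  by apply/andP; apply: reg; rewrite ?mulr_gt0 // dZ lee_fin.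
move=> h; have {h}h : (((size S)%:R * (k * (r / 2) `^ Q))%:E <= (C * (T * r) `^ Q)%:E)%E.
  apply: le_trans up; apply: h.
  - by rewrite mulr_ge0 ?powR_ge0 // ltW.
  - move=> u v uS' vS uv; apply/seteqP; split=> // y []; rewrite !ballEmdist /= => h1 h2.
    have h3 := sepS u v uS' vS uv; have := mtri y u v; rewrite [mdist y v]metric_sym => h4; exfalso; move: h1 h2 h3 h4; lra.
  - move=> u uS'; have rd : ((r / 2)%:E <= diam Z)%E by rewrite dZ lee_fin; move: rle1 r0; lra.
    by have /andP[] := reg u (r / 2) r20 rd.
  - move=> u uS' y; rewrite !ballEmdist /= => uy; have h1 := nearS u uS'.
    have h2 : t * r <= `|t| * r by rewrite ler_wpM2r ?(ltW r0) // ler_norm.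
    have := mtri u x y; rewrite [mdist x u]metric_sym /T mulrDl mul1r; move: uy h1 h2 r0; lra.
rewrite lee_fin !powRM ?invr_ge0 ?(ltW r0) ?(ltW T0) // in h.
have rQ : 0 < r `^ Q by rewrite powR_gt0.
have {}h : (size S)%:R * (k * 2^-1 `^ Q) <= C * T `^ Q.
  by rewrite -(ler_pM2r rQ); move: h; rewrite !mulrA; lra.
rewrite -(ler_nat R) /N2; apply: ltW; apply: le_lt_trans (truncnS_gt _).
by rewrite ler_pdivlMr.
Qed.

Theorem corollary1p4 (R : realType) (Q : R) (Z : metricType R)
    (mu : {outer_measure set Z -> \bar R}) (X : hyperbolic_filling Z)
    (Y : metricType R) (G : set (Y -> Y)) :
  diam Z = 1%:E ->
  borel_regular mu ->
  ahlfors_regular Q mu ->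
  homeomorphic Z (sphere2 R) ->
  linearly_locally_connected Z ->
  quasi_isometric (realization X) Y ->
  isometry_subgroup G ->
  cocompact_action G ->
  exists (n : nat) (A B : 'I_n -> set Z),
    (forall i, positively_separated (A i) (B i)) /\
    ((forall i, (wcap X 2 (A i) (B i) < +oo)%E) ->
     quasisymmetrically_equivalent Z (sphere2 R)).
Proof.
move=> dZ bor reg [h [g [hg gh hC gC]]] [lam [lam1 llc]] [f [C [D [C0 D0 fqi fonto]]]] Gsub Gco.
have diam1 (x y : Z) : mdist x y <= 1.
  by rewrite -lee_fin -dZ; apply: ereal_sup_ubound; exists (x, y).
have far (x : Z) : exists y : Z, 4^-1 <= mdist x y.
  have : ((2^-1)%:E < diam Z)%E by rewrite dZ lte_fin; lra.
  move=> /ereal_sup_gt[_ [[a b] _ <-]]; rewrite lte_fin /= => ab.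
  case: (leP 4^-1 (mdist x a)) => xa; first by exists a.
  exists b; have := mtri x a b; rewrite [mdist a x]metric_sym; move: xa ab; lra.
have Zcompact : compact [set: Z].
  have -> : [set: Z] = g @` [set: sphere2 R].
    by apply/seteqP; split=> // z _; exists (h z).
  apply: continuous_compact; last exact: sphere_compact.
  exact: continuous_subspaceT.
have LLC1 (a : Z) (r : R) : 0 < r -> forall x y, ball a r x -> ball a r y ->
    exists E : set Z, [/\ connected E, E x, E y & forall z, E z -> ball a (lam * r) z].
  by move=> r0 x y ax ay; have [/(_ x y ax ay)[E [[_ cE _] Ex Ey Eb]] _] := llc a r r0; exists E.
have LLC2 (a : Z) (r : R) : 0 < r -> forall x y, ~ ball a r x -> ~ ball a r y ->
    exists E : set Z, [/\ connected E, E x, E y & forall z, E z -> ~ ball a (r / lam) z].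
  by move=> r0 x y ax ay; have [_ /(_ x y ax ay)[E [[_ cE _] Ex Ey Eb]]] := llc a r r0; exists E.
pose p := g (north R).
have Zcon : connected [set: Z].
  have ex (z : Z) : exists E : set Z, [/\ connected E, E p & E z].
    by have [||E [cE Ep Ez _]] := LLC1 p 2 (ltr0Sn R 1) p z; rewrite ?ballEmdist /= ?mdistxx //;
      [apply: le_lt_trans (diam1 _ _) _; lra|exists E].
  have [E EP] := choice ex.
  have -> : [set: Z] = \bigcup_z E z by apply/seteqP; split=> // z _; exists z => //; have [] := EP z.
  apply: bigcup_connected => [|z _]; last by have [] := EP z.
  by exists p => z _; have [] := EP z.
have dbl := ahlfors_doubling dZ Zcompact bor reg.
have [d [c Lm]] := level_metric_exists C0 D0 fqi fonto Gsub Gco.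
have main : (forall A B, positively_separated A B -> (wcap X 2 A B < +oo)%E) ->
    quasisymmetrically_equivalent Z (sphere2 R).
  move=> fin; have [W [ctr [rad cov]]] := fine_covers_exist p diam1 Lm dbl Zcon Zcompact far fin.
  have brd := boards_exist hg gh hC gC Zcompact.
  have [Qj [SQ [SV [wd [ht [flat Qcover Qq rings]]]]]] := tilings_exist lam1 LLC1 cov brd.
  eexists; apply: (limit_quasisymmetry lam1 LLC1 LLC2 diam1 Zcompact flat Qcover Qq _ rings Zcon dbl).
  (* The third coordinate of a point [st a] is not that of the north pole. *)
  move=> i /(can_inj gh) e; have := congr1 (fun v : sphere2 R => val v 0 (lift ord0 (lift ord0 ord0))) e.
  rewrite /= !vec3E => /eqP; rewrite subr_eq addrC -subr_eq subrr eq_sym; apply/negP.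
  by rewrite mulf_neq0 // invr_neq0 // gt_eqF // sq2_gt0.
have [qs|nqs] := pselect (quasisymmetrically_equivalent Z (sphere2 R)).
  by exists 0%N, (fun=> set0), (fun=> set0); split=> // -[].
have [A [B [AB inf]]] : exists A B, positively_separated A B /\ ~ (wcap X 2 A B < +oo)%E.
  apply: contrapT => no; apply: nqs; apply: main => A B AB; apply: contrapT => h'; apply: no.
  by exists A, B.
exists 1%N, (fun=> A), (fun=> B); split=> // /(_ ord0) h'; exact: False_ind (inf h').
Qed.
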